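(* Let $N\ge 2$, let $\Omega\subset\mathbb{R}^N$ be a bounded smooth domain, let $a,b>0$, $\alpha>0$ and $p\in(0,2^* )\setminus\{1\}$. Consider the problem $$(K)\qquad -(a+b\|\nabla u\|_2^{2\alpha})\Delta u=|u|^{p-1}u\ \text{ in }\Omega,\qquad u=0\ \text{ on }\partial\Omega,$$ and the problem $$(E)\qquad -\Delta v=|v|^{p-1}v\ \text{ in }\Omega,\qquad v=0\ \text{ on }\partial\Omega.$$ Put $$S=\left(\inf_{0\not\equiv u\in H_0^1(\Omega)}\frac{\|\nabla u\|_2^2}{\|u\|_{p+1}^2}\right)^{\frac{p+1}{2}},\qquad \gamma=2\alpha+1-p .$$ Then the following hold. (i) If $0<p<1$ or $p>2\alpha+1$, then problem $(K)$ has as many solutions as problem $(E)$ (i.e. the two solution sets have the same cardinality). (ii) If $1<p<2\alpha+1$, then problem $(K)$ has at least two positive solutions when $$ab^{\frac{p-1}{\gamma}}<\gamma\left[\frac{(p-1)^{p-1}}{(2\alpha S)^{2\alpha}}\right]^{\frac1\gamma},$$ has at least one positive solution when $$ab^{\frac{p-1}{\gamma}}=\gamma\left[\frac{(p-1)^{p-1}}{(2\alpha S)^{2\alpha}}\right]^{\frac1\gamma},$$ and has no nontrivial solution when $$ab^{\frac{p-1}{\gamma}}>\gamma\left[\frac{(p-1)^{p-1}}{(2\alpha S)^{2\alpha}}\right]^{\frac1\gamma}.$$ (iii) If $p=2\alpha+1$, then problem $(K)$ has at least one positive solution when $bS<1$, and has no nontrivial solution when $bS\ge 1$.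
   Context: $\|\cdot\|_q$ denotes the norm of $L^q(\Omega)$ for $q>0$, and $\|\nabla u\|_2$ is the $L^2(\Omega)$ norm of $|\nabla u|$. $2^*=+\infty$ if $N=2$ and $2^*=\frac{N+2}{N-2}$ if $N\ge 3$. Solutions are real-valued (possibly sign-changing) classical solutions in $C^2(\Omega)\cap C(\overline\Omega)$, with $\|\nabla u\|_2<\infty$; $|u|^{p-1}u$ is read as $0$ where $u=0$. A solution is nontrivial if it is not identically zero, and positive if it is $>0$ in $\Omega$. *)

(* Defs.v *)
From HB Require Import structures.
From mathcomp Require Import all_boot all_order all_algebra.
From mathcomp Require Import all_classical all_reals all_analysis.

Set Implicit Arguments.
Unset Strict Implicit.
Unset Printing Implicit Defensive.
Import Order.TTheory GRing.Theory Num.Theory numFieldNormedType.Exports.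

Local Open Scope classical_set_scope.
Local Open Scope ring_scope.

(* R^N is 'rV[R]_N.  Its topology is the library's (sup norm) topology, and its
   sigma-algebra is generated by the coordinates, i.e. it is the Borel one. *)
Section measurable_rV.
Context {R : realType} {n : nat}.

Let coord : 'I_n -> 'rV[R]_n -> measurableTypeR R := fun i x => x ord0 i.

Let rV_set0 : g_sigma_preimage coord set0.
Proof. exact: sigma_algebra0. Qed.

Let rV_setC A : g_sigma_preimage coord A -> g_sigma_preimage coord (~` A).
Proof. exact: sigma_algebraC. Qed.

Let rV_bigcup (F : (set 'rV[R]_n)^nat) :
  (forall i, g_sigma_preimage coord (F i)) ->
  g_sigma_preimage coord (\bigcup_i F i).
Proof. exact: sigma_algebra_bigcup. Qed.

HB.instance Definition _ := @isMeasurable.Build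
  (measure_tuple_display default_measure_display)
  'rV[R]_n (g_sigma_preimage coord) rV_set0 rV_setC rV_bigcup.

Lemma measurable_coord (i : 'I_n) :
  measurable_fun [set: 'rV[R]_n] (fun x => x ord0 i : measurableTypeR R).
Proof.
move=> _ Y mY; rewrite setTI; apply: sub_sigma_algebra => /=.
rewrite -bigcup_seq/=; exists i => /=; first by rewrite mem_index_enum.
by exists Y => //; rewrite setTI.
Qed.

Lemma measurable_fun_rVP d (T : measurableType d) (f : T -> 'rV[R]_n) :
  (forall i, measurable_fun setT (fun x => f x ord0 i : measurableTypeR R)) ->
  measurable_fun setT f.
Proof.
move=> mf _ A mA; rewrite setTI; move: A mA.
have : (measurable : set (set 'rV[R]_n)) `<=`
    image_set_system setT f measurable.
  apply: smallest_sub; first exact/sigma_algebra_image/sigma_algebra_measurable.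
  rewrite -bigcup_seq/=; apply: bigcup_sub => i _ A [B mB <-].
  by rewrite /image_set_system/= setTI; have := mf i measurableT B mB;
     rewrite setTI setTI.
by move=> H A /H; rewrite /image_set_system/= setTI.
Qed.

End measurable_rV.

Section lebesgue_rV.
Context {R : realType}.

Section step.
Context {n : nat} (m : {sigma_finite_measure set 'rV[R]_n -> \bar R}).

Definition cons_rV (z : measurableTypeR R * 'rV[R]_n) : 'rV[R]_n.+1 :=
  row_mx (z.1)%:M z.2.

Definition uncons_rV (x : 'rV[R]_n.+1) : measurableTypeR R * 'rV[R]_n :=
  (x ord0 ord0, @rsubmx _ 1 1 n x).

Lemma cons_rVK : cancel cons_rV uncons_rV.
Proof.
move=> [x y]; rewrite /cons_rV /uncons_rV; congr pair; last exact: row_mxKr.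
rewrite mxE; case: splitP => // j _.
by rewrite mxE (ord1 j) eqxx.
Qed.

Lemma measurable_cons_rV : measurable_fun setT cons_rV.
Proof.
apply: measurable_fun_rVP => i.
rewrite /cons_rV.
have [j|j] := split_ordP (i : 'I_(1 + n)) => ->.
  rewrite (_ : (fun _ => _) = fst); first exact: measurable_fst.
  by apply/funext => z /=; rewrite (@row_mxEl R 1 1 n) mxE (ord1 j) eqxx.
rewrite (_ : (fun _ => _) = (fun x : 'rV[R]_n => x ord0 j : measurableTypeR R) \o snd).
  by apply: measurableT_comp; [exact: measurable_coord|exact: measurable_snd].
by apply/funext => z /=; rewrite (@row_mxEr R 1 1 n).
Qed.

Lemma measurable_uncons_rV : measurable_fun setT uncons_rV.
Proof.
apply: measurable_fun_pair; first exact: measurable_coord.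
apply: measurable_fun_rVP => i.
rewrite (_ : (fun _ => _) =
  (fun x : 'rV[R]_n.+1 =>
     x ord0 (rshift 1 i : 'I_n.+1) : measurableTypeR R)).
  exact: measurable_coord.
by apply/funext => x; rewrite mxE.
Qed.

Definition lebesgue_rV_step :=
  pushforward (lebesgue_measure \x m)%E cons_rV.

Let step_measure : {measure set 'rV[R]_n.+1 -> \bar R} :=
  @measure_function_pushforward__canonical__measure_function_Measure
    _ _ _ _ _ (lebesgue_measure \x m)%E _ measurable_cons_rV.

HB.instance Definition _ := isMeasure.Build _ _ _ lebesgue_rV_step
  (measure0 step_measure) (measure_ge0 step_measure)
  (@measure_semi_sigma_additive _ _ _ step_measure).

Let lebesgue_rV_step_sigma_finite : sigma_finite setT lebesgue_rV_step.
Proof.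
have /sigma_finiteP[F [TF ndF Foo]] := sigma_finiteT (@lebesgue_measure R).
have /sigma_finiteP[G [TG ndG Goo]] := sigma_finiteT m.
exists (fun k => uncons_rV @^-1` (F k `*` G k)).
  apply/esym; rewrite -subTset => v _.
  have [i _ Fi] : (\bigcup_i F i) (uncons_rV v).1 by rewrite -TF.
  have [j _ Gj] : (\bigcup_i G i) (uncons_rV v).2 by rewrite -TG.
  exists (maxn i j) => //; split.
    by move: Fi; exact/subsetPset/ndF/leq_maxl.
  by move: Gj; exact/subsetPset/ndG/leq_maxr.
move=> k; have [mF Fk] := Foo k; have [mG Gk] := Goo k; split.
  by rewrite -[X in measurable X]setTI; apply: measurable_uncons_rV => //;
     exact: measurableX.
rewrite /lebesgue_rV_step /pushforward -comp_preimage.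
rewrite (_ : uncons_rV \o cons_rV = id); last first.
  by apply/funext => z /=; rewrite cons_rVK.
by rewrite preimage_id product_measure1E// lte_mul_pinfty// ge0_fin_numE.
Qed.

HB.instance Definition _ := Measure_isSigmaFinite.Build _ _ _
  lebesgue_rV_step lebesgue_rV_step_sigma_finite.

End step.

(* N-dimensional Lebesgue measure: the N-fold product of lebesgue_measure. *)
Fixpoint lebesgue_rV (n : nat) :
    {sigma_finite_measure set 'rV[R]_n -> \bar R} :=
  match n with
  | 0 => \d_(0 : 'rV[R]_0)
  | n'.+1 => lebesgue_rV_step (lebesgue_rV n')
  end.

End lebesgue_rV.
Arguments lebesgue_rV {R} n.

Section functions.
Context {R : realType} {N : nat}.
Implicit Types (Om : set 'rV[R]_N) (u f : 'rV[R]_N -> R)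
  (g : 'rV[R]_N -> 'rV[R]_N).

Definition partial (i : 'I_N) u : 'rV[R]_N -> R :=
  fun x => 'D_(delta_mx ord0 i) u x.

Definition grad u : 'rV[R]_N -> 'rV[R]_N := fun x => \row_i partial i u x.

Definition laplacian u : 'rV[R]_N -> R :=
  fun x => \sum_(i < N) partial i (partial i u) x.

(* `|x| is the sup norm on 'rV[R]_N; this is the Euclidean one. *)
Definition enorm (x : 'rV[R]_N) : R := Num.sqrt (\sum_(i < N) x ord0 i ^+ 2).

(* f is of class C^k in Om, for Om open. *)
Fixpoint Ck Om (k : nat) f : Prop :=
  (forall x, Om x -> {for x, continuous f}) /\
  match k with
  | 0 => True
  | k'.+1 => forall i : 'I_N,
      (forall x, Om x -> derivable f x (delta_mx ord0 i)) /\
      Ck Om k' (partial i f)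
  end.

Definition Cinfty Om f : Prop := forall k, Ck Om k f.

Definition LqNorm Om (q : R) f : \bar R :=
  'N[lebesgue_rV N]_(q%:E)[ (EFin \o f) \_ Om ]%E.

Definition test_function Om f : Prop :=
  Cinfty setT f /\
  exists K, [/\ compact K, K `<=` Om & forall x, ~ K x -> f x = 0].

Definition weak_gradient Om u g : Prop :=
  forall phi, test_function Om phi -> forall i : 'I_N,
    \int[lebesgue_rV N]_(x in Om) (u x * partial i phi x) =
    - \int[lebesgue_rV N]_(x in Om) (g x ord0 i * phi x).

(* u is in H^1(Om), with weak gradient g. *)
Definition H1 Om u g : Prop :=
  [/\ measurable_fun Om u /\ measurable_fun Om g,
      (LqNorm Om 2 u < +oo)%E,
      (LqNorm Om 2 (enorm \o g) < +oo)%E &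
      weak_gradient Om u g].

(* u is in H^1_0(Om), the closure of the test functions in H^1(Om), with weak
   gradient g. *)
Definition H10 Om u g : Prop :=
  H1 Om u g /\
  exists phi : nat -> 'rV[R]_N -> R,
    [/\ forall k, test_function Om (phi k),
        LqNorm Om 2 (fun x => phi k x - u x) @[k --> \oo] --> 0%E &
        LqNorm Om 2 (fun x => enorm (grad (phi k) x - g x)) @[k --> \oo]
          --> 0%E].

(* u is nonzero as an element of H^1_0(Om), i.e. not a.e. zero. *)
Definition rayleigh_quotients Om (q : R) : set (\bar R) :=
  [set r | exists u g,
    [/\ H10 Om u g,
        ~ {ae lebesgue_rV N, forall x, Om x -> u x = 0} &
        r = (LqNorm Om 2 (enorm \o g) ^+ 2 / LqNorm Om q u ^+ 2)%E]].

Definition sobolev_S Om (p : R) : R :=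
  fine (ereal_inf (rayleigh_quotients Om (p + 1)) `^ ((p + 1) / 2))%E.

End functions.

Definition boundary {T : topologicalType} (A : set T) : set T :=
  closure A `\` A°.

(* Near each boundary point, Om is the region strictly above the graph of a
   smooth function of N - 1 coordinates, up to the choice of the remaining
   coordinate axis i and of its orientation s. *)
Definition smooth_boundary {R : realType} {N : nat} (Om : set 'rV[R]_N) : Prop :=
  forall x0, boundary Om x0 ->
  exists (r : R) (i : 'I_N) (s : bool) (h : 'rV[R]_N.-1 -> R),
    [/\ 0 < r, Cinfty setT h &
        forall x, ball x0 r x ->
          (Om x <-> h (col' i x) < (-1) ^+ s * x ord0 i)].

Definition bounded_smooth_domain {R : realType} {N : nat}
    (Om : set 'rV[R]_N) : Prop :=
  [/\ Om !=set0, open Om, connected Om, bounded_set Om & smooth_boundary Om].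

(* The bound is on p; it amounts to p + 1 < 2N/(N-2), the Sobolev exponent. *)
Definition crit_exponent (R : realType) (N : nat) : \bar R :=
  if N == 2%N then +oo%E else ((N%:R + 2) / (N%:R - 2))%:E.

Section problems.
Context {R : realType} {N : nat}.
Implicit Types (Om : set 'rV[R]_N) (u : 'rV[R]_N -> R).

(* A function on the closure of Om is represented by its extension by 0 to
   R^N, so that equality of functions (hence counting solutions) is the
   intended one. *)
Definition admissible Om u : Prop :=
  [/\ Ck Om 2 u,
      {within closure Om, continuous u},
      forall x, boundary Om x -> u x = 0,
      (LqNorm Om 2 (enorm \o grad u) < +oo)%E &
      forall x, ~ closure Om x -> u x = 0].

(* `|u x| `^ (p - 1) * u x is 0 where u x = 0, whatever the sign of p - 1. *)
Definition K_solution Om (a b alpha p : R) u : Prop :=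
  admissible Om u /\
  forall x, Om x ->
    - (a + b * fine (LqNorm Om 2 (enorm \o grad u)) `^ (2 * alpha))
      * laplacian u x = `|u x| `^ (p - 1) * u x.

Definition E_solution Om (p : R) u : Prop :=
  admissible Om u /\
  forall x, Om x -> - laplacian u x = `|u x| `^ (p - 1) * u x.

Definition positive_on Om u : Prop := forall x, Om x -> 0 < u x.

Definition nontrivial_on Om u : Prop := exists2 x, Om x & u x != 0.

End problems.

(* Main.v *)
Require Import Defs.
From mathcomp Require Import all_boot all_order all_algebra.
From mathcomp Require Import all_classical all_reals all_analysis.
From mathcomp Require Import measurable_realfun lebesgue_integral_under.
From mathcomp Require Import ring lra.

Set Implicit Arguments.
Unset Strict Implicit.
Unset Printing Implicit Defensive.
Import Order.TTheory GRing.Theory Num.Theory numFieldNormedType.Exports.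

Local Open Scope classical_set_scope.
Local Open Scope card_scope.
Local Open Scope ring_scope.

(** The Kirchhoff factor a + b D^(2 alpha), with D = ||grad u||_2, is a number,
so the solutions of (K) are the multiples s v of solutions v of (E) such that
a + b (s D(v))^(2 alpha) = s^(p-1).  If p < 1 or p > 2 alpha + 1, this equation
has exactly one root s > 0 for each value of D(v).  If p > 1, testing (K) with
truncations of u and inserting the result into the Sobolev quotient gives
(a + b D^(2 alpha)) S <= D^(p-1) for every nontrivial solution, while equality
can be realised by a multiple of a positive ground state of (E).  What remains
is to compare an affine function of D^(2 alpha) with a power of it.

The ground state comes from one identity: for the kernel rho(z) = 2 F'(1 - |z|^2),
F(s) = exp(-1/s) if s > 0 and F(s) = 0 otherwise, the derivative in s of the
mollification s^N int u(y) rho(s(x-y)) dy only involves the distributional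
Laplacian of u.
Comparing the dyadic scales s = 2^n yields the subcritical compactness of a
minimizing sequence (sup bound from the energy, L^2 bound from translations,
interpolation), the boundedness of the minimizer (dyadic substitute for the
Green function), its interior C^2 regularity (geometric convergence of the
mollified derivatives), its positivity (mean value inequality and
connectedness) and its decay at the boundary (exterior cones). *)

(** * Lebesgue measure and integration on row vectors *)

(** The minimisation takes place among [C^1] functions with compact support, a class stable under
    [C^1] truncations, and the minimizer is only known as an almost everywhere limit of such
    functions, with an integrable majorant of the [q]-th powers, [q = p + 1]. No weak gradient is
    attached to it: its properties are proved on the sequence and passed to the limit with all
    derivatives on the test function, and its energy is recovered at the end by testing the
    equation. The quotients over H^1_0 that define [S] are compared with this infimum by
    mollification. A second obstacle is that a solution is merely continuous up to the boundary,
    without control of its gradient there. It is tested with truncations that vanish where it is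
    small and hence have compact support in [Om]. With [N = M + 2] subcriticality reads
    [M (q - 2) < 4]. The step of a mollification from scale [2^n] to [2^(n+1)] has square at most
    [C 2^(M n)] pointwise, and the integral of the square is at most [C 4^(-n)]; interpolation gives
    the ratio [2^(M (q - 2) / 2) / 4], which is below [1] exactly in the subcritical range. *)

Section measure_rV.
Context {R : realType}.

Lemma rV_coord_le {N : nat} (x : 'rV[R]_N) i : `|x ord0 i| <= `|x|.
Proof. by rewrite [leRHS]mx_normrE (le_bigmax _ _ (ord0, i)). Qed.

Lemma rV_norm_lt {N : nat} (x : 'rV[R]_N) e : 0 < e ->
  (forall i, `|x ord0 i| < e) -> `|x| < e.
Proof.
move=> e0 xe; rewrite [ltLHS]mx_normrE; apply/bigmax_ltP; split => // -[i j] _ /=.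
by rewrite (ord1 i); exact: xe.
Qed.

Lemma rV_norm_le {N : nat} (x : 'rV[R]_N) e : 0 <= e ->
  (forall i, `|x ord0 i| <= e) -> `|x| <= e.
Proof.
move=> e0 xe; rewrite [leLHS]mx_normrE; apply/bigmax_leP; split => // -[i j] _ /=.
by rewrite (ord1 i); exact: xe.
Qed.

(** The sigma-algebra is generated by the coordinates, so an open set is written as the union of the
    boxes with rational centre and radius [1 / (k + 1)] that it contains; these are countably
    many. *)
Lemma open_measurable_rV {N : nat} (U : set 'rV[R]_N) :
  open U -> measurable U.
Proof.
move=> oU.
pose B (k : 'rV[rat]_N * nat) : set 'rV[R]_N :=
  [set x | forall i, `|x ord0 i - ratr (k.1 ord0 i)| < k.2.+1%:R^-1].
have mB k : measurable (B k).
  rewrite (_ : B k = \bigcap_(i in [set: 'I_N]) ((fun x : 'rV[R]_N =>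
     x ord0 i : measurableTypeR R) @^-1`
     ball (ratr (k.1 ord0 i) : R) k.2.+1%:R^-1)); last first.
    apply/seteqP; split=> x Bx i => [_|]; first by rewrite /= /ball/= distrC; exact: Bx.
    by have := Bx i I; rewrite /= /ball/= distrC.
  apply: fin_bigcap_measurable => // i _.
  rewrite -[X in measurable X]setTI; apply: measurable_coord => //.
  by apply: open_measurable; exact: ball_open.
rewrite (_ : U = \bigcup_(k in [set k | B k `<=` U]) B k).
  rewrite bigcup_mkcond; apply: countable_bigcupT_measurable => // k.
  by case: ifPn.
apply/seteqP; split=> x; last first.
  by move=> [k BU Bx]; exact: BU.
move=> Ux; have /nbhs_ballP[e /= e0 xeU] : nbhs x U by exact: open_nbhs_nbhs.
have [n ne] : exists n : nat, n.+1%:R^-1 < e / 2.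
  have e2 : 0 < e / 2 by rewrite divr_gt0.
  by have [n _ nP] := near_infty_natSinv_lt (PosNum e2); exists n; apply: (nP n) => /=.
have /choice[r rx] : forall i : 'I_N, exists r : rat, `|x ord0 i - ratr r| < n.+1%:R^-1.
  move=> i; have n0 : 0 < n.+1%:R^-1 :> R by rewrite invr_gt0.
  have [] := @dense_rat R (ball (x ord0 i) n.+1%:R^-1).
  - by exists (x ord0 i); exact: ballxx.
  - exact: ball_open.
  - by move=> y [xy [q _ qy]]; exists q; rewrite qy.
exists (\row_i r i, n) => /= [|i]; last by rewrite mxE; exact: rx.
move=> y By; apply: xeU; move: By => /= By.
rewrite mx_norm_ball /ball_/=; apply: rV_norm_lt => // j.
rewrite !mxE; have := By j; have := rx j; rewrite !mxE => h1 h2.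
have -> : x ord0 j - y ord0 j = (x ord0 j - ratr (r j)) - (y ord0 j - ratr (r j)) by ring.
apply: le_lt_trans (ler_normB _ _) _; rewrite (splitr e) ltrD//.
  exact: lt_trans h1 ne.
exact: lt_trans h2 ne.
Qed.

Lemma continuous_measurable_rV {N : nat} (f : 'rV[R]_N -> R) :
  continuous f -> measurable_fun [set: 'rV[R]_N] f.
Proof.
move=> cf; apply: (measurability _ (RGenOInfty.measurableE R)) => // _ [_ [a ->] <-].
rewrite setTI; apply: open_measurable_rV; apply: open_comp => //.
Qed.

(** Uniqueness: both sides, as functions of [A], are measures that agree on the intervals []a,
    b]]. *)
Lemma lebesgue_measure_affine (s h : R) (A : set R) : 0 < s -> measurable A ->
  (s%:E * lebesgue_measure ((fun t : R => (s * t + h)%R) @^-1` A) = lebesgue_measure A)%E.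
Proof.
move=> s0 mA.
have mf : measurable_fun [set: measurableTypeR R] (fun t : measurableTypeR R => s * t + h : measurableTypeR R).
  by apply: measurable_funD => //; apply: measurable_funM.
pose m := @measure_function_pushforward__canonical__measure_function_Measure
    _ _ _ _ _ (@lebesgue_measure R) _ mf.
pose ms := [the measure _ _ of mscale (NngNum (ltW s0)) m].
rewrite -[LHS]/(ms A).
apply/esym; apply: (@lebesgue_measure_unique R ms) => // _ [[a b]] _ <-.
rewrite -[RHS]/(s%:E * lebesgue_measure ((fun t : R => (s * t + h)%R) @^-1` `]a, b]))%E.
have -> : (fun t : R => s * t + h) @^-1` `]a, b] = `](a - h) / s, (b - h) / s]%classic.
  apply/seteqP; split=> t /=; rewrite !in_itv/= ltr_pdivrMr// ler_pdivlMr//; lra.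
rewrite !lebesgue_measure_itv/= !lte_fin ltr_pM2r ?invr_gt0// ltrD2r.
case: ifPn => _; last by rewrite mule0.
rewrite -EFinB -EFinM; congr EFin; field; exact: lt0r_neq0.
Qed.



Lemma integral_lebesgue_affine_gt0 (s h : R) (f : R -> \bar R) : 0 < s ->
  measurable_fun [set: measurableTypeR R] f -> (forall x, 0 <= f x)%E ->
  (s%:E * \int[lebesgue_measure]_t f (s * t + h)%R = \int[lebesgue_measure]_t f t)%E.
Proof.
move=> s0 mf f0.
have ma : measurable_fun [set: measurableTypeR R] (fun t : measurableTypeR R => s * t + h : measurableTypeR R).
  by apply: measurable_funD => //; apply: measurable_funM.
pose m := @measure_function_pushforward__canonical__measure_function_Measure
    _ _ _ _ _ (@lebesgue_measure R) _ ma.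
transitivity (s%:E * \int[m]_t f t)%E.
  by rewrite ge0_integral_pushforward.
rewrite -[s]/((NngNum (ltW s0))%:num) -ge0_integral_mscale//.
apply: eq_measure_integral => A mA _; exact: (lebesgue_measure_affine h s0 mA).
Qed.

Lemma integral_lebesgueN (f : R -> \bar R) :
  measurable_fun [set: measurableTypeR R] f -> (forall x, 0 <= f x)%E ->
  (\int[lebesgue_measure]_t f (- t)%R = \int[lebesgue_measure]_t f t)%E.
Proof.
move=> mf f0.
have ma : measurable_fun [set: measurableTypeR R] (fun t : measurableTypeR R => - t : measurableTypeR R).
  exact: measurableT_comp.
pose m := @measure_function_pushforward__canonical__measure_function_Measure
    _ _ _ _ _ (@lebesgue_measure R) _ ma.
transitivity (\int[m]_t f t)%E; first by rewrite ge0_integral_pushforward.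
by apply: eq_measure_integral => A mA _; exact: (lebesgue_measureN mA).
Qed.

Lemma integral_lebesgue_affine (s h : R) (f : R -> \bar R) : s != 0 ->
  measurable_fun [set: measurableTypeR R] f -> (forall x, 0 <= f x)%E ->
  (`|s|%:E * \int[lebesgue_measure]_t f (s * t + h)%R = \int[lebesgue_measure]_t f t)%E.
Proof.
move=> s0 mf f0; case: (ltgtP s 0) s0 => // s0 _; last first.
  by rewrite gtr0_norm// integral_lebesgue_affine_gt0.
have ma : measurable_fun [set: measurableTypeR R] (fun t : measurableTypeR R => s * t + h : measurableTypeR R).
  by apply: measurable_funD => //; apply: measurable_funM.
rewrite -[X in (_ * X)%E]integral_lebesgueN//; last exact: measurableT_comp.
rewrite ltr0_norm//.
under eq_integral do rewrite mulrN -mulNr.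
by rewrite integral_lebesgue_affine_gt0// oppr_gt0.
Qed.

Lemma integral_rVS (n : nat) (f : 'rV[R]_n.+1 -> \bar R) :
  measurable_fun setT f -> (forall x, 0 <= f x)%E ->
  (\int[lebesgue_rV n.+1]_x f x =
   \int[lebesgue_measure]_t \int[lebesgue_rV n]_y f (cons_rV (t, y)))%E.
Proof.
move=> mf f0; rewrite /= /lebesgue_rV_step.
transitivity (\int[pushforward (lebesgue_measure \x lebesgue_rV n)%E cons_rV]_x f x)%E => //.
rewrite ge0_integral_pushforward//; last exact: measurable_cons_rV.
rewrite preimage_setT fubini_tonelli1//; last by move=> z; exact: f0.
by apply: measurableT_comp => //; exact: measurable_cons_rV.
Qed.

Lemma cons_rV_affine (n : nat) (s : R) (h : 'rV[R]_n.+1) (t : R) (y : 'rV[R]_n) :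
  s *: cons_rV (t, y) + h =
  cons_rV (s * t + h ord0 ord0, s *: y + @rsubmx _ 1 1 n h).
Proof.
apply/rowP => i; rewrite [LHS]mxE [X in X + _]mxE /cons_rV.
have [j|j] := split_ordP (i : 'I_(1 + n)) => ->.
  rewrite !(@row_mxEl R 1 1 n) !mxE (ord1 j) eqxx !mulr1n; congr (_ + h _ _).
  exact: val_inj.
rewrite !(@row_mxEr R 1 1 n) !mxE; congr (_ + h _ _).
Qed.

Lemma measurable_affine_rV (n : nat) (s : R) (h : 'rV[R]_n) :
  measurable_fun setT (fun x : 'rV[R]_n => s *: x + h).
Proof.
apply: measurable_fun_rVP => i.
rewrite (_ : (fun _ => _) = fun x : 'rV[R]_n => s * x ord0 i + h ord0 i).
  by apply: measurable_funD => //; apply: measurable_funM => //; exact: measurable_coord.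
by apply/funext => x; rewrite !mxE.
Qed.

(** Induction on the dimension by Tonelli's theorem. Negative [s] is included because convolutions
    use the substitution [z = s (x - y)]. *)
Lemma ge0_integral_affine_rV (N : nat) (s : R) (h : 'rV[R]_N) (f : 'rV[R]_N -> \bar R) :
  s != 0 -> measurable_fun setT f -> (forall x, 0 <= f x)%E ->
  ((`|s| ^+ N)%:E * \int[lebesgue_rV N]_x f (s *: x + h)%R =
   \int[lebesgue_rV N]_x f x)%E.
Proof.
move=> s0; elim: N h f => [|n IH] h f mf f0.
  rewrite expr0 mul1e /= !integral_dirac//; last 1 first.
  - by apply: measurableT_comp => //; exact: measurable_affine_rV.
  by rewrite !diracT !mul1e; congr f; apply/rowP => -[].
have mfc : measurable_fun setT (fun z => f (cons_rV z)).
  by apply: measurableT_comp => //; exact: measurable_cons_rV.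
have mfa : measurable_fun setT (fun x : 'rV[R]_n.+1 => f (s *: x + h)).
  by apply: measurableT_comp => //; exact: measurable_affine_rV.
rewrite !integral_rVS//.
rewrite -[RHS](@integral_lebesgue_affine s (h ord0 ord0))//; last 2 first.
- apply: (@measurable_fun_fubini_tonelli_F _ _ _ _ R (lebesgue_rV n) (fun z => f (cons_rV z))) => //.
- by move=> t; exact: integral_ge0.
rewrite exprS EFinM -muleA; congr (_ * _)%E.
rewrite -ge0_integralZl//; last 2 first.
- apply: (@measurable_fun_fubini_tonelli_F _ _ _ _ R (lebesgue_rV n) (fun z : measurableTypeR R * 'rV[R]_n => f (s *: cons_rV z + h))) => //.
  by apply: (measurableT_comp mfa); exact: measurable_cons_rV.
- by move=> t _; exact: integral_ge0.
apply: eq_integral => t _.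
under eq_integral do rewrite cons_rV_affine.
rewrite (IH (@rsubmx _ 1 1 n h) (fun y => f (cons_rV (s * t + h ord0 ord0, y))))//.
exact: (measurable_fun_pair2 _ mfc).
Qed.

End measure_rV.

(** * Integrable real functions and the rules for their integral *)

Definition L1 {R : realType} {N : nat} (f : 'rV[R]_N -> R) :=
  (lebesgue_rV N).-integrable setT (EFin \o f).

(** Being [fine] of an extended integral, the value is meaningful only for integrable [f]; hence the
    [L1] hypotheses carried by most of the rules below. *)
Definition Int {R : realType} {N : nat} (f : 'rV[R]_N -> R) : R :=
  \int[lebesgue_rV N]_x f x.

(** The source of the Cauchy-Schwarz inequalities for sums and for integrals. When [A = 0] the
    polynomial is affine, and it takes the value [-1] somewhere unless [B = 0]. *)
Lemma quadratic_ge0_disc {R : realFieldType} (A B C : R) : 0 <= A ->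
  (forall t, 0 <= A * t ^+ 2 + 2 * B * t + C) -> B ^+ 2 <= A * C.
Proof.
rewrite le_eqVlt => /predU1P[<- H|A0 H].
  have [->|B0] := eqVneq B 0; first by rewrite expr0n mul0r.
  have := H (- (C + 1) / (2 * B)).
  rewrite (_ : _ + C = -1); first by rewrite lerNr oppr0 ler10.
  by field.
have := H (- B / A).
rewrite (_ : _ + C = (A * C - B ^+ 2) / A); last by field; exact: lt0r_neq0.
by rewrite pmulr_lge0 ?invr_gt0// subr_ge0.
Qed.

Section integral_layer.
Context {R : realType} {N : nat}.
Notation V := 'rV[R]_N.
Notation mu := (lebesgue_rV N).
Implicit Types f g h : V -> R.

Lemma L1_meas f : L1 f -> measurable_fun setT f.
Proof. by move/integrableP => [/measurable_EFinP]. Qed.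

Lemma L1P f : L1 f <-> measurable_fun setT f /\ (\int[mu]_x `|f x|%:E < +oo)%E.
Proof.
split=> [/integrableP[/measurable_EFinP]//|[mf foo]].
by apply/integrableP; split => //; exact/measurable_EFinP.
Qed.

Lemma L1_ext f g : f =1 g -> L1 f -> L1 g.
Proof. by move=> /funext ->. Qed.

Lemma L1D f g : L1 f -> L1 g -> L1 (fun x => f x + g x).
Proof. by move=> If Ig; exact: (integrableD measurableT If Ig). Qed.

Lemma L1B f g : L1 f -> L1 g -> L1 (fun x => f x - g x).
Proof. by move=> If Ig; exact: (integrableB measurableT If Ig). Qed.

Lemma L1Z k f : L1 f -> L1 (fun x => k * f x).
Proof. by move=> If; exact: (integrableZl measurableT k If). Qed.

Lemma L1_0 : L1 (fun _ : V => 0).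
Proof. exact: (integrable0 mu setT). Qed.

Lemma L1_sum (I : Type) (s : seq I) (F : I -> V -> R) : (forall i, L1 (F i)) ->
  L1 (fun x => \sum_(i <- s) F i x).
Proof.
move=> LF; elim: s => [|a s IH].
  by apply: L1_ext L1_0 => x; rewrite big_nil.
by apply: L1_ext (L1D (LF a) IH) => x; rewrite big_cons.
Qed.

Lemma L1_le f g : measurable_fun setT f -> L1 g -> (forall x, `|f x| <= g x) ->
  L1 f.
Proof.
move=> mf Lg fg; apply: (le_integrable measurableT _ _ Lg).
  exact/measurable_EFinP.
by move=> x _ /=; rewrite lee_fin (le_trans (fg x))// ler_norm.
Qed.

Lemma L1_abs f : L1 f -> L1 (fun x => `|f x|).
Proof. by move=> Lf; exact: (integrable_abse Lf). Qed.

Lemma L1Mb f h C : L1 f -> measurable_fun setT h -> (forall x, `|h x| <= C) ->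
  L1 (fun x => f x * h x).
Proof.
move=> Lf mh hC; apply: (@L1_le _ (fun x => C * `|f x|)).
- by apply: measurable_funM => //; exact: L1_meas.
- exact/L1Z/L1_abs.
- by move=> x; rewrite normrM mulrC ler_wpM2r.
Qed.

Lemma Int_ext f g : f =1 g -> Int f = Int g.
Proof. by move=> /funext ->. Qed.

Lemma IntD f g : L1 f -> L1 g -> Int (fun x => f x + g x) = Int f + Int g.
Proof. by move=> If Ig; exact: RintegralD. Qed.

Lemma IntB f g : L1 f -> L1 g -> Int (fun x => f x - g x) = Int f - Int g.
Proof. by move=> If Ig; exact: RintegralB. Qed.

Lemma IntZ k f : L1 f -> Int (fun x => k * f x) = k * Int f.
Proof. by move=> If; exact: RintegralZl. Qed.

Lemma IntN f : L1 f -> Int (fun x => - f x) = - Int f.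
Proof. by move=> If; rewrite -mulN1r -IntZ//; apply: Int_ext => x; rewrite mulN1r. Qed.

Lemma Int0 : Int (fun _ : V => 0) = 0.
Proof. by rewrite /Int /Rintegral integral0. Qed.

Lemma Int_sum (I : Type) (s : seq I) (F : I -> V -> R) : (forall i, L1 (F i)) ->
  Int (fun x => \sum_(i <- s) F i x) = \sum_(i <- s) Int (F i).
Proof.
move=> LF; elim: s => [|a s IH].
  by rewrite big_nil -[RHS]Int0; apply: Int_ext => x; rewrite big_nil.
rewrite big_cons -IH -IntD//; last exact: L1_sum.
by apply: Int_ext => x; rewrite big_cons.
Qed.

Lemma Int_ge0 f : (forall x, 0 <= f x) -> 0 <= Int f.
Proof. by move=> f0; apply: Rintegral_ge0. Qed.

Lemma le_Int f g : L1 f -> L1 g -> (forall x, f x <= g x) -> Int f <= Int g.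
Proof. by move=> Lf Lg fg; apply: le_Rintegral. Qed.

Lemma le_Int_abs f : L1 f -> `|Int f| <= Int (fun x => `|f x|).
Proof. by move=> Lf; apply: le_normr_Rintegral. Qed.

Lemma Int_EFin f : L1 f -> (\int[mu]_x (f x)%:E = (Int f)%:E)%E.
Proof. by move=> Lf; rewrite fineK//; exact: integrable_fin_num. Qed.

Lemma L1_ge0P f : measurable_fun setT f -> (forall x, 0 <= f x) ->
  (\int[mu]_x (f x)%:E < +oo)%E -> L1 f.
Proof.
move=> mf f0 foo; apply/L1P; split => //.
by under eq_integral do rewrite ger0_norm//.
Qed.

Lemma Int_eq0_ae f : L1 f -> (forall x, 0 <= f x) -> Int f = 0 ->
  {ae mu, forall x, f x = 0}.
Proof.
move=> Lf f0 If0.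
have mf : measurable_fun setT (EFin \o f) by apply/measurable_EFinP; exact: L1_meas.
have /(proj1 (ae_eq_integral_abs mu measurableT mf)) : (\int[mu]_x `|(EFin \o f) x| = 0)%E.
  under eq_integral do rewrite /= ger0_norm//.
  by rewrite Int_EFin// If0.
by apply: filterS => x /(_ I) /= [].
Qed.

Lemma Int_ae f g : L1 f -> L1 g -> {ae mu, forall x, f x = g x} -> Int f = Int g.
Proof.
move=> Lf Lg fg; congr fine; apply: ae_eq_integral => //.
- by apply/measurable_EFinP; exact: L1_meas.
- by apply/measurable_EFinP; exact: L1_meas.
- by apply: filterS fg => x + _ /= => ->.
Qed.

Lemma le_Int_ae f g : L1 f -> L1 g -> {ae mu, forall x, f x <= g x} ->
  Int f <= Int g.
Proof.
move=> Lf Lg fg.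
have LM : L1 (fun x => Num.max (f x) (g x)).
  apply: (@L1_le _ (fun x => `|f x| + `|g x|)).
  - by apply: measurable_maxr; exact: L1_meas.
  - by apply: L1D; exact: L1_abs.
  - by move=> x; rewrite /Num.max; case: ifP => _; rewrite ?lerDl ?lerDr.
rewrite [leRHS](_ : _ = Int (fun x => Num.max (f x) (g x))).
  by apply: le_Int => // x; rewrite le_max lexx.
by apply: Int_ae => //; apply: filterS fg => x fg; rewrite max_r.
Qed.

Lemma ge0_Int_affine (s : R) (h : V) g : s != 0 -> (forall x, 0 <= g x) -> L1 g ->
  L1 (fun x => g (s *: x + h)) /\
  Int (fun x => g (s *: x + h)) = `|s| ^- N * Int g.
Proof.
move=> s0 g0 Lg; have mg := L1_meas Lg.
have mg' : measurable_fun setT (fun x : V => g (s *: x + h)).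
  by apply: measurableT_comp => //; exact: measurable_affine_rV.
have mEg : measurable_fun setT (EFin \o g) by exact/measurable_EFinP.
have sN : 0 < `|s| ^+ N by rewrite exprn_gt0// normr_gt0.
have := @ge0_integral_affine_rV R N s h (EFin \o g) s0 mEg g0.
rewrite /= (Int_EFin Lg) => H.
have Lg' : L1 (fun x => g (s *: x + h)).
  apply: L1_ge0P => //; rewrite ltey; apply/eqP => E; move: H.
  by rewrite E gt0_muley// lte_fin.
split => //; move: H; rewrite Int_EFin// -EFinM => -[<-].
by rewrite mulrA mulVf ?mul1r// lt0r_neq0.
Qed.

Lemma Int_affine (s : R) (h : V) f : s != 0 -> L1 f ->
  L1 (fun x => f (s *: x + h)) /\
  Int (fun x => f (s *: x + h)) = `|s| ^- N * Int f.
Proof.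
move=> s0 Lf.
have La := L1_abs Lf.
have L1p := L1D La Lf.
have L1m := L1B La Lf.
have p0 x : 0 <= `|f x| + f x by rewrite -lerBlDr sub0r -normrN ler_norm.
have m0 x : 0 <= `|f x| - f x by rewrite subr_ge0 ler_norm.
have [A1 A2] := ge0_Int_affine h s0 p0 L1p.
have [B1 B2] := ge0_Int_affine h s0 m0 L1m.
have E x : f x = 2^-1 * ((`|f x| + f x) - (`|f x| - f x)) by field.
have -> : (fun x => f (s *: x + h)) = (fun x => 2^-1 *
    ((`|f (s *: x + h)| + f (s *: x + h)) - (`|f (s *: x + h)| - f (s *: x + h)))).
  by apply/funext => x; exact: E.
split; first by apply: L1Z; exact: L1B.
rewrite IntZ; last exact: L1B.
rewrite IntB// A2 B2 -mulrBr -IntB// mulrCA -IntZ; last exact: L1B.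
by congr (_ * _); apply: Int_ext => x; rewrite -E.
Qed.

Lemma Int_shift (h : V) f : L1 f ->
  L1 (fun x => f (x + h)) /\ Int (fun x => f (x + h)) = Int f.
Proof.
move=> /(@Int_affine 1 h f (oner_neq0 _)).
have -> : (fun x => f (1 *: x + h)) = (fun x => f (x + h)).
  by apply/funext => x; rewrite scale1r.
by rewrite normr1 expr1n invr1 mul1r.
Qed.

Lemma Int_dct (f_ : nat -> V -> R) f g :
  (forall n, measurable_fun setT (f_ n)) -> measurable_fun setT f -> L1 g ->
  {ae mu, forall x, f_ n x @[n --> \oo] --> f x} ->
  {ae mu, forall x, forall n, `|f_ n x| <= g x} ->
  L1 f /\ Int (f_ n) @[n --> \oo] --> Int f.
Proof.
move=> mf_ mf Lg cv fg.
have [] := @dominated_convergence _ _ R mu setT measurableT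
  (fun n x => (f_ n x)%:E) (EFin \o f) (EFin \o g).
- by move=> n; exact/measurable_EFinP.
- exact/measurable_EFinP.
- by apply: filterS cv => x cv _; apply: cvg_EFin => //; exact: nearW.
- exact: Lg.
- by apply: filterS fg => x fg n _ /=; rewrite lee_fin.
move=> Lf _ cvI; split => //; rewrite /Int /Rintegral.
apply: fine_cvg; rewrite fineK//; exact: integrable_fin_num.
Qed.

(** Gives integrability of a limit when only the integrals are bounded and no majorant is at
    hand. *)
Lemma Int_fatou (f_ : nat -> V -> R) f C :
  (forall n, L1 (f_ n)) -> (forall n x, 0 <= f_ n x) ->
  measurable_fun setT f -> (forall x, 0 <= f x) ->
  {ae mu, forall x, f_ n x @[n --> \oo] --> f x} ->
  (forall n, Int (f_ n) <= C) ->
  L1 f /\ Int f <= C.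
Proof.
move=> Lf f_0 mf f0 cv IC.
have mf_ n : measurable_fun setT (EFin \o f_ n) by apply/measurable_EFinP; exact: L1_meas.
have key : (\int[mu]_x (f x)%:E <= C%:E)%E.
  rewrite (@ge0_ae_eq_integral _ _ _ mu setT _ (fun x => limn_einf (fun n => (f_ n x)%:E)))//.
  - apply: (le_trans (fatou mu measurableT mf_ _)).
      by move=> n x _; rewrite lee_fin.
    apply: (@le_trans _ _ (limn_einf (fun n => C%:E))).
      rewrite !limn_einf_lim; apply: lee_lim; [exact: is_cvg_einfs..|].
      apply: nearW => n; apply: le_ereal_inf_tmp => _ [m /= nm <-].
      apply: (@le_trans _ _ (\int[mu]_x (f_ m x)%:E)%E).
        by apply: ereal_inf_lbound; exists m.
      by rewrite Int_EFin// lee_fin.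
    rewrite is_cvg_limn_einfE; first by rewrite lim_cst.
    by apply/cvg_ex; exists C%:E; exact: cvg_cst.
  - exact/measurable_EFinP.
  - rewrite (_ : (fun _ => _) = \- (fun x => limn_esup (fun n => - (f_ n x)%:E)))%E.
      apply: measurableT_comp => //; apply: (@measurable_fun_limn_esup _ _ _ _ (fun n x => - (f_ n x)%:E)%E) => n.
      by apply: measurableT_comp => //; exact: mf_.
    by apply/funext => x; rewrite /= (limn_esupN (fun n => (f_ n x)%:E)) oppeK.
  - by move=> x _; rewrite lee_fin.
  - move=> x _; rewrite limn_einf_lim; apply: lime_ge; first exact: is_cvg_einfs.
    by apply: nearW => n; apply: le_ereal_inf_tmp => _ [m /= nm <-]; rewrite lee_fin.
  - apply: filterS cv => x cv _ /=.
    have cvE : (f_ n x)%:E @[n --> \oo] --> (f x)%:E.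
      by apply: cvg_EFin => //; exact: nearW.
    by rewrite is_cvg_limn_einfE; [rewrite (cvg_lim _ cvE)|apply/cvg_ex; exists (f x)%:E].
have Lff : L1 f.
  apply: L1_ge0P => //; exact: le_lt_trans key (ltry _).
by split => //; rewrite -lee_fin -Int_EFin.
Qed.

(** The integral of [a t^2 + 2 b t + c] is nonnegative for every [t], as its integrand is. The form
    [b^2 <= a c] leaves open how a weight is shared between the two factors. *)
Lemma Int_CS (a b c : V -> R) : L1 a -> L1 b -> L1 c ->
  (forall x, 0 <= a x) -> (forall x, 0 <= c x) ->
  (forall x, b x ^+ 2 <= a x * c x) ->
  Int b ^+ 2 <= Int a * Int c.
Proof.
move=> La Lb Lc a0 c0 bac; apply: quadratic_ge0_disc; first exact: Int_ge0.
move=> t.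
have La' := L1Z (t ^+ 2) La; have Lb' := L1Z (2 * t) Lb.
rewrite (_ : _ + _ = Int (fun x => t ^+ 2 * a x + 2 * t * b x + c x)); last first.
  rewrite IntD//; last exact: L1D.
  by rewrite IntD// !IntZ//; ring.
apply: Int_ge0 => x; have := a0 x; rewrite le_eqVlt => /predU1P[ax0|ax0].
  have : b x ^+ 2 <= 0 by rewrite (le_trans (bac x))// -ax0 mul0r.
  rewrite le_eqVlt ltNge sqr_ge0 orbF sqrf_eq0 => /eqP ->.
  by rewrite -ax0 !mulr0 !add0r.
rewrite -(pmulr_rge0 _ ax0).
rewrite (_ : _ * _ = (a x * t + b x) ^+ 2 + (a x * c x - b x ^+ 2)); last by ring.
by rewrite addr_ge0 ?sqr_ge0// subr_ge0.
Qed.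

End integral_layer.

(** * Boxes and functions of bounded support *)

Section finite_box.
Context {R : realType}.

Definition box (N : nat) (r : R) : set 'rV[R]_N := [set x | forall i, `|x ord0 i| <= r].

Lemma measurable_box N r : measurable (@box N r).
Proof.
rewrite (_ : box r = \bigcap_(i in [set: 'I_N]) ((fun x : 'rV[R]_N =>
     x ord0 i : measurableTypeR R) @^-1` `[- r, r])); last first.
  apply/seteqP; split=> x Bx i => [_|]; first by rewrite /= in_itv/= -ler_norml; exact: Bx.
  by have := Bx i I; rewrite /= in_itv/= -ler_norml.
apply: fin_bigcap_measurable => // i _.
by rewrite -[X in measurable X]setTI; apply: measurable_coord.
Qed.

Lemma finite_box N (r : R) : (lebesgue_rV N (@box N r) < +oo)%E.
Proof.
elim: N => [|n IH]; first by rewrite /= diracE ltry.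
rewrite /= /lebesgue_rV_step /pushforward.
rewrite (_ : cons_rV @^-1` _ = `[- r, r]%classic `*` @box n r); last first.
  apply/seteqP; split=> -[t y] /=.
    move=> B; split => [|i] /=.
      have := B ord0; rewrite /cons_rV mxE; case: splitP => // j _.
      by rewrite mxE (ord1 j) eqxx in_itv/= -ler_norml.
    have := B (rshift 1 i : 'I_n.+1).
    by rewrite /cons_rV (@row_mxEr R 1 1 n).
  rewrite in_itv/= -ler_norml => -[tr yr] i; rewrite /cons_rV.
  have [j|j] := split_ordP (i : 'I_(1 + n)) => ->.
    by rewrite (@row_mxEl R 1 1 n) mxE (ord1 j) eqxx.
  by rewrite (@row_mxEr R 1 1 n).
rewrite product_measure1E//; last exact: measurable_box.
have E : (@lebesgue_measure R [set` `[- r, r]%R] < +oo)%E.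
  by rewrite lebesgue_measure_itv/=; case: ifPn => // _; rewrite -EFinB ltry.
by rewrite lte_mul_pinfty// ge0_fin_numE.
Qed.

End finite_box.

Section bounded_support.
Context {R : realType} {N : nat}.
Notation V := 'rV[R]_N.
Notation mu := (lebesgue_rV N).
Implicit Types f g h : V -> R.

Lemma L1_indic_box (r : R) : L1 (\1_(@box R N r)).
Proof.
apply: L1_ge0P => //.
- by apply: measurable_indic; exact: measurable_box.
- by rewrite integral_indic ?setIT ?finite_box//; exact: measurable_box.
Qed.

Lemma L1_bounded f r C : measurable_fun setT f -> (forall x, `|f x| <= C) ->
  (forall x, r < `|x| -> f x = 0) -> L1 f.
Proof.
move=> mf fC fr; apply: (@L1_le _ _ _ (fun x => C * \1_(@box R N r) x)) => //.
  by apply: L1Z; exact: L1_indic_box.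
move=> x; rewrite indicE; case: (boolP (x \in _)) => [|xr]; rewrite ?mulr1//.
rewrite fr ?normr0 ?mulr0//.
rewrite ltNge; apply: contra xr => xr; rewrite inE => i.
exact: le_trans (rV_coord_le _ _) xr.
Qed.

End bounded_support.

(** * Functions of class C^k *)

Section derivatives.
Context {R : realType}.

(** A form without division, so that derivatives of limits and at exceptional points follow from an
    inequality on increments. *)
Lemma is_derive_epsP {W : normedModType R} (f : W -> R) (x v : W) (d : R) :
  (forall e : R, 0 < e -> exists2 del : R, 0 < del & forall h : R, h != 0 -> `|h| < del ->
     `|f (h *: v + x) - f x - h * d| <= e * `|h|) <-> is_derive x v f d.
Proof.
split=> [H|].
  have cv : h^-1 *: (f (h *: v + x) - f x) @[h --> 0^'] --> d.
    apply/cvgrPdist_le => e e0; have [del del0 Hd] := H e e0.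
    exists del => // h hd h0.
    have {}hd : `|h| < del by move: hd; rewrite /= distrC subr0.
    have h0' : 0 < `|h| by rewrite normr_gt0.
    rewrite -(ler_pM2r h0').
    rewrite -normrM mulrBl distrC.
    rewrite (_ : _ - _ = f (h *: v + x) - f x - h * d) ?Hd//.
    by rewrite /= [_ *: _]mulrC mulfVK// mulrC.
  apply: DeriveDef; first by apply/cvg_ex; exists d.
  exact: cvg_lim.
move=> [df Df] e e0.
have /cvgrPdist_le/(_ e e0)[del /= del0 Hd] :
    h^-1 *: (f (h *: v + x) - f x) @[h --> 0^'] --> d.
  by rewrite -Df; exact: df.
exists del => // h h0 hd; have := Hd h.
rewrite /= distrC subr0 => /(_ hd h0).
have h0' : 0 < `|h| by rewrite normr_gt0.
rewrite -(ler_pM2r h0').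
rewrite -normrM mulrBl distrC.
rewrite (_ : _ - _ = f (h *: v + x) - f x - h * d)//.
by rewrite /= [_ *: _]mulrC mulfVK// mulrC.
Qed.

Context {N : nat}.
Notation V := 'rV[R]_N.
Implicit Types (f g : V -> R) (x y v : V) (Om : set V).

Notation e_ i := (delta_mx ord0 i : V).

Lemma is_derive_line f y v (t : R) d : is_derive (y + t *: v) v f d ->
  is_derive t 1 (fun t : R => f (y + t *: v)) d.
Proof.
move=> /is_derive_epsP H; apply/is_derive_epsP => e e0.
have [del del0 Hd] := H e e0; exists del => // h h0 hd.
have := Hd h h0 hd; rewrite addrCA -scalerDl.
by rewrite /= [h *: 1]mulr1.
Qed.

Lemma mvt_dir f y v (c : R) :
  (forall t : R, `|t| <= `|c| -> derivable f (y + t *: v) v) ->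
  exists2 th : R, `|th| <= `|c| & f (y + c *: v) - f y = c * 'D_v f (y + th *: v).
Proof.
move=> df; pose g := fun t : R => f (y + t *: v).
have dg (t : R) : `|t| <= `|c| -> is_derive t 1 g ('D_v f (y + t *: v)).
  by move=> tc; apply: is_derive_line; apply: DeriveDef => //; exact: df.
have g0 : f y = g 0 by rewrite /g scale0r addr0.
have [c0|c0] := leP 0 c.
  have H (t : R) : t \in `[0, c] -> `|t| <= `|c|.
    by rewrite in_itv/= => /andP[t0 tc]; rewrite !ger0_norm.
  have [||th thc E] := @MVT_segment R g (fun t => 'D_v f (y + t *: v)) 0 c c0.
  - by move=> t tc; apply/dg/H; apply: subset_itv_oo_cc tc.
  - by apply: derivable_within_continuous => t /H /dg [].
  by exists th; [exact: H|rewrite -/(g c) g0 E subr0 mulrC].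
have H (t : R) : t \in `[c, 0] -> `|t| <= `|c|.
  by rewrite in_itv/= => /andP[ct t0]; rewrite !ler0_norm ?lerN2// ltW.
have [||th thc E] := @MVT_segment R g (fun t => 'D_v f (y + t *: v)) c 0 (ltW c0).
- by move=> t tc; apply/dg/H; apply: subset_itv_oo_cc tc.
- by apply: derivable_within_continuous => t /H /dg [].
exists th; first exact: H.
by rewrite -/(g c) g0 -opprB E sub0r mulrN opprK mulrC.
Qed.

Lemma CkS Om k f : Ck Om k.+1 f -> Ck Om k f.
Proof.
elim: k f => [|k IH] f /= [cf H]; first by split.
by split => // i; have [df Hi] := H i; split => //; exact: IH.
Qed.

Lemma Ck_le Om k l f : (k <= l)%N -> Ck Om l f -> Ck Om k f.
Proof.
move=> kl; rewrite -(subnK kl); elim: (l - k)%N => // n IH /CkS; exact: IH.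
Qed.

Lemma Ck_cont Om k f : Ck Om k f -> forall x, Om x -> {for x, continuous f}.
Proof. by case: k => [|k] []. Qed.

Lemma CkT_cont k f : Ck setT k f -> continuous f.
Proof. by move=> /Ck_cont H x; exact: H. Qed.

Lemma Ck_partial Om k f i : Ck Om k.+1 f -> Ck Om k (partial i f).
Proof. by move=> [_ H]; have [] := H i. Qed.

Lemma Ck_derivable Om k f i x : Ck Om k.+1 f -> Om x -> derivable f x (e_ i).
Proof. by move=> [_ H]; have [H1 _] := H i; exact: H1. Qed.

Lemma Ck_sub Om Om' k f : Om' `<=` Om -> Ck Om k f -> Ck Om' k f.
Proof.
move=> s; elim: k f => [|k IH] f [cf H]; split => //.
- by move=> x /s; exact: cf.
- by move=> x /s; exact: cf.
- move=> i; have [H1 H2] := H i; split; last exact: IH.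
  by move=> x /s; exact: H1.
Qed.

Lemma Ck_setU Om Om' k f : Ck Om k f -> Ck Om' k f -> Ck (Om `|` Om') k f.
Proof.
elim: k f => [|k IH] f [cf H] [cf' H']; split => //.
- by move=> x [/cf|/cf'].
- by move=> x [/cf|/cf'].
- move=> i; have [H1 H2] := H i; have [H3 H4] := H' i; split; last exact: IH.
  by move=> x [/H1|/H3].
Qed.

Lemma norm_delta i : `|e_ i| <= 1.
Proof.
apply: rV_norm_le => // j; rewrite mxE eqxx/=.
by case: (_ == _); rewrite ?normr1 ?normr0.
Qed.

(** The increment is decomposed along the corners [x + p k], where [p k] keeps the first [k]
    coordinates of [h]; each piece moves in one coordinate direction, where the mean value theorem
    applies. The oscillations of the partial derivatives, each at most [e1 = e / (N + 1)], add up to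
    at most [e]. *)
Lemma C1_incr Om f x : open Om -> Ck Om 1 f -> Om x -> forall e : R, 0 < e ->
  exists2 del : R, 0 < del & forall h : V, `|h| < del ->
    `|f (x + h) - f x - \sum_i h ord0 i * partial i f x| <= e * `|h|.
Proof.
move=> oOm cf Ox e e0.
pose e1 := e / N.+1%:R.
have e10 : 0 < e1 by rewrite divr_gt0.
have [del del0 Hdel] : exists2 del, 0 < del & forall y, `|y - x| < del ->
    Om y /\ forall i, `|partial i f y - partial i f x| <= e1.
  have : \forall y \near x, Om y /\ forall i, `|partial i f y - partial i f x| <= e1.
    near=> y; split; first by near: y; exact: open_nbhs_nbhs.
    near: y; apply: filter_forall => i.
    have [_ cp] := cf.2 i; have /cvgrPdist_le/(_ e1 e10) := cp.1 x Ox.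
    by apply: filterS => y; rewrite distrC.
  move=> /nbhs_ballP[del /= del0 Hd]; exists del => // y yx; apply: Hd.
  by rewrite mx_norm_ball /ball_/= distrC.
exists del => // h hd.
pose p (k : nat) : V := \row_j (if (j < k)%N then h ord0 j else 0).
have p0 : p 0%N = 0 by apply/rowP => j; rewrite !mxE.
have pN : p N = h by apply/rowP => j; rewrite mxE ltn_ord.
have step (k : 'I_N) :
    `|f (x + p k.+1) - f (x + p k) - h ord0 k * partial k f x| <= e1 * `|h|.
  have near_x (t : R) : `|t| <= `|h ord0 k| -> `|x + p k + t *: e_ k - x| < del.
    move=> tk; rewrite (_ : _ - x = p k + t *: e_ k); last by rewrite -[x + _ + _]addrA [LHS]addrC addKr.
    apply: le_lt_trans hd; apply: rV_norm_le => // j; rewrite !mxE eqxx/=.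
    have [jk|jk|/val_inj <-] := ltngtP j k.
    - by rewrite -val_eqE/= (ltn_eqF jk) mulr0 addr0 rV_coord_le.
    - by rewrite -val_eqE/= (gtn_eqF jk) mulr0 addr0 normr0.
    - by rewrite eqxx mulr1 add0r (le_trans tk)// rV_coord_le.
  have -> : p k.+1 = p k + h ord0 k *: e_ k.
    apply/rowP => j; rewrite !mxE eqxx/= ltnS leq_eqVlt.
    have [/val_inj ->|jk] := eqVneq (j : nat) k.
      by rewrite ltnn eqxx mulr1 add0r.
    by rewrite (_ : (j == k) = false) ?mulr0 ?addr0//; apply/negbTE.
  rewrite addrA.
  have [|th thh ->] := @mvt_dir f (x + p k) (e_ k) (h ord0 k).
    move=> t /near_x /Hdel[Oy _]; exact: Ck_derivable cf Oy.
  have [_ /(_ k) H] := Hdel _ (near_x _ thh).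
  rewrite -mulrBr normrM mulrC ler_pM//.
  exact: rV_coord_le.
have -> : f (x + h) - f x - \sum_i h ord0 i * partial i f x =
    \sum_(k < N) (f (x + p k.+1) - f (x + p k) - h ord0 k * partial k f x).
  rewrite sumrB; congr (_ - _).
  rewrite -(big_mkord xpredT (fun k => f (x + p k.+1) - f (x + p k))).
  by rewrite (telescope_sumr (fun k => f (x + p k)))// p0 pN addr0.
apply: (le_trans (ler_norm_sum _ _ _)).
apply: (@le_trans _ _ (\sum_(k < N) e1 * `|h|)); first by apply: ler_sum => k _; exact: step.
rewrite sumr_const card_ord -mulr_natl mulrA ler_wpM2r//.
rewrite /e1 mulrCA ler_piMr ?(ltW e0)// ler_pdivrMr// mul1r ler_nat.
by rewrite leqnSn.
Unshelve. all: by end_near. Qed.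

Lemma C1_is_derive Om f x v : open Om -> Ck Om 1 f -> Om x ->
  is_derive x v f (\sum_i v ord0 i * partial i f x).
Proof.
move=> oOm cf Ox; apply/is_derive_epsP => e e0.
have v0 : 0 < `|v| + 1 by rewrite ltr_wpDl.
have [del del0 Hd] := C1_incr oOm cf Ox (divr_gt0 e0 v0).
exists (del / (`|v| + 1)); first exact: divr_gt0.
move=> h h0; rewrite ltr_pdivlMr// => hd.
have : `|h *: v| < del.
  by rewrite normrZ (le_lt_trans _ hd)// ler_wpM2l// lerDl.
move=> /Hd; rewrite [x + _]addrC => H.
rewrite (_ : h * _ = \sum_i (h *: v) ord0 i * partial i f x); last first.
  by rewrite mulr_sumr; apply: eq_bigr => i _; rewrite mxE mulrA.
apply: (le_trans H); rewrite normrZ -mulrA ler_wpM2l ?(ltW e0)//.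
by rewrite mulrCA ler_piMr// ler_pdivrMl// mulr1 lerDl.
Qed.

Lemma is_derive_partial f x i d : is_derive x (e_ i) f d -> partial i f x = d.
Proof. by move=> H; rewrite /partial derive_val. Qed.

Lemma derivable_partial f x i : derivable f x (e_ i) ->
  is_derive x (e_ i) f (partial i f x).
Proof. by move=> df; apply: DeriveDef. Qed.

Lemma near_partial f g x i : {near x, f =1 g} -> partial i f x = partial i g x.
Proof.
move=> fg; rewrite /partial; apply: near_eq_derive => //.
Qed.

Lemma near_continuous f g x : {near x, f =1 g} ->
  {for x, continuous f} -> {for x, continuous g}.
Proof.
move=> fg cf; rewrite /prop_for /continuous_at -(nbhs_singleton fg).
exact: cvg_trans (@near_eq_cvg _ _ (nbhs x) _ f g fg) cf.
Qed.

Lemma Ck_ext Om k f g : open Om -> (forall x, Om x -> f x = g x) ->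
  Ck Om k f -> Ck Om k g.
Proof.
move=> oOm; elim: k f g => [|k IH] f g fg [cf H].
  split => // x Ox; apply: near_continuous (cf x Ox).
  by near=> y; apply: fg; near: y; exact: open_nbhs_nbhs.
have nfg x : Om x -> {near x, f =1 g}.
  by move=> Ox; near=> y; apply: fg; near: y; exact: open_nbhs_nbhs.
split.
  by move=> x Ox; apply: near_continuous (cf x Ox); exact: nfg.
move=> i; have [df Hi] := H i; split.
  by move=> x Ox; apply: (near_eq_derivable (nfg x Ox)); exact: df.
apply: IH Hi => x Ox; apply: near_partial; exact: nfg.
Unshelve. all: by end_near. Qed.

End derivatives.

Section derive_rules.
Context {R : realType}.

Lemma is_derive_mul {W : normedModType R} (f g : W -> R) x v df dg :
  is_derive x v f df -> is_derive x v g dg ->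
  is_derive x v (fun y => f y * g y) (f x * dg + g x * df).
Proof. by move=> H1 H2; exact: is_deriveM. Qed.

Lemma is_derive_add {W : normedModType R} (f g : W -> R) x v df dg :
  is_derive x v f df -> is_derive x v g dg ->
  is_derive x v (fun y => f y + g y) (df + dg).
Proof. by move=> H1 H2; exact: is_deriveD. Qed.

Lemma is_derive_scl {W : normedModType R} (f : W -> R) x v (k df : R) :
  is_derive x v f df -> is_derive x v (fun y => k * f y) (k * df).
Proof. by move=> H1; exact: is_deriveZ. Qed.

Lemma is_derive_affine {W : normedModType R} (f : W -> R) (s : R) (h y v : W) d :
  is_derive (s *: y + h) v f d ->
  is_derive y v (fun y => f (s *: y + h)) (s * d).
Proof.
move=> /is_derive_epsP H; apply/is_derive_epsP => e e0.
have s0 : 0 < `|s| + 1 by rewrite ltr_wpDl.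
have [del del0 Hd] := H (e / (`|s| + 1)) (divr_gt0 e0 s0).
exists (del / (`|s| + 1)); first exact: divr_gt0.
move=> k k0; rewrite ltr_pdivlMr// => kd.
have E : s *: (k *: v + y) + h = (s * k) *: v + (s *: y + h).
  by rewrite scalerDr scalerA addrA.
rewrite E mulrA [k * s]mulrC.
have [->|sk0] := eqVneq (s * k) 0.
  by rewrite scale0r add0r subrr mul0r subr0 normr0 mulr_ge0// ltW.
apply: le_trans (Hd _ sk0 _) _.
  by rewrite normrM mulrC (le_lt_trans _ kd)// ler_wpM2l// lerDl.
rewrite normrM -mulrA ler_wpM2l ?(ltW e0)// mulrA ler_piMl//.
by rewrite ler_pdivrMl// mulr1 lerDl.
Qed.

Lemma is_derive_lineP {W : normedModType R} (f : W -> R) (x v : W) d :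
  is_derive x v f d <-> is_derive (0 : R) 1 (fun t : R => f (t *: v + x)) d.
Proof.
split=> /is_derive_epsP H; apply/is_derive_epsP => e e0;
  have [del del0 Hd] := H e e0; exists del => // h h0 hd;
  have := Hd h h0 hd; by rewrite scale0r add0r addr0 [h *: 1]mulr1.
Qed.

Lemma is_derive_comp1 {W : normedModType R} (b : R -> R) (f : W -> R) x v b' df :
  is_derive (f x) 1 b b' -> is_derive x v f df ->
  is_derive x v (fun y => b (f y)) (b' * df).
Proof.
move=> Hb /is_derive_lineP Hf; apply/is_derive_lineP.
have Hb' : is_derive (f (0 *: v + x)) 1 b b' by rewrite scale0r add0r.
exact: (@is_derive1_comp _ b (fun t => f (t *: v + x)) 0 b' df).
Qed.

End derive_rules.

(** * Algebra of C^k functions and symmetry of second derivatives *)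

Section Ck_algebra.
Context {R : realType} {N : nat}.
Notation V := 'rV[R]_N.
Implicit Types (f g : V -> R) (x y v : V) (Om : set V).
Notation e_ i := (delta_mx ord0 i : V).

Lemma Ck_derive Om k f i x : Ck Om k.+1 f -> Om x ->
  is_derive x (e_ i) f (partial i f x).
Proof. by move=> cf Ox; apply: derivable_partial; exact: Ck_derivable cf Ox. Qed.

Lemma Ck_cst Om k (c : R) : Ck Om k (fun _ => c).
Proof.
elim: k c => [|k IH] c; split => //.
- by move=> x _; exact: cst_continuous.
- by move=> x _; exact: cst_continuous.
move=> i; split; first by move=> x _; exact: derivable_cst.
rewrite (_ : partial i _ = fun _ => 0)//.
by apply/funext => x; rewrite /partial derive_cst.
Qed.

Lemma Ck_coord Om k (j : 'I_N) : Ck Om k (fun x => x ord0 j).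
Proof.
have D x i : is_derive x (e_ i) (fun x => x ord0 j) ((i == j)%:R : R).
  apply/is_derive_epsP => e e0; exists 1 => // h h0 _.
  rewrite !mxE eqxx/= addrK [j == i]eq_sym subrr normr0.
  by rewrite mulr_ge0// ltW.
case: k => [|k]; split => //; try by move=> x _; exact: coord_continuous.
move=> i; split; first by move=> x _; have [] := D x i.
rewrite (_ : partial i _ = fun _ => (i == j)%:R); first exact: Ck_cst.
by apply/funext => x; rewrite (is_derive_partial (D x i)).
Qed.

Lemma Ck_add Om k f g : open Om -> Ck Om k f -> Ck Om k g -> Ck Om k (fun x => f x + g x).
Proof.
move=> oOm; elim: k f g => [|k IH] f g cf cg; split => //;
  try by move=> x Ox; apply: continuousD; [exact: Ck_cont cf _ Ox|exact: Ck_cont cg _ Ox].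
move=> i; have D x (Ox : Om x) := is_derive_add (Ck_derive i cf Ox) (Ck_derive i cg Ox).
split; first by move=> x Ox; have [] := D x Ox.
apply: Ck_ext (IH _ _ (Ck_partial i cf) (Ck_partial i cg)) => // x Ox.
by rewrite (is_derive_partial (D x Ox)).
Qed.

Lemma Ck_mul Om k f g : open Om -> Ck Om k f -> Ck Om k g -> Ck Om k (fun x => f x * g x).
Proof.
move=> oOm; elim: k f g => [|k IH] f g cf cg; split => //;
  try by move=> x Ox; apply: continuousM; [exact: Ck_cont cf _ Ox|exact: Ck_cont cg _ Ox].
move=> i; have D x (Ox : Om x) := is_derive_mul (Ck_derive i cf Ox) (Ck_derive i cg Ox).
split; first by move=> x Ox; have [] := D x Ox.
apply: Ck_ext (Ck_add oOm (IH _ _ (CkS cf) (Ck_partial i cg)) (IH _ _ (CkS cg) (Ck_partial i cf))) => // x Ox.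
by rewrite (is_derive_partial (D x Ox)).
Qed.

Lemma Ck_scl Om k (c : R) f : open Om -> Ck Om k f -> Ck Om k (fun x => c * f x).
Proof. by move=> oOm cf; apply: Ck_mul => //; exact: Ck_cst. Qed.

Lemma Ck_sum Om k (I : Type) (s : seq I) (F : I -> V -> R) : open Om ->
  (forall i, Ck Om k (F i)) -> Ck Om k (fun x => \sum_(i <- s) F i x).
Proof.
move=> oOm cF; elim: s => [|a s IH].
  by apply: Ck_ext (Ck_cst Om k 0) => // x _; rewrite big_nil.
by apply: Ck_ext (Ck_add oOm (cF a) IH) => // x _; rewrite big_cons.
Qed.

Lemma C1_comp Om (b b' : R -> R) f : open Om ->
  (forall s : R, is_derive s 1 b (b' s)) -> continuous b' ->
  Ck Om 1 f -> Ck Om 1 (fun x => b (f x)) /\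
  forall i x, Om x -> partial i (fun x => b (f x)) x = b' (f x) * partial i f x.
Proof.
move=> oOm Db cb' cf.
have D i x (Ox : Om x) := is_derive_comp1 (Db (f x)) (Ck_derive i cf Ox).
have Pb i x (Ox : Om x) := is_derive_partial (D i x Ox).
have cb : continuous b.
  by move=> s; apply: differentiable_continuous; apply/derivable1_diffP; have [] := Db s.
split => //; split.
  move=> x Ox; apply: (@continuous_comp _ _ _ f b); last exact: cb.
  exact: (Ck_cont cf).
move=> i; split; first by move=> x Ox; have [] := D i x Ox.
have : Ck Om 0 (fun x => b' (f x) * partial i f x).
  apply: Ck_mul => //; last exact: Ck_partial.
  split => // x Ox; apply: (@continuous_comp _ _ _ f b'); last exact: cb'.
  exact: (Ck_cont cf).
by apply: Ck_ext => // x Ox; rewrite Pb.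
Qed.

(** Extension by zero: [Om] and the complement of [K] are open and cover the space, and the function
    vanishes on the latter. *)
Lemma Ck_glue Om K k f : open Om -> closed K -> K `<=` Om -> Ck Om k f ->
  (forall x, ~ K x -> f x = 0) -> Ck setT k f.
Proof.
move=> oOm cK KO cf f0.
have oK : open (~` K) by exact: closed_openC.
rewrite (_ : setT = Om `|` ~` K); last first.
  by apply/esym; rewrite -subTset => x _; case: (pselect (K x)) => [/KO|]; [left|right].
apply: Ck_setU => //; apply: Ck_ext (Ck_cst _ k 0) => // x Kx.
by rewrite f0.
Qed.

Lemma Ck_affine k f (s : R) h : Ck setT k f -> Ck setT k (fun y => f (s *: y + h)).
Proof.
have ca : continuous (fun y : V => s *: y + h).
  by move=> y; apply: (@continuousD R V V (fun y => s *: y) (fun=> h)); [exact: scaler_continuous|exact: cst_continuous].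
elim: k f => [|k IH] f cf; split => //;
  try by move=> x _; apply: (@continuous_comp _ _ _ (fun y : V => s *: y + h) f); [exact: ca|exact: Ck_cont cf _ _].
move=> i; have D x : is_derive x (e_ i) (fun y => f (s *: y + h)) (s * partial i f (s *: x + h)).
  by apply: is_derive_affine; exact: Ck_derive cf _.
split; first by move=> x _; have [] := D x.
apply: Ck_ext (Ck_scl s openT (IH _ (Ck_partial i cf))); first exact: openT.
by move=> x _; rewrite (is_derive_partial (D x)).
Qed.

Lemma partial_affine f (s : R) h i y : derivable f (s *: y + h) (e_ i) ->
  partial i (fun y => f (s *: y + h)) y = s * partial i f (s *: y + h).
Proof.
by move=> df; apply: is_derive_partial; apply: is_derive_affine; exact: derivable_partial.
Qed.

Lemma continuous_approx_eq f g x :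
  {for x, continuous f} -> {for x, continuous g} ->
  (forall d : R, 0 < d -> exists y1 y2,
     [/\ `|y1 - x| < d, `|y2 - x| < d & f y1 = g y2]) -> f x = g x.
Proof.
move=> cf cg H.
apply/eqP; rewrite -subr_eq0 -normr_le0; apply/ler_addgt0Pl => e e0; rewrite addr0.
have e2 : 0 < e / 2 by rewrite divr_gt0.
move/cvgrPdist_le : cf => /(_ _ e2)/nbhs_ballP[d1 /= d10 H1].
move/cvgrPdist_le : cg => /(_ _ e2)/nbhs_ballP[d2 /= d20 H2].
have d0 : 0 < Num.min d1 d2 by rewrite lt_min d10.
have [y1 [y2 [y1x y2x E]]] := H _ d0.
have -> : f x - g x = (f x - f y1) - (g x - g y2) by rewrite E opprB addrA subrK.
rewrite (le_trans (ler_normB _ _))// [leRHS]splitr lerD//.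
  apply: H1; rewrite mx_norm_ball /ball_/= distrC (lt_le_trans y1x)//.
  by rewrite ge_min lexx.
apply: H2; rewrite mx_norm_ball /ball_/= distrC (lt_le_trans y2x)//.
by rewrite ge_min lexx orbT.
Qed.

(** The second difference [G t] is symmetric in the two directions. Applying the mean value theorem
    twice, in either order, evaluates it as [t^2] times a mixed derivative at a point within [2 |t|]
    of [x]; continuity concludes. *)
Lemma schwarz f i j x : Ck setT 2 f -> partial i (partial j f) x = partial j (partial i f) x.
Proof.
move=> cf.
pose G (t : R) := f (x + t *: e_ i + t *: e_ j) - f (x + t *: e_ i) - f (x + t *: e_ j) + f x.
have key a b (t : R) : (a, b) = (i, j) \/ (a, b) = (j, i) ->
    exists2 y, `|y - x| <= 2 * `|t| & G t = t * t * partial a (partial b f) y.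
  move=> ab.
  pose phi y := f (y + t *: e_ a) - f y.
  have Dphi y : is_derive y (e_ b) phi (partial b f (y + t *: e_ a) - partial b f y).
    have D1 : is_derive y (e_ b) (fun y => f (y + t *: e_ a)) (partial b f (y + t *: e_ a)).
      have /= := @is_derive_affine R V f 1 (t *: e_ a) y (e_ b) (partial b f (y + t *: e_ a)).
      under eq_fun do rewrite scale1r.
      by rewrite mul1r scale1r; apply; exact: Ck_derive cf _.
    by apply: is_deriveB => //; exact: Ck_derive cf _.
  have [|th tht E1] := @mvt_dir R N phi x (e_ b) t.
    by move=> u _; have [] := Dphi (x + u *: e_ b).
  have [|th' tht' E2] := @mvt_dir R N (partial b f) (x + th *: e_ b) (e_ a) t.
    by move=> u _; have [] := Ck_derive a (Ck_partial b cf) (I : setT (x + th *: e_ b + u *: e_ a)).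
  exists (x + th *: e_ b + th' *: e_ a).
    rewrite (_ : _ - x = th *: e_ b + th' *: e_ a); last by rewrite -[x + _ + _]addrA [LHS]addrC addKr.
    rewrite (le_trans (ler_normD _ _))//.
    rewrite !normrZ mulr_natl mulr2n lerD//.
      by rewrite (le_trans _ tht)// ler_piMr// norm_delta.
    by rewrite (le_trans _ tht')// ler_piMr// norm_delta.
  move: E1; have -> : 'D_(e_ b) phi (x + th *: e_ b) =
      partial b f (x + th *: e_ b + t *: e_ a) - partial b f (x + th *: e_ b).
    by have [_ ->] := Dphi (x + th *: e_ b).
  rewrite E2 mulrA => <-.
  rewrite /G /phi; case: ab => [[-> ->]|[-> ->]].
    by rewrite addrAC [x + t *: e_ j + _]addrAC; ring.
  by rewrite addrAC; ring.
apply: continuous_approx_eq; [exact: Ck_cont (Ck_partial i (Ck_partial j cf)) _ _|exact: Ck_cont (Ck_partial j (Ck_partial i cf)) _ _|].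
move=> d d0; pose t := d / 4.
have t0 : 0 < t by rewrite divr_gt0.
have td : 2 * `|t| < d by rewrite gtr0_norm// /t; lra.
have [y1 y1x E1] := key i j t (or_introl erefl).
have [y2 y2x E2] := key j i t (or_intror erefl).
exists y1, y2; split; [exact: le_lt_trans td|exact: le_lt_trans td|].
have tt : t * t != 0 by rewrite mulf_neq0// lt0r_neq0.
by apply: (mulfI tt); exact: etrans (esym E1) E2.
Qed.

End Ck_algebra.

(** * Bump functions *)

Section smooth_flat.
Context {R : realType}.

(** With [x = 1/s], the derivative of [P(x) exp (- x)] with respect to [s] is
    [x^2 (P - P')(x) exp (- x)]. *)
Fixpoint flat_poly (m : nat) : {poly R} :=
  if m is m'.+1 then 'X^2 * (flat_poly m' - (flat_poly m')^`()) else 1.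

(* The m-th derivative of the function equal to exp (-1/s) for s > 0 and to 0 for s <= 0. *)
Definition flat (m : nat) (s : R) : R :=
  if 0 < s then (flat_poly m).[s^-1] * expR (- s^-1) else 0.

(** For [k > 0], the inequality [t / k <= exp (t / k)] is raised to the power [k], whence the
    constant [k^k]. *)
Lemma expR_dom_pow k : exists2 C : R, 0 <= C & forall t, 0 <= t -> t ^+ k <= C * expR t.
Proof.
case: k => [|k]; first by exists 1 => // t t0; rewrite mul1r expr0 -expR0 ler_expR.
exists (k.+1%:R ^+ k.+1); first exact: exprn_ge0.
move=> t t0; have k0 : 0 < k.+1%:R :> R by [].
have : t / k.+1%:R <= expR (t / k.+1%:R).
  by apply: le_trans (expR_ge1Dx _); rewrite lerDr.
rewrite ler_pdivrMr// mulrC => H.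
have : t ^+ k.+1 <= (k.+1%:R * expR (t / k.+1%:R)) ^+ k.+1 by rewrite lerXn2r// nnegrE mulr_ge0// expR_ge0.
by rewrite exprMn -expRM_natl [k.+1%:R * (_ / _)]mulrC divfK// lt0r_neq0.
Qed.

Lemma expR_dom_poly (q : {poly R}) : exists2 C : R, 0 <= C &
  forall t, 0 <= t -> `|q.[t]| * expR (- t) <= C.
Proof.
have [c c0 Hc] : exists2 c : nat -> R, (forall k, 0 <= c k) & forall k t, 0 <= t -> t ^+ k <= c k * expR t.
  have /choice[c Hc] : forall k, exists C : R, 0 <= C /\ forall t, 0 <= t -> t ^+ k <= C * expR t.
    by move=> k; have [C C0 H] := expR_dom_pow k; exists C.
  by exists c => k; have [] := Hc k.
exists (\sum_(i < size q) `|q`_i| * c i); first by apply: sumr_ge0 => i _; rewrite mulr_ge0.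
move=> t t0; rewrite expRN ler_pdivrMr ?expR_gt0// horner_coef.
apply: (le_trans (ler_norm_sum _ _ _)); rewrite mulr_suml; apply: ler_sum => i _.
by rewrite normrM normrX (ger0_norm t0) -mulrA ler_wpM2l// Hc.
Qed.

(** Quadratic smallness at [0] is what makes every [flat m] differentiable there with derivative
    [0]. *)
Lemma flat_quad m : exists2 C : R, 0 <= C & forall s, `|flat m s| <= C * s ^+ 2.
Proof.
have [C C0 H] := expR_dom_poly ('X^2 * flat_poly m).
exists C => // s; rewrite /flat; case: ifPn => s0; last by rewrite normr0 mulr_ge0// sqr_ge0.
have := H s^-1; rewrite invr_ge0 => /(_ (ltW s0)).
have s2 : 0 < s ^+ 2 by rewrite exprn_gt0.
rewrite hornerM hornerXn exprVn normrM (@ger0_norm _ (s ^- 2)) ?invr_ge0 ?(ltW s2)//.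
by rewrite -mulrA ler_pdivrMl// normrM (ger0_norm (expR_ge0 _)) [C * _]mulrC.
Qed.

Lemma is_derive_flat m (s : R) : is_derive s 1 (flat m) (flat m.+1 s).
Proof.
have [s0|s0|->] := ltgtP s 0.
- have -> : flat m.+1 s = 0 by rewrite /flat ltNge (ltW s0).
  apply: (near_eq_is_derive _ (is_derive_cst (0 : R) s 1)).
  by near=> t; rewrite /flat ltNge ltW//=; near: t; exact: lt_nbhsl.
- have -> : flat m.+1 s = (flat_poly m.+1).[s^-1] * expR (- s^-1) by rewrite /flat s0.
  have sn0 : s != 0 by rewrite lt0r_neq0.
  have DV : is_derive s 1 (fun t : R => t^-1) (- s ^- 2).
    have := @is_deriveV R id s 1 1 sn0 (is_derive_id _ _).
    by rewrite /= [_ *: 1]mulr1.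
  have D1 := is_derive_comp1 (is_derive_poly (flat_poly m) s^-1) DV.
  have D2 : is_derive s 1 (fun t : R => - t^-1) (s ^- 2).
    have := is_derive_scl (-1) DV; under eq_fun do rewrite mulN1r.
    by rewrite mulN1r opprK.
  have D3 := is_derive_comp1 (f := fun t : R => - t^-1) (is_derive_expR (- s^-1)) D2.
  have D := is_derive_mul D1 D3.
  have E : (flat_poly m).[s^-1] * (expR (- s^-1) * s ^- 2) +
      expR (- s^-1) * ((flat_poly m)^`().[s^-1] * - s ^- 2) =
      (flat_poly m.+1).[s^-1] * expR (- s^-1).
    by rewrite /= hornerM hornerD hornerN hornerXn exprVn; ring.
  rewrite E in D; apply: (near_eq_is_derive _ D).
  by near=> t; rewrite /flat ifT//; near: t; exact: lt_nbhsr.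
- have -> : flat m.+1 0 = 0 by rewrite /flat ltxx.
  have [C C0 H] := flat_quad m.
  have fm0 : flat m 0 = 0 by rewrite /flat ltxx.
  apply/is_derive_epsP => e e0; have C1 : 0 < C + 1 by rewrite ltr_wpDl.
  exists (e / (C + 1)); first exact: divr_gt0.
  move=> h h0; rewrite ltr_pdivlMr// => hd.
  rewrite addr0 [h *: 1]mulr1 mulr0 subr0 fm0 subr0 (le_trans (H h))//.
  have -> : h ^+ 2 = `|h| * `|h| by rewrite -expr2 -normrX ger0_norm ?sqr_ge0.
  rewrite mulrA ler_wpM2r//.
  by rewrite (le_trans _ (ltW hd))// mulrC ler_wpM2l// lerDl.
Unshelve. all: by end_near. Qed.

Lemma continuous_flat m : continuous (flat m).
Proof.
move=> s; apply: differentiable_continuous; apply/derivable1_diffP.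
by have [] := is_derive_flat m s.
Qed.

Lemma flat0_ge0 s : 0 <= flat 0 s.
Proof. by rewrite /flat; case: ifPn => // _; rewrite hornerC mul1r expR_ge0. Qed.

Lemma flat1_gt0 s : 0 < s -> flat 1 s = s ^- 2 * expR (- s^-1).
Proof.
by move=> s0; rewrite /flat s0 /= derivC subr0 mulr1 hornerXn exprVn.
Qed.

Lemma flat1_ge0 s : 0 <= flat 1 s.
Proof.
case: (ltP 0 s) => s0; last by rewrite /flat ltNge s0.
by rewrite flat1_gt0// mulr_ge0 ?expR_ge0// invr_ge0 exprn_ge0// ltW.
Qed.

Lemma flat_le0 m s : s <= 0 -> flat m s = 0.
Proof. by move=> s0; rewrite /flat ltNge s0. Qed.

End smooth_flat.

Section bumpf.
Context {R : realType} {N : nat}.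
Notation V := 'rV[R]_N.
Notation e_ i := (delta_mx ord0 i : V).

(** The Euclidean norm squared: the norm of the space is the sup norm, which is not smooth, so the
    bumps are radial for the Euclidean one and [norm_le_sqn] compares the two. *)
Definition sqn (z : V) : R := \sum_i z ord0 i ^+ 2.

Definition bumpf (m : nat) (z : V) : R := flat m (1 - sqn z).

Lemma sqn_ge0 (z : V) : 0 <= sqn z.
Proof. by apply: sumr_ge0 => i _; exact: sqr_ge0. Qed.

Lemma sqn_coord (z : V) i : z ord0 i ^+ 2 <= sqn z.
Proof. by rewrite /sqn (bigD1 i)//= lerDl sumr_ge0// => j _; exact: sqr_ge0. Qed.

Lemma norm_le_sqn (z : V) : `|z| ^+ 2 <= sqn z.
Proof.
have [->|z0] := eqVneq z 0; first by rewrite normr0 expr0n sqn_ge0.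
have mz : mx_norm z != 0 by rewrite -[mx_norm z]/(`|z|) normr_eq0.
have [[a i] /= E] := mx_norm_neq0 mz.
by rewrite [`|z|]E (ord1 a) -normrX ger0_norm ?sqr_ge0// sqn_coord.
Qed.

Lemma Ck_sqn Om k : open Om -> Ck Om k sqn.
Proof.
move=> oOm; apply: Ck_sum => // i.
by apply: Ck_mul => //; exact: Ck_coord.
Qed.

Lemma partial_sqn i (z : V) : partial i sqn z = 2 * z ord0 i.
Proof.
have D : is_derive z (e_ i) sqn (\sum_j ((i == j)%:R * z ord0 j + z ord0 j * (i == j)%:R)).
  rewrite (_ : sqn = \sum_j (fun z : V => z ord0 j ^+ 2)); last first.
    by apply/funext => y; rewrite fct_sumE.
  apply: is_derive_sum => j.
  have Dj : is_derive z (e_ i) (fun y : V => y ord0 j) ((i == j)%:R : R).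
    have := @C1_is_derive R N setT (fun y : V => y ord0 j) z (e_ i) openT (Ck_coord _ _ _) I.
    have -> : \sum_k (e_ i) ord0 k * partial k (fun y : V => y ord0 j) z = (i == j)%:R => //.
    rewrite (bigD1 i)//= big1 => [|k ki]; last by rewrite mxE eqxx (negbTE ki) mul0r.
    rewrite mxE !eqxx mul1r addr0.
    apply: is_derive_partial; apply/is_derive_epsP => e e0; exists 1 => // h h0 _.
    rewrite !mxE eqxx/= addrK [j == i]eq_sym subrr normr0.
    by rewrite mulr_ge0// ltW.
  have := is_derive_mul Dj Dj.
  by rewrite addrC mulrC [X in _ + X]mulrC addrC mulrC.
rewrite (is_derive_partial D) (bigD1 i)//= big1 => [|j ji].
  by rewrite eqxx mul1r mulr1 addr0 mulr_natl.
by rewrite eq_sym (negbTE ji) mul0r mulr0 addr0.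
Qed.

Lemma is_derive_bump m i (z : V) :
  is_derive z (e_ i) (bumpf m) (- 2 * z ord0 i * bumpf m.+1 z).
Proof.
have D1 : is_derive z (e_ i) (fun z => 1 - sqn z) (- (2 * z ord0 i)).
  have Ds := Ck_derive i (@Ck_sqn setT 1 openT) (I : setT z).
  have := is_derive_add (is_derive_cst (1 : R) z (e_ i)) (is_derive_scl (-1) Ds).
  rewrite partial_sqn add0r mulN1r.
  by under eq_fun do rewrite mulN1r.
have := is_derive_comp1 (f := fun z => 1 - sqn z) (is_derive_flat m (1 - sqn z)) D1.
by rewrite mulrC mulNr.
Qed.

Lemma partial_bump m i : partial i (bumpf m) = fun z => - 2 * z ord0 i * bumpf m.+1 z.
Proof. by apply/funext => z; rewrite (is_derive_partial (is_derive_bump m i z)). Qed.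

Lemma Ck_bump k m : Ck setT k (bumpf m).
Proof.
have cb m' : continuous (bumpf m').
  move=> z; apply: (@continuous_comp _ _ _ (fun z => 1 - sqn z) (flat m')); last exact: continuous_flat.
  apply: continuousB; first exact: cst_continuous.
  exact: (CkT_cont (@Ck_sqn setT 0 openT)).
elim: k m => [|k IH] m; first by split => // x _; exact: cb.
split => [x _|i]; first exact: cb.
split; first by move=> x _; have [] := is_derive_bump m i x.
rewrite partial_bump; apply: Ck_mul => //; first exact: openT.
by apply: Ck_scl; [exact: openT|exact: Ck_coord].
Qed.

Lemma bump_supp m (z : V) : 1 <= sqn z -> bumpf m z = 0.
Proof. by move=> z1; rewrite /bumpf flat_le0// subr_le0. Qed.

End bumpf.

(** * Geometric and locally uniform limits *)

Section limits.
Context {R : realType}.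

Lemma geo_limit (a : nat -> R) (C : R) n0 : 0 <= C ->
  (forall n, (n0 <= n)%N -> `|a n.+1 - a n| <= C * 2^-1 ^+ n) ->
  a n @[n --> \oo] --> limn a /\
  forall n, (n0 <= n)%N -> `|a n - limn a| <= 2 * C * 2^-1 ^+ n.
Proof.
move=> C0 H.
(* The factor [1 - 2^-k], a partial geometric sum, is what makes the induction on [k] close. *)
have step n k : (n0 <= n)%N -> `|a (n + k)%N - a n| <= 2 * C * 2^-1 ^+ n * (1 - 2^-1 ^+ k).
  move=> nn0; elim: k => [|k IH]; first by rewrite addn0 subrr normr0 expr0 subrr mulr0.
  rewrite addnS (_ : _ - _ = (a (n + k).+1 - a (n + k)%N) + (a (n + k)%N - a n)); last by ring.
  apply: (le_trans (ler_normD _ _)).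
  apply: (le_trans (lerD (H _ (leq_trans nn0 (leq_addr _ _))) IH)).
  rewrite exprD exprS le_eqVlt; apply/orP; left; apply/eqP.
  by field.
have bnd n k : (n0 <= n)%N -> `|a (n + k)%N - a n| <= 2 * C * 2^-1 ^+ n.
  move=> nn0; apply: (le_trans (step n k nn0)); apply: ler_piMr.
    by rewrite mulr_ge0// ?mulr_ge0// exprn_ge0.
  by rewrite lerBlDr lerDl exprn_ge0.
have g0 : 2 * C * 2^-1 ^+ n @[n --> \oo] --> 0.
  rewrite -(mulr0 (2 * C)); apply: cvgMr.
  by apply: cvg_expr; rewrite ger0_norm// invf_lt1// ltr1n.
have cva : cvgn a.
  apply/cauchy_cvgP/cauchyP => e e0.
  have [n1 _ Hn1] : \forall n \near \oo, `|2 * C * 2^-1 ^+ n| < e.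
    by move/cvgr0_norm_lt : g0; apply.
  have Hn := Hn1 _ (leq_maxr n0 n1); exists (a (maxn n0 n1)).
  exists (maxn n0 n1) => // n /= hn; rewrite /ball/= distrC.
  rewrite -(subnKC hn); apply: le_lt_trans (bnd _ _ (leq_maxl _ _)) _.
  by apply: le_lt_trans Hn; rewrite ler_norm.
split => // n hn.
have cvn : `|a n - a (n + k)%N| @[k --> \oo] --> `|a n - limn a|.
  apply: cvg_norm; apply: cvgB; first exact: cvg_cst.
  have -> : (fun k => a (n + k)%N) = [sequence a (k + n)%N]_k.
    by apply/funext => k; rewrite addnC.
  by rewrite cvg_shiftn.
rewrite -(cvg_lim _ cvn)//; apply: limr_le; first by apply/cvg_ex; eexists; exact: cvn.
by apply: nearW => k; rewrite distrC; exact: bnd.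
Qed.

Context {N : nat}.
Notation V := 'rV[R]_N.
Notation e_ i := (delta_mx ord0 i : V).
Implicit Types (f g : V -> R).

Lemma ball_limit_continuous (f_ : nat -> V -> R) f x (d : R) : 0 < d ->
  (forall e : R, 0 < e -> exists2 n, {for x, continuous (f_ n)} &
     forall y, `|y - x| < d -> `|f_ n y - f y| <= e) ->
  {for x, continuous f}.
Proof.
move=> d0 H; apply/(@cvgrPdist_le _ _ _ (nbhs x)) => e e0.
have e3 : 0 < e / 3 by rewrite divr_gt0.
have [n cn Hn] := H _ e3.
move/cvgrPdist_le : cn => /(_ _ e3)/nbhs_ballP[d1 /= d10 cn].
apply/nbhs_ballP; exists (Num.min d d1); first by rewrite /= lt_min d0.
move=> y; rewrite mx_norm_ball /ball_/= lt_min => /andP[yd yd1].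
have -> : f x - f y = (f x - f_ n x) + (f_ n x - f_ n y) + (f_ n y - f y) by ring.
have H1 : `|f x - f_ n x| <= e / 3 by rewrite distrC Hn// subrr normr0.
have H2 : `|f_ n x - f_ n y| <= e / 3 by apply: cn; rewrite mx_norm_ball /ball_/=.
have H3 : `|f_ n y - f y| <= e / 3 by apply: Hn; rewrite distrC.
apply: (le_trans (ler_normD _ _)); apply: (le_trans (lerD (ler_normD _ _) (lexx _))).
by lra.
Qed.

(** The mean value theorem writes the increment of [f_ n] as [h] times its derivative at a nearby
    point; uniform convergence replaces that derivative by [g], continuity moves the point to [x],
    and the resulting bound passes to the limit in [n]. *)
Lemma uniform_limit_derive (f_ : nat -> V -> R) f (g : V -> R) x i (d : R) : 0 < d ->
  (forall y, `|y - x| < d -> f_ n y @[n --> \oo] --> f y) ->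
  (\forall n \near \oo, forall y, `|y - x| < d -> derivable (f_ n) y (e_ i)) ->
  (forall e : R, 0 < e -> \forall n \near \oo, forall y, `|y - x| < d ->
     `|partial i (f_ n) y - g y| <= e) ->
  {for x, continuous g} -> is_derive x (e_ i) f (g x).
Proof.
move=> d0 cv df ug cg; apply/is_derive_epsP => e e0.
have e2 : 0 < e / 2 by rewrite divr_gt0.
move/cvgrPdist_le : cg => /(_ _ e2)/nbhs_ballP[d1 /= d10 H1].
exists (Num.min d d1); first by rewrite lt_min d0.
move=> h h0; rewrite lt_min => /andP[hd hd1].
have he (t : R) : `|t| <= `|h| -> `|(x + t *: e_ i) - x| <= `|h|.
  move=> th; rewrite addrAC subrr add0r normrZ (le_trans _ th)// ler_piMr//.
  exact: norm_delta.
have cvl : `|f_ n (h *: e_ i + x) - f_ n x - h * g x| @[n --> \oo] -->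
    `|f (h *: e_ i + x) - f x - h * g x|.
  apply: cvg_norm; apply: cvgB; last exact: cvg_cst.
  apply: cvgB; apply: cv; last by rewrite subrr normr0.
  by rewrite [h *: _ + x]addrC (le_lt_trans (he h _)).
rewrite -(cvg_lim _ cvl)//; apply: limr_le; first by apply/cvg_ex; eexists; exact: cvl.
near=> n.
have dfn : forall y, `|y - x| < d -> derivable (f_ n) y (e_ i) by near: n; exact: df.
have ugn : forall y, `|y - x| < d -> `|partial i (f_ n) y - g y| <= e / 2.
  by near: n; exact: ug.
have [|th thh] := @mvt_dir R N (f_ n) x (e_ i) h.
  by move=> t th; apply: dfn; apply: le_lt_trans (he t th) hd.
rewrite [h *: _ + x]addrC => ->.
rewrite -mulrBr normrM mulrC ler_wpM2r//.
set y := x + th *: e_ i.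
have yx : `|y - x| <= `|h| by exact: he.
have -> : 'D_(e_ i) (f_ n) y - g x = (partial i (f_ n) y - g y) - (g x - g y).
  by rewrite /partial; ring.
rewrite (le_trans (ler_normB _ _))// [leRHS]splitr lerD//.
  by apply: ugn; exact: le_lt_trans hd.
by apply: H1; rewrite mx_norm_ball /ball_/= distrC; exact: le_lt_trans hd1.
Unshelve. all: by end_near. Qed.

End limits.

(** * Integration by parts and convolution *)

Section bounded_support_calculus.
Context {R : realType} {N : nat}.
Notation V := 'rV[R]_N.
Notation mu := (lebesgue_rV N).
Notation e_ i := (delta_mx ord0 i : V).
Implicit Types (f g : V -> R) (Om : set V).

Definition bsupp f := exists r : R, forall x, r < `|x| -> f x = 0.

Lemma bsupp_mull f g : bsupp f -> bsupp (fun x => f x * g x).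
Proof. by move=> [r H]; exists r => x /H ->; rewrite mul0r. Qed.

Lemma bsupp_mulr f g : bsupp g -> bsupp (fun x => f x * g x).
Proof. by move=> [r H]; exists r => x /H ->; rewrite mulr0. Qed.

Lemma compact_cball (r : R) : compact [set x : V | `|x| <= r].
Proof.
apply: bounded_closed_compact.
  by exists r; split; rewrite ?num_real// => s rs x /= xr; rewrite (le_trans xr)// ltW.
have -> : [set x : V | `|x| <= r] = (@Num.norm R V) @^-1` [set t : R | t <= r] by [].
by apply: closed_comp => [x _|]; [exact: norm_continuous|exact: closed_le].
Qed.

Lemma compact_bounded_on f (K : set V) : compact K ->
  (forall x, K x -> {for x, continuous f}) ->
  exists2 C : R, 0 <= C & forall x, K x -> `|f x| <= C.
Proof.
move=> cK cf; have [->|/set0P K0] := eqVneq K set0; first by exists 0.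
have [|c Kc Hc] := @EVT_max_rV R N (fun x => `|f x|) K K0 cK.
  apply: continuous_in_subspaceT => x; rewrite inE => /cf H.
  by apply: (@continuous_comp _ _ _ f (@Num.norm R R)) => //; exact: norm_continuous.
by exists `|f c| => // x Kx; apply: Hc; rewrite inE.
Qed.

Lemma C0_bounded f : continuous f -> bsupp f ->
  exists2 C : R, 0 <= C & forall x, `|f x| <= C.
Proof.
move=> cf [r fr].
have [C C0 HC] := compact_bounded_on (@compact_cball r) (fun x _ => cf x).
exists C => // x; have [xr|/fr ->] := leP `|x| r; first exact: HC.
by rewrite normr0.
Qed.

Lemma L1_C0 f : continuous f -> bsupp f -> L1 f.
Proof.
move=> cf bf; have [C _ fC] := C0_bounded cf bf; have [r fr] := bf.
exact: L1_bounded (continuous_measurable_rV cf) fC fr.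
Qed.

Lemma partial0_near f x i : (\forall y \near x, f y = 0) -> partial i f x = 0.
Proof.
move=> fx; rewrite (@near_partial _ _ f (fun _ => 0))//.
by rewrite /partial derive_cst.
Qed.

Lemma partial_supp f r i : (forall x, r < `|x| -> f x = 0) ->
  forall x, r < `|x| -> partial i f x = 0.
Proof.
move=> fr x rx; apply: partial0_near.
have : \forall y \near x, r < `|y|.
  have := @norm_continuous R V x => /cvgr_gt; exact.
by apply: filterS => y; exact: fr.
Qed.

Lemma bsupp_partial f i : bsupp f -> bsupp (partial i f).
Proof. by move=> [r fr]; exists r; exact: partial_supp. Qed.

Lemma C1_lipschitz f : Ck setT 1 f -> bsupp f ->
  exists2 C : R, 0 <= C & forall x h, `|f (x + h) - f x| <= C * `|h|.
Proof.
move=> cf bf.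
have /choice[c Hc] : forall i, exists C : R, 0 <= C /\ forall x, `|partial i f x| <= C.
  move=> i; have [C C0 H] := C0_bounded (CkT_cont (Ck_partial i cf)) (bsupp_partial i bf).
  by exists C.
exists (\sum_i c i); first by apply: sumr_ge0 => i _; have [] := Hc i.
move=> x h; have D y := C1_is_derive h openT cf (I : setT y).
have [|th _] := @mvt_dir R N f x h 1; first by move=> t _; have [] := D (x + t *: h).
rewrite scale1r mul1r => ->; have [_ ->] := D (x + th *: h).
apply: (le_trans (ler_norm_sum _ _ _)); rewrite mulr_suml; apply: ler_sum => i _.
rewrite normrM mulrC ler_pM//; first by have [_] := Hc i.
exact: rV_coord_le.
Qed.

(** By translation invariance the difference quotients have integral [0]; they converge to the
    derivative and are dominated through the Lipschitz constant. *)
Lemma Int_partial0 f i : Ck setT 1 f -> bsupp f -> Int (partial i f) = 0.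
Proof.
move=> cf bf; have [C C0 fC] := C1_lipschitz cf bf; have [r fr] := bf.
have Lf := L1_C0 (CkT_cont cf) bf.
pose u n : V -> R := fun x => n.+1%:R * (f (x + n.+1%:R^-1 *: e_ i) - f x).
have Lu n : L1 (u n) by apply: L1Z; apply: L1B => //; exact: (Int_shift _ Lf).1.
have Iu n : Int (u n) = 0.
  have [L E] := Int_shift (n.+1%:R^-1 *: e_ i) Lf.
  by rewrite IntZ ?IntB// ?E ?subrr ?mulr0//; exact: L1B.
have [|||||_ cv] := @Int_dct R N u (partial i f) (fun x => C * \1_(@box R N (`|r| + 1)) x).
- by move=> n; exact: L1_meas.
- exact: continuous_measurable_rV (CkT_cont (Ck_partial i cf)).
- by apply: L1Z; exact: L1_indic_box.
- apply: aeW => x; have /is_derive_epsP H := Ck_derive i cf (I : setT x).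
  apply/cvgrPdist_le => e e0; have [del del0 Hd] := H e e0.
  have [m _ Hm] := near_infty_natSinv_lt (PosNum del0).
  exists m => // n /Hm /= nd.
  have n0 : 0 < n.+1%:R^-1 :> R by rewrite invr_gt0.
  have := Hd n.+1%:R^-1 (lt0r_neq0 n0); rewrite gtr0_norm// => /(_ nd).
  move=> H1.
  have nn : n.+1%:R != 0 :> R by [].
  rewrite /u (_ : _ - _ = - (n.+1%:R * (f (n.+1%:R^-1 *: e_ i + x) - f x - n.+1%:R^-1 * partial i f x))); last first.
    by rewrite [x + _]addrC [in RHS]mulrBr [n.+1%:R * (_^-1 * _)]mulrA mulfV// mul1r opprB.
  rewrite normrN normrM ger0_norm// -[leRHS](mulVKf nn) ler_wpM2l//.
  by rewrite [_^-1 * e]mulrC.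
- apply: aeW => x n; rewrite /u normrM ger0_norm//.
  have h1 : `|n.+1%:R^-1 *: e_ i| <= n.+1%:R^-1.
    by rewrite normrZ ger0_norm ?invr_ge0// ler_piMr ?invr_ge0// norm_delta.
  rewrite indicE; case: (boolP (x \in _)) => [_|xr].
    rewrite mulr1 -[leRHS](mulVKf (_ : n.+1%:R != 0 :> R))// ler_wpM2l//.
    by rewrite (le_trans (fC _ _))// mulrC ler_wpM2r.
  have rx : `|r| + 1 < `|x|.
    rewrite ltNge; apply: contra xr => xr; rewrite inE => j.
    exact: le_trans (rV_coord_le _ _) xr.
  rewrite !fr ?subrr ?normr0 ?mulr0//.
    by rewrite (le_lt_trans (ler_norm r))// (le_lt_trans _ rx)// lerDl.
  rewrite (le_lt_trans (ler_norm r))//.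
  have H1 : `|x| <= `|x + n.+1%:R^-1 *: e_ i| + n.+1%:R^-1.
    by rewrite -{1}(addrK (n.+1%:R^-1 *: e_ i) x) (le_trans (ler_normB _ _))// lerD2l.
  have H2 : n.+1%:R^-1 <= 1 :> R by rewrite invf_le1// ler1n.
  rewrite -(ltrD2r n.+1%:R^-1); apply: le_lt_trans (lt_le_trans rx H1).
  by rewrite lerD2l.
move: cv; under eq_fun do rewrite Iu.
by move/(cvg_lim (@Rhausdorff R)); rewrite lim_cst.
Qed.

Lemma L1_glue Om K f (psi : V -> R) : open Om -> closed K -> K `<=` Om ->
  Ck Om 0 f -> Ck setT 0 psi -> (forall x, ~ K x -> psi x = 0) -> bsupp psi ->
  L1 (fun x => f x * psi x).
Proof.
move=> oOm cK KO cf cp p0 bp; apply: L1_C0; last exact: bsupp_mulr.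
have : Ck setT 0 (fun x => f x * psi x).
  apply: (Ck_glue oOm cK KO); last by move=> x /p0 ->; rewrite mulr0.
  by apply: Ck_mul => //; exact: Ck_sub cp.
exact: CkT_cont.
Qed.

(** [f] is regular in [Om] only, but the product [f psi] vanishes off [K] and extends to a [C^1]
    function of bounded support, whose derivatives have integral [0]. *)
Lemma IBP_local Om K f psi i : open Om -> closed K -> K `<=` Om ->
  Ck Om 1 f -> Ck setT 1 psi -> (forall x, ~ K x -> psi x = 0) -> bsupp psi ->
  Int (fun x => partial i f x * psi x) = - Int (fun x => f x * partial i psi x).
Proof.
move=> oOm cK KO cf cp p0 bp.
have dp0 x : ~ K x -> partial i psi x = 0.
  move=> Kx; apply: partial0_near; have : open (~` K) by exact: closed_openC.
  move=> oK; have : nbhs x (~` K) by exact: open_nbhs_nbhs.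
  by apply: filterS => y; exact: p0.
have L1f : L1 (fun x => partial i f x * psi x).
  by apply: (L1_glue oOm cK KO) => //; [exact: Ck_partial|exact: CkS].
have L2f : L1 (fun x => f x * partial i psi x).
  apply: (L1_glue oOm cK KO) => //; [exact: CkS|exact: Ck_partial|exact: bsupp_partial].
have ch : Ck setT 1 (fun x => f x * psi x).
  apply: (Ck_glue oOm cK KO); last by move=> x /p0 ->; rewrite mulr0.
  by apply: Ck_mul => //; exact: Ck_sub cp.
have := Int_partial0 i ch (bsupp_mulr _ bp).
rewrite (_ : partial i _ = fun x => f x * partial i psi x + partial i f x * psi x).
  by rewrite IntD// => /eqP; rewrite addrC addr_eq0 => /eqP.
apply/funext => x; case: (pselect (K x)) => [/KO Ox|Kx]; last first.
  rewrite dp0// p0// !mulr0 addr0; apply: partial0_near.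
  have oK : open (~` K) by exact: closed_openC.
  have : nbhs x (~` K) by exact: open_nbhs_nbhs.
  by apply: filterS => y /p0 ->; rewrite mulr0.
rewrite [RHS]addrC [in RHS]mulrC [in RHS]addrC.
apply: is_derive_partial.
exact: is_derive_mul (Ck_derive i cf Ox) (Ck_derive i cp (I : setT x)).
Qed.

Lemma IBP f psi i : Ck setT 1 f -> Ck setT 1 psi -> bsupp psi ->
  Int (fun x => partial i f x * psi x) = - Int (fun x => f x * partial i psi x).
Proof.
move=> cf cp bp; apply: (IBP_local i openT closedT (@subset_refl _ setT)) => // x.
by move=> /(_ I).
Qed.

End bounded_support_calculus.

(** * Kernels supported in the unit ball and their convolutions *)

Section under_integral.
Context {R : realType} {N : nat}.
Notation V := 'rV[R]_N.
Notation mu := (lebesgue_rV N).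
Notation e_ i := (delta_mx ord0 i : V).
Implicit Types (f g chi th : V -> R).

Lemma Int_DUI g (k dk : R -> V -> R) (t0 d C C' : R) : 0 < d -> L1 g ->
  (forall t, `|t - t0| < d -> measurable_fun setT (k t) /\ forall y, `|k t y| <= C') ->
  (forall t y, `|t - t0| < d -> is_derive t 1 (k^~ y) (dk t y)) ->
  (forall t y, `|t - t0| < d -> `|dk t y| <= C) ->
  is_derive t0 1 (fun t => Int (fun y => g y * k t y)) (Int (fun y => g y * dk t0 y)).
Proof.
move=> d0 Lg mk Dk bk.
pose F t y := g y * k t y.
have in_I t : `]t0 - d, t0 + d[%classic t -> `|t - t0| < d.
  by rewrite /= in_itv/= ltr_norml => /andP[h1 h2]; apply/andP; split; lra.
have It0 : `]t0 - d, t0 + d[%classic t0 by rewrite /= in_itv/=; apply/andP; split; lra.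
have DF t y : `|t - t0| < d -> is_derive t 1 (F^~ y) (g y * dk t y).
  by move=> td; apply: is_derive_scl; exact: Dk.
have H1 t : `]t0 - d, t0 + d[%classic t -> mu.-integrable setT (EFin \o F t).
  by move=> /in_I td; have [m b] := mk t td; exact: L1Mb Lg m b.
have H2 t y : `]t0 - d, t0 + d[%classic t -> setT y -> derivable (F^~ y) t 1.
  by move=> /in_I td _; have [] := DF t y td.
have LG : mu.-integrable setT (EFin \o (fun y => C * `|g y|)).
  by have := L1Z C (L1_abs Lg).
have C0 (y : V) : 0 <= C.
  by apply: le_trans (bk t0 y _); rewrite // subrr normr0.
have H3 y : 0 <= C * `|g y| by rewrite mulr_ge0// (C0 y).
have E t y : `|t - t0| < d -> partial1of2 F t y = g y * dk t y.
  by move=> td; rewrite partial1of2E; have [_ ->] := DF t y td.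
have H4 t y : `]t0 - d, t0 + d[%classic t -> setT y -> `|partial1of2 F t y| <= C * `|g y|.
  move=> /in_I td _; rewrite E// normrM mulrC ler_wpM2r//; exact: bk.
have D1 := @derivable_under_integral R _ _ mu F setT measurableT t0 (t0 - d) (t0 + d) It0 H1 H2 _ H3 LG H4.
have D2 := @differentiation_under_integral R _ _ mu F setT measurableT t0 (t0 - d) (t0 + d) It0 H1 H2 _ H3 LG H4.
apply: DeriveDef; first exact: D1.
rewrite -derive1E [LHS]D2; apply: Int_ext => y.
by rewrite E// subrr normr0.
Qed.

Definition unit_kernel chi := Cinfty setT chi /\ forall z, 1 < sqn z -> chi z = 0.

(** Convolution with [chi (s .)] without the factor [s^N]: the power of [s] is put in separately,
    because it depends on the number of derivatives taken. *)
Definition cv g chi (s : R) (x : V) := Int (fun y => g y * chi (s *: (x - y))).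

Lemma kernel_bsupp chi : unit_kernel chi -> bsupp chi.
Proof.
move=> [_ H]; exists 1 => z z1; apply: H; apply: lt_le_trans (norm_le_sqn z).
by rewrite expr_gt1.
Qed.

Lemma kernel_partial chi i : unit_kernel chi -> unit_kernel (partial i chi).
Proof.
move=> [C H]; split; first by move=> k; exact: Ck_partial (C k.+1).
move=> z z1; apply: partial0_near.
have : \forall y \near z, 1 < sqn y.
  have cs : {for z, continuous (@sqn R N)} by exact: (CkT_cont (@Ck_sqn R N setT 0 openT)).
  by move/cvgr_gt : cs => /(_ _ z1).
by apply: filterS => y; exact: H.
Qed.

Lemma kernel_bump m : unit_kernel (bumpf m).
Proof.
split; first by move=> k; exact: Ck_bump.
by move=> z /ltW; exact: bump_supp.
Qed.

Lemma kernel_scl (c : R) chi : unit_kernel chi -> unit_kernel (fun z => c * chi z).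
Proof.
move=> [C H]; split; first by move=> k; apply: Ck_scl => //; exact: openT.
by move=> z /H ->; rewrite mulr0.
Qed.

Lemma kernel_add chi th : unit_kernel chi -> unit_kernel th -> unit_kernel (fun z => chi z + th z).
Proof.
move=> [C H] [C' H']; split; first by move=> k; apply: Ck_add => //; exact: openT.
by move=> z h; rewrite H// H'// addr0.
Qed.

Lemma kernel_coord j chi : unit_kernel chi -> unit_kernel (fun z => z ord0 j * chi z).
Proof.
move=> [C H]; split.
  by move=> k; apply: Ck_mul => //; [exact: openT|exact: Ck_coord].
by move=> z /H ->; rewrite mulr0.
Qed.

Lemma kernel_sum (I : Type) (s : seq I) (F : I -> V -> R) :
  (forall i, unit_kernel (F i)) -> unit_kernel (fun z => \sum_(i <- s) F i z).
Proof.
move=> kF; split; first by move=> k; apply: Ck_sum => [|i]; [exact: openT|exact: (kF i).1].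
by move=> z z1; apply: big1 => i _; exact: (kF i).2.
Qed.

Lemma kernel_bounded chi : unit_kernel chi -> exists2 C : R, 0 <= C & forall z, `|chi z| <= C.
Proof. by move=> k; apply: C0_bounded (kernel_bsupp k); exact: CkT_cont (k.1 0%N). Qed.

Lemma kernel_L1 chi : unit_kernel chi -> L1 chi.
Proof. by move=> k; apply: L1_C0 (kernel_bsupp k); exact: CkT_cont (k.1 0%N). Qed.

Definition moved chi (s : R) x : V -> R := fun y => chi (s *: (x - y)).

Lemma movedE chi s x : moved chi s x = fun y => chi ((- s) *: y + s *: x).
Proof. by apply/funext => y; rewrite /moved scalerBr scaleNr addrC. Qed.

Lemma moved_Cinfty chi s x : unit_kernel chi -> Cinfty setT (moved chi s x).
Proof. by move=> [C _] k; rewrite movedE; exact: Ck_affine. Qed.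

Lemma partial_moved chi s x i : unit_kernel chi ->
  partial i (moved chi s x) = fun y => - s * moved (partial i chi) s x y.
Proof.
move=> [C _]; apply/funext => y; rewrite [in LHS]movedE partial_affine ?movedE//.
exact: Ck_derivable (C 1%N) _.
Qed.

Lemma moved_meas chi s x : unit_kernel chi -> measurable_fun setT (moved chi s x).
Proof.
by move=> k; apply: continuous_measurable_rV; exact: CkT_cont (moved_Cinfty s x k 0%N).
Qed.

Lemma moved_supp chi s x y : unit_kernel chi -> 1 < `|s| * `|x - y| -> moved chi s x y = 0.
Proof.
move=> [_ H] h; apply: H; apply: lt_le_trans (norm_le_sqn _).
by rewrite normrZ expr_gt1.
Qed.

Lemma moved_bsupp chi s x : 0 < s -> unit_kernel chi -> bsupp (moved chi s x).
Proof.
move=> s0 k; exists (`|x| + s^-1) => y xy; apply: moved_supp => //.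
rewrite gtr0_norm// -ltr_pdivrMl// mulr1.
rewrite -(ltrD2l `|x|) (lt_le_trans xy)// -lerBlDl distrC.
by rewrite lerB_dist.
Qed.

Lemma laplacian_moved chi s x : unit_kernel chi ->
  laplacian (moved chi s x) = fun y => s ^+ 2 * moved (laplacian chi) s x y.
Proof.
move=> k; apply/funext => y; rewrite /laplacian /moved mulr_sumr; apply: eq_bigr => i _.
rewrite -/(moved chi s x) partial_moved//.
have Dk := Ck_derive i (moved_Cinfty s x (kernel_partial i k) 1%N) (I : setT y).
rewrite (is_derive_partial (is_derive_scl (- s) Dk)) partial_moved; last exact: kernel_partial.
by rewrite mulrA mulrNN -expr2.
Qed.

Lemma kernel_laplacian chi : unit_kernel chi -> unit_kernel (laplacian chi).
Proof. by move=> k; apply: kernel_sum => i; do 2 apply: kernel_partial. Qed.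

Lemma cv_L1 g chi s x : L1 g -> unit_kernel chi -> L1 (fun y => g y * chi (s *: (x - y))).
Proof.
move=> Lg k; have [C C0 HC] := kernel_bounded k.
exact: L1Mb Lg (moved_meas s x k) (fun y => HC _).
Qed.

Lemma cv_derive_x g chi s x i : L1 g -> unit_kernel chi ->
  is_derive x (e_ i) (cv g chi s) (s * cv g (partial i chi) s x).
Proof.
move=> Lg k; apply/is_derive_lineP.
have [C C0 HC] := kernel_bounded k.
have ki := kernel_partial i k.
have [C' C'0 HC'] := kernel_bounded ki.
have -> : s * cv g (partial i chi) s x =
    Int (fun y => g y * (s * partial i chi (s *: (0 *: e_ i + x - y)))).
  rewrite /cv -IntZ; last exact: (cv_L1 s x Lg ki).
  by apply: Int_ext => y; rewrite scale0r add0r mulrCA.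
apply: (@Int_DUI g (fun t y => chi (s *: (t *: e_ i + x - y)))
  (fun t y => s * partial i chi (s *: (t *: e_ i + x - y))) 0 1 (`|s| * C') C ltr01 Lg).
- move=> t _; split => // ; exact: (moved_meas s (t *: e_ i + x) k).
- move=> t y _.
  have E u : s *: (u *: e_ i + x - y) = s *: (x - y) + u *: (s *: e_ i).
    by rewrite -addrA scalerDr [LHS]addrC !scalerA [s * u]mulrC.
  have -> : (fun t => chi (s *: (t *: e_ i + x - y))) = (fun u => chi (s *: (x - y) + u *: (s *: e_ i))).
    by apply/funext => u; rewrite E.
  apply: is_derive_line; rewrite E.
  have := C1_is_derive (s *: e_ i) openT (k.1 1%N) (I : setT (s *: (x - y) + t *: (s *: e_ i))).
  rewrite (bigD1 i)//= big1 => [|j ji]; last by rewrite !mxE eqxx (negbTE ji) mulr0 mul0r.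
  by rewrite !mxE !eqxx mulr1 addr0.
- by move=> t y _; rewrite normrM ler_wpM2l.
Qed.

Lemma Ck_cv g chi s k : L1 g -> unit_kernel chi -> Ck setT k (cv g chi s).
Proof.
move=> Lg; have cc th : unit_kernel th -> continuous (cv g th s).
  move=> kt x; have [C C0 HC] := C1_lipschitz (kt.1 1%N) (kernel_bsupp kt).
  apply/(@cvgrPdist_le _ _ _ (nbhs x)) => e e0.
  pose A := C * `|s| * Int (fun y => `|g y|) + 1.
  have A0 : 0 < A by rewrite ltr_wpDl// mulr_ge0// ?mulr_ge0//; exact: Int_ge0.
  apply/nbhs_ballP; exists (e / A); first exact: divr_gt0.
  move=> z; rewrite mx_norm_ball /ball_/= ltr_pdivlMr// => xz.
  have L1x := cv_L1 s x Lg kt; have L1z := cv_L1 s z Lg kt.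
  rewrite /cv -IntB//; apply: (le_trans (le_Int_abs (L1B L1x L1z))).
  apply: (@le_trans _ _ (Int (fun y => (C * `|s| * `|x - z|) * `|g y|))).
    apply: le_Int; [exact/L1_abs/L1B|exact/L1Z/L1_abs|move=> y].
    rewrite -mulrBr normrM mulrC ler_wpM2r//.
    rewrite (_ : s *: (x - y) = s *: (z - y) + s *: (x - z)).
      by rewrite (le_trans (HC _ _))// normrZ mulrA.
    by rewrite -scalerDr; congr (_ *: _); rewrite [RHS]addrC addrA subrK.
  rewrite IntZ; last exact: L1_abs.
  rewrite mulrAC (le_trans _ (ltW xz))// mulrC ler_wpM2l// lerDl//.
elim: k chi => [|k IH] chi kc; first by split => // x _; exact: cc.
split => [x _|i]; first exact: cc.
split; first by move=> x _; have [] := cv_derive_x s x i Lg kc.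
rewrite (_ : partial i _ = fun x => s * cv g (partial i chi) s x).
  by apply: Ck_scl; [exact: openT|apply: IH; exact: kernel_partial].
by apply/funext => x; rewrite (is_derive_partial (cv_derive_x s x i Lg kc)).
Qed.

(** The radial derivative [z . grad chi]; it appears when [chi (s (x - y))] is differentiated in
    [s]. *)
Definition euler chi : V -> R := fun z => \sum_j z ord0 j * partial j chi z.

Lemma kernel_euler chi : unit_kernel chi -> unit_kernel (euler chi).
Proof. by move=> k; apply: kernel_sum => j; apply: kernel_coord; exact: kernel_partial. Qed.

Lemma cv_derive_s g chi (s : R) x : 0 < s -> L1 g -> unit_kernel chi ->
  is_derive s 1 (fun s => cv g chi s x) (s^-1 * cv g (euler chi) s x).
Proof.
move=> s0 Lg k.
have [C C0 HC] := kernel_bounded k.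
have ke := kernel_euler k.
have [C' C'0 HC'] := kernel_bounded ke.
have s20 : 0 < s / 2 by rewrite divr_gt0.
have -> : s^-1 * cv g (euler chi) s x = Int (fun y => g y * (s^-1 * euler chi (s *: (x - y)))).
  rewrite /cv -IntZ; last exact: (cv_L1 s x Lg ke).
  by apply: Int_ext => y; rewrite mulrCA.
apply: (@Int_DUI g (fun t y => chi (t *: (x - y)))
  (fun t y => t^-1 * euler chi (t *: (x - y))) s (s / 2) (2 / s * C') C s20 Lg).
- move=> t _; split => // ; exact: (moved_meas t x k).
- move=> t y ts; have t0 : 0 < t by move: ts; rewrite ltr_norml => /andP[]; lra.
  have -> : (fun t => chi (t *: (x - y))) = (fun u => chi (0 + u *: (x - y))).
    by apply/funext => u; rewrite add0r.
  apply: is_derive_line; rewrite add0r.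
  have := C1_is_derive (x - y) openT (k.1 1%N) (I : setT (t *: (x - y))).
  rewrite /euler mulr_sumr; under [X in _ -> is_derive _ _ _ X]eq_bigr do
    rewrite mxE !mulrA mulVf ?(lt0r_neq0 t0)// mul1r.
  by [].
- move=> t y ts; have t0 : s / 2 < t by move: ts; rewrite ltr_norml => /andP[]; lra.
  have t00 : 0 < t by exact: lt_trans t0.
  rewrite normrM ler_pM// ger0_norm ?invr_ge0 ?(ltW t00)//.
  by rewrite -[2 / s]invf_div lef_pV2 ?posrE// ltW.
Qed.

End under_integral.

(** * Scale derivative of mollifications *)

Section kernel_identity.
Context {R : realType} {N : nat}.
Notation V := 'rV[R]_N.
Notation mu := (lebesgue_rV N).
Notation e_ i := (delta_mx ord0 i : V).
Implicit Types (f g chi th : V -> R).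

(* With this relation the s-derivative of s^d int g(y) chi(s(x-y)) dy only involves the
   distributional Laplacian of g. *)
Definition euler_hom (d : nat) chi th :=
  forall z, d%:R * chi z + euler chi z = - laplacian th z.

Definition rho : V -> R := fun z => 2 * bumpf 1 z.

Lemma kernel_rho : unit_kernel rho.
Proof. by apply: kernel_scl; exact: kernel_bump. Qed.

Lemma rho_ge0 z : 0 <= rho z.
Proof. by rewrite mulr_ge0//; exact: flat1_ge0. Qed.

Lemma partial_scl (k : R) f i : (forall x, derivable f x (e_ i)) ->
  partial i (fun x => k * f x) = fun x => k * partial i f x.
Proof.
move=> df; apply/funext => x; apply: is_derive_partial.
by apply: is_derive_scl; exact: derivable_partial.
Qed.

Lemma is_derive_coord j i (z : V) : is_derive z (e_ i) (fun y : V => y ord0 j) ((i == j)%:R : R).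
Proof.
apply/is_derive_epsP => e e0; exists 1 => // h h0 _.
rewrite !mxE eqxx/= addrK [j == i]eq_sym subrr normr0.
by rewrite mulr_ge0// ltW.
Qed.

Lemma kernel_derive chi i z : unit_kernel chi -> is_derive z (e_ i) chi (partial i chi z).
Proof. by move=> k; exact: Ck_derive (k.1 1%N) (I : setT z). Qed.

Lemma is_derive_coord_mul j i chi z : unit_kernel chi ->
  is_derive z (e_ i) (fun z => z ord0 j * chi z) ((i == j)%:R * chi z + z ord0 j * partial i chi z).
Proof.
move=> k; have := is_derive_mul (is_derive_coord j i z) (kernel_derive i z k).
by rewrite addrC [chi z * _]mulrC.
Qed.

Lemma partial_bumpf0 i : partial i (bumpf 0) = fun z : V => - (z ord0 i * rho z).
Proof. by rewrite partial_bump; apply/funext => z; rewrite /rho; ring. Qed.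

(** The gradient of [bumpf 0] is [- z rho(z)], so minus its Laplacian is the divergence of [z rho],
    namely [N rho + z . grad rho]. This determines the choice of [rho]. *)
Lemma hom_base : euler_hom N rho (bumpf 0).
Proof.
move=> z; rewrite /euler /laplacian.
have Pr j : partial j rho z = - 4 * (z ord0 j * bumpf 2 z).
  rewrite partial_scl; last by move=> x; have [] := is_derive_bump 1 j x.
  by rewrite partial_bump; ring.
have P2 j : partial j (partial j (bumpf 0)) z = - (rho z + z ord0 j * partial j rho z).
  rewrite partial_bumpf0.
  have := is_derive_scl (-1) (is_derive_coord_mul j j z kernel_rho).
  under eq_fun do rewrite mulN1r.
  by rewrite mulN1r eqxx mul1r => /is_derive_partial.
under [in RHS]eq_bigr do rewrite P2.
rewrite sumrN opprK big_split/= sumr_const card_ord mulr_natl.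
by [].
Qed.

Lemma partial_sum (I : Type) (s : seq I) (F : I -> V -> R) i z :
  (forall k, derivable (F k) z (e_ i)) ->
  partial i (fun z => \sum_(k <- s) F k z) z = \sum_(k <- s) partial i (F k) z.
Proof.
move=> dF; apply: is_derive_partial; elim: s => [|a s IH].
  rewrite big_nil (_ : (fun _ => _) = cst 0); first exact: is_derive_cst.
  by apply/funext => y; rewrite big_nil.
rewrite big_cons (_ : (fun _ => _) = fun z => F a z + \sum_(k <- s) F k z).
  by apply: is_derive_add => //; exact: derivable_partial.
by apply/funext => y; rewrite big_cons.
Qed.

(** [d_i (z . grad chi) = d_i chi + z . grad (d_i chi)]: differentiation raises the degree by one,
    so the derivatives of a mollification obey identities of the same kind. *)
Lemma hom_step d chi th i : unit_kernel chi -> unit_kernel th ->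
  euler_hom d chi th -> euler_hom d.+1 (partial i chi) (partial i th).
Proof.
move=> kc kt H z.
have sw j (t : V -> R) : unit_kernel t -> partial i (partial j t) = partial j (partial i t).
  by move=> k; apply/funext => y; apply: schwarz; exact: k.1.
have L : partial i (fun z => d%:R * chi z + euler chi z) z =
    d%:R * partial i chi z + (partial i chi z + euler (partial i chi) z).
  have De : partial i (euler chi) z = partial i chi z + euler (partial i chi) z.
    rewrite /euler partial_sum; last first.
      by move=> j; have [] := is_derive_coord_mul j i z (kernel_partial j kc).
    have E j : partial i (fun z => z ord0 j * partial j chi z) z =
        (i == j)%:R * partial j chi z + z ord0 j * partial j (partial i chi) z.
      by rewrite (is_derive_partial (is_derive_coord_mul j i z (kernel_partial j kc))) sw.
    under eq_bigr do rewrite E.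
    rewrite big_split/= (bigD1 i)//= eqxx mul1r big1 ?addr0// => j ji.
    by rewrite eq_sym (negbTE ji) mul0r.
  rewrite -De; apply: is_derive_partial; apply: is_derive_add.
    by apply: is_derive_scl; exact: kernel_derive.
  by apply: kernel_derive; exact: kernel_euler.
have Rr : partial i (fun z => - laplacian th z) z = - laplacian (partial i th) z.
  have -> : laplacian (partial i th) z = partial i (laplacian th) z.
    rewrite /laplacian partial_sum; last first.
      by move=> j; have [] := kernel_derive i z (kernel_partial j (kernel_partial j kt)).
    apply: eq_bigr => j _.
    have E1 := sw j (partial j th) (kernel_partial j kt); have E2 := sw j th kt.
    by rewrite E1 E2.
  apply: is_derive_partial; have := is_derive_scl (-1) (kernel_derive i z (kernel_laplacian kt)).
  by under eq_fun do rewrite mulN1r; rewrite mulN1r.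
rewrite -Rr -(_ : (fun z => d%:R * chi z + euler chi z) = fun z => - laplacian th z); last exact/funext.
by rewrite L -[d.+1]addn1 natrD mulrDl mul1r addrA.
Qed.

Lemma cv_add g chi th s x : L1 g -> unit_kernel chi -> unit_kernel th ->
  cv g (fun z => chi z + th z) s x = cv g chi s x + cv g th s x.
Proof.
move=> Lg kc kt; rewrite /cv -IntD; [|exact: (cv_L1 s x Lg kc)|exact: (cv_L1 s x Lg kt)].
by apply: Int_ext => y; rewrite mulrDr.
Qed.

Lemma cv_scl g chi (k : R) s x : L1 g -> unit_kernel chi ->
  cv g (fun z => k * chi z) s x = k * cv g chi s x.
Proof.
move=> Lg kc; rewrite /cv -IntZ; last exact: (cv_L1 s x Lg kc).
by apply: Int_ext => y; rewrite mulrCA.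
Qed.

Lemma cv_hom_derive d g chi th (s : R) x : 0 < s -> L1 g -> unit_kernel chi -> unit_kernel th ->
  euler_hom d.+1 chi th ->
  is_derive s 1 (fun s => s ^+ d.+1 * cv g chi s x) (- (s ^+ d * cv g (laplacian th) s x)).
Proof.
move=> s0 Lg kc kt H.
have D1 : is_derive s 1 (fun t : R => t ^+ d.+1) (d.+1%:R * s ^+ d).
  apply: DeriveDef; first exact: exprn_derivable.
  by rewrite exp_derive [_ *: 1]mulr1.
have := is_derive_mul D1 (cv_derive_s x s0 Lg kc).
rewrite (_ : _ + _ = - (s ^+ d * cv g (laplacian th) s x))//.
have -> : cv g (laplacian th) s x = - (d.+1%:R * cv g chi s x + cv g (euler chi) s x).
  rewrite -cv_scl// -cv_add//; [|exact: kernel_scl|exact: kernel_euler].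
  rewrite -mulN1r -cv_scl//; last first.
    by apply: kernel_add; [exact: kernel_scl|exact: kernel_euler].
  by apply: Int_ext => y; rewrite H mulN1r opprK.
rewrite exprS; field; exact: lt0r_neq0.
Qed.

Lemma cv_hom_step d g chi th (s0 s1 : R) x B : 0 < s0 -> s0 <= s1 -> L1 g ->
  unit_kernel chi -> unit_kernel th -> euler_hom d.+1 chi th ->
  (forall s, s0 <= s -> s <= s1 -> `|s ^+ d * cv g (laplacian th) s x| <= B) ->
  `|s1 ^+ d.+1 * cv g chi s1 x - s0 ^+ d.+1 * cv g chi s0 x| <= (s1 - s0) * B.
Proof.
move=> s00 s01 Lg kc kt H HB.
pose W (s : R) := s ^+ d.+1 * cv g chi s x.
have D s : s0 <= s -> is_derive s 1 W (- (s ^+ d * cv g (laplacian th) s x)).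
  by move=> ss; apply: cv_hom_derive => //; exact: lt_le_trans ss.
have [||c] := @MVT_segment R W (fun s => - (s ^+ d * cv g (laplacian th) s x)) s0 s1 s01.
- by move=> s; rewrite in_itv/= => /andP[/ltW ss _]; exact: D.
- by apply: derivable_within_continuous => s; rewrite in_itv/= => /andP[ss _]; have [] := D s ss.
rewrite in_itv/= => /andP[c0 c1] E; rewrite -/(W s1) -/(W s0) E normrM normrN mulrC.
by rewrite ger0_norm ?subr_ge0// ler_wpM2l ?subr_ge0// HB.
Qed.

(** A nonpositive Laplacian at every scale makes the scaled convolution increase with [s]; for
    [chi = rho] this is the mean value inequality of superharmonic functions. *)
Lemma cv_hom_mono d g chi th (s0 s1 : R) x : 0 < s0 -> s0 <= s1 -> L1 g ->
  unit_kernel chi -> unit_kernel th -> euler_hom d.+1 chi th ->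
  (forall s, s0 <= s -> s <= s1 -> cv g (laplacian th) s x <= 0) ->
  s0 ^+ d.+1 * cv g chi s0 x <= s1 ^+ d.+1 * cv g chi s1 x.
Proof.
move=> s00 s01 Lg kc kt H HB.
pose W (s : R) := s ^+ d.+1 * cv g chi s x.
have D s : s0 <= s -> is_derive s 1 W (- (s ^+ d * cv g (laplacian th) s x)).
  by move=> ss; apply: cv_hom_derive => //; exact: lt_le_trans ss.
have [||c] := @MVT_segment R W (fun s => - (s ^+ d * cv g (laplacian th) s x)) s0 s1 s01.
- by move=> s; rewrite in_itv/= => /andP[/ltW ss _]; exact: D.
- by apply: derivable_within_continuous => s; rewrite in_itv/= => /andP[ss _]; have [] := D s ss.
rewrite in_itv/= => /andP[c0 c1] E; rewrite -subr_ge0 -/(W s1) -/(W s0) E.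
rewrite mulr_ge0 ?subr_ge0// oppr_ge0 mulr_ge0_le0 ?HB// exprn_ge0// ltW//.
exact: lt_le_trans c0.
Qed.

(** The one-sided form serves subsolutions, for which the scale derivative is bounded from above
    only. *)
Lemma cv_hom_upper d g chi th (s0 s1 : R) x B : 0 < s0 -> s0 <= s1 -> L1 g ->
  unit_kernel chi -> unit_kernel th -> euler_hom d.+1 chi th ->
  (forall s, s0 <= s -> s <= s1 -> - (s ^+ d * cv g (laplacian th) s x) <= B) ->
  s1 ^+ d.+1 * cv g chi s1 x - s0 ^+ d.+1 * cv g chi s0 x <= (s1 - s0) * B.
Proof.
move=> s00 s01 Lg kc kt H HB.
pose W (s : R) := s ^+ d.+1 * cv g chi s x.
have D s : s0 <= s -> is_derive s 1 W (- (s ^+ d * cv g (laplacian th) s x)).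
  by move=> ss; apply: cv_hom_derive => //; exact: lt_le_trans ss.
have [||c] := @MVT_segment R W (fun s => - (s ^+ d * cv g (laplacian th) s x)) s0 s1 s01.
- by move=> s; rewrite in_itv/= => /andP[/ltW ss _]; exact: D.
- by apply: derivable_within_continuous => s; rewrite in_itv/= => /andP[ss _]; have [] := D s ss.
rewrite in_itv/= => /andP[c0 c1] E; rewrite -/(W s1) -/(W s0) E mulrC.
by rewrite ler_wpM2l ?subr_ge0// HB.
Qed.

Lemma cv_laplacian_weak f g th (s : R) x : 0 < s -> unit_kernel th ->
  Int (fun y => g y * laplacian (moved th s x) y) = - Int (fun y => f y * moved th s x y) ->
  L1 g ->
  cv g (laplacian th) s x = - (s ^- 2 * cv f th s x).
Proof.
move=> s0 kt W Lg; rewrite /cv.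
have s2 : s ^+ 2 != 0 by rewrite expf_neq0// lt0r_neq0.
apply: (mulfI s2); rewrite mulrN mulrA mulfV// mul1r -W -IntZ.
  by apply: Int_ext => y; rewrite laplacian_moved// mulrCA.
exact: (cv_L1 s x Lg (kernel_laplacian kt)).
Qed.

(** Only one derivative is moved to [phi], because the energy controls no more; the other one stays
    on the kernel, hence the factor [s^-1]. *)
Lemma cv_laplacian_C1 (phi : V -> R) th (s : R) x : 0 < s -> unit_kernel th ->
  Ck setT 1 phi -> bsupp phi ->
  cv phi (laplacian th) s x = s^-1 * \sum_i cv (partial i phi) (partial i th) s x.
Proof.
move=> s0 kt cp bp.
have sn0 : s != 0 by rewrite lt0r_neq0.
have Lp : L1 phi by apply: L1_C0 => //; exact: CkT_cont cp.
have kii i : unit_kernel (partial i (partial i th)) by do 2 apply: kernel_partial.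
transitivity (\sum_i cv phi (partial i (partial i th)) s x).
  rewrite /cv -Int_sum; last by move=> i; exact: (cv_L1 s x Lp (kii i)).
  by apply: Int_ext => y; rewrite /laplacian mulr_sumr.
rewrite mulr_sumr; apply: eq_bigr => i _.
have ki := kernel_partial i kt.
suff -> : cv (partial i phi) (partial i th) s x = s * cv phi (partial i (partial i th)) s x.
  by rewrite mulKf.
rewrite /cv IBP//; [|exact: moved_Cinfty ki _|exact: moved_bsupp].
rewrite -(IntZ s (cv_L1 s x Lp (kii i))) -IntN.
  apply: Int_ext => y.
  by rewrite -/(moved (partial i th) s x) partial_moved// /moved; ring.
rewrite -/(moved (partial i th) s x) partial_moved//.
apply: L1_ext (L1Z (- s) (cv_L1 s x Lp (kii i))) => y.
by rewrite /moved; ring.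
Qed.

Lemma Int_moved (F : V -> R) (s : R) x : 0 < s -> L1 F ->
  L1 (fun y => F (s *: (x - y))) /\ Int (fun y => F (s *: (x - y))) = s ^- N * Int F.
Proof.
move=> s0 LF; have sn0 : - s != 0 by rewrite oppr_eq0 lt0r_neq0.
have := Int_affine (s *: x) sn0 LF.
rewrite normrN gtr0_norm//.
have -> // : (fun y => F (s *: (x - y))) = (fun y => F (- s *: y + s *: x)).
by apply/funext => y; rewrite scalerBr scaleNr addrC.
Qed.

Lemma cv_bound_sup f th (s M : R) x : 0 < s -> unit_kernel th -> L1 f ->
  (forall y, s * `|x - y| <= 1 -> `|f y| <= M) ->
  `|cv f th s x| <= M * (s ^- N * Int (fun z => `|th z|)).
Proof.
move=> s0 kt Lf fM.
have La := L1_abs (kernel_L1 kt).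
have [L1' <-] := Int_moved x s0 La.
have Lc := cv_L1 s x Lf kt.
apply: (le_trans (le_Int_abs Lc)); rewrite -IntZ//.
apply: le_Int; [exact: L1_abs|exact: L1Z|move=> y].
rewrite normrM; have [h|h] := leP (s * `|x - y|) 1; first by rewrite ler_wpM2r// fM.
have E : th (s *: (x - y)) = 0 by apply: (@moved_supp _ _ th s x y kt); rewrite gtr0_norm.
by rewrite E normr0 !mulr0.
Qed.

Lemma cv_bound_CS f th (s : R) x : 0 < s -> unit_kernel th -> L1 f -> L1 (fun y => f y ^+ 2) ->
  cv f th s x ^+ 2 <= Int (fun y => f y ^+ 2) * (s ^- N * Int (fun z => th z ^+ 2)).
Proof.
move=> s0 kt Lf Lf2.
have Lt2 : L1 (fun z => th z ^+ 2).
  have [C C0 HC] := kernel_bounded kt.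
  exact: L1Mb (kernel_L1 kt) (L1_meas (kernel_L1 kt)) HC.
have [L2' <-] := Int_moved x s0 Lt2.
apply: Int_CS => //; first exact: (cv_L1 s x Lf kt).
- by move=> y; exact: sqr_ge0.
- by move=> y; exact: sqr_ge0.
- by move=> y; rewrite exprMn.
Qed.

End kernel_identity.

(** * Energy and mollification *)

Section energy.
Context {R : realType} {N : nat}.
Notation V := 'rV[R]_N.
Notation mu := (lebesgue_rV N).
Notation e_ i := (delta_mx ord0 i : V).
Implicit Types (f g chi th phi : V -> R).

Definition energy phi : R := Int (fun x => \sum_i partial i phi x ^+ 2).

Lemma CS_sum (a b : 'I_N -> R) :
  (\sum_i a i * b i) ^+ 2 <= (\sum_i a i ^+ 2) * (\sum_i b i ^+ 2).
Proof.
apply: quadratic_ge0_disc; first by apply: sumr_ge0 => i _; exact: sqr_ge0.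
move=> t; rewrite (_ : _ + _ = \sum_i (a i * t + b i) ^+ 2); first by apply: sumr_ge0 => i _; exact: sqr_ge0.
rewrite mulr_suml -mulrA mulr_suml mulr_sumr -!big_split/=; apply: eq_bigr => i _; ring.
Qed.

Lemma sqr_sum_le n (a : 'I_n -> R) : (\sum_i a i) ^+ 2 <= n%:R * \sum_i a i ^+ 2.
Proof.
apply: quadratic_ge0_disc => // t.
rewrite (_ : _ + _ = \sum_i (t + a i) ^+ 2); first by apply: sumr_ge0 => i _; exact: sqr_ge0.
transitivity (\sum_(i < n) (t ^+ 2 + 2 * a i * t + a i ^+ 2)).
  by rewrite !big_split/= sumr_const card_ord -mulr_suml -mulr_sumr [n%:R * _]mulr_natl.
by apply: eq_bigr => i _; ring.
Qed.

Lemma energy_ge0 phi : 0 <= energy phi.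
Proof. by apply: Int_ge0 => x; apply: sumr_ge0 => i _; exact: sqr_ge0. Qed.

Lemma C0_partial i phi : Ck setT 1 phi -> continuous (partial i phi).
Proof. by move=> c; exact: CkT_cont (Ck_partial i c). Qed.

Lemma continuous_sqr f : continuous f -> continuous (fun x => f x ^+ 2).
Proof. by move=> cf x; under eq_fun do rewrite expr2; apply: continuousM; exact: cf. Qed.

Lemma L1_sqr f : continuous f -> bsupp f -> L1 (fun x => f x ^+ 2).
Proof.
move=> cf bf; apply: L1_C0; first exact: continuous_sqr.
by have [r H] := bf; exists r => x /H ->; rewrite expr0n.
Qed.

Lemma L1_partial_sqr phi i : Ck setT 1 phi -> bsupp phi -> L1 (fun x => partial i phi x ^+ 2).
Proof. by move=> cp bp; apply: L1_sqr; [exact: C0_partial|exact: bsupp_partial]. Qed.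

Lemma energyE phi : Ck setT 1 phi -> bsupp phi ->
  L1 (fun x => \sum_i partial i phi x ^+ 2) /\
  energy phi = \sum_i Int (fun x => partial i phi x ^+ 2).
Proof.
move=> cp bp; split; first by apply: L1_sum => i; exact: L1_partial_sqr.
by rewrite /energy Int_sum// => i; exact: L1_partial_sqr.
Qed.

Lemma energy_partial phi i : Ck setT 1 phi -> bsupp phi ->
  Int (fun x => partial i phi x ^+ 2) <= energy phi.
Proof.
move=> cp bp; have [_ ->] := energyE cp bp; rewrite (bigD1 i)//= lerDl sumr_ge0// => j _.
by apply: Int_ge0 => x; exact: sqr_ge0.
Qed.

(** The translation by [h] is divided into [n + 1] equal ones. By Cauchy-Schwarz and translation
    invariance the integral is at most that of the squared difference quotient [v n], which tends to
    the directional derivative [Dh]. *)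
Lemma shift_energy phi h : Ck setT 1 phi -> bsupp phi ->
  Int (fun x => (phi (x + h) - phi x) ^+ 2) <= sqn h * energy phi.
Proof.
move=> cp bp; have [C C0 HC] := C1_lipschitz cp bp; have [r fr] := bp.
have cphi := CkT_cont cp.
have cshift k : continuous (fun x : V => phi (x + k)).
  move=> x; apply: (@continuous_comp _ _ _ (fun x : V => x + k) phi); last exact: cphi.
  by apply: continuousD; [exact: cvg_id|exact: cst_continuous].
have bshift k : bsupp (fun x => phi (x + k)).
  exists (r + `|k|) => x rx; apply: fr; rewrite -(ltrD2r `|k|) (lt_le_trans rx)//.
  by rewrite -{1}(addrK k x) (le_trans (ler_normB _ _)).
have bB f g : bsupp f -> bsupp g -> bsupp (fun x => f x - g x).
  move=> [s fs] [t gt]; exists (Num.max s t) => x; rewrite gt_max => /andP[h1 h2].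
  by rewrite fs// gt// subrr.
have Lsq k l : L1 (fun x => (phi (x + k) - phi (x + l)) ^+ 2).
  by apply: L1_sqr; [move=> x; apply: continuousB; exact: cshift|exact: bB].
have Lsq0 k : L1 (fun x => (phi (x + k) - phi x) ^+ 2).
  by apply: L1_ext (Lsq k 0) => x; rewrite addr0.
pose v n : V -> R := fun x => n.+1%:R * (phi (x + n.+1%:R^-1 *: h) - phi x).
pose Dh x := \sum_i h ord0 i * partial i phi x.
have step n : Int (fun x => (phi (x + h) - phi x) ^+ 2) <= Int (fun x => v n x ^+ 2).
  pose d := n.+1%:R^-1 *: h.
  have dh : h = n.+1%:R *: d by rewrite scalerA mulfV// scale1r.
  pose w (j : nat) x := phi (x + j%:R *: d).
  have Lw j : L1 (fun x => (w j.+1 x - w j x) ^+ 2) by exact: Lsq.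
  have Iw j : Int (fun x => (w j.+1 x - w j x) ^+ 2) = Int (fun x => (phi (x + d) - phi x) ^+ 2).
    have L0 : L1 (fun x => (phi (x + d) - phi x) ^+ 2) := Lsq0 d.
    have [_ <-] := Int_shift (j%:R *: d) L0.
    by apply: Int_ext => x; rewrite /w -natr1 scalerDl scale1r addrA.
  apply: (@le_trans _ _ (Int (fun x => n.+1%:R * \sum_(j < n.+1) (w j.+1 x - w j x) ^+ 2))).
    apply: le_Int; [exact: Lsq0|by apply/L1Z/L1_sum => j; exact: Lw|move=> x].
    rewrite (_ : phi (x + h) - phi x = \sum_(j < n.+1) (w j.+1 x - w j x)); first exact: sqr_sum_le.
    rewrite -(big_mkord xpredT (fun j => w j.+1 x - w j x)) telescope_sumr//.
    by rewrite /w -dh scale0r addr0.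
  rewrite IntZ; last by apply: L1_sum => j; exact: Lw.
  rewrite Int_sum//; under eq_bigr do rewrite Iw.
  rewrite sumr_const card_ord -[Int _ *+ _]mulr_natl mulrA -expr2 -(IntZ _ (Lsq0 d)).
  apply: le_Int; [|by apply: L1_ext (L1Z (n.+1%:R ^+ 2) (Lsq d 0)) => x; rewrite addr0 /v exprMn|by move=> x; rewrite /v exprMn].
  exact: L1Z.
have LDh : L1 (fun x => Dh x ^+ 2).
  apply: L1_sqr; first by apply: CkT_cont; apply: (@Ck_sum R N setT 0) => [|i]; [exact: openT|apply: Ck_scl; [exact: openT|exact: Ck_partial]].
  exists r => x rx; apply: big1 => i _.
  by rewrite (@partial_supp _ _ _ _ _ fr) ?mulr0.
have Lv n : L1 (fun x => v n x ^+ 2).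
  by apply: L1_ext (L1Z (n.+1%:R ^+ 2) (Lsq (n.+1%:R^-1 *: h) 0)) => x; rewrite addr0 /v exprMn.
have [|||||_ cv] := @Int_dct R N (fun n x => v n x ^+ 2) (fun x => Dh x ^+ 2) (fun x => (C * `|h|) ^+ 2 * \1_(@box R N (`|r| + `|h|)) x).
- by move=> n; exact: L1_meas.
- exact: L1_meas.
- by apply: L1Z; exact: L1_indic_box.
- apply: aeW => x.
  suff : v n x @[n --> \oo] --> Dh x by move=> H; under eq_fun do rewrite expr2; rewrite expr2; exact: cvgM.
  have /is_derive_epsP H := C1_is_derive h openT cp (I : setT x).
  apply/cvgrPdist_le => e e0; have [del del0 Hd] := H e e0.
  have [m _ Hm] := near_infty_natSinv_lt (PosNum del0).
  exists m => // n /Hm /= nd.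
  have n0 : 0 < n.+1%:R^-1 :> R by rewrite invr_gt0.
  have := Hd n.+1%:R^-1 (lt0r_neq0 n0); rewrite gtr0_norm// => /(_ nd) H1.
  have nn : n.+1%:R != 0 :> R by [].
  rewrite /v (_ : _ - _ = - (n.+1%:R * (phi (n.+1%:R^-1 *: h + x) - phi x - n.+1%:R^-1 * Dh x))); last first.
    by rewrite [x + _]addrC [in RHS]mulrBr [n.+1%:R * (_^-1 * _)]mulrA mulfV// mul1r opprB.
  rewrite normrN normrM ger0_norm// -[leRHS](mulVKf nn) ler_wpM2l//.
  by rewrite [_^-1 * e]mulrC.
- apply: aeW => x n; rewrite ger0_norm ?sqr_ge0//.
  have h1 : `|n.+1%:R^-1 *: h| = n.+1%:R^-1 * `|h| by rewrite normrZ ger0_norm ?invr_ge0.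
  have h2 : n.+1%:R^-1 * `|h| <= `|h| by rewrite ler_piMl// invf_le1// ler1n.
  rewrite indicE; case: (boolP (x \in _)) => [_|xr].
    rewrite mulr1 -[leLHS]ger0_norm ?sqr_ge0// normrX lerXn2r ?nnegrE ?mulr_ge0//.
    rewrite /v normrM ger0_norm// -ler_pdivlMl// (le_trans (HC _ _))// h1.
    by rewrite mulrCA.
  have rx : `|r| + `|h| < `|x|.
    rewrite ltNge; apply: contra xr => xr; rewrite inE => j.
    exact: le_trans (rV_coord_le _ _) xr.
  rewrite /v !fr ?subrr ?mulr0 ?expr0n//.
    by rewrite (le_lt_trans (ler_norm r))// (le_lt_trans _ rx)// lerDl.
  rewrite (le_lt_trans (ler_norm r))// -(ltrD2r `|h|) (lt_le_trans rx)//.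
  rewrite -{1}(addrK (n.+1%:R^-1 *: h) x) (le_trans (ler_normB _ _))// lerD2l.
  by rewrite h1.
have [LE _] := energyE cp bp.
apply: (@le_trans _ _ (Int (fun x => Dh x ^+ 2))).
  rewrite -(cvg_lim (@Rhausdorff R) cv).
  apply: limr_ge; first by apply/cvg_ex; eexists; exact: cv.
  by apply: nearW => n; exact: step.
rewrite -IntZ//; apply: le_Int => //; first exact: L1Z.
by move=> x; exact: CS_sum.
Qed.

(** A translation by [2 r + 1] moves the support off itself, so the left side of [shift_energy]
    becomes twice the integral of [phi^2]. *)
Lemma poincare phi r : (0 < N)%N -> Ck setT 1 phi -> 0 <= r ->
  (forall x, r < `|x| -> phi x = 0) ->
  Int (fun x => phi x ^+ 2) <= (2 * r + 1) ^+ 2 * energy phi.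
Proof.
move=> N0 cp r0 fr; have bp : bsupp phi by exists r.
pose L := 2 * r + 1; have L0 : 0 <= L by rewrite addr_ge0// mulr_ge0.
pose h : V := L *: e_ (Ordinal N0).
have H := shift_energy h cp bp.
have sh : sqn h = L ^+ 2.
  rewrite /sqn (bigD1 (Ordinal N0))//= !mxE !eqxx mulr1 big1 ?addr0// => i i0.
  by rewrite !mxE (negbTE i0) andbF mulr0 expr0n.
have nh : `|h| = L.
  apply/eqP; rewrite eq_le; apply/andP; split.
    by rewrite normrZ ger0_norm// ler_piMr// norm_delta.
  have := rV_coord_le h (Ordinal N0).
  by rewrite !mxE !eqxx mulr1 ger0_norm.
have L2 := L1_sqr (CkT_cont cp) bp.
have [L2h I2h] := Int_shift h L2.
have : Int (fun x => (phi (x + h) - phi x) ^+ 2) = 2 * Int (fun x => phi x ^+ 2).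
  rewrite mulr_natl mulr2n -{1}I2h -IntD//; apply: Int_ext => x.
  have [xr|/fr ->] := leP `|x| r; last by rewrite subr0 expr0n addr0.
  rewrite (fr (x + h)) ?sub0r ?sqrrN ?expr0n ?add0r//.
  have : L <= `|x + h| + `|x| by rewrite -nh -{1}(addKr x h) addrC ler_normB.
  rewrite /L; lra.
move=> E; move: H; rewrite E sh => H.
apply: le_trans H; rewrite ler_peMl ?ler1n//; apply: Int_ge0 => x; exact: sqr_ge0.
Qed.

End energy.

Section tonelli.
Context {R : realType} {N : nat}.
Notation V := 'rV[R]_N.
Notation mu := (lebesgue_rV N).

Lemma measurable_prod_rV (a b : R) (f : V -> R) : measurable_fun setT f ->
  measurable_fun setT (fun z : V * V => f (a *: z.1 + b *: z.2)).
Proof.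
move=> mf; apply: (measurableT_comp mf).
apply: measurable_fun_rVP => i.
rewrite (_ : (fun _ => _) = fun z : V * V => a * z.1 ord0 i + b * z.2 ord0 i).
  apply: measurable_funD; apply: measurable_funM => //.
    exact: (measurableT_comp (measurable_coord i) measurable_fst).
  exact: (measurableT_comp (measurable_coord i) measurable_snd).
by apply/funext => z; rewrite !mxE.
Qed.

Lemma measurable_fst_rV (f : V -> R) : measurable_fun setT f ->
  measurable_fun setT (fun z : V * V => f z.1).
Proof. by move=> mf; apply: measurableT_comp. Qed.

Lemma measurable_snd_rV (f : V -> R) : measurable_fun setT f ->
  measurable_fun setT (fun z : V * V => f z.2).
Proof. by move=> mf; apply: measurableT_comp. Qed.

Lemma Int_tonelli (G : V * V -> R) (k : V -> R) :
  measurable_fun setT G -> (forall z, 0 <= G z) ->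
  (forall x, L1 (fun y => G (x, y))) -> (forall y, L1 (fun x => G (x, y))) ->
  (forall y, Int (fun x => G (x, y)) <= k y) -> L1 k ->
  L1 (fun x => Int (fun y => G (x, y))) /\ Int (fun x => Int (fun y => G (x, y))) <= Int k.
Proof.
move=> mG G0 Lx Ly Gk Lk.
have mEG : measurable_fun setT (EFin \o G) by apply/measurable_EFinP.
have EG0 z : (0 <= (EFin \o G) z)%E by rewrite /= lee_fin.
have mF : measurable_fun setT (fun x => Int (fun y => G (x, y))).
  apply/measurable_EFinP.
  have := @measurable_fun_fubini_tonelli_F _ _ _ _ R mu (EFin \o G) mEG EG0.
  apply: eq_measurable_fun => x _ /=; rewrite /fubini_F/=.
  by rewrite Int_EFin.
have FT := @fubini_tonelli _ _ _ _ R mu mu (EFin \o G) mEG EG0.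
have E : (\int[mu]_x (Int (fun y => G (x, y)))%:E <= (Int k)%:E)%E.
  have -> : (\int[mu]_x (Int (fun y => G (x, y)))%:E = \int[mu]_x \int[mu]_y (G (x, y))%:E)%E.
    by apply: eq_integral => x _; rewrite Int_EFin.
  rewrite [leLHS]FT /fubini_G/= -Int_EFin//.
  apply: ge0_le_integral => //.
  - by move=> y _; apply: integral_ge0 => x _; rewrite lee_fin.
  - exact: (@measurable_fun_fubini_tonelli_G _ _ _ _ R mu (EFin \o G) mEG EG0).
  - by apply/measurable_EFinP; exact: L1_meas.
  - by move=> y _; rewrite Int_EFin// lee_fin.
have LF : L1 (fun x => Int (fun y => G (x, y))).
  apply: L1_ge0P => //; first by move=> x; exact: Int_ge0.
  exact: le_lt_trans E (ltry _).
by split => //; rewrite -lee_fin -Int_EFin.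
Qed.

End tonelli.

(** * Error of mollification in the L^2 and sup norms *)

Section mollification.
Context {R : realType} {N : nat}.
Notation V := 'rV[R]_N.
Notation mu := (lebesgue_rV N).
Notation e_ i := (delta_mx ord0 i : V).
Implicit Types (f g chi th phi : V -> R).

(** The kernel is not normalised: at points of continuity of [g], [moll g s] tends to
    [rho_mass * g], and this constant is carried along. *)
Definition rho_mass : R := @Int R N rho.

Definition moll g (s : R) (x : V) : R := s ^+ N * cv g rho s x.

Lemma rho_mass_ge0 : 0 <= rho_mass.
Proof. by apply: Int_ge0 => z; exact: rho_ge0. Qed.

Lemma moll_L1 g (s : R) x : 0 < s -> L1 g -> L1 (fun z => g (x - s^-1 *: z) * rho z).
Proof.
move=> s0 Lg; have [C C0 HC] := kernel_bounded (@kernel_rho R N).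
have ms : - s^-1 != 0 by rewrite oppr_eq0 invr_eq0 lt0r_neq0.
have [L _] := Int_affine x ms Lg.
apply: L1_ext (L1Mb L (L1_meas (kernel_L1 (@kernel_rho R N))) HC) => z.
by rewrite scaleNr addrC.
Qed.

Lemma mollE g (s : R) x : 0 < s -> L1 g ->
  moll g s x = Int (fun z => g (x - s^-1 *: z) * rho z).
Proof.
move=> s0 Lg; have [_] := Int_moved x s0 (moll_L1 x s0 Lg).
have sn0 : s != 0 by rewrite lt0r_neq0.
have -> : (fun y => g (x - s^-1 *: (s *: (x - y))) * rho (s *: (x - y))) = fun y => g y * rho (s *: (x - y)).
  by apply/funext => y; rewrite scalerA mulVf// scale1r subKr.
rewrite /moll /cv => ->; rewrite mulrA mulfV ?mul1r// expf_neq0//.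
Qed.

Lemma moll_sub g (s : R) x : 0 < s -> L1 g ->
  moll g s x - rho_mass * g x = Int (fun z => (g (x - s^-1 *: z) - g x) * rho z).
Proof.
move=> s0 Lg; rewrite mollE// mulrC -IntZ; last exact: kernel_L1 kernel_rho.
rewrite -IntB; [|exact: moll_L1|by apply: L1Z; exact: kernel_L1 kernel_rho].
by apply: Int_ext => z; rewrite mulrBl.
Qed.

(** Cauchy-Schwarz with weight [rho], then Tonelli. On the support of the kernel the shift [z / s]
    has Euclidean length at most [1 / s], so [shift_energy] produces the factor [s^-2]. *)
Lemma moll_L2 phi (s : R) : 0 < s -> Ck setT 1 phi -> bsupp phi ->
  L1 (fun x => (moll phi s x - rho_mass * phi x) ^+ 2) /\
  Int (fun x => (moll phi s x - rho_mass * phi x) ^+ 2) <= rho_mass ^+ 2 * (s ^- 2 * energy phi).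
Proof.
move=> s0 cp bp; have Lp := L1_C0 (CkT_cont cp) bp.
have kr := @kernel_rho R N; have Lr := kernel_L1 kr.
have [Cr Cr0 HCr] := kernel_bounded kr; have [Cp Cp0 HCp] := C0_bounded (CkT_cont cp) bp.
have mp : measurable_fun setT phi by exact: L1_meas.
have mr : measurable_fun setT (@rho R N) by exact: L1_meas.
pose G (w : V * V) := (phi (w.1 - s^-1 *: w.2) - phi w.1) ^+ 2 * rho w.2.
have mG : measurable_fun setT G.
  apply: measurable_funM; last exact: measurable_snd_rV.
  under eq_fun do rewrite expr2.
  have mD : measurable_fun setT (fun w : V * V => phi (w.1 - s^-1 *: w.2) - phi w.1).
    apply: measurable_funB; last exact: measurable_fst_rV.
    have := @measurable_prod_rV R N 1 (- s^-1) phi mp.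
    by under eq_fun do rewrite scale1r scaleNr.
  exact: measurable_funM.
have G0 w : 0 <= G w by rewrite mulr_ge0 ?sqr_ge0 ?rho_ge0.
have mx1 (x : V) : measurable_fun setT (fun z : V => phi (x - s^-1 *: z) - phi x).
  apply: measurable_funB => //; have := measurableT_comp mp (@measurable_affine_rV R N (- s^-1) x).
  by apply: eq_measurable_fun => z _ /=; rewrite scaleNr addrC.
have b1 x y : `|phi y - phi x| <= 2 * Cp.
  by rewrite (le_trans (ler_normB _ _))// mulr_natl mulr2n lerD.
have LGx x : L1 (fun z => G (x, z)).
  apply: L1_ext (L1Mb (C := (2 * Cp) ^+ 2) (h := fun z => (phi (x - s^-1 *: z) - phi x) ^+ 2) Lr _ _).
  - by move=> z; rewrite mulrC.
  - by under eq_fun do rewrite expr2; exact: measurable_funM.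
  - by move=> z; rewrite normrX lerXn2r ?nnegrE// mulr_ge0.
have LGs h : L1 (fun x => (phi (x + h) - phi x) ^+ 2).
  have Lh : L1 (fun x => phi (x + h) - phi x) by apply: L1B => //; exact: (Int_shift h Lp).1.
  exact: L1Mb Lh (L1_meas Lh) (fun x => b1 _ _).
have LGz z : L1 (fun x => G (x, z)).
  by apply: L1_ext (L1Z (rho z) (LGs (- (s^-1 *: z)))) => x; rewrite mulrC.
have Gk z : Int (fun x => G (x, z)) <= s ^- 2 * energy phi * rho z.
  rewrite [X in X <= _](_ : _ = rho z * Int (fun x => (phi (x - s^-1 *: z) - phi x) ^+ 2)); last first.
    by rewrite -IntZ//; apply: Int_ext => x; rewrite mulrC.
  have [z1|z1] := ltP 1 (sqn z); first by rewrite kr.2// mul0r mulr0.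
  rewrite [leRHS]mulrC ler_wpM2l ?rho_ge0//.
  apply: (le_trans (shift_energy _ cp bp)); rewrite ler_wpM2r ?energy_ge0//.
  rewrite /sqn; under eq_bigr do rewrite !mxE sqrrN exprMn exprVn.
  by rewrite -mulr_sumr ler_piMr// invr_ge0 exprn_ge0// ltW.
have [LI HI] := Int_tonelli mG G0 LGx LGz Gk (L1Z (s ^- 2 * energy phi) Lr).
rewrite IntZ// in HI.
have key x : (moll phi s x - rho_mass * phi x) ^+ 2 <= rho_mass * Int (fun z => G (x, z)).
  rewrite moll_sub//; apply: Int_CS => //.
  - apply: L1_ext (L1Mb (C := 2 * Cp) (h := fun z => phi (x - s^-1 *: z) - phi x) Lr (mx1 x) _); first by move=> z; rewrite mulrC.
    by move=> z; exact: b1.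
  - exact: rho_ge0.
  - by move=> z; rewrite /G /= le_eqVlt; apply/orP; left; apply/eqP; ring.
have Lm : L1 (fun x => (moll phi s x - rho_mass * phi x) ^+ 2).
  apply: L1_le (L1Z rho_mass LI) _; last by move=> x; rewrite ger0_norm ?sqr_ge0.
  apply: continuous_measurable_rV; apply: continuous_sqr => x; apply: continuousB.
    apply: (@continuousM _ _ (fun=> s ^+ N)); first exact: cst_continuous.
    exact: CkT_cont (Ck_cv s 0 Lp kr) x.
  by apply: (@continuousM _ _ (fun=> rho_mass)); [exact: cst_continuous|exact: CkT_cont cp x].
split => //; apply: (le_trans (le_Int Lm (L1Z rho_mass LI) key)).
rewrite IntZ// expr2 -mulrA ler_wpM2l ?rho_mass_ge0//.
by rewrite (le_trans HI)// mulrC.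
Qed.

Lemma cv_bsupp g chi r (s : R) : 0 < s -> (forall x, r < `|x| -> g x = 0) -> unit_kernel chi ->
  forall x, r + s^-1 < `|x| -> cv g chi s x = 0.
Proof.
move=> s0 gr kc x rx; rewrite /cv -[RHS](@Int0 R N); apply: Int_ext => y.
have [yr|/gr ->] := leP `|y| r; last by rewrite mul0r.
rewrite -/(moved chi s x y) moved_supp ?mulr0// gtr0_norm// -ltr_pdivrMl// mulr1.
rewrite -(ltrD2l r) (lt_le_trans rx)//.
apply: (@le_trans _ _ (`|y| + `|x - y|)); last by rewrite lerD2r.
by rewrite addrC -{1}(subrK y x) ler_normD.
Qed.

Lemma continuous_moll g (s : R) : L1 g -> continuous (moll g s).
Proof.
move=> Lg x; apply: (@continuousM _ _ (fun=> s ^+ N)); first exact: cst_continuous.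
exact: CkT_cont (Ck_cv s 0 Lg kernel_rho) x.
Qed.

Lemma moll_bsupp g (s : R) : 0 < s -> bsupp g -> bsupp (moll g s).
Proof.
by move=> s0 [r gr]; exists (r + s^-1) => x rx; rewrite /moll (cv_bsupp s0 gr kernel_rho)// mulr0.
Qed.

End mollification.

Section mollification_sup.
Context {R : realType} {M : nat}.
Local Notation N := M.+2.
Notation V := 'rV[R]_N.
Notation mu := (lebesgue_rV N).
Implicit Types (f g chi th phi : V -> R).

Definition dyad (n : nat) : R := 2 ^+ n.

Lemma dyad_gt0 n : 0 < dyad n.
Proof. exact: exprn_gt0. Qed.

Definition kernel_const : R := \sum_(i < N) Int (fun z : V => partial i (bumpf 0) z ^+ 2).

Lemma kernel_const_ge0 : 0 <= kernel_const.
Proof. by apply: sumr_ge0 => i _; apply: Int_ge0 => z; exact: sqr_ge0. Qed.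

(** The scale derivative is a convolution of [grad phi], of size at most
    [s^(N-1) s^-1 (E s^-N)^(1/2)] up to a constant, [E] being the energy, by Cauchy-Schwarz. This is
    of order [s^(M/2 - 1)]; multiplied by the length [2^n] of the dyadic interval and squared, it
    gives [2^(M n)]. *)
Lemma moll_step_sup phi n x : Ck setT 1 phi -> bsupp phi ->
  (moll phi (dyad n.+1) x - moll phi (dyad n) x) ^+ 2 <=
    (N%:R * kernel_const * 2 ^+ M) * energy phi * (2 ^+ M) ^+ n.
Proof.
move=> cp bp; have Lp := L1_C0 (CkT_cont cp) bp.
have kb := @kernel_bump R N 0.
pose A := N%:R * kernel_const * energy phi * (2 ^+ M * (2 ^+ M) ^+ n * (2 ^+ n) ^- 2).
have A0 : 0 <= A by rewrite !mulr_ge0 ?kernel_const_ge0 ?energy_ge0 ?invr_ge0 ?exprn_ge0.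
have n12 : dyad n <= dyad n.+1 by rewrite /dyad exprS ler_peMl ?exprn_ge0// ler1n.
have := @cv_hom_step R N M.+1 phi rho (bumpf 0) (dyad n) (dyad n.+1) x (Num.sqrt A) (dyad_gt0 n) n12 Lp kernel_rho kb hom_base.
move=> /(_ _) H.
have {}H : `|moll phi (dyad n.+1) x - moll phi (dyad n) x| <= (dyad n.+1 - dyad n) * Num.sqrt A.
  apply: H => s s1 s2; have s0 : 0 < s by exact: lt_le_trans (dyad_gt0 n) s1.
  rewrite -(@ler_pXn2r _ 2) ?nnegrE ?sqrtr_ge0// sqr_sqrtr// real_normK ?num_real//.
  rewrite cv_laplacian_C1// [s ^+ M.+1]exprS mulrACA mulfV ?lt0r_neq0// mul1r.
  rewrite exprMn; pose B := energy phi * (s ^- N * kernel_const).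
  have S : (\sum_i cv (partial i phi) (partial i (bumpf 0)) s x) ^+ 2 <= N%:R * B.
    apply: (le_trans (sqr_sum_le _)); rewrite ler_wpM2l// /B /kernel_const !mulr_sumr.
    apply: ler_sum => i _.
    have ci := @C0_partial _ _ i _ cp; have bi := bsupp_partial i bp.
    apply: (le_trans (cv_bound_CS x s0 (kernel_partial i kb) (L1_C0 ci bi) (L1_sqr ci bi))).
    rewrite ler_wpM2r ?energy_partial// mulr_ge0 ?invr_ge0 ?exprn_ge0 ?(ltW s0)//.
    by apply: Int_ge0 => z; exact: sqr_ge0.
  apply: (le_trans (ler_wpM2l (sqr_ge0 _) S)).
  rewrite [leLHS](_ : _ = N%:R * kernel_const * energy phi * (s ^+ M * s ^- 2)); last first.
    have sN : s ^- N = s ^- 2 * (s ^+ M)^-1 by rewrite -invfM -exprD.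
    rewrite /B sN.
    have sM0 : s ^+ M != 0 by rewrite expf_neq0// lt0r_neq0.
    have s20 : s != 0 by rewrite lt0r_neq0.
    move: (s ^+ M) sM0 (energy phi) kernel_const (N%:R : R) => y y0 E K n0 {A A0}.
    by field; rewrite y0 s20.
  rewrite /A ler_wpM2l ?mulr_ge0 ?kernel_const_ge0 ?energy_ge0//.
  have sM : s ^+ M <= 2 ^+ M * (2 ^+ M) ^+ n.
    by rewrite -exprS -exprM mulnC exprM lerXn2r ?nnegrE ?exprn_ge0 ?(ltW s0).
  rewrite ler_pM ?exprn_ge0 ?invr_ge0 ?(ltW s0)//; first by rewrite exprn_ge0// ltW.
  by rewrite lef_pV2 ?posrE ?exprn_gt0// lerXn2r ?nnegrE ?exprn_ge0 ?(ltW s0).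
rewrite -real_normK ?num_real//.
have : `|moll phi (dyad n.+1) x - moll phi (dyad n) x| ^+ 2 <= ((dyad n.+1 - dyad n) * Num.sqrt A) ^+ 2.
  by rewrite lerXn2r ?nnegrE// mulr_ge0 ?subr_ge0 ?sqrtr_ge0.
move=> /le_trans; apply; rewrite exprMn sqr_sqrtr//.
have -> : dyad n.+1 - dyad n = 2 ^+ n by rewrite /dyad exprS; ring.
rewrite le_eqVlt; apply/orP; left; apply/eqP.
rewrite /A; field; by rewrite expf_neq0.
Qed.

End mollification_sup.

(** * Subcritical compactness *)

Section Lq_tools.
Context {R : realType} {N : nat}.
Notation V := 'rV[R]_N.

Lemma measurable_powR_abs (f : V -> R) (q : R) : measurable_fun setT f ->
  measurable_fun setT (fun x => `|f x| `^ q).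
Proof.
move=> mf; apply: (@measurableT_comp _ _ _ _ _ _ (@powR R ^~ q)); first exact: measurable_powR.
exact: measurableT_comp.
Qed.

Lemma L1_powR (f : V -> R) (C q : R) : 0 < q -> measurable_fun setT f ->
  (forall x, `|f x| <= C) -> bsupp f -> L1 (fun x => `|f x| `^ q).
Proof.
move=> q0 mf fC [r fr]; apply: (@L1_bounded _ _ _ r (C `^ q)).
- exact: measurable_powR_abs.
- move=> x; rewrite ger0_norm ?powR_ge0// ge0_ler_powR// ?nnegrE ?(ltW q0)//.
  by rewrite (le_trans _ (fC x)).
- by move=> x /fr ->; rewrite normr0 powR0// lt0r_neq0.
Qed.

Lemma L1_powR_C0 (f : V -> R) (q : R) : 0 < q -> continuous f -> bsupp f -> L1 (fun x => `|f x| `^ q).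
Proof.
move=> q0 cf bf; have [C _ fC] := C0_bounded cf bf.
exact: L1_powR q0 (continuous_measurable_rV cf) fC bf.
Qed.

Lemma two_sqr (u v w : R) : (u - v) ^+ 2 <= 2 * (u - w) ^+ 2 + 2 * (v - w) ^+ 2.
Proof.
rewrite -subr_ge0 (_ : _ - _ = (u - w + (v - w)) ^+ 2); first exact: sqr_ge0.
by ring.
Qed.

Lemma Int_two_sqr (a b d : V -> R) (X : R) : L1 (fun x => a x ^+ 2) -> L1 (fun x => b x ^+ 2) ->
  L1 (fun x => d x ^+ 2) -> (forall x, d x ^+ 2 <= 2 * a x ^+ 2 + 2 * b x ^+ 2) ->
  Int (fun x => a x ^+ 2) <= X -> Int (fun x => b x ^+ 2) <= X ->
  Int (fun x => d x ^+ 2) <= 4 * X.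
Proof.
move=> La Lb Ld dab aX bX.
apply: (le_trans (le_Int Ld (L1D (L1Z 2 La) (L1Z 2 Lb)) dab)).
rewrite (IntD (L1Z 2 La) (L1Z 2 Lb)) !IntZ//; lra.
Qed.

Lemma geo_sum_le (g : R) m K : 0 <= g -> g < 1 ->
  \sum_(k < K) g ^+ (m + k) <= g ^+ m * (1 - g)^-1.
Proof.
move=> g0 g1; have g10 : 0 < 1 - g by rewrite subr_gt0.
rewrite (_ : \sum_(k < K) _ = g ^+ m * \sum_(k < K) g ^+ k); last first.
  by rewrite mulr_sumr; apply: eq_bigr => k _; rewrite exprD.
rewrite ler_wpM2l ?exprn_ge0// -(ler_pM2l g10) divff ?lt0r_neq0//.
have := subrX1 g K; rewrite -opprB -[g - 1]opprB mulNr => /oppr_inj <-.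
by rewrite lerBlDr lerDl exprn_ge0.
Qed.

(** Replaces Minkowski's inequality: each [|d k|] is at most [b^(m + k) Y^(1/q)], where [Y] is the
    weighted sum, and these bounds are summed as a geometric series. The price [b^-(m + k)] is later
    paid by the geometric decay of the terms. *)
Lemma weighted_sum_powR K (d : 'I_K -> R) (b q : R) m : 0 < q -> 0 < b -> b < 1 ->
  `|\sum_(k < K) d k| `^ q <=
  (1 - b)^-1 `^ q * \sum_(k < K) (b ^- (m + k) * `|d k|) `^ q.
Proof.
move=> q0 b0 b1.
have B0 : 0 <= (1 - b)^-1 by rewrite invr_ge0 subr_ge0 ltW.
set Y := \sum_(k < K) _ `^ q.
have Y0 : 0 <= Y by apply: sumr_ge0 => k _; exact: powR_ge0.
have bk k : 0 < b ^+ (m + k) by exact: exprn_gt0.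
have dk k : `|d k| <= b ^+ (m + k) * Y `^ q^-1.
  have h : (b ^- (m + k) * `|d k|) `^ q <= Y.
    by rewrite /Y (bigD1 k)//= lerDl sumr_ge0// => j _; exact: powR_ge0.
  rewrite -ler_pdivrMl//.
  have z0 : 0 <= b ^- (m + k) * `|d k| by rewrite mulr_ge0// invr_ge0 ltW.
  rewrite -[leLHS]powRr1// -(mulfV (lt0r_neq0 q0)) powRrM.
  by rewrite ge0_ler_powR ?nnegrE ?powR_ge0// invr_ge0 ltW.
have le1 : `|\sum_(k < K) d k| <= (1 - b)^-1 * Y `^ q^-1.
  apply: (le_trans (ler_norm_sum _ _ _)).
  apply: (le_trans (ler_sum _ (fun k _ => dk k))); rewrite -mulr_suml ler_wpM2r ?powR_ge0//.
  rewrite (le_trans (geo_sum_le m K (ltW b0) b1))// ler_piMl//.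
  by rewrite exprn_ile1// ltW.
apply: (@le_trans _ _ (((1 - b)^-1 * Y `^ q^-1) `^ q)).
  by rewrite ge0_ler_powR ?nnegrE ?(ltW q0)// mulr_ge0// powR_ge0.
by rewrite powRM ?powR_ge0// -powRrM mulVf ?lt0r_neq0// powRr1.
Qed.

Lemma powRXn (x a : R) n : 0 <= x -> (x ^+ n) `^ a = (x `^ a) ^+ n.
Proof. by move=> x0; rewrite -powR_mulrn// powRAC powR_mulrn// powR_ge0. Qed.

Lemma powR_gt1 (x e : R) : 1 < x -> 0 < e -> 1 < x `^ e.
Proof.
by move=> x1 e0; have := @gt0_ltr_powR R e e0 1 x; rewrite powR1 !nnegrE; apply => //; rewrite ltW// (lt_trans _ x1).
Qed.

Lemma powR_abs_cvg (u : nat -> R) (l e : R) : 0 < e -> u n @[n --> \oo] --> l ->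
  `|u n| `^ e @[n --> \oo] --> `|l| `^ e.
Proof.
move=> e0 cu; have cn : `|u n| @[n --> \oo] --> `|l| by exact: cvg_norm.
have [l0|l0] := eqVneq l 0; last first.
  have cc : {for `|l|, continuous (fun t : R => t `^ e)}.
    apply: differentiable_continuous; apply/derivable1_diffP.
    have l1 : 0 < `|l| by rewrite normr_gt0.
    by have [] := is_derive1_powR e l1.
  exact: cvg_comp cn cc.
rewrite l0 normr0 powR0 ?lt0r_neq0//; apply/cvgrPdist_le => d d0.
have d1 : 0 < d `^ e^-1 by exact: powR_gt0.
move/cvgrPdist_le : cn => /(_ _ d1); apply: filterS => n.
rewrite l0 normr0 !sub0r !normrN normr_id (ger0_norm (powR_ge0 _ _)) => h.
have -> : d = (d `^ e^-1) `^ e by rewrite -powRrM mulVf ?lt0r_neq0// powRr1// ltW.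
by rewrite ge0_ler_powR ?nnegrE ?(ltW e0)// ltW.
Qed.

Lemma powR_abs_half (x e : R) : `|x| `^ e = (x ^+ 2) `^ (e / 2).
Proof.
by rewrite -real_normK ?num_real// -powR_mulrn// -powRrM mulrC divfK.
Qed.

Lemma telescope_shift (F : nat -> R) m K :
  \sum_(k < K) (F (m + k).+1 - F (m + k)%N) = F (m + K)%N - F m.
Proof.
elim: K => [|K IH]; first by rewrite big_ord0 addn0 subrr.
by rewrite big_ord_recr/= IH addnS addrC addrA subrK.
Qed.

End Lq_tools.

(** * Approximation in L^q by dyadic mollifications *)

Section Lq_approximation.
Context {R : realType} {M : nat}.
Local Notation N := M.+2.
Notation V := 'rV[R]_N.
Local Notation mass := (@rho_mass R M.+2).
Variable q : R.
Hypotheses (q2 : 2 < q) (subcritical : M%:R * (q - 2) < 4).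

Let q0 : 0 < q. Proof. exact: lt_trans q2. Qed.
Let a0 : 0 < (q - 2) / 2. Proof. by rewrite divr_gt0// subr_gt0. Qed.

(** From [|D|^q = |D|^(q-2) D^2]: the pointwise bound [2^(M n)] of the square enters with exponent
    [(q - 2) / 2] and meets the bound [4^-n] of its integral. *)
Definition rate : R := (2 ^+ M) `^ ((q - 2) / 2) / 4.

Lemma rate_gt0 : 0 < rate.
Proof. by rewrite divr_gt0// powR_gt0// exprn_gt0. Qed.

Lemma rate_lt1 : rate < 1.
Proof.
rewrite ltr_pdivrMr// mul1r -powR_mulrn// -powRrM.
set e := M%:R * _; have e2 : 0 < 2 - e.
  by rewrite /e mulrA subr_gt0 ltr_pdivrMr// -natrM.
have -> : 4 = 2 `^ e * 2 `^ (2 - e) :> R.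
  rewrite -powRD; last by rewrite implybE addrC subrK pnatr_eq0.
  by rewrite addrC subrK powR_mulrn//; ring.
by rewrite ltr_pMr ?powR_gt0// powR_gt1// ltr1n.
Qed.

Lemma moll_step_Lq : exists2 C : R, 0 <= C & forall (phi : V -> R) n, Ck setT 1 phi -> bsupp phi ->
  Int (fun x => `|moll phi (dyad n.+1) x - moll phi (dyad n) x| `^ q) <=
    C * energy phi `^ (q / 2) * rate ^+ n.
Proof.
pose A : R := N%:R * @kernel_const R M * 2 ^+ M.
have A0 : 0 <= A by rewrite !mulr_ge0 ?kernel_const_ge0 ?exprn_ge0.
pose c : R := mass.
exists (A `^ ((q - 2) / 2) * (4 * c ^+ 2)); first by rewrite mulr_ge0 ?powR_ge0// mulr_ge0// sqr_ge0.
move=> phi n cp bp; have Lp := L1_C0 (CkT_cont cp) bp.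
have cD : continuous (fun x => moll phi (dyad n.+1) x - moll phi (dyad n) x).
  by move=> x; apply: continuousB; exact: continuous_moll.
have bD : bsupp (fun x => moll phi (dyad n.+1) x - moll phi (dyad n) x).
  have [r1 h1] := moll_bsupp (dyad_gt0 n) bp; have [r2 h2] := moll_bsupp (dyad_gt0 n.+1) bp.
  by exists (Num.max r1 r2) => x; rewrite gt_max => /andP[/h1 -> /h2 ->]; rewrite subrr.
have E0 := energy_ge0 phi.
have LD2 := L1_sqr cD bD.
have I2 : Int (fun x => (moll phi (dyad n.+1) x - moll phi (dyad n) x) ^+ 2) <= 4 * c ^+ 2 * energy phi * 4^-1 ^+ n.
  have [L1a I1a] := moll_L2 (dyad_gt0 n.+1) cp bp.
  have [L1b I1b] := moll_L2 (dyad_gt0 n) cp bp.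
  have d1 : dyad n ^- 2 = 4^-1 ^+ n :> R by rewrite /dyad -exprM mulnC exprM exprVn (_ : 2 ^+ 2 = 4)//; ring.
  have d2 : dyad n.+1 ^- 2 <= 4^-1 ^+ n :> R.
    rewrite -d1 lef_pV2 ?posrE ?exprn_gt0 ?dyad_gt0// lerXn2r ?nnegrE ?(ltW (dyad_gt0 _))//.
    by rewrite /dyad exprS ler_peMl ?exprn_ge0// ler1n.
  have h1 : c ^+ 2 * (dyad n.+1 ^- 2 * energy phi) <= c ^+ 2 * (4^-1 ^+ n * energy phi).
    by apply: ler_wpM2l; [exact: sqr_ge0|exact: ler_wpM2r].
  have h2 : c ^+ 2 * (dyad n ^- 2 * energy phi) <= c ^+ 2 * (4^-1 ^+ n * energy phi).
    by rewrite d1.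
  have EX : 4 * c ^+ 2 * energy phi * 4^-1 ^+ n = 4 * (c ^+ 2 * (4^-1 ^+ n * energy phi)).
    by rewrite -!mulrA [energy phi * _]mulrC.
  rewrite EX; apply: (Int_two_sqr L1a L1b LD2 _ (le_trans I1a h1) (le_trans I1b h2)) => x.
  exact: two_sqr.
have pw x : `|moll phi (dyad n.+1) x - moll phi (dyad n) x| `^ q <=
    (A * energy phi * (2 ^+ M) ^+ n) `^ ((q - 2) / 2) * (moll phi (dyad n.+1) x - moll phi (dyad n) x) ^+ 2.
  have -> : q = (q - 2) + 2 by rewrite subrK.
  rewrite powRD; last by rewrite implybE subrK lt0r_neq0.
  rewrite addrK powR_mulrn// real_normK ?num_real// ler_wpM2r ?sqr_ge0//.
  rewrite powR_abs_half ge0_ler_powR ?nnegrE ?sqr_ge0 ?(ltW a0)//.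
    by rewrite mulr_ge0 ?exprn_ge0// mulr_ge0.
  exact: moll_step_sup.
have Lq := L1_powR_C0 q0 cD bD.
apply: (le_trans (le_Int Lq (L1Z _ LD2) pw)); rewrite IntZ//.
apply: (le_trans (ler_wpM2l (powR_ge0 _ _) I2)).
have EA : (A * energy phi * (2 ^+ M) ^+ n) `^ ((q - 2) / 2) =
    A `^ ((q - 2) / 2) * energy phi `^ ((q - 2) / 2) * ((2 ^+ M) `^ ((q - 2) / 2)) ^+ n.
  have h1 : 0 <= A * energy phi by rewrite mulr_ge0.
  have h2 : 0 <= (2 ^+ M) ^+ n :> R by rewrite exprn_ge0// exprn_ge0.
  by rewrite (powRM _ h1 h2) (powRM _ A0 E0) powRXn// exprn_ge0.
rewrite EA [leRHS](_ : _ = A `^ ((q - 2) / 2) * (4 * c ^+ 2) * energy phi `^ (q / 2) * (((2 ^+ M) `^ ((q - 2) / 2)) ^+ n * 4^-1 ^+ n)); last first.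
  by rewrite /rate exprMn.
have -> : energy phi `^ (q / 2) = energy phi `^ ((q - 2) / 2) * energy phi.
  rewrite -{3}[energy phi]powRr1// -powRD; first by congr (_ `^ _); field.
  by rewrite implybE; apply/orP; left; apply: lt0r_neq0; rewrite addr_gt0.
rewrite le_eqVlt; apply/orP; left; apply/eqP.
move: (_ `^ _) (_ `^ _) (_ ^+ n) (_ ^+ n) => x1 x2 x3 x4; ring.
Qed.

Lemma moll_cvg (phi : V -> R) x : Ck setT 1 phi -> bsupp phi ->
  moll phi (dyad n) x @[n --> \oo] --> mass * phi x.
Proof.
move=> cp bp; have [C C0 HC] := C1_lipschitz cp bp.
have Lp := L1_C0 (CkT_cont cp) bp; have Lr := kernel_L1 (@kernel_rho R N).
have g0 : C * mass * 2^-1 ^+ n @[n --> \oo] --> 0.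
  rewrite -(mulr0 (C * mass)); apply: cvgMr; apply: cvg_expr.
  by rewrite ger0_norm// invf_lt1// ltr1n.
have bnd n : `|mass * phi x - moll phi (dyad n) x| <= C * mass * 2^-1 ^+ n.
  rewrite distrC moll_sub ?dyad_gt0//.
  have Lm : L1 (fun z => (phi (x - (dyad n)^-1 *: z) - phi x) * rho z).
    apply: L1_ext (L1B (moll_L1 x (dyad_gt0 n) Lp) (L1Z (phi x) Lr)) => z.
    by rewrite mulrBl.
  apply: (le_trans (le_Int_abs Lm)).
  rewrite [leRHS](_ : _ = Int (fun z => (C * 2^-1 ^+ n) * @rho R N z)); last by rewrite IntZ// mulrAC.
  apply: le_Int; [exact: L1_abs|exact: L1Z|move=> z].
  rewrite normrM (ger0_norm (rho_ge0 z)).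
  have [z1|z1] := ltP 1 (sqn z); first by rewrite kernel_rho.2// !mulr0.
  rewrite ler_wpM2r ?rho_ge0// (le_trans (HC _ _))// ler_wpM2l// normrN normrZ.
  rewrite ger0_norm ?invr_ge0 ?(ltW (dyad_gt0 n))// /dyad exprVn ler_piMr ?invr_ge0 ?exprn_ge0//.
  by rewrite -(@expr_le1 _ 2)// (le_trans (norm_le_sqn z)).
apply/cvgrPdist_le => e e0; move/cvgr0_norm_le : g0 => /(_ _ e0).
by apply: filterS => n; apply: le_trans; rewrite (le_trans (bnd n))// ler_norm.
Qed.

(** The steps beyond scale [2^m] telescope; the bound for finitely many of them is uniform and
    passes to the limit by Fatou's lemma. *)
Lemma Lq_approximation : exists C g : R, [/\ 0 <= C, 0 < g, g < 1 &
  forall (phi : V -> R) m, Ck setT 1 phi -> bsupp phi ->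
  L1 (fun x => `|mass * phi x - moll phi (dyad m) x| `^ q) /\
    Int (fun x => `|mass * phi x - moll phi (dyad m) x| `^ q) <=
    C * energy phi `^ (q / 2) * g ^+ m].
Proof.
have [C C0 HC] := moll_step_Lq.
have r0 := rate_gt0; have r1 := rate_lt1.
(* The decay is split in two: one half pays for the weights of [weighted_sum_powR], as [b^q = g],
   and the other half, as [g * g = rate], remains to be summed. *)
pose g := rate `^ 2^-1; pose b := g `^ q^-1.
have qi0 : 0 < q^-1 by rewrite invr_gt0.
have lt1 (x e : R) : 0 < x -> x < 1 -> 0 < e -> x `^ e < 1.
  by move=> x0 x1 e0; have := @gt0_ltr_powR R e e0 x 1; rewrite powR1 !nnegrE; apply => //; exact: ltW.
have g0 : 0 < g by exact: powR_gt0.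
have g1 : g < 1 by apply: lt1 => //; rewrite invr_gt0.
have b0 : 0 < b by exact: powR_gt0.
have b1 : b < 1 by exact: lt1.
have g2 : g * g = rate.
  rewrite /g -powRD ?(lt0r_neq0 r0) ?implybT//; rewrite (_ : 2^-1 + 2^-1 = 1); [by rewrite powRr1// ltW|lra].
have bq : b `^ q = g by rewrite /b -powRrM mulVf ?lt0r_neq0// powRr1// ltW.
pose B := (1 - b)^-1 `^ q.
have B0 : 0 <= B by exact: powR_ge0.
have g10 : 0 <= (1 - g)^-1 by rewrite invr_ge0 subr_ge0 ltW.
exists (B * C * (1 - g)^-1), g; split => //; first by rewrite !mulr_ge0.
move=> phi m cp bp; have Lp := L1_C0 (CkT_cont cp) bp.
have E0 : 0 <= energy phi `^ (q / 2) by exact: powR_ge0.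
pose D n x := moll phi (dyad n.+1) x - moll phi (dyad n) x.
have cM k : continuous (fun x => moll phi (dyad (m + k)) x - moll phi (dyad m) x).
  by move=> x; apply: continuousB; exact: continuous_moll.
have bM k : bsupp (fun x => moll phi (dyad (m + k)) x - moll phi (dyad m) x).
  have [s1 h1] := moll_bsupp (dyad_gt0 (m + k)) bp; have [s2 h2] := moll_bsupp (dyad_gt0 m) bp.
  by exists (Num.max s1 s2) => x; rewrite gt_max => /andP[/h1 -> /h2 ->]; rewrite subrr.
have LM k := L1_powR_C0 q0 (@cM k) (@bM k).
have cD n : continuous (D n) by move=> x; apply: continuousB; exact: continuous_moll.
have bD n : bsupp (D n).
  have [s1 h1] := moll_bsupp (dyad_gt0 n.+1) bp; have [s2 h2] := moll_bsupp (dyad_gt0 n) bp.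
  by exists (Num.max s1 s2) => x; rewrite gt_max => /andP[h3 h4]; rewrite /D h1// h2// subrr.
have LD n : L1 (fun x => `|D n x| `^ q) := L1_powR_C0 q0 (@cD n) (@bD n).
have wD n x : (b ^- n * `|D n x|) `^ q = g ^- n * `|D n x| `^ q.
  rewrite powRM ?invr_ge0 ?exprn_ge0 ?(ltW b0)// -powR_inv1 ?exprn_ge0 ?(ltW b0)//.
  by rewrite powRAC powRXn ?(ltW b0)// bq powR_inv1// exprn_ge0// ltW.
have LwD n : L1 (fun x => (b ^- n * `|D n x|) `^ q).
  by apply: L1_ext (L1Z (g ^- n) (LD n)) => x; rewrite wD.
have IK K : Int (fun x => `|moll phi (dyad (m + K)) x - moll phi (dyad m) x| `^ q) <=
    B * C * (1 - g)^-1 * energy phi `^ (q / 2) * g ^+ m.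
  apply: (@le_trans _ _ (Int (fun x => B * \sum_(k < K) (b ^- (m + k) * `|D (m + k)%N x|) `^ q))).
    apply: le_Int => //; first by apply/L1Z/L1_sum => k; exact: LwD.
    move=> x.
    have := telescope_shift (fun n => moll phi (dyad n) x) m K => /= <-.
    exact: (weighted_sum_powR (fun k : 'I_K => D (m + k)%N x)).
  rewrite IntZ; last by apply: L1_sum => k; exact: LwD.
  rewrite -!mulrA ler_wpM2l// Int_sum; last by move=> k; exact: LwD.
  apply: (@le_trans _ _ (\sum_(k < K) C * energy phi `^ (q / 2) * g ^+ (m + k))).
    apply: ler_sum => k _; under Int_ext do rewrite wD.
    rewrite IntZ// (le_trans (ler_wpM2l _ (HC phi (m + k)%N cp bp)))// ?invr_ge0 ?exprn_ge0 ?(ltW g0)//.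
    rewrite -g2 exprMn le_eqVlt; apply/orP; left; apply/eqP.
    have gk : g ^+ (m + k) != 0 by rewrite expf_neq0// lt0r_neq0.
    by move: (g ^+ (m + k)) gk => w w0; field.
  rewrite -mulr_sumr -mulrA ler_wpM2l// [leRHS]mulrCA ler_wpM2l//.
  by rewrite mulrC; exact: geo_sum_le (ltW g0) g1.
have [||||Lf If] := @Int_fatou R N (fun K x => `|moll phi (dyad (m + K)) x - moll phi (dyad m) x| `^ q)
  (fun x => `|mass * phi x - moll phi (dyad m) x| `^ q) _ LM _ _ _ _ IK; last by split.
- by move=> n x; exact: powR_ge0.
- apply: measurable_powR_abs; apply: continuous_measurable_rV => x; apply: (@continuousB _ _ _ (fun x => mass * phi x)).
    by apply: (@continuousM _ _ (fun=> mass)); [exact: cst_continuous|exact: CkT_cont cp x].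
  exact: continuous_moll.
- by move=> x; exact: powR_ge0.
- apply: aeW => x.
  apply: (powR_abs_cvg (u := fun n => moll phi (dyad (m + n)) x - moll phi (dyad m) x)) => //.
  apply: cvgB; last exact: cvg_cst.
  have -> : (fun n => moll phi (dyad (m + n)) x) = [sequence moll phi (dyad (n + m)) x]_n.
    by apply/funext => n; rewrite addnC.
  by rewrite (cvg_shiftn m (fun n => moll phi (dyad n) x)); exact: moll_cvg.
Qed.

End Lq_approximation.

(** * Extraction of convergent subsequences *)

Section extraction.
Context {R : realType}.

(** Infinite sets of indices are used instead of subsequences, so that successive extractions need
    no reindexing before the diagonal one. *)
Definition infinite_nat (P : nat -> Prop) := forall n : nat, exists2 k, (n <= k)%N & P k.

Lemma infinite_bisect (a : nat -> R) (eta : R) n : 0 < eta -> forall P lo, infinite_nat P ->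
  (forall k, P k -> lo <= a k <= lo + eta * 2 ^+ n) ->
  exists2 Q, infinite_nat Q & (forall k, Q k -> P k) /\
    forall k l, Q k -> Q l -> `|a k - a l| <= eta.
Proof.
move=> eta0; elim: n => [|n IH] P lo iP aP.
  exists P => //; split => // k l /aP/andP[k1 k2] /aP/andP[l1 l2].
  by rewrite expr0 mulr1 in k2 l2; rewrite ler_norml; apply/andP; split; lra.
pose mid := lo + eta * 2 ^+ n.
have E : eta * 2 ^+ n.+1 = eta * 2 ^+ n + eta * 2 ^+ n by rewrite exprS; ring.
have [iL|niL] := pselect (infinite_nat (fun k => P k /\ a k <= mid)).
  have H0 k : P k /\ a k <= mid -> lo <= a k <= lo + eta * 2 ^+ n.
    by move=> [/aP/andP[-> _] ->].
  have [Q iQ [QP H]] := IH _ lo iL H0.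
  by exists Q => //; split => // k /QP[].
have iU : infinite_nat (fun k => P k /\ mid < a k).
  have [n0 Hn0] : exists n0 : nat, forall k, (n0 <= k)%N -> P k -> mid < a k.
    apply: contrapT => H; apply: niL => m; apply: contrapT => H1; apply: H; exists m => k mk Pk.
    by rewrite ltNge; apply/negP => ak; apply: H1; exists k.
  move=> m; have [k mk Pk] := iP (maxn m n0).
  exists k; first by rewrite (leq_trans _ mk)// leq_maxl.
  by split => //; apply: Hn0 => //; rewrite (leq_trans _ mk)// leq_maxr.
have H0 k : P k /\ mid < a k -> mid <= a k <= mid + eta * 2 ^+ n.
  move=> [/aP/andP[_ h1] h2]; rewrite (ltW h2)/= (le_trans h1)// /mid; lra.
have [Q iQ [QP H]] := IH _ mid iU H0.
by exists Q => //; split => // k /QP[].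
Qed.

Lemma infinite_close (a : nat -> R) (C eta : R) P : 0 < eta -> (forall k, `|a k| <= C) ->
  infinite_nat P -> exists2 Q, infinite_nat Q & (forall k, Q k -> P k) /\
    forall k l, Q k -> Q l -> `|a k - a l| <= eta.
Proof.
move=> eta0 aC iP.
have [n Hn] : exists n : nat, 2 * C <= eta * 2 ^+ n.
  exists (Num.bound (2 * C / eta)).
  rewrite -ler_pdivrMl// mulrC (le_trans (ler_norm _))//.
  have h := ltW (archi_boundP (normr_ge0 (2 * C / eta))).
  have C0 : 0 <= C by rewrite (le_trans _ (aC 0%N)).
  have z : 0 <= 2 * C / eta by rewrite divr_ge0 ?mulr_ge0// ltW.
  rewrite ger0_norm// in h *.
  rewrite (le_trans h)// -natrX ler_nat.
  exact: ltnW (ltn_expl _ _).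
apply: (@infinite_bisect a eta n eta0 P (- C)) => // k _.
have := aC k; rewrite ler_norml => /andP[-> h]; lra.
Qed.

Lemma infinite_close_seq (T : Type) (a : nat -> T -> R) (C eta : R) (s : seq T) P : 0 < eta ->
  (forall k x, `|a k x| <= C) -> infinite_nat P ->
  exists2 Q, infinite_nat Q & (forall k, Q k -> P k) /\
    forall k l, Q k -> Q l -> forall i, (i < size s)%N -> forall x0, `|a k (nth x0 s i) - a l (nth x0 s i)| <= eta.
Proof.
move=> eta0 aC; elim: s P => [|x s IH] P iP; first by exists P.
have [Q iQ [QP HQ]] := @infinite_close (fun k => a k x) C eta P eta0 (fun k => aC k x) iP.
have [Q' iQ' [QP' HQ']] := IH Q iQ.
exists Q' => //; split; first by move=> k /QP'/QP.
move=> k l Qk Ql [|i] isz x0 /=; first by apply: HQ; exact: QP'.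
exact: HQ'.
Qed.

(** Keeps the diagonal argument independent of the meaning of closeness, which will be a bound on
    the integral of [|phi k - phi l|^q]. *)
Lemma diagonal_extraction (close : R -> nat -> nat -> Prop) :
  (forall eta P, 0 < eta -> infinite_nat P -> exists2 Q, infinite_nat Q &
     (forall k, Q k -> P k) /\ forall k l, Q k -> Q l -> close eta k l) ->
  exists sg : nat -> nat, (forall j, (sg j < sg j.+1)%N) /\
    forall j k l, (j <= k)%N -> (j <= l)%N -> close (2^-1 ^+ j) (sg k) (sg l).
Proof.
move=> H.
have pos j : 0 < 2^-1 ^+ j :> R by rewrite exprn_gt0// invr_gt0.
have [next Hn] : exists next : nat * {P : nat -> Prop | infinite_nat P} -> {P : nat -> Prop | infinite_nat P},
    forall jP, (forall k, sval (next jP) k -> sval jP.2 k) /\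
      forall k l, sval (next jP) k -> sval (next jP) l -> close (2^-1 ^+ jP.1) k l.
  suff /choice[f Hf] : forall jP : nat * {P : nat -> Prop | infinite_nat P}, exists Q : {P : nat -> Prop | infinite_nat P},
    (forall k, sval Q k -> sval jP.2 k) /\ forall k l, sval Q k -> sval Q l -> close (2^-1 ^+ jP.1) k l.
    by exists f.
  move=> [j [P iP]] /=; have [Q iQ HQ] := H _ P (pos j) iP.
  by exists (exist _ Q iQ).
have iT : infinite_nat (fun=> True) by move=> n; exists n.
pose S := fix S j := if j is j'.+1 then next (j, S j') else next (0%N, exist _ _ iT).
have Sc j k l : sval (S j) k -> sval (S j) l -> close (2^-1 ^+ j) k l.
  by case: j => [|j]; [exact: (Hn (0%N, exist _ _ iT)).2|exact: (Hn (j.+1, S j)).2].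
have Sd j k : sval (S j.+1) k -> sval (S j) k by exact: (Hn (j.+1, S j)).1.
have Sm j i k : (j <= i)%N -> sval (S i) k -> sval (S j) k.
  by move=> ji; rewrite -(subnK ji); elim: (i - j)%N => // n IH /Sd; exact: IH.
have /choice[pick Hp] : forall jn : nat * nat, exists k, (jn.2 <= k)%N /\ sval (S jn.1) k.
  by move=> [j n]; have [k nk Sk] := svalP (S j) n; exists k.
pose sg := fix sg j := if j is j'.+1 then pick (j, (sg j').+1) else pick (0%N, 0%N).
have sgS j : sval (S j) (sg j) by case: j => [|j]; exact: (Hp (_, _)).2.
exists sg; split; first by move=> j; exact: (Hp (j.+1, (sg j).+1)).1.
by move=> j k l jk jl; apply: Sc; [exact: Sm jk (sgS k)|exact: Sm jl (sgS l)].
Qed.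

Context {N : nat}.
Notation V := 'rV[R]_N.
Notation mu := (lebesgue_rV N).

Lemma finite_net (r d : R) : 0 < d -> exists s : seq V, forall x, `|x| <= r ->
  exists2 y, y \in s & `|x - y| < d.
Proof.
move=> d0; have := @compact_cball R N r; rewrite compact_cover => cc.
have [|x xr|D _ HD] := cc V setT (fun y => ball y d) _ _.
- by move=> y _; exact: ball_open.
- by exists x => //; exact: ballxx.
exists (finmap.enum_fset D) => x xr; have [y yD xy] := HD x xr.
exists y => //; move: xy; by rewrite mx_norm_ball /ball_/= distrC.
Qed.

(** The theorem of Arzela and Ascoli in the form fed to the diagonal argument: the values on a
    finite net are made close by finitely many extractions, and the Lipschitz bound extends this to
    all points. *)
Lemma equilipschitz_close (F : nat -> V -> R) (C L r eta : R) P : 0 < eta -> 0 <= L ->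
  (forall k x, `|F k x| <= C) -> (forall k x y, `|F k x - F k y| <= L * `|x - y|) ->
  (forall k x, r < `|x| -> F k x = 0) -> infinite_nat P ->
  exists2 Q, infinite_nat Q & (forall k, Q k -> P k) /\
    forall k l, Q k -> Q l -> forall x, `|F k x - F l x| <= eta.
Proof.
move=> eta0 L0 FC FL Fr iP.
have e3 : 0 < eta / 3 by rewrite divr_gt0.
have L1 : 0 < L + 1 by rewrite ltr_wpDl.
have [s Hs] := @finite_net r (eta / 3 / (L + 1)) (divr_gt0 e3 L1).
have [Q iQ [QP HQ]] := infinite_close_seq s e3 FC iP.
exists Q => //; split => // k l Qk Ql x.
have [xr|xr] := leP `|x| r; last by rewrite !Fr// subrr normr0 ltW.
have [y ys xy] := Hs x xr.
have h1 m : `|F m x - F m y| <= eta / 3.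
  rewrite (le_trans (FL m x y))//.
  apply: (le_trans (ler_wpM2l L0 (ltW xy))).
  by rewrite mulrCA ler_piMr ?(ltW e3)// ler_pdivrMr// mul1r lerDl.
have h2 : `|F k y - F l y| <= eta / 3.
  by rewrite -(nth_index y ys); apply: HQ => //; rewrite index_mem.
have -> : F k x - F l x = (F k x - F k y) + (F k y - F l y) - (F l x - F l y) by ring.
apply: (le_trans (ler_normB _ _)); apply: (le_trans (lerD (ler_normD _ _) (lexx _))).
have := h1 k; have := h1 l; lra.
Qed.

Lemma mu_box (r : R) : 0 <= r -> mu (@box R N r) = ((2 * r) ^+ N)%:E.
Proof.
move=> r0; elim: N => [|n IH].
  by rewrite expr0 /= diracE mem_set// => -[].
rewrite /= /lebesgue_rV_step /pushforward.
rewrite (_ : cons_rV @^-1` _ = `[- r, r]%classic `*` @box R n r); last first.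
  apply/seteqP; split=> -[t y] /=.
    move=> B; split => [|i] /=.
      have := B ord0; rewrite /cons_rV mxE; case: splitP => // j _.
      by rewrite mxE (ord1 j) eqxx in_itv/= -ler_norml.
    have := B (rshift 1 i : 'I_n.+1).
    by rewrite /cons_rV (@row_mxEr R 1 1 n).
  rewrite in_itv/= -ler_norml => -[tr yr] i; rewrite /cons_rV.
  have [j|j] := split_ordP (i : 'I_(1 + n)) => ->.
    by rewrite (@row_mxEl R 1 1 n) mxE (ord1 j) eqxx.
  by rewrite (@row_mxEr R 1 1 n).
rewrite product_measure1E//; last exact: measurable_box.
rewrite [X in (_ * X)%E]IH.
have E : (@lebesgue_measure R [set` `[- r, r]%R] = (2 * r)%:E)%E.
  rewrite lebesgue_measure_itv/= lte_fin.
  case: ifPn => [_|]; first by rewrite -EFinB; congr EFin; ring.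
  by rewrite -leNgt => h; congr EFin; lra.
transitivity ((2 * r)%:E * ((2 * r) ^+ n)%:E)%E; last by rewrite -EFinM exprS.
by congr (_ * _)%E; exact: E.
Qed.

Lemma Int_indic_box (r : R) : 0 <= r -> Int (\1_(@box R N r)) = (2 * r) ^+ N.
Proof.
move=> r0; apply: EFin_inj; rewrite -Int_EFin; last exact: L1_indic_box.
rewrite integral_indic ?setIT.
- exact: mu_box.
- exact: measurableT.
- exact: measurable_box.
Qed.

Lemma Int_ge_box (f : V -> R) x (d e : R) : L1 f -> (forall y, 0 <= f y) -> 0 <= d ->
  (forall y, `|y - x| <= d -> e <= f y) -> e * (2 * d) ^+ N <= Int f.
Proof.
move=> Lf f0 d0 fe.
have Lb := @L1_indic_box R N d; have [Ls Is] := Int_shift (- x) Lb.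
rewrite -Int_indic_box// -Is -IntZ//; apply: le_Int => //; first exact: L1Z.
move=> y; rewrite indicE; case: (boolP (_ \in _)) => [|_]; last by rewrite mulr0.
rewrite mulr1 inE => h; apply: fe; apply: rV_norm_le => //.
Qed.

Lemma Int_eq0_at (f : V -> R) x : L1 f -> (forall y, 0 <= f y) -> Int f = 0 ->
  {for x, continuous f} -> f x = 0.
Proof.
move=> Lf f0 I0 cf; apply/eqP; rewrite eq_le f0 andbT leNgt; apply/negP => fx.
have f2 : 0 < f x / 2 by rewrite divr_gt0.
move/cvgrPdist_le : cf => /(_ _ f2)/nbhs_ballP[d /= d0 H].
have d2 : 0 < d / 2 by rewrite divr_gt0.
have := @Int_ge_box f x (d / 2) (f x / 2) Lf f0 (ltW d2) _; rewrite I0 leNgt mulr_gt0 ?exprn_gt0 ?mulr_gt0//.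
move=> /(_ _)/negP; apply => //; move=> y yx.
have := H y; rewrite mx_norm_ball /ball_/= distrC => /(_ _) h.
have {}h : `|f x - f y| <= f x / 2 by apply: h; rewrite (le_lt_trans yx)// ltr_pdivrMr// ltr_pMr// ltr1n.
have := ler_norm (f x - f y); lra.
Qed.

Lemma rho_mass_gt0 : 0 < @rho_mass R N.
Proof.
rewrite lt_neqAle rho_mass_ge0 andbT eq_sym; apply/negP => /eqP I0.
have cr : {for 0, continuous (@rho R N)} by exact: (CkT_cont (kernel_rho.1 0%N)).
have := @Int_eq0_at rho 0 (kernel_L1 kernel_rho) rho_ge0 I0 cr.
rewrite /rho /bumpf /sqn big1 => [|i _]; last by rewrite mxE expr0n.
rewrite subr0 flat1_gt0// => /eqP; apply/negP; rewrite mulf_neq0// mulf_neq0 ?invr_eq0 ?expf_neq0//.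
Qed.

(** The series of the [h k] has integral at most [2], hence a finite sum almost everywhere; [S] is
    that sum. *)
Lemma ae_series (h : nat -> V -> R) : (forall k, L1 (h k)) -> (forall k x, 0 <= h k x) ->
  (forall k, Int (h k) <= 2^-1 ^+ k) -> exists S : V -> R, [/\ L1 S, forall x, 0 <= S x &
  {ae mu, forall x, forall n, \sum_(k < n) h k x <= S x}].
Proof.
move=> Lh h0 Ih.
have mh k : measurable_fun setT (fun x => (h k x)%:E) by apply/measurable_EFinP; exact: L1_meas.
have h0E k x : setT x -> (0 <= (h k x)%:E)%E by rewrite lee_fin.
have mS : measurable_fun setT (fun x => \sum_(k <oo) (h k x)%:E)%E.
  by apply: ge0_emeasurable_sum => // k x _; rewrite lee_fin.
have IS : (\int[mu]_x \sum_(k <oo) (h k x)%:E <= 2%:E)%E.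
  rewrite integral_nneseries//.
  apply: lime_le.
    by apply: is_cvg_nneseries => k _ _; apply: integral_ge0 => x _; rewrite lee_fin.
  apply: nearW => n; under eq_bigr do rewrite Int_EFin//.
  rewrite sumEFin lee_fin big_mkord.
  apply: (le_trans (ler_sum _ (fun (k : 'I_n) _ => Ih k))).
  have := @geo_sum_le R 2^-1 0 n; under eq_bigr do rewrite add0n.
  move=> /(_ _ _)/le_trans; apply; rewrite ?invr_ge0// ?invf_lt1 ?ltr1n//.
  by rewrite expr0 mul1r (_ : (1 - 2^-1)^-1 = 2 :> R)//; field.
have S0 x : (0 <= \sum_(k <oo) (h k x)%:E)%E.
  by apply: nneseries_ge0 => k _ _; rewrite lee_fin.
have mf : measurable_fun setT (fun x => fine (\sum_(k <oo) (h k x)%:E)%E).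
  exact: (@measurableT_comp _ _ _ _ _ _ fine).
exists (fun x => fine (\sum_(k <oo) (h k x)%:E)%E); split.
- apply: L1_ge0P => //; first by move=> x; exact: fine_ge0.
  apply: le_lt_trans (ltry 2); apply: le_trans IS.
  apply: ge0_le_integral => //.
  + by move=> x _; rewrite lee_fin fine_ge0.
  + exact/measurable_EFinP.
  + by move=> x _; case: (\sum_(k <oo) _)%E (S0 x) => //=; rewrite leey.
- by move=> x; exact: fine_ge0.
have : mu.-integrable setT (fun x => \sum_(k <oo) (h k x)%:E)%E.
  apply/integrableP; split => //.
  rewrite (eq_integral (fun x => \sum_(k <oo) (h k x)%:E)%E); last by move=> x _; rewrite gee0_abs.
  exact: le_lt_trans IS (ltry _).
move=> /(integrable_ae measurableT); apply: filterS => x /(_ I) fx n.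
rewrite -lee_fin fineK//.
have hx i : (0 <= i)%N -> xpredT i -> (0 <= (h i x)%:E)%E by rewrite lee_fin.
apply: le_trans (nneseries_lim_ge n hx).
by rewrite sumEFin lee_fin big_mkord.
Qed.

Lemma powR_add3 (a b c q : R) : 0 < q -> `|a + b + c| `^ q <= 3 `^ q * (`|a| `^ q + `|b| `^ q + `|c| `^ q).
Proof.
move=> q0; set Y := _ + _ + _ `^ q.
have Y0 : 0 <= Y by rewrite !addr_ge0 ?powR_ge0.
have bd (x : R) : `|x| `^ q <= Y -> `|x| <= Y `^ q^-1.
  move=> xY; have {1}-> : `|x| = (`|x| `^ q) `^ q^-1 by rewrite -powRrM mulfV ?lt0r_neq0// powRr1.
  by rewrite ge0_ler_powR ?nnegrE ?powR_ge0// invr_ge0 ltW.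
have -> : Y = (Y `^ q^-1) `^ q by rewrite -powRrM mulVf ?lt0r_neq0// powRr1.
rewrite -powRM ?powR_ge0// ge0_ler_powR ?nnegrE ?(ltW q0)//; first by rewrite mulr_ge0 ?powR_ge0.
have pa := powR_ge0 `|a| q; have pb := powR_ge0 `|b| q; have pc := powR_ge0 `|c| q.
have ha : `|a| <= Y `^ q^-1 by apply: bd; rewrite /Y; lra.
have hb : `|b| <= Y `^ q^-1 by apply: bd; rewrite /Y; lra.
have hc : `|c| <= Y `^ q^-1 by apply: bd; rewrite /Y; lra.
have := ler_normD (a + b) c; have := ler_normD a b; lra.
Qed.

(** The Riesz-Fischer argument. Besides the almost everywhere limit it provides an integrable
    majorant of all the [q]-th powers, which later permits dominated convergence for every exponent
    up to [q]. *)
Lemma Lq_complete (f : nat -> V -> R) (q : R) : 0 < q -> (forall k, measurable_fun setT (f k)) ->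
  L1 (fun x => `|f 0%N x| `^ q) ->
  (forall k l, L1 (fun x => `|f k x - f l x| `^ q)) ->
  (forall j k l, (j <= k)%N -> (j <= l)%N ->
     Int (fun x => `|f k x - f l x| `^ q) <= 2^-1 ^+ j * (2^-1 ^+ j) `^ q) ->
  exists u H : V -> R, [/\ measurable_fun setT u, L1 H,
    {ae mu, forall x, f k x @[k --> \oo] --> u x} &
    {ae mu, forall x, forall k, `|f k x| `^ q <= H x}].
Proof.
move=> q0 mf L0 Lf Hf.
(* The upper limit is measurable on the whole space, whatever happens on the exceptional null
   set. *)
pose u x := fine (limn_esup (fun k => (f k x)%:E)).
have mu_ : measurable_fun setT u.
  apply: (@measurableT_comp _ _ _ _ _ _ fine) => //.
  apply: (@measurable_fun_limn_esup _ _ _ _ (fun k x => (f k x)%:E)) => k.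
  exact/measurable_EFinP.
(* The weight [2^k] is absorbed by the factor [(2^-j)^q] of the hypothesis; a bound [S x] for the
   series then forces [|f k.+1 x - f k x| <= S(x)^(1/q) 2^-k]. *)
pose h k x := (2^-1 ^- k * `|f k.+1 x - f k x|) `^ q.
have hE k x : h k x = (2 ^+ k) `^ q * `|f k.+1 x - f k x| `^ q.
  by rewrite /h exprVn invrK powRM// exprn_ge0.
have Lh k : L1 (h k) by apply: L1_ext (L1Z ((2 ^+ k) `^ q) (Lf k.+1 k)) => x; rewrite hE.
have Ih k : Int (h k) <= 2^-1 ^+ k.
  under Int_ext do rewrite hE.
  rewrite IntZ// (le_trans (ler_wpM2l (powR_ge0 _ _) (Hf k k.+1 k (leqnSn k) (leqnn k))))//.
  rewrite mulrCA -powRM ?exprn_ge0 ?invr_ge0// -exprMn divff// expr1n powR1 mulr1.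
  exact: lexx.
have h0 k x : 0 <= h k x by exact: powR_ge0.
have [S [LS S0 HS]] := ae_series Lh h0 Ih.
have hS x n : (forall n, \sum_(k < n) h k x <= S x) -> h n x <= S x.
  move=> /(_ n.+1); apply: le_trans.
  by rewrite big_ord_recr/= lerDr sumr_ge0.
have cv : {ae mu, forall x, f k x @[k --> \oo] --> u x}.
  apply: filterS HS => x HC.
  have st k : (0 <= k)%N -> `|f k.+1 x - f k x| <= S x `^ q^-1 * 2^-1 ^+ k.
    move=> _; rewrite exprVn -ler_pdivrMr ?invr_gt0 ?exprn_gt0// invrK mulrC.
    have z0 : 0 <= 2 ^+ k * `|f k.+1 x - f k x| by rewrite mulr_ge0// exprn_ge0.
    have {1}-> : 2 ^+ k * `|f k.+1 x - f k x| = ((2 ^+ k * `|f k.+1 x - f k x|) `^ q) `^ q^-1.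
      by rewrite -powRrM mulfV ?lt0r_neq0// powRr1.
    rewrite ge0_ler_powR ?nnegrE ?powR_ge0 ?invr_ge0 ?(ltW q0)//.
    by have := hS x k HC; rewrite /h exprVn invrK.
  have [cl _] := geo_limit (powR_ge0 _ _) st.
  have cE : (f k x)%:E @[k --> \oo] --> (limn (f ^~ x))%:E by apply: cvg_EFin => //; exact: nearW.
  have -> // : u x = limn (f ^~ x).
  rewrite /u; have [_ E] := cvg_limn_einf_sup cE.
  by rewrite E.
exists u, (fun x => 3 `^ q * (`|f 0%N x| `^ q + (1 - 2^-1)^-1 `^ q * S x)); split => //.
  by apply: L1Z; apply: L1D => //; exact: L1Z.
apply: filterS HS => x HC k.
have -> : f k x = f 0%N x + \sum_(j < k) (f j.+1 x - f j x) + 0.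
  have T : \sum_(j < k) (f j.+1 x - f j x) = f k x - f 0%N x := telescope_shift (f ^~ x) 0 k.
  by rewrite T addr0 addrC subrK.
apply: (le_trans (powR_add3 _ _ _ q0)); rewrite ler_wpM2l ?powR_ge0//.
rewrite normr0 powR0 ?lt0r_neq0// addr0 lerD2l.
have i2 : (2^-1 : R) < 1 by rewrite invf_lt1// ltr1n.
have i0 : 0 < (2^-1 : R) by rewrite invr_gt0.
apply: (le_trans (weighted_sum_powR (fun j : 'I_k => f j.+1 x - f j x) 0 q0 i0 i2)).
by rewrite ler_wpM2l ?powR_ge0//; exact: HC.
Qed.

End extraction.

(** * Compactness of sequences of bounded energy *)

Section compactness.
Context {R : realType}.

Lemma C1_lipschitz_bound {N : nat} (f : 'rV[R]_N -> R) (L : R) : Ck setT 1 f ->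
  (forall i x, `|partial i f x| <= L) -> forall x y, `|f x - f y| <= N%:R * L * `|x - y|.
Proof.
move=> cf fL x y.
have D z : is_derive z (x - y) f (\sum_i (x - y) ord0 i * partial i f z).
  by apply: (C1_is_derive (x - y) openT cf).
have [|th _] := @mvt_dir _ _ f y (x - y) 1.
  by move=> t _; have [] := D (y + t *: (x - y)).
rewrite (_ : y + 1 *: (x - y) = x); last by rewrite scale1r addrC subrK.
rewrite mul1r => ->.
have [_ ->] := D (y + th *: (x - y)).
apply: (le_trans (ler_norm_sum _ _ _)).
apply: (@le_trans _ _ (\sum_(i < N) L * `|x - y|)).
  by apply: ler_sum => i _; rewrite normrM mulrC ler_pM// rV_coord_le.
by rewrite sumr_const card_ord -[leLHS]mulr_natl mulrA.
Qed.

Lemma Int_lin3 {N : nat} (a b c : 'rV[R]_N -> R) (k A B : R) : 0 <= k -> L1 a -> L1 b -> L1 c ->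
  Int a <= A -> Int b <= B -> Int c <= A -> Int (fun x => k * (a x + b x + c x)) <= k * (2 * A + B).
Proof.
move=> k0 La Lb Lc aA bB cA.
rewrite (IntZ _ (L1D (L1D La Lb) Lc)) ler_wpM2l// (IntD (L1D La Lb) Lc) (IntD La Lb).
by move: (Int a) (Int b) (Int c) aA bB cA => x y z; lra.
Qed.

Context {M : nat}.
Local Notation N := M.+2.
Notation V := 'rV[R]_N.
Notation mu := (lebesgue_rV N).
Local Notation mass := (@rho_mass R M.+2).

Lemma cv_bound_energy chi (r s E : R) : 0 < s -> 0 <= r -> unit_kernel chi -> exists2 C : R, 0 <= C &
  forall (phi : V -> R), Ck setT 1 phi -> (forall x, r < `|x| -> phi x = 0) -> energy phi <= E ->
  forall x, `|cv phi chi s x| <= C.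
Proof.
move=> s0 r0 kc; set I := Int (fun z => chi z ^+ 2).
have I0 : 0 <= I by apply: Int_ge0 => z; exact: sqr_ge0.
have B0 : 0 <= s ^- N * I by rewrite mulr_ge0// invr_ge0 exprn_ge0// ltW.
exists (Num.sqrt ((2 * r + 1) ^+ 2 * E * (s ^- N * I))); first exact: sqrtr_ge0.
move=> phi cp pr Ep x.
have bp : bsupp phi by exists r.
have h := cv_bound_CS x s0 kc (L1_C0 (CkT_cont cp) bp) (L1_sqr (CkT_cont cp) bp).
have P : Int (fun y => phi y ^+ 2) <= (2 * r + 1) ^+ 2 * E.
  by apply: (le_trans (poincare (ltn0Sn _) cp r0 pr)); rewrite ler_wpM2l// sqr_ge0.
rewrite -sqrtr_sqr ler_wsqrtr// (le_trans h)//.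
by rewrite ler_wpM2r.
Qed.

Lemma moll_equilipschitz (r s E : R) : 0 < s -> 0 <= r -> exists C L : R, [/\ 0 <= C, 0 <= L &
  forall (phi : V -> R), Ck setT 1 phi -> (forall x, r < `|x| -> phi x = 0) -> energy phi <= E ->
  (forall x, `|moll phi s x| <= C) /\ forall x y, `|moll phi s x - moll phi s y| <= L * `|x - y|].
Proof.
move=> s0 r0.
have [C C0 HC] := cv_bound_energy E s0 r0 (@kernel_rho R N).
have /choice[L HL] : forall i : 'I_N, exists L : R, 0 <= L /\
    forall (phi : V -> R), Ck setT 1 phi -> (forall x, r < `|x| -> phi x = 0) -> energy phi <= E ->
    forall x, `|cv phi (partial i rho) s x| <= L.
  by move=> i; have [L L0 HL] := cv_bound_energy E s0 r0 (kernel_partial i (@kernel_rho R N)); exists L.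
have sN : 0 <= s ^+ N by rewrite exprn_ge0// ltW.
have SL : 0 <= \sum_i L i by apply: sumr_ge0 => i _; exact: (HL i).1.
exists (s ^+ N * C), (N%:R * (s ^+ N * (s * \sum_i L i))); split; first exact: mulr_ge0.
  by rewrite mulr_ge0// mulr_ge0// mulr_ge0// ltW.
move=> phi cp pr Ep; split.
  by move=> x; rewrite /moll normrM ger0_norm// ler_wpM2l//; exact: HC.
have Lp : L1 phi by apply: L1_C0 (CkT_cont cp) _; exists r.
have cm : Ck setT 1 (moll phi s).
  by apply: Ck_scl; [exact: openT|exact: Ck_cv (@kernel_rho R N)].
apply: C1_lipschitz_bound => // i x.
have -> : partial i (moll phi s) x = s ^+ N * (s * cv phi (partial i rho) s x).
  apply: is_derive_partial; apply: is_derive_scl.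
  exact: cv_derive_x Lp (@kernel_rho R N).
rewrite normrM (ger0_norm sN) ler_wpM2l// normrM (gtr0_norm s0) ler_wpM2l ?(ltW s0)//.
apply: (le_trans ((HL i).2 phi cp pr Ep x)).
by rewrite (bigD1 i)//= lerDl sumr_ge0// => j _; exact: (HL j).1.
Qed.

Variable q : R.
Hypotheses (q2 : 2 < q) (subcritical : M%:R * (q - 2) < 4).
Let q0 : 0 < q. Proof. exact: lt_trans q2. Qed.

Lemma Int_moll_close (f g : V -> R) (r s eta : R) : 0 < s -> 0 <= r -> 0 <= eta ->
  L1 f -> L1 g -> (forall x, r < `|x| -> f x = 0) -> (forall x, r < `|x| -> g x = 0) ->
  (forall x, `|moll f s x - moll g s x| <= eta) ->
  L1 (fun x => `|moll f s x - moll g s x| `^ q) /\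
  Int (fun x => `|moll f s x - moll g s x| `^ q) <= eta `^ q * (2 * (r + s^-1)) ^+ N.
Proof.
move=> s0 r0 e0 Lf Lg fr gr H.
have si0 : 0 <= s^-1 by rewrite invr_ge0 ltW.
have rs : 0 <= r + s^-1 by rewrite addr_ge0.
have z x : r + s^-1 < `|x| -> moll f s x - moll g s x = 0.
  move=> h; rewrite /moll (cv_bsupp s0 fr (@kernel_rho R N) h).
  by rewrite (cv_bsupp s0 gr (@kernel_rho R N) h) subrr.
have L : L1 (fun x => `|moll f s x - moll g s x| `^ q).
  apply: L1_powR_C0 => //; last by exists (r + s^-1).
  move=> x; apply: (@continuousB _ _ _ (moll f s) (moll g s)); exact: continuous_moll.
split => //; rewrite -Int_indic_box// -IntZ; last exact: L1_indic_box.
apply: le_Int => //; first by apply: L1Z; exact: L1_indic_box.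
move=> x; rewrite indicE; case: (boolP (_ \in _)) => [_|].
  by rewrite mulr1 ge0_ler_powR ?nnegrE ?(ltW q0).
move=> /negP xb; rewrite z; first by rewrite normr0 powR0 ?lt0r_neq0// mulr0.
rewrite ltNge; apply/negP => h; apply: xb; rewrite inE => i.
exact: le_trans (rV_coord_le _ _) h.
Qed.

Lemma Int_Lq_close (phi psi : V -> R) (r s E C g eta : R) m : s = dyad m -> 0 <= r -> 0 <= eta -> 0 <= C ->
  0 < g -> (forall (phi : V -> R) m, Ck setT 1 phi -> bsupp phi ->
  L1 (fun x => `|mass * phi x - moll phi (dyad m) x| `^ q) /\
    Int (fun x => `|mass * phi x - moll phi (dyad m) x| `^ q) <=
    C * energy phi `^ (q / 2) * g ^+ m) ->
  Ck setT 1 phi -> Ck setT 1 psi -> (forall x, r < `|x| -> phi x = 0) ->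
  (forall x, r < `|x| -> psi x = 0) -> energy phi <= E -> energy psi <= E ->
  (forall x, `|moll phi s x - moll psi s x| <= eta) ->
  Int (fun x => `|phi x - psi x| `^ q) <=
    mass^-1 `^ q * (3 `^ q * (2 * (C * E `^ (q / 2) * g ^+ m) + eta `^ q * (2 * (r + s^-1)) ^+ N)).
Proof.
move=> sE r0 e0 C0 g0 HA cp cq pr qr Ep Eq H.
have s0 : 0 < s by rewrite sE dyad_gt0.
have bp : bsupp phi by exists r.
have bq : bsupp psi by exists r.
have Lp := L1_C0 (CkT_cont cp) bp; have Lq := L1_C0 (CkT_cont cq) bq.
have [L2 I2] := Int_moll_close s0 r0 e0 Lp Lq pr qr H.
have [L1a I1] := HA phi m cp bp; have [L3 I3] := HA psi m cq bq.
have cm := @rho_mass_gt0 R N.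
have E1 (f : V -> R) : energy f <= E -> C * energy f `^ (q / 2) * g ^+ m <= C * E `^ (q / 2) * g ^+ m.
  move=> fE; rewrite ler_wpM2r ?exprn_ge0 ?(ltW g0)// ler_wpM2l//.
  have E0 : 0 <= E by apply: le_trans fE; exact: energy_ge0.
  have q20 : 0 <= q / 2 by rewrite divr_ge0// ltW.
  by rewrite ge0_ler_powR ?nnegrE ?energy_ge0.
have {}I1 := le_trans I1 (E1 _ Ep); have {}I3 := le_trans I3 (E1 _ Eq).
pose G x := 3 `^ q * (`|mass * phi x - moll phi (dyad m) x| `^ q + `|moll phi s x - moll psi s x| `^ q +
   `|mass * psi x - moll psi (dyad m) x| `^ q).
have LS := L1D (L1D L1a L2) L3.
have LG : L1 G by exact: L1Z.
have IG : Int G <= 3 `^ q * (2 * (C * E `^ (q / 2) * g ^+ m) + eta `^ q * (2 * (r + s^-1)) ^+ N).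
  exact: (Int_lin3 (powR_ge0 3 q) L1a L2 L3 I1 I2 I3).
apply: (@le_trans _ _ (Int (fun x => mass^-1 `^ q * G x))); last first.
  by rewrite (IntZ _ LG) ler_wpM2l ?powR_ge0.
apply: le_Int => //; last first.
- move=> x; rewrite (_ : phi x - psi x = mass^-1 * (mass * phi x - mass * psi x)); last first.
    by rewrite -mulrBr mulKf// lt0r_neq0.
  rewrite normrM powRM// ger0_norm ?invr_ge0 ?(ltW cm)// ler_wpM2l ?powR_ge0//.
  rewrite (_ : mass * phi x - _ = (mass * phi x - moll phi (dyad m) x) + (moll phi s x - moll psi s x)
    + (moll psi (dyad m) x - mass * psi x)); last by rewrite sE; ring.
  apply: (le_trans (powR_add3 _ _ _ q0)); rewrite ler_wpM2l ?powR_ge0// lerD2l.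
  by rewrite distrC.
- exact: L1Z.
- apply: L1_powR_C0 => //.
    by move=> x; apply: (@continuousB _ _ _ phi psi); [exact: CkT_cont cp x|exact: CkT_cont cq x].
  by exists r => x h; rewrite pr// qr// subrr.
Qed.

(** At a fixed scale the mollifications are bounded and equi-Lipschitz by the energy bound, and they
    approximate the functions in [L^q] uniformly along the sequence. The target [eta * eta^q] is the
    rate requested by [Lq_complete]. *)
Lemma energy_compact (phi : nat -> V -> R) (r E : R) : 0 <= r -> (forall k, Ck setT 1 (phi k)) ->
  (forall k x, r < `|x| -> phi k x = 0) -> (forall k, energy (phi k) <= E) ->
  exists (sg : nat -> nat) (u H : V -> R), [/\ forall j, (sg j < sg j.+1)%N,
    measurable_fun setT u, L1 H,
    {ae mu, forall x, phi (sg k) x @[k --> \oo] --> u x} &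
    {ae mu, forall x, forall k, `|phi (sg k) x| `^ q <= H x}].
Proof.
move=> r0 cp pr Ep.
have [C [g [C0 g0 g1 HA]]] := Lq_approximation q2 subcritical.
have bp k : bsupp (phi k) by exists r => x; exact: pr.
have Lp k := L1_C0 (CkT_cont (cp k)) (bp k).
have K0 : 0 <= mass^-1 `^ q * 3 `^ q by rewrite mulr_ge0 ?powR_ge0.
have [|sg [sgS Hs]] := @diagonal_extraction R (fun t k l => Int (fun x => `|phi k x - phi l x| `^ q) <= t * t `^ q).
  move=> eta P eta0 iP.
  set K := mass^-1 `^ q * 3 `^ q; pose t := eta * eta `^ q.
  have t0 : 0 < t by rewrite mulr_gt0 ?powR_gt0.
  have A0 : 0 <= K * (2 * (C * E `^ (q / 2))) by rewrite !mulr_ge0 ?powR_ge0.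
  have [m Hm] : exists m, K * (2 * (C * E `^ (q / 2))) * g ^+ m <= t / 2.
    have : K * (2 * (C * E `^ (q / 2))) * g ^+ n @[n --> \oo] --> K * (2 * (C * E `^ (q / 2))) * 0.
      by apply: cvgMr; apply: cvg_expr; rewrite ger0_norm// ltW.
    have t20 : 0 < t / 2 by rewrite divr_gt0.
    rewrite mulr0 => /cvgr0_norm_le h; have [m _ Hm] := h _ t20; exists m.
    exact: le_trans (ler_norm _) (Hm m (leqnn m)).
  pose B := K * (2 * (r + (dyad m)^-1)) ^+ N.
  have d0 := @dyad_gt0 R m.
  have B0 : 0 <= B by rewrite mulr_ge0// exprn_ge0// mulr_ge0// addr_ge0// invr_ge0 ltW.
  have B1 : 0 < B + 1 by rewrite ltr_wpDl.
  (* Chosen so that [eta'^q] times the volume factor [B] is at most [t / 2]; the scale [m] has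
     already brought the approximation errors down to [t / 2]. *)
  pose eta' := (t / 2 / (B + 1)) `^ q^-1.
  have w0 : 0 < t / 2 / (B + 1) by rewrite divr_gt0// divr_gt0.
  have e'0 : 0 < eta' by exact: powR_gt0.
  have e'q : eta' `^ q = t / 2 / (B + 1) by rewrite -powRrM mulVf ?lt0r_neq0// powRr1// ltW.
  have [C1 [L [C10 L0 HL]]] := moll_equilipschitz E d0 r0.
  have [|||Q iQ [QP HQ]] := @equilipschitz_close _ _ (fun k => moll (phi k) (dyad m)) C1 L (r + (dyad m)^-1) eta' P e'0 L0 _ _ _ iP.
  - by move=> k x; have [+ _] := HL (phi k) (cp k) (pr k) (Ep k); apply.
  - by move=> k x y; have [_ +] := HL (phi k) (cp k) (pr k) (Ep k); apply.
  - by move=> k x h; rewrite /moll (cv_bsupp d0 (pr k) (@kernel_rho R N) h) mulr0.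
  exists Q => //; split => // k l Qk Ql.
  apply: (le_trans (Int_Lq_close erefl r0 (ltW e'0) C0 g0 HA (cp k) (cp l) (pr k) (pr l) (Ep k) (Ep l) (HQ k l Qk Ql))).
  rewrite e'q mulrA -/K mulrDr.
  have h2 : K * (t / 2 / (B + 1) * (2 * (r + (dyad m)^-1)) ^+ N) <= t / 2.
    rewrite mulrCA -/B mulrAC -mulrA ler_piMr ?divr_ge0 ?(ltW t0)//.
    by rewrite ler_pdivrMr// mul1r lerDl.
  rewrite -[X in _ <= X]/t [X in _ <= X]splitr lerD//.
  by rewrite (le_trans _ Hm)// !mulrA.
have Ld k l : L1 (fun x => `|phi (sg k) x - phi (sg l) x| `^ q).
  apply: L1_powR_C0 => //.
    by move=> x; apply: (@continuousB _ _ _ (phi (sg k)) (phi (sg l))); [exact: CkT_cont (cp (sg k)) x|exact: CkT_cont (cp (sg l)) x].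
  by exists r => x h; rewrite !pr// subrr.
have [||u [H [mu_ LH cu Hu]]] := @Lq_complete _ _ (fun k => phi (sg k)) q q0 _ _ Ld Hs.
- by move=> k; exact: L1_meas.
- by apply: L1_powR_C0 => //; exact: CkT_cont.
by exists sg, u, H.
Qed.

End compactness.

(** * Truncations *)

Section truncation.
Context {R : realType}.

(** A convex [C^1] substitute for the positive part, within [d] of it and with slope in [[0, 1]]:
    composition keeps functions [C^1] and does not increase the energy. *)
Definition beta (d s : R) : R := if 0 < s then s ^+ 2 / (s + d) else 0.
Definition dbeta (d s : R) : R := 1 - (d / (Num.max s 0 + d)) ^+ 2.

Variable d : R.
Hypothesis d0 : 0 < d.

Lemma beta_ge0 s : 0 <= beta d s.
Proof. by rewrite /beta; case: ltP => // s0; rewrite divr_ge0 ?sqr_ge0// addr_ge0// ltW. Qed.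

Lemma beta_le0 s : s <= 0 -> beta d s = 0.
Proof. by move=> s0; rewrite /beta ltNge s0. Qed.

Lemma beta_le s : 0 <= s -> beta d s <= s.
Proof.
move=> s0; rewrite /beta; case: ltP => // s1.
have sd : 0 < s + d by rewrite addr_gt0.
rewrite ler_pdivrMr// expr2 mulrDr lerDl mulr_ge0// ltW//.
Qed.

Lemma beta_ge s : s - d <= beta d s.
Proof.
rewrite /beta; case: ltP => s0; last by rewrite subr_le0 (le_trans s0)// ltW.
have sd : 0 < s + d by rewrite addr_gt0.
rewrite ler_pdivlMr//; have := sqr_ge0 d; lra.
Qed.

Lemma beta_sqr s : beta d s <= s ^+ 2 / d.
Proof.
rewrite /beta; case: ltP => s0; last by rewrite divr_ge0 ?sqr_ge0// ltW.
rewrite ler_wpM2l ?sqr_ge0// lef_pV2 ?posrE ?addr_gt0// lerDr ltW//.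
Qed.

Lemma max_d s : 0 < Num.max s 0 + d.
Proof. by rewrite ltr_wpDl// le_max lexx orbT. Qed.

Lemma dbeta_ge0 s : 0 <= dbeta d s.
Proof.
rewrite /dbeta subr_ge0 expr_le1// ?divr_ge0 ?(ltW d0) ?(ltW (max_d s))//.
by rewrite ler_pdivrMr ?max_d// mul1r lerDr le_max lexx orbT.
Qed.

Lemma dbeta_le1 s : dbeta d s <= 1.
Proof. by rewrite /dbeta gerBl sqr_ge0. Qed.

Lemma dbeta_le0 s : s <= 0 -> dbeta d s = 0.
Proof. by move=> s0; rewrite /dbeta max_r// add0r divff ?lt0r_neq0// expr1n subrr. Qed.

Lemma continuous_dbeta : continuous (dbeta d).
Proof.
move=> s.
have c : {for s, continuous (fun s : R => d / (Num.max s 0 + d))}.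
  apply: (@continuousM _ _ (fun=> d)); first exact: cst_continuous.
  apply: (@continuousV _ _ (fun s : R => Num.max s 0 + d)); first by rewrite lt0r_neq0// max_d.
  apply: (@continuousD _ _ _ (fun s : R => Num.max s 0) (fun=> d)); last exact: cst_continuous.
  by apply: (@continuous_max _ _ (fun s : R => s) (fun=> 0)); [exact: cvg_id|exact: cst_continuous].
have c2 := @continuousM _ _ (fun s : R => d / (Num.max s 0 + d)) (fun s : R => d / (Num.max s 0 + d)) s c c.
exact: (@continuousB _ _ _ (fun=> 1 : R) (fun s : R => (d / (Num.max s 0 + d)) ^+ 2) s (@cst_continuous _ _ _ _) c2).
Qed.

Lemma beta_pos s : 0 <= s -> beta d s = s - d + d ^+ 2 / (s + d).
Proof.
move=> s0; have sd : s + d != 0 by rewrite lt0r_neq0// ltr_wpDl.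
rewrite /beta; case: ltP => s1; first by field.
have -> : s = 0 by apply/eqP; rewrite eq_le s0 s1.
by rewrite !add0r; field; rewrite lt0r_neq0.
Qed.

Lemma dbeta_pos s : 0 <= s -> dbeta d s = 1 - d ^+ 2 / (s + d) ^+ 2.
Proof. by move=> s0; rewrite /dbeta max_l// expr_div_n. Qed.

Lemma beta_taylor_pos s t : 0 <= s -> 0 <= t ->
  0 <= beta d t - beta d s - (t - s) * dbeta d s <= (t - s) ^+ 2 / d.
Proof.
move=> s0 t0; have sd : 0 < s + d by rewrite ltr_wpDl.
have td : 0 < t + d by rewrite ltr_wpDl.
rewrite !beta_pos// dbeta_pos//.
have -> : t - d + d ^+ 2 / (t + d) - (s - d + d ^+ 2 / (s + d)) - (t - s) * (1 - d ^+ 2 / (s + d) ^+ 2) =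
    (t - s) ^+ 2 * (d / (s + d)) ^+ 2 / (t + d).
  by field; rewrite !lt0r_neq0.
have h0 : 0 <= (d / (s + d)) ^+ 2 by exact: sqr_ge0.
have h1 : (d / (s + d)) ^+ 2 <= 1.
  by rewrite expr_le1 ?divr_ge0 ?(ltW d0) ?(ltW sd)// ler_pdivrMr// mul1r lerDr.
apply/andP; split; first by rewrite divr_ge0 ?(ltW td)// mulr_ge0// sqr_ge0.
have h2 : (t - s) ^+ 2 * (d / (s + d)) ^+ 2 <= (t - s) ^+ 2 by rewrite ler_piMr// sqr_ge0.
have h3 : (t + d)^-1 <= d^-1 by rewrite lef_pV2 ?posrE// lerDr.
by rewrite ler_pM// ?invr_ge0 ?(ltW td)// mulr_ge0// sqr_ge0.
Qed.

(** A quadratic remainder valid for all [s] and [t] gives the derivative everywhere at once,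
    including [0], where the two formulas meet. *)
Lemma beta_taylor s t : `|beta d t - beta d s - (t - s) * dbeta d s| <= (t - s) ^+ 2 / d.
Proof.
have di : 0 <= d^-1 by rewrite invr_ge0 ltW.
have [s0|s0] := leP 0 s; last first.
  rewrite (beta_le0 (ltW s0)) dbeta_le0 ?(ltW s0)// mulr0 !subr0 ger0_norm ?beta_ge0//.
  have [t0|t0] := ltP 0 t; last by rewrite beta_le0// divr_ge0 ?sqr_ge0 ?(ltW d0).
  rewrite (le_trans (beta_sqr t))// ler_wpM2r// !expr2 ler_pM// ?(ltW t0)// lerBrDr gerDl ltW//.
have [t0|t0] := leP 0 t.
  by have /andP[h1 h2] := beta_taylor_pos s0 t0; rewrite ger0_norm.
have /andP[h1 h2] := beta_taylor_pos s0 (lexx 0).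
rewrite beta_le0 ?(ltW t0)//; rewrite beta_le0// in h1 h2.
have D0 := dbeta_ge0 s.
have D1 : dbeta d s <= 2 * s / d.
  rewrite dbeta_pos//; have sd : 0 < s + d by rewrite ltr_wpDl.
  rewrite -subr_ge0 (_ : _ - _ = s * (2 * s ^+ 2 + 3 * s * d) / (d * (s + d) ^+ 2)).
    have := ltW d0 => dd; rewrite divr_ge0 ?mulr_ge0 ?addr_ge0 ?mulr_ge0 ?sqr_ge0//.
  by field; rewrite !lt0r_neq0.
have X : 0 <= (- t) * dbeta d s by rewrite mulr_ge0// oppr_ge0 ltW.
have X2 : (- t) * dbeta d s <= (- t) * (2 * s / d) by rewrite ler_wpM2l// oppr_ge0 ltW.
have E : (t - s) ^+ 2 / d = (0 - s) ^+ 2 / d + (- t) * (2 * s / d) + t ^+ 2 / d by ring.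
have T2 : 0 <= t ^+ 2 / d by rewrite mulr_ge0 ?sqr_ge0.
rewrite ger0_norm; lra.
Qed.

Lemma is_derive_beta (s : R) : is_derive s 1 (beta d) (dbeta d s).
Proof.
apply/is_derive_epsP => e e0; exists (e * d); first exact: mulr_gt0.
move=> h h0 hd; rewrite -[h *: 1]/(h * 1) mulr1.
have := beta_taylor s (h + s); rewrite addrK => /le_trans; apply.
rewrite ler_pdivrMr// -real_normK ?num_real// expr2 mulrAC ler_wpM2r// ltW//.
Qed.

End truncation.

Section competitors.
Context {R : realType} {N : nat}.
Notation V := 'rV[R]_N.
Notation mu := (lebesgue_rV N).
Implicit Types (Om : set V) (f g phi psi : V -> R).

(** The class in which the quotient is minimised. It is larger than that of the test functions
    because the truncations are only [C^1]. *)
Definition C1c Om f := Ck setT 1 f /\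
  exists2 K : set V, compact K & K `<=` Om /\ forall x, ~ K x -> f x = 0.

Lemma C1cZ Om k f : C1c Om f -> C1c Om (fun x => k * f x).
Proof.
move=> [cf [K cK [KO fK]]]; split; first exact: (Ck_scl _ openT).
by exists K => //; split => // x /fK ->; rewrite mulr0.
Qed.

Lemma C1c_supp Om (r : R) f : (forall x, Om x -> `|x| <= r) -> C1c Om f -> forall x, r < `|x| -> f x = 0.
Proof.
move=> Hr [_ [K _ [KO fK]]] x xr; apply: fK => /KO/Hr; by rewrite leNgt xr.
Qed.

Lemma energy_le phi psi : Ck setT 1 phi -> bsupp phi -> Ck setT 1 psi -> bsupp psi ->
  (forall i x, partial i phi x ^+ 2 <= partial i psi x ^+ 2) -> energy phi <= energy psi.
Proof.
move=> c1 b1 c2 b2 H; have [L1a _] := energyE c1 b1; have [L1b _] := energyE c2 b2.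
by apply: le_Int => // x; apply: ler_sum => i _; exact: H.
Qed.

Lemma energyZ k phi : Ck setT 1 phi -> bsupp phi -> energy (fun x => k * phi x) = k ^+ 2 * energy phi.
Proof.
move=> c b; have [L _] := energyE c b.
rewrite /energy -IntZ//; apply: Int_ext => x; rewrite mulr_sumr; apply: eq_bigr => i _.
rewrite partial_scl; first by rewrite exprMn.
by move=> y; exact: Ck_derivable c _.
Qed.

Lemma sum_lin3 (I : finType) (a b c d : I -> R) (k l : R) :
  (forall i, a i = b i - k * c i + l * d i) ->
  \sum_i a i = \sum_i b i - k * \sum_i c i + l * \sum_i d i.
Proof. by move=> E; rewrite (eq_bigr _ (fun i _ => E i)) big_split/= sumrB -!mulr_sumr. Qed.

(** In the cross term both derivatives are moved to [psi], so that it passes to the limit along a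
    sequence of functions [phi] whose gradients are not known to converge. *)
Lemma energy_add phi psi (t : R) : Ck setT 1 phi -> bsupp phi -> Ck setT 2 psi -> bsupp psi ->
  energy (fun x => phi x + t * psi x) =
  energy phi - 2 * t * Int (fun x => phi x * laplacian psi x) + t ^+ 2 * energy psi.
Proof.
move=> c1 b1 c2 b2; have c2' := CkS c2.
have ct : Ck setT 1 (fun x => t * psi x) by exact: (Ck_scl _ openT).
have cs : Ck setT 1 (fun x => phi x + t * psi x) by exact: (Ck_add openT).
have bs : bsupp (fun x => phi x + t * psi x).
  have [r1 h1] := b1; have [r2 h2] := b2; exists (Num.max r1 r2) => x.
  by rewrite gt_max => /andP[/h1 -> /h2 ->]; rewrite mulr0 addr0.
have Lc i : L1 (fun x => partial i psi x * partial i phi x).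
  apply: L1_C0; last by apply: bsupp_mulr; exact: bsupp_partial.
  by move=> x; apply: (@continuousM _ _ (partial i psi)); exact: C0_partial.
have cii i : continuous (partial i (partial i psi)).
  by apply: CkT_cont; apply: (Ck_partial (k := 0)); exact: (Ck_partial (k := 1)).
have Ll i : L1 (fun x => phi x * partial i (partial i psi) x).
  apply: L1_C0; last exact: bsupp_mull.
  by move=> x; apply: (@continuousM _ _ phi); [exact: CkT_cont c1 x|exact: cii].
have E i : Int (fun x => partial i (fun x => phi x + t * psi x) x ^+ 2) =
    Int (fun x => partial i phi x ^+ 2) - 2 * t * Int (fun x => phi x * partial i (partial i psi) x)
    + t ^+ 2 * Int (fun x => partial i psi x ^+ 2).
  have -> : Int (fun x => phi x * partial i (partial i psi) x) = - Int (fun x => partial i psi x * partial i phi x).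
    by rewrite -(IBP i (Ck_partial (k := 1) i c2) c1 b1); apply: Int_ext => x; rewrite mulrC.
  have A := @L1_partial_sqr _ _ phi i c1 b1; have B := @L1_partial_sqr _ _ psi i c2' b2.
  rewrite mulrN opprK -(IntZ _ (Lc i)) -(IntZ _ B) -(IntD A (L1Z _ (Lc i))) -(IntD (L1D A (L1Z _ (Lc i))) (L1Z _ B)).
  apply: Int_ext => x.
  have -> : partial i (fun x => phi x + t * psi x) x = partial i phi x + t * partial i psi x.
    apply: is_derive_partial; apply: is_derive_add; first by apply: derivable_partial; exact: Ck_derivable c1 _.
    by apply: is_derive_scl; apply: derivable_partial; exact: Ck_derivable c2' _.
  by move: (partial i phi x) (partial i psi x) => a b; ring.
have S : Int (fun x => phi x * laplacian psi x) = \sum_i Int (fun x => phi x * partial i (partial i psi) x).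
  by apply: etrans (Int_sum _ Ll); apply: Int_ext => x; rewrite /laplacian mulr_sumr.
rewrite (energyE cs bs).2 (energyE c1 b1).2 (energyE c2' b2).2 S.
exact: sum_lin3 E.
Qed.

End competitors.

(** * Inequalities for real powers *)

Section powR_inequalities.
Context {R : realType}.

(** Young's inequality for [y^th] and [1] with exponents [1 / th] and [1 / (1 - th)]. *)
Lemma powR_bernoulli (y th : R) : 0 <= y -> 0 < th -> th < 1 -> y `^ th <= 1 + th * (y - 1).
Proof.
move=> y0 t0 t1.
have q0 : 0 < (1 - th)^-1 by rewrite invr_gt0 subr_gt0.
have := @conjugate_powR R (y `^ th) 1 th^-1 (1 - th)^-1 (powR_ge0 _ _) ler01.
rewrite invr_gt0 => /(_ t0 q0); rewrite !invrK addrC subrK => /(_ erefl).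
rewrite mulr1 powR1 -powRrM mulfV ?lt0r_neq0// powRr1//; lra.
Qed.

(** The previous bound for [1 / (1 + X)] is inverted, and [(1 - w)^-1 >= 1 + w]. *)
Lemma powR_bernoulli_lower (X th : R) : 0 < 1 + X -> 0 < th -> th < 1 ->
  1 + th * X / (1 + X) <= (1 + X) `^ th.
Proof.
move=> X0 t0 t1.
have X1 : 0 <= (1 + X)^-1 by rewrite invr_ge0 ltW.
have := @powR_bernoulli (1 + X)^-1 th X1 t0 t1.
have P : 0 < (1 + X) `^ th by exact: powR_gt0.
have -> : (1 + X)^-1 `^ th = ((1 + X) `^ th)^-1.
  apply: (mulIf (lt0r_neq0 P)).
  by rewrite -powRM ?(ltW X0)// !mulVf ?lt0r_neq0// powR1.
set w := th * X / (1 + X).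
have -> : 1 + th * ((1 + X)^-1 - 1) = 1 - w by rewrite /w; field; rewrite lt0r_neq0.
move=> h; have w1 : 0 < 1 - w by apply: lt_le_trans h; rewrite invr_gt0.
have : (1 - w)^-1 <= (1 + X) `^ th by rewrite -[leRHS]invrK lef_pV2 ?posrE ?invr_gt0.
move=> H; apply: le_trans H; rewrite -[leRHS]div1r ler_pdivlMr// -subr_ge0.
rewrite (_ : _ - _ = w ^+ 2) ?sqr_ge0//; ring.
Qed.

(** Convexity of [s^q], deduced from Bernoulli's inequality with exponent [1 / q] at [(t / s)^q]. *)
Lemma powR_tangent (s t q : R) : 0 <= s -> 0 <= t -> 1 < q ->
  s `^ q + q * s `^ (q - 1) * (t - s) <= t `^ q.
Proof.
move=> s0 t0 q1; have q0 : 0 < q by exact: lt_trans q1.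
have q10 : 0 < q - 1 by rewrite subr_gt0.
have [->|sn] := eqVneq s 0.
  by rewrite !powR0 ?lt0r_neq0// mulr0 mul0r addr0 powR_ge0.
have sp : 0 < s by rewrite lt0r sn.
have := @powR_bernoulli ((t / s) `^ q) q^-1 (powR_ge0 _ _).
rewrite invr_gt0 invf_lt1// => /(_ q0 q1).
rewrite -powRrM mulfV ?lt0r_neq0// powRr1 ?divr_ge0// => h.
have sq : s `^ q = s * s `^ (q - 1).
  by rewrite -{2}[s]powRr1// -powRD ?sn ?implybT// addrC subrK.
have tq : t `^ q = s `^ q * (t / s) `^ q.
  by rewrite -powRM ?divr_ge0// mulrC divfK.
have h2 : q * (t / s - 1) + 1 <= (t / s) `^ q.
  have : q * (t / s) <= q * (1 + q^-1 * ((t / s) `^ q - 1)) by rewrite ler_wpM2l// ltW.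
  have -> : q * (1 + q^-1 * ((t / s) `^ q - 1)) = q + (t / s) `^ q - 1.
    by move: (_ `^ q) => w; field; rewrite lt0r_neq0.
  lra.
rewrite tq; apply: le_trans (ler_wpM2l (powR_ge0 s q) h2).
have -> : s `^ q * (q * (t / s - 1) + 1) = s `^ q + q * s `^ (q - 1) * (t - s); last exact: lexx.
by rewrite sq; move: (s `^ _) => w; field.
Qed.

Lemma small_poly_le (x y c1 c2 t0 : R) : 0 < t0 ->
  (forall t, 0 < t -> t < t0 -> x <= y + c1 * t + c2 * t ^+ 2) -> x <= y.
Proof.
move=> t00 H; apply/ler_addgt0Pr => e e0.
set c := `|c1| + `|c2| + 1.
have c0 : 0 < c by rewrite /c ltr_wpDl// addr_ge0.
pose t := Num.min (t0 / 2) (Num.min 1 (e / c)).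
have t1 : t <= 1 by rewrite /t !ge_min lexx orbT.
have t2 : t <= e / c by rewrite /t !ge_min lexx !orbT.
have tp : 0 < t by rewrite /t !lt_min ltr01 !divr_gt0.
have tt : t < t0.
  by rewrite (@le_lt_trans _ _ (t0 / 2))// ?ge_min ?lexx// ltr_pdivrMr// ltr_pMr// ltr1n.
apply: (le_trans (H t tp tt)); rewrite -addrA lerD2l.
have h1 : c1 * t <= `|c1| * t by rewrite ler_wpM2r ?(ltW tp)// ler_norm.
have h2 : c2 * t ^+ 2 <= `|c2| * t.
  apply: (@le_trans _ _ (`|c2| * t ^+ 2)); first by rewrite ler_wpM2r ?sqr_ge0// ler_norm.
  by rewrite ler_wpM2l// expr2 ler_piMr ?(ltW tp).
have h3 : c * t <= e by rewrite mulrC -ler_pdivlMr.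
have : c * t = `|c1| * t + `|c2| * t + t by rewrite /c; ring.
lra.
Qed.

End powR_inequalities.

Section even_truncation.
Context {R : realType}.
Variable d : R.
Hypothesis d0 : 0 < d.

(** Equals [beta d] of the absolute value, but is written without it so that differentiability at
    [0] needs no separate argument. *)
Definition beta_abs (d s : R) : R := beta d s + beta d (- s).
Definition dbeta_abs (d s : R) : R := dbeta d s - dbeta d (- s).

Lemma is_derive_beta_abs (s : R) : is_derive s 1 (beta_abs d) (dbeta_abs d s).
Proof.
have E : (fun y : R => beta d (-1 *: y + 0)) = (fun y => beta d (- y)).
  by apply: funext => y; rewrite scaleN1r addr0.
have D : is_derive s 1 (fun y : R => beta d (-1 *: y + 0)) (-1 * dbeta d (- s)).
  by apply: is_derive_affine; rewrite scaleN1r addr0; exact: is_derive_beta.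
by rewrite E mulN1r in D; exact: is_derive_add (is_derive_beta d0 s) D.
Qed.

Lemma continuous_dbeta_abs : continuous (dbeta_abs d).
Proof.
move=> s; apply: (@continuousB _ _ _ (dbeta d) (fun s => dbeta d (- s))); first exact: continuous_dbeta.
apply: (@continuous_comp _ _ _ (fun s : R => - s) (dbeta d)); last exact: continuous_dbeta.
exact: opp_continuous.
Qed.

Lemma beta_absE s : beta_abs d s = beta d `|s|.
Proof.
rewrite /beta_abs; have [s0|s0] := leP 0 s.
  by rewrite ger0_norm// [X in _ + X]beta_le0 ?addr0// oppr_le0.
by rewrite ltr0_norm// beta_le0 ?add0r// ltW.
Qed.

Lemma dbeta_abs_sqr s : dbeta_abs d s ^+ 2 <= 1.
Proof.
have h (x : R) : 0 <= x -> x <= 1 -> x ^+ 2 <= 1 by move=> x0 x1; rewrite expr_le1.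
rewrite /dbeta_abs; have [s0|s0] := leP 0 s.
  by rewrite [X in _ - X]dbeta_le0 ?oppr_le0// subr0 h ?dbeta_ge0 ?dbeta_le1.
by rewrite dbeta_le0 ?(ltW s0)// sub0r sqrrN h ?dbeta_ge0 ?dbeta_le1.
Qed.

End even_truncation.

(** * Existence of a minimizer *)

Section ground_state.
Context {R : realType} {M : nat}.
Local Notation N := M.+2.
Notation V := 'rV[R]_N.
Notation mu := (lebesgue_rV N).
Variables (Om : set V) (r0 q : R) (x0 : V).
Hypotheses (openOm : open Om) (Om_r0 : forall x, Om x -> `|x| <= r0) (Om_x0 : Om x0).
Hypotheses (q2 : 2 < q) (subcritical : M%:R * (q - 2) < 4).

Let q0 : 0 < q. Proof. exact: lt_trans q2. Qed.
Let q1 : 1 < q. Proof. by apply: lt_trans q2; rewrite ltr1n. Qed.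
Let r00 : 0 <= r0. Proof. exact: le_trans (Om_r0 Om_x0). Qed.

Local Notation nrm f := (Int (fun x : V => `|f x| `^ q)).

Lemma C1c_bsupp f : C1c Om f -> bsupp f.
Proof. by move=> cf; exists r0; exact: C1c_supp cf. Qed.

Lemma C1c_L1 f : C1c Om f -> L1 f.
Proof. by move=> cf; apply: L1_C0 (CkT_cont cf.1) (C1c_bsupp cf). Qed.

Lemma C1c_L1q f e : 0 < e -> C1c Om f -> L1 (fun x => `|f x| `^ e).
Proof. by move=> e0 cf; apply: L1_powR_C0 => //; [exact: CkT_cont cf.1|exact: C1c_bsupp]. Qed.

Lemma C1c_comp (b b' : R -> R) f : (forall s : R, is_derive s 1 b (b' s)) -> continuous b' ->
  b 0 = 0 -> (forall s, b' s ^+ 2 <= 1) -> C1c Om f ->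
  C1c Om (fun x => b (f x)) /\ energy (fun x => b (f x)) <= energy f.
Proof.
move=> Db cb b0 b1 cf; have [cbf E] := C1_comp openT Db cb cf.1.
have cB : C1c Om (fun x => b (f x)).
  by split => //; have [_ [K cK [KO fK]]] := cf; exists K => //; split => // x /fK ->.
split; first exact: cB.
apply: (energy_le cB.1 (C1c_bsupp cB) cf.1 (C1c_bsupp cf)).
by move=> i x; rewrite E// exprMn ler_piMl ?sqr_ge0.
Qed.

Lemma compact_ball (y : V) (e : R) : compact [set z : V | `|z - y| <= e].
Proof.
rewrite (_ : [set z | _] = (fun z => z + y) @` [set z | `|z| <= e]).
  apply: continuous_compact; last exact: compact_cball.
  by apply: continuous_subspaceT => z; apply: continuousD; [exact: cvg_id|exact: cst_continuous].
apply/seteqP; split=> z /=; first by move=> zy; exists (z - y) => //; rewrite subrK.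
by move=> [w /= we <-]; rewrite addrK.
Qed.

Lemma exists_C1c : exists2 f, C1c Om f & 0 < nrm f.
Proof.
have /nbhs_ballP[e /= e0 He] : nbhs x0 Om by exact: open_nbhs_nbhs.
pose s := 2 / e; have s0 : 0 < s by rewrite divr_gt0.
have kr := @kernel_rho R N.
have Cm : C1c Om (moved rho s x0).
  split; first exact: (moved_Cinfty s x0 kr 1%N).
  exists [set z | `|z - x0| <= e / 2]; first exact: compact_ball.
  split.
    move=> z /= h; apply: He; rewrite mx_norm_ball /ball_/= distrC (le_lt_trans h)//.
    by rewrite ltr_pdivrMr// ltr_pMr// ltr1n.
  move=> z /= /negP; rewrite -ltNge => h; apply: (moved_supp kr).
  by rewrite gtr0_norm// distrC -ltr_pdivrMl// mulr1 /s invf_div.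
exists (moved rho s x0) => //.
rewrite lt_neqAle Int_ge0 ?andbT; last by move=> x; exact: powR_ge0.
apply/negP => /eqP I0.
have ae0 := Int_eq0_ae (C1c_L1q q0 Cm) (fun x => powR_ge0 _ _) (esym I0).
have [_ IE] := Int_moved x0 s0 (kernel_L1 kr).
have : Int (moved rho s x0) = Int (fun _ : V => 0).
  apply: Int_ae; [exact: C1c_L1|exact: L1_0|].
  apply: filterS ae0 => x; move/eqP; rewrite powR_eq0 => /andP[/eqP h _].
  by apply/eqP; rewrite -normr_eq0 h.
rewrite Int0 /moved IE => /eqP; rewrite mulf_eq0 invr_eq0 expf_eq0/= gt_eqF//=.
by rewrite gt_eqF// rho_mass_gt0.
Qed.

Lemma nrmZ k f : C1c Om f -> nrm (fun x => k * f x) = `|k| `^ q * nrm f.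
Proof.
move=> cf; rewrite -IntZ; last exact: C1c_L1q.
by apply: Int_ext => x; rewrite normrM powRM.
Qed.

Lemma normalize f : C1c Om f -> 0 < nrm f ->
  nrm (fun x => (nrm f `^ q^-1)^-1 * f x) = 1.
Proof.
move=> cf n0; rewrite nrmZ// ger0_norm ?invr_ge0 ?powR_ge0//.
have P : 0 < nrm f `^ q^-1 by exact: powR_gt0.
have {2}-> : nrm f = (nrm f `^ q^-1) `^ q by rewrite -powRrM mulVf ?lt0r_neq0// powRr1// ltW.
by rewrite -powRM ?invr_ge0 ?(ltW P)// mulVf ?lt0r_neq0// powR1.
Qed.

(** The infimum of the Sobolev quotient over [C1c] functions; [rayleigh_inf] identifies it with the
    one over H^1_0. *)
Definition sobolev_inf : R := inf [set energy f | f in [set f | C1c Om f /\ nrm f = 1]].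
Local Notation I := sobolev_inf.

Lemma has_inf_energy : has_inf [set energy f | f in [set f | C1c Om f /\ nrm f = 1]].
Proof.
split; last by exists 0 => _ [f _ <-]; exact: energy_ge0.
have [f cf nf] := exists_C1c.
by eexists; exists (fun x => (nrm f `^ q^-1)^-1 * f x) => //; split; [exact: C1cZ|exact: normalize].
Qed.

Lemma sobolev_ineq f : C1c Om f -> I * nrm f `^ (2 / q) <= energy f.
Proof.
move=> cf; have n0 : 0 <= nrm f by apply: Int_ge0 => x; exact: powR_ge0.
have [E|nn] := eqVneq (nrm f) 0.
  by rewrite E powR0 ?mulr0 ?energy_ge0// lt0r_neq0// divr_gt0.
have np : 0 < nrm f by rewrite lt0r nn.
have P : 0 < nrm f `^ q^-1 by exact: powR_gt0.
have : I <= energy (fun x => (nrm f `^ q^-1)^-1 * f x).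
  apply: ge_inf; first exact: has_inf_energy.2.
  by exists (fun x => (nrm f `^ q^-1)^-1 * f x) => //; split; [exact: C1cZ|exact: normalize].
rewrite energyZ; [|exact: cf.1|exact: C1c_bsupp].
have -> : nrm f `^ (2 / q) = (nrm f `^ q^-1) ^+ 2 by rewrite -powR_mulrn ?powR_ge0// -powRrM [_ * 2]mulrC.
by rewrite exprVn mulrC -ler_pdivlMr ?exprn_gt0.
Qed.

Lemma sobolev_near e : 0 < e -> exists f, [/\ C1c Om f, nrm f = 1 & energy f <= I + e].
Proof.
move=> e0; have [_ [f [cf nf] <-] /ltW h] := inf_adherent e0 has_inf_energy.
by exists f.
Qed.

(** The absolute value of [f] is replaced by [beta_abs d f] to stay in [C1c]; this lowers the norm
    slightly, hence the window from [1 - e] to [1]. *)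
Lemma sobolev_near_ge0 e : 0 < e -> exists f, [/\ C1c Om f, forall x, 0 <= f x,
  nrm f <= 1, 1 - e <= nrm f & energy f <= I + e].
Proof.
move=> e0; have [f [cf nf Ef]] := sobolev_near e0.
pose d n : R := 2^-1 ^+ n.
have d0 n : 0 < d n by rewrite exprn_gt0// invr_gt0.
have T n := C1c_comp (is_derive_beta_abs (d0 n)) (continuous_dbeta_abs (d0 n))
  (etrans (beta_absE (d n) 0) (beta_le0 (d n) (eq_ind_r (fun x => x <= 0) (lexx 0) (normr0 R)))) (dbeta_abs_sqr (d0 n)) cf.
have bl n x : `|beta_abs (d n) (f x)| <= `|f x|.
  by rewrite beta_absE ger0_norm ?beta_ge0// beta_le.
have Lf := C1c_L1q q0 cf.
have [|||||_ cv] := @Int_dct _ _ (fun n x => `|beta_abs (d n) (f x)| `^ q) (fun x => `|f x| `^ q) (fun x => `|f x| `^ q).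
- by move=> n; exact: L1_meas (C1c_L1q q0 (T n).1).
- exact: L1_meas Lf.
- exact: Lf.
- apply: aeW => x; rewrite -(normr_id (f x)).
  apply: (powR_abs_cvg (u := fun n => beta_abs (d n) (f x)) q0).
  apply/cvgrPdist_le => t t0.
  have : d n @[n --> \oo] --> 0 by apply: cvg_expr; rewrite ger0_norm// invf_lt1// ltr1n.
  move=> /cvgr0_norm_le /(_ _ t0); apply: filterS => n; rewrite ger0_norm ?(ltW (d0 n))//.
  apply: le_trans; rewrite beta_absE ger0_norm; last by rewrite subr_ge0 beta_le.
  by rewrite lerBlDr -lerBlDl; exact: beta_ge.
- apply: aeW => x n; rewrite ger0_norm ?powR_ge0//.
  by rewrite ge0_ler_powR ?nnegrE ?(ltW q0).
have {cv} : \forall n \near \oo, `|nrm f - nrm (fun x => beta_abs (d n) (f x))| <= e.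
  by move/cvgrPdist_le : cv; apply.
move=> [n _ /(_ n (leqnn n))/= h].
exists (fun x => beta_abs (d n) (f x)); split.
- exact: (T n).1.
- by move=> x; rewrite beta_absE beta_ge0.
- rewrite -nf; apply: le_Int => //; first exact: C1c_L1q (T n).1.
  by move=> x; rewrite ge0_ler_powR ?nnegrE ?(ltW q0).
- by rewrite -nf; move: h; rewrite ler_norml => /andP[_]; lra.
- exact: le_trans (T n).2 Ef.
Qed.

(** The limit [u] is recorded through almost everywhere convergence and the majorant [H] only; no
    gradient of [u] is involved. *)
Definition minimizing (phi : nat -> V -> R) (u H : V -> R) :=
  [/\ forall k, [/\ C1c Om (phi k), forall x, 0 <= phi k x & energy (phi k) <= I + 2^-1 ^+ k],
      nrm (phi k) @[k --> \oo] --> (1 : R),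
      [/\ measurable_fun setT u, forall x, 0 <= u x & forall x, ~ Om x -> u x = 0],
      L1 H /\ {ae mu, forall x, forall k, `|phi k x| `^ q <= H x} &
      {ae mu, forall x, phi k x @[k --> \oo] --> u x}].

Lemma exists_minimizing : exists phi u H, minimizing phi u H.
Proof.
have pos k : 0 < 2^-1 ^+ k :> R by rewrite exprn_gt0// invr_gt0.
have /choice[phi Hphi] : forall k : nat, exists f, [/\ C1c Om f, forall x, 0 <= f x,
  nrm f <= 1, 1 - 2^-1 ^+ k <= nrm f & energy f <= I + 2^-1 ^+ k].
  by move=> k; exact: sobolev_near_ge0.
have [|||sg [u [H [sgS mu_ LH cu Hu]]]] := @energy_compact R M q q2 subcritical phi r0 (I + 1) r00.
- by move=> k; have [[]] := Hphi k.
- by move=> k x; have [cf _ _ _ _] := Hphi k; exact: C1c_supp cf x.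
- move=> k; have [_ _ _ _ /le_trans] := Hphi k; apply; rewrite lerD2l.
  by rewrite exprn_ile1 ?invr_ge0// invf_le1// ler1n.
have sgk k : (k <= sg k)%N by elim: k => // k IH; exact: leq_ltn_trans IH (sgS k).
have le2 k : 2^-1 ^+ sg k <= 2^-1 ^+ k :> R.
  by rewrite ler_wiXn2l// ?invr_ge0// invf_le1// ler1n.
(* A modification on a null set: the convergent values are already nonnegative and vanish off [Om],
   and now this holds at every point. *)
pose u' x := \1_Om x * Num.max (u x) 0.
exists (fun k => phi (sg k)), u', H; split => //.
- move=> k; have [cf f0 _ _ Ef] := Hphi (sg k); split => //.
  by rewrite (le_trans Ef)// lerD2l.
- apply/cvgrPdist_le => e e0.
  have : 2^-1 ^+ n @[n --> \oo] --> (0 : R) by apply: cvg_expr; rewrite ger0_norm// invf_lt1// ltr1n.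
  move=> /cvgr0_norm_le /(_ _ e0); apply: filterS => n; rewrite ger0_norm ?(ltW (pos n))//.
  have [_ _ n1 n2 _] := Hphi (sg n); apply: le_trans; rewrite ger0_norm ?subr_ge0//.
  by have := le2 n; lra.
- split.
  + apply: (@measurable_funM _ _ _ _ (\1_Om : V -> R)); first by apply: measurable_indic; exact: open_measurable_rV.
    by apply: measurable_maxr => //; exact: measurable_cst.
  + by move=> x; rewrite mulr_ge0// ?le_max ?lexx ?orbT// indicE.
  + by move=> x nx; rewrite /u' indicE memNset// mul0r.
- apply: filterS cu => x cx.
  have [Ox|nOx] := pselect (Om x).
    rewrite /u' indicE mem_set// mul1r max_l//.
    by apply: (ler_cvg_to (@cvg_cst _ (0 : R) _ _ _) cx); apply: nearW => k; have [_ p0 _ _ _] := Hphi (sg k).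
  rewrite /u' indicE memNset// mul0r.
  apply: (@cvg_trans _ ((fun=> 0) @ \oo)); last exact: cvg_cst.
  apply: near_eq_cvg; apply: nearW => k.
  by have [[_ [K _ [KO ->]]]] := Hphi (sg k) => // /KO.
Qed.

Lemma powR_le1D (s e : R) : 0 <= s -> 0 < e -> e <= q -> s `^ e <= 1 + s `^ q.
Proof.
move=> s0 e0 eq; have [s1|s1] := leP s 1.
  have h : s `^ e <= 1 `^ e by rewrite ge0_ler_powR ?nnegrE// ltW.
  by rewrite powR1 in h; rewrite (le_trans h)// lerDl powR_ge0.
by rewrite (le_trans (ler_powR (ltW s1) eq))// lerDr.
Qed.

Section Euler_Lagrange.
Variables (phi : nat -> V -> R) (u H : V -> R).
Hypothesis min_u : minimizing phi u H.

(** One majorant for all exponents [0 < e <= q]: [s^e <= 1 + s^q], and the functions vanish outside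
    the box. *)
Let G x := \1_(@box R N r0) x + H x.

Let LG : L1 G.
Proof. by have [_ _ _ [LH _] _] := min_u; apply: L1D => //; exact: L1_indic_box. Qed.

Let G_ge e : 0 < e -> e <= q -> {ae mu, forall x, forall k, `|phi k x| `^ e <= G x}.
Proof.
have [Hp _ _ [_ aH] _] := min_u; move=> e0 eq; apply: filterS aH => x Hx k.
have [xr|xr] := leP `|x| r0.
  rewrite /G indicE mem_set; last by move=> i; exact: le_trans (rV_coord_le _ _) xr.
  by rewrite (le_trans (powR_le1D _ e0 eq))// lerD2l.
have [cf _ _] := Hp k; rewrite (C1c_supp Om_r0 cf xr) normr0 powR0 ?lt0r_neq0//.
by rewrite addr_ge0// ?indicE// (le_trans _ (Hx 0%N)) ?powR_ge0.
Qed.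

Lemma minimizing_cvg (e C : R) (h : V -> R) : 0 < e -> e <= q -> measurable_fun setT h ->
  (forall x, `|h x| <= C) ->
  L1 (fun x => u x `^ e * h x) /\
  Int (fun x => `|phi k x| `^ e * h x) @[k --> \oo] --> Int (fun x => u x `^ e * h x).
Proof.
have [Hp _ [mu_ u0 _] _ cu] := min_u => e0 eq mh hC.
apply: (Int_dct (g := fun x => C * G x)).
- move=> k; apply: measurable_funM => //; apply: measurable_powR_abs.
  by have [cf _ _] := Hp k; exact: L1_meas (C1c_L1 cf).
- apply: measurable_funM => //.
  by apply: (@measurableT_comp _ _ _ _ _ _ (@powR R ^~ e)) => //; exact: measurable_powR.
- exact: L1Z.
- apply: filterS cu => x cx; apply: (@cvgM _ _ _ _ (fun k => `|phi k x| `^ e) (fun=> h x)); last exact: cvg_cst.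
  by rewrite -[u x]ger0_norm//; exact: powR_abs_cvg.
- apply: filterS (G_ge e0 eq) => x Gx k.
  by rewrite normrM ger0_norm ?powR_ge0// mulrC ler_pM// powR_ge0.
Qed.

Lemma minimizer_norm : L1 (fun x => u x `^ q) /\ Int (fun x => u x `^ q) = 1.
Proof.
have [_ n1 _ _ _] := min_u.
have [|L cv] := @minimizing_cvg q 1 (fun=> 1) q0 (lexx q) (measurable_cst _).
  by move=> x; rewrite normr1.
have E (f : V -> R) : (fun x => f x * 1) = f by apply/funext => x; rewrite mulr1.
rewrite E in L cv; split => //.
have cv' : nrm (phi k) @[k --> \oo] --> Int (fun x => u x `^ q).
  by apply: cvg_trans cv; apply: near_eq_cvg; apply: nearW => k; rewrite E.
by rewrite -(cvg_lim _ cv')// (cvg_lim _ n1).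
Qed.

(** If the infimum were [0], the Poincare inequality along the sequence and Fatou's lemma would give
    [u = 0] almost everywhere, against the norm [1] of [u]. *)
Lemma sobolev_inf_gt0 : 0 < I.
Proof.
have I0 : 0 <= I.
  by apply: lb_le_inf; [exact: has_inf_energy.1|move=> _ [f _ <-]; exact: energy_ge0].
rewrite lt_neqAle I0 andbT; apply/negP => /eqP I00.
have [Hp _ [mu_ u0 _] _ cu] := min_u.
have [Lu I1] := minimizer_norm.
have Fat m : L1 (fun x => u x ^+ 2) /\ Int (fun x => u x ^+ 2) <= (2 * r0 + 1) ^+ 2 * 2^-1 ^+ m.
  apply: (Int_fatou (f_ := fun k x => phi (m + k)%N x ^+ 2)).
  - by move=> k; have [cf _ _] := Hp (m + k)%N; apply: L1_sqr; [exact: CkT_cont cf.1|exact: C1c_bsupp].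
  - by move=> k x; exact: sqr_ge0.
  - exact: measurable_funM.
  - by move=> x; exact: sqr_ge0.
  - apply: filterS cu => x cx.
    have cx' : phi (m + k)%N x @[k --> \oo] --> u x.
      have -> : (fun k => phi (m + k)%N x) = [sequence phi (k + m)%N x]_k by apply/funext => k; rewrite addnC.
      by rewrite (cvg_shiftn m (phi ^~ x)).
    exact: (cvgM cx' cx').
  - move=> k; have [cf _ Ef] := Hp (m + k)%N.
    apply: (le_trans (poincare (ltn0Sn _) cf.1 r00 (C1c_supp Om_r0 cf))).
    rewrite ler_wpM2l ?sqr_ge0// (le_trans Ef)// -I00 add0r.
    by rewrite ler_wiXn2l ?leq_addr// ?invr_ge0// invf_le1// ler1n.
have Z : Int (fun x => u x ^+ 2) = 0.
  apply/eqP; rewrite eq_le Int_ge0 ?andbT; last by move=> x; exact: sqr_ge0.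
  have c : (2 * r0 + 1) ^+ 2 * 2^-1 ^+ m @[m --> \oo] --> (2 * r0 + 1) ^+ 2 * 0.
    by apply: cvgMr; apply: cvg_expr; rewrite ger0_norm// invf_lt1// ltr1n.
  rewrite mulr0 in c; by apply: (ler_cvg_to (@cvg_cst _ (Int (fun x => u x ^+ 2)) _ _ _) c); apply: nearW => k; exact: (Fat k).2.
have := Int_eq0_ae (Fat 0%N).1 (fun x => sqr_ge0 _) Z => ae0.
have : Int (fun x => u x `^ q) = Int (fun _ : V => 0).
  apply: Int_ae => //; first exact: L1_0.
  by apply: filterS ae0 => x /eqP; rewrite sqrf_eq0 => /eqP ->; rewrite powR0// lt0r_neq0.
by rewrite I1 Int0 => /eqP; rewrite oner_eq0.
Qed.

(** A one-sided first variation carried out on the minimizing sequence. At fixed [t] the Sobolev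
    inequality for the competitors is passed to the limit in [k]; only then does [t] tend to [0].
    Competitors may fall short of [phi k + t psi] by [d], which leaves room for truncations. *)
Lemma Euler_Lagrange (psi : V -> R) : Ck setT 2 psi -> bsupp psi ->
  (forall k (d t : R), 0 < d -> 0 < t -> exists T, [/\ C1c Om T, forall x, 0 <= T x,
     forall x, phi k x + t * psi x - d <= T x & energy T <= energy (fun x => phi k x + t * psi x)]) ->
  I * Int (fun x => u x `^ (q - 1) * psi x) <= - Int (fun x => u x * laplacian psi x).
Proof.
move=> c2 bp comp; have c1 := CkS c2.
have [Hp n1 [mu_ u0 _] _ cu] := min_u.
have q10 : 0 < q - 1 by rewrite subr_gt0.
have q1q : q - 1 <= q by rewrite gerBl.
have [C _ psiC] := C0_bounded (CkT_cont c1) bp.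
have mpsi := continuous_measurable_rV (CkT_cont c1).
have [_ cA] := minimizing_cvg q10 q1q mpsi psiC.
have clap : continuous (laplacian psi).
  have ci i : continuous (partial i (partial i psi)).
    by apply: CkT_cont; apply: (Ck_partial (k := 0)); exact: (Ck_partial (k := 1)).
  by apply: (CkT_cont (k := 0)); apply: (Ck_sum _ openT) => i; split => // x _; exact: ci.
have blap : bsupp (laplacian psi).
  have [r pr] := bp; exists r => x xr; rewrite /laplacian big1// => i _.
  exact: partial_supp (partial_supp i pr) x xr.
have [C' _ lapC] := C0_bounded clap blap.
have [_ cB] := minimizing_cvg ltr01 (ltW q1) (continuous_measurable_rV clap) lapC.
set A := Int (fun x => u x `^ (q - 1) * psi x) in cA *.
have EB : Int (fun x => u x `^ 1 * laplacian psi x) = Int (fun x => u x * laplacian psi x).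
  by apply: Int_ext => x; rewrite powRr1.
rewrite {}EB in cB; set B := Int (fun x => u x * laplacian psi x) in cB *.
have cB' : Int (fun x => phi k x * laplacian psi x) @[k --> \oo] --> B.
  apply: cvg_trans cB; apply: near_eq_cvg; apply: nearW => k.
  by apply: Int_ext => x; have [_ p0 _] := Hp k; rewrite powRr1// ger0_norm.
have Ip := sobolev_inf_gt0.
have key t : 0 < t -> 0 < 1 + q * t * A ->
    I * (1 + q * t * A) `^ (2 / q) <= I - 2 * t * B + t ^+ 2 * energy psi.
  move=> t0 tA.
  pose d k : R := 2^-1 ^+ k.
  have d0 k : 0 < d k by rewrite exprn_gt0// invr_gt0.
  have cd : d k @[k --> \oo] --> (0 : R) by apply: cvg_expr; rewrite ger0_norm// invf_lt1// ltr1n.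
  (* By the tangent inequality at [phi k x], [b k] is a lower bound for the integral of the [q]-th
     power of the competitor; the truncation error [d k] tends to [0] together with [1 / k], and
     [Int G] bounds its coefficient. *)
  pose b k := nrm (phi k) + q * (t * Int (fun x => `|phi k x| `^ (q - 1) * psi x) - d k * Int G).
  have cb : b k @[k --> \oo] --> 1 + q * t * A.
    rewrite (_ : 1 + q * t * A = 1 + q * (t * A - 0 * Int G)); last by rewrite mul0r subr0 mulrA.
    apply: cvgD => //; apply: cvgMr; apply: cvgB; first exact: cvgMr.
    exact: cvgMl.
  have bT k : 0 < b k -> I * `|b k| `^ (2 / q) <= I + d k - 2 * t * Int (fun x => phi k x * laplacian psi x) + t ^+ 2 * energy psi.
    move=> bk; have [T [cT T0 Tge ET]] := comp k (d k) t (d0 k) t0.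
    have [cf p0 Ef] := Hp k; have bf := C1c_bsupp cf.
    have Lq := C1c_L1q q0 cf; have Lq1 := C1c_L1q q10 cf.
    have bn : b k <= nrm T.
      have L1a : L1 (fun x => `|phi k x| `^ (q - 1) * psi x) by exact: L1Mb Lq1 mpsi psiC.
      have LX := L1B (L1Z t L1a) (L1Z (d k) Lq1).
      apply: (@le_trans _ _ (Int (fun x => `|phi k x| `^ q + q * (t * (`|phi k x| `^ (q - 1) * psi x) - d k * `|phi k x| `^ (q - 1))))).
        rewrite (IntD Lq (L1Z q LX)) (IntZ q LX) (IntB (L1Z t L1a) (L1Z (d k) Lq1)) !IntZ// /b.
        rewrite lerD2l ler_wpM2l ?(ltW q0)// lerD2l lerN2 ler_wpM2l ?(ltW (d0 k))//.
        by apply: le_Int_ae => //; apply: filterS (G_ge q10 q1q) => x; exact.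
      apply: le_Int; [exact: L1D Lq (L1Z q LX)|exact: C1c_L1q|move=> x].
      rewrite !ger0_norm//; apply: le_trans (powR_tangent (p0 x) (T0 x) q1).
      rewrite lerD2l -mulrA ler_wpM2l ?(ltW q0)//.
      have P := powR_ge0 (phi k x) (q - 1).
      have -> : t * (phi k x `^ (q - 1) * psi x) - d k * phi k x `^ (q - 1) = phi k x `^ (q - 1) * (t * psi x - d k) by ring.
      by rewrite ler_wpM2l// lerBrDl addrA; exact: Tge.
    have h1 : I * `|b k| `^ (2 / q) <= I * nrm T `^ (2 / q).
      rewrite ler_wpM2l ?(ltW Ip)// gtr0_norm// ge0_ler_powR ?nnegrE ?(ltW bk)//.
        by rewrite divr_ge0// ltW.
      exact: le_trans (ltW bk) bn.
    apply: (le_trans h1); apply: (le_trans (sobolev_ineq cT)); apply: (le_trans ET).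
    rewrite (energy_add t cf.1 bf c2 bp) lerD2r lerD2r.
    exact: Ef.
  have cl : I * `|b k| `^ (2 / q) @[k --> \oo] --> I * `|1 + q * t * A| `^ (2 / q).
    by apply: cvgMr; apply: powR_abs_cvg => //; rewrite divr_gt0.
  have cr : I + d k - 2 * t * Int (fun x => phi k x * laplacian psi x) + t ^+ 2 * energy psi @[k --> \oo] -->
      I + 0 - 2 * t * B + t ^+ 2 * energy psi.
    apply: cvgD; last exact: cvg_cst.
    apply: cvgB; last exact: cvgMr.
    by apply: cvgD => //; exact: cvg_cst.
  rewrite gtr0_norm// in cl; rewrite addr0 in cr.
  apply: (ler_cvg_to cl cr).
  have H1 : \forall k \near \oo, 0 < b k by exact: cvgr_gt cb _ tA.
  by apply: filterS H1 => k; exact: bT.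
have [t0 t00 Ht0] : exists2 t0, 0 < t0 & forall t, 0 < t -> t < t0 -> 0 < 1 + q * t * A.
  have w : 0 < q * `|A| + 1 by rewrite ltr_wpDl// mulr_ge0// ltW.
  exists (q * `|A| + 1)^-1; rewrite ?invr_gt0// => t t0 tt.
  have : t * (q * `|A| + 1) < 1 by move: tt; rewrite -[_^-1]mul1r ltr_pdivlMr.
  have : - (q * t * `|A|) <= q * t * A.
    by rewrite -mulrN ler_wpM2l ?mulr_ge0 ?(ltW q0) ?(ltW t0)// lerNl -normrN ler_norm.
  have -> : t * (q * `|A| + 1) = q * t * `|A| + t by ring.
  lra.
apply: (@small_poly_le _ _ _ (energy psi / 2 - q * A * B) (q * A * energy psi / 2) t0 t00) => t tp tt.
have P := Ht0 t tp tt.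
have th0 : 0 < 2 / q by rewrite divr_gt0.
have th1 : 2 / q < 1 by rewrite ltr_pdivrMr// mul1r.
(* Bernoulli's inequality linearises the power [2 / q]; after division by [2 t], what remains is a
   polynomial error vanishing with [t]. *)
have h := le_trans (ler_wpM2l (ltW Ip) (powR_bernoulli_lower P th0 th1)) (key t tp P).
have {}h : 2 * t * (I * A) / (1 + q * t * A) <= - 2 * t * B + t ^+ 2 * energy psi.
  have E : I * (1 + 2 / q * (q * t * A) / (1 + q * t * A)) = I + 2 * t * (I * A) / (1 + q * t * A).
    by field; rewrite !lt0r_neq0.
  by rewrite E in h; lra.
rewrite ler_pdivrMr// in h.
rewrite -(ler_pM2l (_ : 0 < 2 * t)) ?mulr_gt0//.
apply: (le_trans h); rewrite le_eqVlt; apply/orP; left; apply/eqP; field.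
by [].
Qed.

End Euler_Lagrange.

End ground_state.

(** * Boundedness and weak equation *)

Section boundedness.
Context {R : realType} {M : nat}.
Local Notation N := M.+2.
Notation V := 'rV[R]_N.
Notation mu := (lebesgue_rV N).
Local Notation mass := (@rho_mass R M.+2).

(** Along indices where the integrals are at most [4^-j], the series of [2^j f (m j)] has a finite
    sum almost everywhere, so its terms decay. *)
Lemma ae_subsequence (f : nat -> V -> R) : (forall m, L1 (f m)) -> (forall m x, 0 <= f m x) ->
  Int (f m) @[m --> \oo] --> 0 ->
  exists m : nat -> nat, (forall j, (j <= m j)%N) /\ {ae mu, forall x, f (m j) x @[j --> \oo] --> 0}.
Proof.
move=> Lf f0 cg.
have pos j : 0 < 2^-1 ^+ j :> R by rewrite exprn_gt0// invr_gt0.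
have /choice[m Hm] : forall j : nat, exists m, (j <= m)%N /\ Int (f m) <= 2^-1 ^+ j * 2^-1 ^+ j.
  move=> j; have e0 : 0 < 2^-1 ^+ j * 2^-1 ^+ j :> R by rewrite mulr_gt0.
  move/cvgr0_norm_le : cg => /(_ _ e0)[n _ Hn].
  exists (maxn j n); split; first exact: leq_maxl.
  by rewrite (le_trans (ler_norm _))//; apply: Hn; rewrite /= leq_maxr.
exists m; split; first by move=> j; exact: (Hm j).1.
have [||| S [LS S0 HS]] := @ae_series _ _ (fun j x => 2 ^+ j * f (m j) x).
- by move=> j; exact: L1Z.
- by move=> j x; rewrite mulr_ge0// exprn_ge0.
- move=> j; rewrite IntZ// (le_trans (ler_wpM2l _ (Hm j).2)) ?exprn_ge0//.
  by rewrite mulrA -exprMn divff// expr1n mul1r.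
apply: filterS HS => x Sx; apply/cvgr0Pnorm_le => e e0.
have cS : S x * 2^-1 ^+ n @[n --> \oo] --> 0.
  by rewrite -(mulr0 (S x)); apply: cvgMr; apply: cvg_expr; rewrite ger0_norm// invf_lt1// ltr1n.
move/cvgr0Pnorm_le : cS => /(_ e e0); apply: filterS => j.
apply: le_trans; rewrite ger0_norm// (le_trans _ (ler_norm _))//.
rewrite exprVn ler_pdivlMr ?exprn_gt0// mulrC; apply: le_trans (Sx j.+1).
by rewrite big_ord_recr/= lerDr sumr_ge0// => i _; rewrite mulr_ge0// exprn_ge0.
Qed.

Variables (Om : set V) (r0 q : R) (x0 : V).
Hypotheses (openOm : open Om) (Om_r0 : forall x, Om x -> `|x| <= r0) (Om_x0 : Om x0).
Hypotheses (q2 : 2 < q) (subcritical : M%:R * (q - 2) < 4).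

Let q0 : 0 < q. Proof. exact: lt_trans q2. Qed.
Let q1 : 1 < q. Proof. by apply: lt_trans q2; rewrite ltr1n. Qed.
Let q10 : 0 < q - 1. Proof. by rewrite subr_gt0. Qed.
Let q20 : 0 < q - 2. Proof. by rewrite subr_gt0. Qed.
Let r00 : 0 <= r0. Proof. exact: le_trans (Om_r0 Om_x0). Qed.

(** The weak form of [- Laplacian u <= I u^(q-1)] on the whole space: the support of [psi] may cross
    the boundary of [Om]. This is what gives access to mean values near the boundary. *)
Definition subsolution (I : R) (u : V -> R) := forall psi : V -> R, Ck setT 2 psi -> bsupp psi ->
  (forall x, 0 <= psi x) -> - Int (fun x => u x * laplacian psi x) <= I * Int (fun x => u x `^ (q - 1) * psi x).

Section iteration.
Variables (I : R) (u : V -> R).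
Hypotheses (I0 : 0 < I) (mu_ : measurable_fun setT u) (u0 : forall x, 0 <= u x)
  (uOm : forall x, ~ Om x -> u x = 0) (Lu : L1 (fun x => u x `^ q)) (Iu : Int (fun x => u x `^ q) = 1)
  (sub : subsolution I u).

Let ur0 x : r0 < `|x| -> u x = 0.
Proof. by move=> xr; apply: uOm => /Om_r0; rewrite leNgt xr. Qed.

Lemma L1_lower_power e : 0 < e -> e <= q -> L1 (fun x => u x `^ e).
Proof.
move=> e0 eq; apply: (L1_le (g := fun x => \1_(@box R N r0) x + u x `^ q)).
- by apply: (@measurableT_comp _ _ _ _ _ _ (@powR R ^~ e)) => //; exact: measurable_powR.
- by apply: L1D => //; exact: L1_indic_box.
- move=> x; rewrite ger0_norm ?powR_ge0//.
  have [xr|xr] := leP `|x| r0.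
    rewrite indicE mem_set; last by move=> i; exact: le_trans (rV_coord_le _ _) xr.
    exact: (powR_le1D (u0 x) e0 eq).
  by rewrite ur0// !powR0 ?lt0r_neq0// addr0 indicE.
Qed.

Let Lu1 : L1 u.
Proof. by apply: L1_ext (L1_lower_power ltr01 (ltW q1)) => x; rewrite powRr1. Qed.

(** This box contains the support of the kernel moved to [x] at every scale [s >= 2^n]; it does not
    depend on [s] and is symmetric in [x] and [y]. *)
Definition near_box (n : nat) (x y : V) : R := \1_(@box R N (2^-1 ^+ n)) (x - y).

Lemma near_box_ge0 n x y : 0 <= near_box n x y.
Proof. by rewrite /near_box indicE. Qed.

Lemma near_box_le1 n x y : near_box n x y <= 1.
Proof. by rewrite /near_box indicE lern1; case: (_ \in _). Qed.

Lemma near_boxC n x y : near_box n x y = near_box n y x.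
Proof.
rewrite /near_box !indicE.
suff -> : (x - y \in @box R N (2^-1 ^+ n)) = (y - x \in @box R N (2^-1 ^+ n)) by [].
by apply/idP/idP; rewrite !inE => h i; rewrite (le_trans _ (h i))// -opprB mxE normrN.
Qed.

Lemma near_box_meas n x : measurable_fun setT (near_box n x).
Proof.
have mB : measurable_fun setT (\1_(@box R N (2^-1 ^+ n)) : V -> R).
  by apply: measurable_indic; exact: measurable_box.
rewrite (_ : near_box n x = (\1_(@box R N (2^-1 ^+ n)) : V -> R) \o (fun y => -1 *: y + x)).
  exact: measurableT_comp mB (measurable_affine_rV (-1) x).
by apply/funext => y /=; rewrite /near_box scaleN1r addrC.
Qed.

Lemma Int_near_box n x : L1 (near_box n x) /\ Int (near_box n x) = (2 * 2^-1 ^+ n) ^+ N.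
Proof.
have n0 : -1 != 0 :> R by rewrite oppr_eq0 oner_eq0.
have [L E] := Int_affine x n0 (L1_indic_box (2^-1 ^+ n)).
have F : (fun y => \1_(@box R N (2^-1 ^+ n)) (-1 *: y + x)) =1 near_box n x.
  by move=> y; rewrite /near_box scaleN1r addrC.
split; first exact: L1_ext F L.
rewrite -(Int_ext F) E normrN1 expr1n invr1 mul1r Int_indic_box//.
Qed.

Lemma moved_near_box th (C : R) (s : R) n x y : unit_kernel th -> (forall z, `|th z| <= C) ->
  dyad n <= s -> moved th s x y <= C * near_box n x y.
Proof.
move=> kt tC sn; have s0 : 0 < s by apply: lt_le_trans sn; exact: dyad_gt0.
have [h|h] := leP `|x - y| (2^-1 ^+ n).
  rewrite /near_box indicE mem_set ?mulr1; last by move=> i; exact: le_trans (rV_coord_le _ _) h.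
  exact: le_trans (ler_norm _) (tC _).
rewrite (moved_supp kt); first by rewrite mulr_ge0 ?near_box_ge0// (le_trans _ (tC 0)).
rewrite gtr0_norm//; apply: (@le_lt_trans _ _ (s * 2^-1 ^+ n)); last by rewrite ltr_pM2l.
by rewrite exprVn ler_pdivlMr ?exprn_gt0// mul1r.
Qed.

Definition step_const : R := sval (cid2 (kernel_bounded (@kernel_bump R N 0))) * 2 ^+ M.+1.

Lemma step_const_ge0 : 0 <= step_const.
Proof. by rewrite /step_const; case: cid2 => C C0 HC /=; rewrite mulr_ge0// exprn_ge0. Qed.

Let mul_near_L1 g n x : L1 g -> L1 (fun y => g y * near_box n x y).
Proof.
move=> Lg; apply: (L1Mb (C := 1) Lg); first exact: near_box_meas.
by move=> y; rewrite ger0_norm ?near_box_ge0// near_box_le1.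
Qed.

Lemma bumpf0_ge0 (z : V) : 0 <= bumpf 0 z.
Proof. exact: flat0_ge0. Qed.

(** Testing the weak inequality with the nonnegative kernel at scale [s] yields a factor [s^-2];
    then [s^(N-1) s^-2] times the length [2^n] of the dyadic interval is of order [2^(M n)]. *)
Lemma moll_step_upper n x : moll u (dyad n.+1) x - moll u (dyad n) x <=
  step_const * (2 ^+ M) ^+ n * (I * Int (fun y => u y `^ (q - 1) * near_box n x y)).
Proof.
have kb := @kernel_bump R N 0; have kr := @kernel_rho R N.
have qq : q - 1 <= q by rewrite gerBl.
have Lfu := L1_lower_power q10 qq.
rewrite /step_const; case: cid2 => C C0 HC /=.
set J := Int _; have J0 : 0 <= J by apply: Int_ge0 => y; rewrite mulr_ge0 ?powR_ge0 ?near_box_ge0.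
have d0 := @dyad_gt0 R n.
have dS : dyad n.+1 = 2 * dyad n :> R by rewrite /dyad exprS.
pose B := dyad n.+1 ^+ M.+1 * (dyad n ^- 2 * (I * (C * J))).
have dle : dyad n <= dyad n.+1 :> R by rewrite dS ler_peMl ?ler1n ?ltW.
have HB s : dyad n <= s -> s <= dyad n.+1 -> - (s ^+ M.+1 * cv u (laplacian (bumpf 0)) s x) <= B.
  move=> s1 s2; have s0 : 0 < s by exact: lt_le_trans s1.
  have P1 : - cv u (laplacian (bumpf 0)) s x <= s ^- 2 * (I * (C * J)).
    have c2 : Ck setT 2 (moved (bumpf 0) s x) by exact: moved_Cinfty.
    have := sub c2 (moved_bsupp x s0 kb) (fun y => bumpf0_ge0 _).
    rewrite laplacian_moved//.
    have -> : Int (fun y => u y * (s ^+ 2 * moved (laplacian (bumpf 0)) s x y)) = s ^+ 2 * cv u (laplacian (bumpf 0)) s x.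
      rewrite -IntZ; last exact: cv_L1 (kernel_laplacian kb).
      by apply: Int_ext => y; rewrite mulrCA.
    rewrite -mulrN -ler_pdivlMl ?exprn_gt0// => /le_trans; apply.
    rewrite ler_pM2l ?invr_gt0 ?exprn_gt0// ler_pM2l//.
    rewrite -IntZ; last exact: mul_near_L1.
    apply: le_Int; [exact: cv_L1 Lfu kb|apply: L1Z; exact: mul_near_L1|move=> y].
    rewrite mulrCA ler_wpM2l ?powR_ge0//; exact: moved_near_box.
  rewrite -mulrN; apply: (@le_trans _ _ (s ^+ M.+1 * (s ^- 2 * (I * (C * J))))).
    by rewrite ler_wpM2l// exprn_ge0// ltW.
  have X0 : 0 <= I * (C * J) by rewrite mulr_ge0 ?(ltW I0)// mulr_ge0.
  have h1 : s ^+ M.+1 <= dyad n.+1 ^+ M.+1 by rewrite lerXn2r ?nnegrE ?(ltW s0) ?(ltW (dyad_gt0 _)).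
  have h2 : s ^- 2 * (I * (C * J)) <= dyad n ^- 2 * (I * (C * J)).
    by rewrite ler_wpM2r// lef_pV2 ?posrE ?exprn_gt0// lerXn2r ?nnegrE ?(ltW s0)// ltW.
  have h3 : 0 <= s ^+ M.+1 by rewrite exprn_ge0// ltW.
  have h4 : 0 <= s ^- 2 * (I * (C * J)) by rewrite mulr_ge0// invr_ge0 exprn_ge0// ltW.
  exact: ler_pM h3 h4 h1 h2.
apply: (le_trans (cv_hom_upper d0 dle Lu1 kr kb (@hom_base R N) HB)).
rewrite le_eqVlt; apply/orP; left; apply/eqP.
have -> : (2 ^+ M) ^+ n = dyad n ^+ M :> R by rewrite /dyad -!exprM mulnC.
rewrite /B dS; have dn : dyad n != 0 :> R by rewrite lt0r_neq0.
by rewrite exprMn [dyad n ^+ M.+1]exprS; move: (dyad n) (2 ^+ M.+1) dn => t w dn; field.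
Qed.

(* A dyadic substitute for the Green function: it bounds the growth of the
   mollifications of a subsolution.  Since its integral against [u `^ (q - 2)] is
   small for large [j0], the part of [u] above a large constant, weighted by
   [u `^ (q - 2)], has an integral at most half of itself. *)
Definition iter_kernel (j0 n : nat) (x y : V) : R :=
  \sum_(k < n) step_const * I * (2 ^+ M) ^+ (j0 + k) * near_box (j0 + k) x y.

Lemma iter_kernel_ge0 j0 n x y : 0 <= iter_kernel j0 n x y.
Proof.
apply: sumr_ge0 => k _; rewrite mulr_ge0 ?near_box_ge0//.
by rewrite mulr_ge0 ?exprn_ge0// mulr_ge0 ?step_const_ge0// ltW.
Qed.

Lemma iter_kernelC j0 n x y : iter_kernel j0 n x y = iter_kernel j0 n y x.
Proof. by apply: eq_bigr => k _; rewrite near_boxC. Qed.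

Lemma mul_iter_kernel g j0 n x : L1 g -> L1 (fun y => g y * iter_kernel j0 n x y) /\
  Int (fun y => g y * iter_kernel j0 n x y) =
  \sum_(k < n) step_const * I * (2 ^+ M) ^+ (j0 + k) * Int (fun y => g y * near_box (j0 + k) x y).
Proof.
move=> Lg.
have E : (fun y => \sum_(k < n) step_const * I * (2 ^+ M) ^+ (j0 + k) * (g y * near_box (j0 + k) x y)) =1
    (fun y => g y * iter_kernel j0 n x y).
  by move=> y; rewrite /iter_kernel mulr_sumr; apply: eq_bigr => k _; rewrite mulrCA.
have Lk (k : 'I_n) := L1Z (step_const * I * (2 ^+ M) ^+ (j0 + k)) (mul_near_L1 (j0 + k)%N x Lg).
split; first by apply: L1_ext E _; exact: L1_sum.
rewrite -(Int_ext E) (Int_sum _ Lk); apply: eq_bigr => k _; rewrite IntZ//.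
exact: mul_near_L1.
Qed.

Lemma moll_upper j0 n x : moll u (dyad (j0 + n)) x <=
  moll u (dyad j0) x + Int (fun y => u y `^ (q - 1) * iter_kernel j0 n x y).
Proof.
have qq : q - 1 <= q by rewrite gerBl.
rewrite (mul_iter_kernel _ _ _ (L1_lower_power q10 qq)).2.
rewrite addrC -lerBlDr -(telescope_shift (fun n => moll u (dyad n) x)).
apply: ler_sum => k _; apply: (le_trans (moll_step_upper _ _)).
by rewrite mulrA [X in X * _]mulrAC.
Qed.

(** The ratio [2^(M - 2 N / q)] of the bounds in [young_near]; it is below [1] exactly when
    [M q < 2 N], which is subcriticality again. *)
Definition young_rate : R := 2 ^+ M / (2 `^ (N%:R / q)) ^+ 2.

Let sigma : R := 2 `^ (N%:R / q).
Let sigma0 : 0 < sigma. Proof. exact: powR_gt0. Qed.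

Lemma young_rate_lt1 : young_rate < 1.
Proof.
rewrite ltr_pdivrMr ?exprn_gt0// mul1r -!powR_mulrn ?powR_ge0// -powRrM.
have l2 : 1 < 2 :> R by rewrite ltr1n.
rewrite -(@ltr_ln R) ?posrE ?powR_gt0// !ln_powR ltr_pM2r ?ln_gt0//.
rewrite mulrAC ltr_pdivlMr//; move: subcritical; rewrite -[N]addn2 natrD; lra.
Qed.

Let sigma_young : sigma `^ (q - 2) = 4 * young_rate.
Proof.
have E : sigma `^ (q - 2) * sigma ^+ 2 = 4 * 2 ^+ M.
  rewrite -powR_mulrn ?(ltW sigma0)// -powRD; last by rewrite (lt0r_neq0 sigma0) implybT.
  by rewrite subrK -powRrM divfK ?lt0r_neq0// powR_mulrn// !exprS; ring.
by rewrite /young_rate -/sigma mulrA -E mulfK// expf_neq0// lt0r_neq0.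
Qed.

Lemma young_near n x : (2 ^+ M) ^+ n * Int (fun y => u y `^ (q - 2) * near_box n x y) <=
  (2 ^+ N + 1) * young_rate ^+ n.
Proof.
have qq : q - 2 <= q by rewrite gerBl.
have L2 := L1_lower_power q20 qq.
(* The level [t = 2^(n N / q)] balances two estimates of [u^(q-2)]: below [t] the volume [2^(- n N)]
   of the box is used, above it [t^-2 u^q]. *)
set t := sigma ^+ n; have t0 : 0 < t by exact: exprn_gt0.
have [Lb Eb] := Int_near_box n x.
have yg y : u y `^ (q - 2) * near_box n x y <= t `^ (q - 2) * near_box n x y + t ^- 2 * u y `^ q.
  have b0 := near_box_ge0 n x y; have b1 := near_box_le1 n x y.
  have [h|h] := leP (u y) t.
    apply: ler_wpDr; first by rewrite mulr_ge0 ?powR_ge0// invr_ge0 exprn_ge0// ltW.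
    by rewrite ler_wpM2r// ge0_ler_powR ?nnegrE ?(ltW q20) ?(ltW t0).
  apply: ler_wpDl; first by rewrite mulr_ge0 ?powR_ge0.
  apply: (@le_trans _ _ (u y `^ (q - 2))); first by rewrite ler_piMr ?powR_ge0.
  have up : 0 < u y by exact: lt_trans h.
  have -> : u y `^ q = u y `^ (q - 2) * u y ^+ 2.
    by rewrite -powR_mulrn// -powRD ?subrK// (lt0r_neq0 up) implybT.
  rewrite mulrCA ler_peMr ?powR_ge0// ler_pdivlMl ?exprn_gt0// mulr1.
  by rewrite lerXn2r ?nnegrE ?(ltW t0)// ltW.
have P : 0 <= (2 ^+ M) ^+ n :> R by rewrite exprn_ge0// exprn_ge0.
apply: (@le_trans _ _ ((2 ^+ M) ^+ n * (t `^ (q - 2) * (2 * 2^-1 ^+ n) ^+ N + t ^- 2))).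
  have L3 := L1Z (t `^ (q - 2)) Lb; have L4 := L1Z (t ^- 2) Lu.
  have E : Int (fun y => t `^ (q - 2) * near_box n x y + t ^- 2 * u y `^ q) =
      t `^ (q - 2) * (2 * 2^-1 ^+ n) ^+ N + t ^- 2.
    by rewrite (IntD L3 L4) (IntZ _ Lb) (IntZ _ Lu) Iu mulr1 Eb.
  by rewrite ler_wpM2l// -E; apply: le_Int => //; [exact: mul_near_L1|exact: L1D].
rewrite le_eqVlt; apply/orP; left; apply/eqP.
rewrite /t powRXn ?(ltW sigma0)// sigma_young.
have -> : (sigma ^+ n) ^- 2 = (sigma ^- 2) ^+ n by rewrite exprVn -!exprM mulnC.
have -> : young_rate ^+ n = (2 ^+ M) ^+ n * (sigma ^- 2) ^+ n by rewrite -exprMn.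
have -> : (4 * young_rate) ^+ n = 4 ^+ n * ((2 ^+ M) ^+ n * (sigma ^- 2) ^+ n).
  by rewrite exprMn; congr (_ * _); rewrite -exprMn.
have -> : (2 * 2^-1 ^+ n) ^+ N = 2 ^+ N * ((2 ^+ M) ^- n * 4 ^- n) :> R.
  rewrite exprMn; congr (_ * _); rewrite -[LHS]exprM mulnC [LHS]exprM.
  rewrite -[(2 ^+ M) ^- n]exprVn -[4 ^- n]exprVn -exprMn -invfM; congr (_ ^+ n).
  by rewrite exprVn; congr (_^-1); rewrite !exprS; ring.
have p4 : 4 ^+ n != 0 :> R by rewrite expf_neq0.
have p2 : (2 ^+ M) ^+ n != 0 :> R by rewrite expf_neq0// expf_neq0.
move: p4 p2; set a : R := 4 ^+ n; set b : R := (2 ^+ M) ^+ n; set c := (sigma ^- 2) ^+ n.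
by move: a b c (2 ^+ N : R) => a b c d p4 p2; field; rewrite p4 p2.
Qed.

Lemma iter_kernel_small : exists j0, forall n x,
  Int (fun y => u y `^ (q - 2) * iter_kernel j0 n x y) <= mass / 2.
Proof.
have qq : q - 2 <= q by rewrite gerBl.
have L2 := L1_lower_power q20 qq.
have y1 := young_rate_lt1.
have y0 : 0 <= young_rate by rewrite divr_ge0// exprn_ge0// powR_ge0.
pose A := step_const * I * (2 ^+ N + 1) * (1 - young_rate)^-1.
have m2 : 0 < mass / 2 by rewrite divr_gt0// rho_mass_gt0.
have cA : A * young_rate ^+ n @[n --> \oo] --> 0.
  by rewrite -(mulr0 A); apply: cvgMr; apply: cvg_expr; rewrite ger0_norm.
move/cvgr0_norm_le : cA => /(_ _ m2)[j0 _ /(_ j0 (leqnn _))/= Hj].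
exists j0 => n x; rewrite (mul_iter_kernel _ _ _ L2).2.
have K0 : 0 <= step_const * I by rewrite mulr_ge0 ?step_const_ge0// ltW.
apply: le_trans (le_trans (ler_norm _) Hj).
apply: (@le_trans _ _ (\sum_(k < n) step_const * I * (2 ^+ N + 1) * young_rate ^+ (j0 + k))).
  apply: ler_sum => k _; rewrite -!(mulrA (step_const * I)) ler_wpM2l//; exact: young_near.
rewrite -mulr_sumr /A -[leRHS]mulrA; apply: ler_wpM2l.
  by rewrite mulr_ge0// addr_ge0// exprn_ge0.
by rewrite [leRHS]mulrC; exact: geo_sum_le.
Qed.

Lemma ae_upper_bound (m : nat -> nat) : (forall j, (j <= m j)%N) ->
  {ae mu, forall x, moll u (dyad (m j)) x @[j --> \oo] --> mass * u x} ->
  exists2 B : R, 0 <= B & {ae mu, forall x, u x <= B}.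
Proof.
move=> mj cu; have [j0 Hj] := iter_kernel_small.
have c0 := @rho_mass_gt0 R N.
have qq1 : q - 1 <= q by rewrite gerBl.
have qq2 : q - 2 <= q by rewrite gerBl.
have L1q := L1_lower_power q10 qq1; have L2q := L1_lower_power q20 qq2.
have d0 := @dyad_gt0 R j0.
have bu : bsupp u by exists r0.
have [M0 M00 HM0] := C0_bounded (@continuous_moll _ _ u (dyad j0) Lu1) (moll_bsupp d0 bu).
(* With this choice [M0 + B * (mass / 2) = B * mass]: the coarse mollification and the contribution
   of the part of [u] below [B] are absorbed, and only the excess [z] remains. *)
pose B := 2 * M0 / mass; exists B; first by rewrite divr_ge0 ?mulr_ge0// ltW.
have B0 : 0 <= B by rewrite divr_ge0 ?mulr_ge0// ltW.
pose W x := u x `^ (q - 2); pose z x := Num.max (u x - B) 0.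
have W0 x : 0 <= W x by exact: powR_ge0.
have z0 x : 0 <= z x by rewrite /z le_max lexx orbT.
have zu x : z x <= u x by rewrite /z ge_max u0 andbT gerBl.
have uz x : u x <= B + z x by rewrite /z -lerBlDl le_max lexx.
have mz : measurable_fun setT z.
  by apply: measurable_maxr => //; apply: measurable_funB => //; exact: measurable_cst.
have mW : measurable_fun setT W by exact: L1_meas L2q.
have Wu x : W x * u x = u x `^ (q - 1).
  have [->|un] := eqVneq (u x) 0; first by rewrite mulr0 powR0// lt0r_neq0.
  have -> : q - 1 = q - 2 + 1 by ring.
  by rewrite powRD ?un ?implybT// powRr1.
have LWz : L1 (fun x => W x * z x).
  apply: (L1_le (g := fun x => u x `^ (q - 1))) => //; first exact: measurable_funM.
  by move=> x; rewrite ger0_norm ?mulr_ge0// -Wu ler_wpM2l.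
pose P n x := Int (fun y => W y * z y * iter_kernel j0 n x y).
have P0 n x : 0 <= P n x by apply: Int_ge0 => y; rewrite mulr_ge0 ?iter_kernel_ge0// mulr_ge0.
have UP n x : moll u (dyad (j0 + n)) x / mass - B <= P n x / mass.
  rewrite lerBlDr -[B](mulfK (lt0r_neq0 c0)) -mulrDl ler_pM2r ?invr_gt0//.
  apply: (le_trans (moll_upper j0 n x)).
  apply: (@le_trans _ _ (M0 + (B * (mass / 2) + P n x))); last first.
    have -> : B * mass = M0 + B * (mass / 2) by rewrite /B; field; rewrite lt0r_neq0.
    by rewrite [leRHS]addrC addrA.
  apply: lerD; first exact: le_trans (ler_norm _) (HM0 x).
  have [La Ea] := mul_iter_kernel j0 n x L2q.
  have [Lb Eb] := mul_iter_kernel j0 n x LWz.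
  have [Lc Ec] := mul_iter_kernel j0 n x L1q.
  apply: (@le_trans _ _ (B * Int (fun y => W y * iter_kernel j0 n x y) + P n x)); last first.
    by rewrite lerD2r ler_wpM2l//; exact: Hj.
  rewrite -(IntZ B La) -(IntD (L1Z B La) Lb); apply: le_Int => //; first exact: L1D (L1Z B La) Lb.
  move=> y; rewrite -Wu.
  have -> : B * (W y * iter_kernel j0 n x y) + W y * z y * iter_kernel j0 n x y =
    W y * (B + z y) * iter_kernel j0 n x y by ring.
  by rewrite ler_wpM2r ?iter_kernel_ge0// ler_wpM2l.
(* Tonelli's theorem and the symmetry of the kernel turn the inner integral into the one that
   [iter_kernel_small] bounds by [mass / 2]. *)
have key n : L1 (fun x => W x * P n x) /\ Int (fun x => W x * P n x) <= mass / 2 * Int (fun x => W x * z x).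
  have mK : measurable_fun setT (fun v : V * V => W v.1 * (W v.2 * z v.2 * iter_kernel j0 n v.1 v.2)).
    apply: measurable_funM; first exact: measurable_fst_rV.
    apply: measurable_funM; first by apply: (measurable_snd_rV (f := fun y => W y * z y)); exact: measurable_funM.
    apply: measurable_sum => k; apply: measurable_funM; first exact: measurable_cst.
    have := @measurable_prod_rV _ _ 1 (-1) (\1_(@box R N (2^-1 ^+ (j0 + k))) : V -> R) (measurable_indic (@measurable_box R N _)).
    by apply: eq_measurable_fun => v _ /=; rewrite /near_box scale1r scaleN1r.
  have [||||| L E] := @Int_tonelli _ _ (fun v => W v.1 * (W v.2 * z v.2 * iter_kernel j0 n v.1 v.2))
    (fun y => mass / 2 * (W y * z y)) mK.
  - by move=> v; rewrite !mulr_ge0 ?iter_kernel_ge0.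
  - by move=> x /=; apply: L1Z; exact: (mul_iter_kernel j0 n x LWz).1.
  - move=> y /=; apply: (L1_ext (f := fun x => W y * z y * (W x * iter_kernel j0 n y x))).
      by move=> x; rewrite iter_kernelC; ring.
    by apply: L1Z; exact: (mul_iter_kernel j0 n y L2q).1.
  - move=> y /=.
    rewrite (Int_ext (g := fun x => W y * z y * (W x * iter_kernel j0 n y x))); last first.
      by move=> x; rewrite iter_kernelC; ring.
    rewrite IntZ; last exact: (mul_iter_kernel j0 n y L2q).1.
    by rewrite mulrC ler_wpM2r ?mulr_ge0//; exact: Hj.
  - exact: L1Z.
  have EP : (fun x => Int (fun y => W x * (W y * z y * iter_kernel j0 n x y))) =1 (fun x => W x * P n x).
    by move=> x; rewrite IntZ//; exact: (mul_iter_kernel j0 n x LWz).1.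
  split; first exact: L1_ext EP L.
  by rewrite -(Int_ext EP) -(IntZ _ LWz).
(* Since [m (j0 + j) >= j0] the truncated subtraction is exact; it writes the scales of convergence
   in the form [j0 + n]. *)
pose n j := (m (j0 + j) - j0)%N.
have nj j : (j0 + n j)%N = m (j0 + j)%N by rewrite /n subnKC// (leq_trans _ (mj _))// leq_addr.
pose g j x := W x * Num.max (moll u (dyad (j0 + n j)) x / mass - B) 0.
have mg j : measurable_fun setT (g j).
  apply: measurable_funM => //; apply: measurable_maxr; last exact: measurable_cst.
  apply: continuous_measurable_rV => x.
  apply: (@continuousB _ _ _ (fun x => moll u (dyad (j0 + n j)) x / mass) (fun=> B)); last exact: cst_continuous.
  by apply: (@continuousM _ _ (moll u (dyad (j0 + n j))) (fun=> mass^-1)); [exact: continuous_moll|exact: cst_continuous].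
have gP j x : 0 <= g j x <= mass^-1 * (W x * P (n j) x).
  rewrite /g; apply/andP; split; first by rewrite mulr_ge0// le_max lexx orbT.
  rewrite [leRHS]mulrCA ler_wpM2l// [mass^-1 * _]mulrC ge_max UP/=.
  by rewrite divr_ge0// ltW.
have Ig j : L1 (g j) /\ Int (g j) <= 2^-1 * Int (fun x => W x * z x).
  have [Lk Ek] := key (n j).
  have Lg : L1 (g j).
    apply: (L1_le (mg j) (L1Z (mass^-1) Lk)) => y.
    by have /andP[h1 h2] := gP j y; rewrite ger0_norm.
  split => //; apply: (@le_trans _ _ (mass^-1 * Int (fun x => W x * P (n j) x))).
    by rewrite -IntZ//; apply: le_Int => //; [exact: L1Z|move=> x; have /andP[] := gP j x].
  rewrite ler_pdivrMl//; apply: (le_trans Ek); rewrite mulrA le_eqVlt; apply/orP; left; apply/eqP; ring.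
have cg : {ae mu, forall x, g j x @[j --> \oo] --> W x * z x}.
  apply: filterS cu => x cx.
  have c1 : moll u (dyad (j0 + n j)) x @[j --> \oo] --> mass * u x.
    have -> : (fun j => moll u (dyad (j0 + n j)) x) = [sequence moll u (dyad (m (j + j0)%N)) x]_j.
      by apply/funext => j; rewrite nj addnC.
    by rewrite (cvg_shiftn j0 (fun j => moll u (dyad (m j)) x)).
  have cc : {for mass * u x, continuous (fun t : R => Num.max (t / mass - B) 0)}.
    apply: (@continuous_max _ _ (fun t : R => t / mass - B) (fun=> 0)); last exact: cst_continuous.
    apply: (@continuousB _ _ _ (fun t : R => t / mass) (fun=> B)); last exact: cst_continuous.
    by apply: (@continuousM _ _ (fun t : R => t) (fun=> mass^-1)); [exact: cvg_id|exact: cst_continuous].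
  have -> : z x = Num.max (mass * u x / mass - B) 0 by rewrite [mass * _]mulrC mulfK// lt0r_neq0.
  by apply: cvgMr; exact: (continuous_cvg _ cc c1).
(* Fatou's lemma gives [X <= X / 2] for the finite integral [X] of [W z], so that [X = 0]. *)
have [LL II] := Int_fatou (fun j => (Ig j).1) (fun j x => (andP (gP j x)).1) (L1_meas LWz)
  (fun x => mulr_ge0 (W0 x) (z0 x)) cg (fun j => (Ig j).2).
have IZ : Int (fun x => W x * z x) = 0.
  have h : 0 <= Int (fun x => W x * z x) by apply: Int_ge0 => x; rewrite mulr_ge0.
  lra.
have := Int_eq0_ae LL (fun x => mulr_ge0 (W0 x) (z0 x)) IZ.
apply: filterS => x /eqP; rewrite mulf_eq0 => /orP[|/eqP zx].
  by rewrite /W powR_eq0 => /andP[/eqP -> _].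
by have := uz x; rewrite zx addr0.
Qed.

End iteration.

End boundedness.

(** * Weak equation of the minimizer *)

Section weak_solution.
Context {R : realType} {M : nat}.
Local Notation N := M.+2.
Notation V := 'rV[R]_N.
Notation mu := (lebesgue_rV N).
Local Notation mass := (@rho_mass R M.+2).
Variables (Om : set V) (r0 q : R) (x0 : V).
Hypotheses (openOm : open Om) (Om_r0 : forall x, Om x -> `|x| <= r0) (Om_x0 : Om x0).
Hypotheses (q2 : 2 < q) (subcritical : M%:R * (q - 2) < 4).
Let q0 : 0 < q. Proof. exact: lt_trans q2. Qed.
Let q1 : 1 < q. Proof. by apply: lt_trans q2; rewrite ltr1n. Qed.
Let q10 : 0 < q - 1. Proof. by rewrite subr_gt0. Qed.
Let r00 : 0 <= r0. Proof. exact: le_trans (Om_r0 Om_x0). Qed.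
Local Notation I := (sobolev_inf Om q).

Definition weak_equation (f u : V -> R) := forall psi : V -> R, Ck setT 2 psi ->
  (exists2 K : set V, compact K & K `<=` Om /\ forall x, ~ K x -> psi x = 0) ->
  Int (fun x => u x * laplacian psi x) = - Int (fun x => f x * psi x).

Lemma laplacianN (psi : V -> R) : Ck setT 2 psi ->
  laplacian (fun x => -1 * psi x) = fun x => -1 * laplacian psi x.
Proof.
move=> c2; apply/funext => x; rewrite /laplacian mulr_sumr; apply: eq_bigr => i _.
have c1 := CkS c2.
rewrite (partial_scl (-1) (f := psi)); last by move=> y; exact: Ck_derivable c1 Logic.I.
by rewrite partial_scl// => y; exact: Ck_derivable (Ck_partial (k := 1) i c2) Logic.I.
Qed.

Lemma continuous_laplacian (psi : V -> R) : Ck setT 2 psi -> continuous (laplacian psi).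
Proof.
move=> c2; apply: (CkT_cont (k := 0)); apply: (Ck_sum _ openT) => i; split => // x _.
have c1 : Ck setT 1 (partial i psi) by exact: (Ck_partial (k := 1)).
exact: (CkT_cont (k := 0) (Ck_partial (k := 0) i c1)).
Qed.

Lemma bsupp_laplacian (psi : V -> R) : bsupp psi -> bsupp (laplacian psi).
Proof.
move=> [r pr]; exists r => x xr; rewrite /laplacian big1// => i _.
exact: partial_supp (partial_supp i pr) x xr.
Qed.

Lemma compact_bsupp (psi : V -> R) :
  (exists2 K : set V, compact K & K `<=` Om /\ forall x, ~ K x -> psi x = 0) -> bsupp psi.
Proof.
by move=> [K cK [KO pK]]; exists r0 => x xr; apply: pK => /KO/Om_r0; rewrite leNgt xr.
Qed.

Section minimizer.
Variables (phi : nat -> V -> R) (u H : V -> R).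
Hypothesis min_u : minimizing Om q phi u H.

(** [beta d] vanishes on negative numbers. Hence for [psi <= 0] the competitor is supported where
    [phi k] is, even if the support of [psi] leaves [Om]; this case yields the subsolution property
    across the boundary. *)
Lemma truncated_competitor (psi : V -> R) k (d t : R) : Ck setT 1 psi -> bsupp psi -> 0 < d -> 0 < t ->
  (forall x, psi x <= 0) \/
    (exists2 K : set V, compact K & K `<=` Om /\ forall x, ~ K x -> psi x = 0) ->
  exists T, [/\ C1c Om T, forall x, 0 <= T x, forall x, phi k x + t * psi x - d <= T x &
    energy T <= energy (fun x => phi k x + t * psi x)].
Proof.
move=> c1 bp d0 t0 alt; have [Hp _ _ _ _] := min_u; have [cf p0 _] := Hp k.
have cs : Ck setT 1 (fun x => phi k x + t * psi x).
  by apply: (Ck_add openT) => //; [exact: cf.1|exact: (Ck_scl _ openT)].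
have bs : bsupp (fun x => phi k x + t * psi x).
  have [r1 h1] := C1c_bsupp Om_r0 cf; have [r2 h2] := bp; exists (Num.max r1 r2) => x.
  by rewrite gt_max => /andP[/h1 -> /h2 ->]; rewrite mulr0 addr0.
have [cT ET] := C1_comp openT (is_derive_beta d0) (continuous_dbeta d0) cs.
have CT : C1c Om (fun x => beta d (phi k x + t * psi x)).
  split => //; have [_ [K cK [KO fK]]] := cf; case: alt => [pn|[K' cK' [KO' pK]]].
    by exists K => //; split => // x /fK ->; rewrite beta_le0// add0r pmulr_rle0.
  exists (K `|` K'); first exact: compactU.
  split; first by move=> x [/KO|/KO'].
  move=> x nK; rewrite fK ?pK ?mulr0 ?addr0 ?beta_le0// => h; apply: nK; [by right|by left].
exists (fun x => beta d (phi k x + t * psi x)); split.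
- exact: CT.
- by move=> x; exact: beta_ge0.
- by move=> x; exact: beta_ge.
- apply: (energy_le CT.1 (C1c_bsupp Om_r0 CT) cs bs) => i x.
  rewrite ET// exprMn ler_piMl ?sqr_ge0//.
  by rewrite expr_le1// ?dbeta_ge0// dbeta_le1.
Qed.

Lemma minimizer_L1 (psi : V -> R) : Ck setT 2 psi -> bsupp psi ->
  L1 (fun x => u x `^ (q - 1) * psi x) /\ L1 (fun x => u x * laplacian psi x).
Proof.
move=> c2 bp; have [_ _ [mu_ u0 _] _ _] := min_u; split.
  have [C _ HC] := C0_bounded (CkT_cont c2) bp.
  have qq : q - 1 <= q by rewrite gerBl.
  exact: (minimizing_cvg Om_r0 min_u q10 qq (continuous_measurable_rV (CkT_cont c2)) HC).1.
have [C _ HC] := C0_bounded (continuous_laplacian c2) (bsupp_laplacian bp).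
apply: L1_ext (minimizing_cvg Om_r0 min_u ltr01 (ltW q1) (continuous_measurable_rV (continuous_laplacian c2)) HC).1.
by move=> x; rewrite powRr1.
Qed.

Lemma minimizer_opp (psi : V -> R) : Ck setT 2 psi -> bsupp psi ->
  (forall x, psi x <= 0) \/
    (exists2 K : set V, compact K & K `<=` Om /\ forall x, ~ K x -> psi x = 0) ->
  I * Int (fun x => u x `^ (q - 1) * psi x) <= - Int (fun x => u x * laplacian psi x).
Proof.
move=> c2 bp alt; apply: (Euler_Lagrange openOm Om_r0 Om_x0 q2 min_u c2 bp) => k d t d0 t0.
exact: truncated_competitor (CkS c2) bp d0 t0 alt.
Qed.

Lemma Int_opp (psi : V -> R) : Ck setT 2 psi -> bsupp psi ->
  Int (fun x => u x `^ (q - 1) * (-1 * psi x)) = - Int (fun x => u x `^ (q - 1) * psi x) /\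
  Int (fun x => u x * laplacian (fun x => -1 * psi x) x) = - Int (fun x => u x * laplacian psi x).
Proof.
move=> c2 bp; have [LA LB] := minimizer_L1 c2 bp; rewrite laplacianN//.
by split; rewrite -IntN//; apply: Int_ext => x; rewrite mulN1r mulrN.
Qed.

Lemma opp_ineq (k a b a' b' : R) : a' = - a -> b' = - b -> k * a' <= - b' -> - b <= k * a.
Proof. by move=> -> ->; rewrite mulrN opprK lerNl. Qed.

Lemma minimizer_sub : subsolution q I u.
Proof.
move=> psi c2 bp p0.
have c2' : Ck setT 2 (fun x => -1 * psi x) by exact: (Ck_scl _ openT).
have b' : bsupp (fun x => -1 * psi x) by exact: bsupp_mulr.
have [E1 E2] := Int_opp c2 bp.
have n0 x : -1 * psi x <= 0 by rewrite mulN1r oppr_le0.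
exact: opp_ineq E1 E2 (minimizer_opp c2' b' (or_introl n0)).
Qed.

Lemma minimizer_eq : weak_equation (fun x => I * u x `^ (q - 1)) u.
Proof.
move=> psi c2 sp; have bp := compact_bsupp sp.
have [LA LB] := minimizer_L1 c2 bp.
have -> : Int (fun x => I * u x `^ (q - 1) * psi x) = I * Int (fun x => u x `^ (q - 1) * psi x).
  by rewrite -IntZ//; apply: Int_ext => x; rewrite mulrA.
have c2' : Ck setT 2 (fun x => -1 * psi x) by exact: (Ck_scl _ openT).
have b' : bsupp (fun x => -1 * psi x) by exact: bsupp_mulr.
have [E1 E2] := Int_opp c2 bp.
have H2 := minimizer_opp c2 bp (or_intror sp).
have H1 := opp_ineq E1 E2 (minimizer_opp c2' b' (or_intror _)).
apply: oppr_inj; rewrite opprK; apply: le_anti; rewrite H2 andbT; apply: H1.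
have [K cK [KO pK]] := sp.
by exists K => //; split => // x /pK ->; rewrite mulr0.
Qed.

Lemma minimizer_moll_cvg : exists m : nat -> nat, (forall j, (j <= m j)%N) /\
  {ae mu, forall x, moll u (dyad (m j)) x @[j --> \oo] --> mass * u x}.
Proof.
have [Hp _ [mu_ u0 _] _ cu] := min_u.
have [C [g [C0 g0 g1 HA]]] := Lq_approximation q2 subcritical.
have I0 := sobolev_inf_gt0 openOm Om_r0 Om_x0 q2 min_u.
have L1u : L1 u.
  have one (x : V) : `|1 : R| <= 1 by rewrite normr1.
  have [L _] := minimizing_cvg Om_r0 min_u ltr01 (ltW q1) (measurable_cst (1 : R)) one.
  by apply: L1_ext L => x; rewrite powRr1// mulr1.
pose f m x := `|mass * u x - moll u (dyad m) x| `^ q.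
have Hf m : L1 (f m) /\ Int (f m) <= C * (I + 1) `^ (q / 2) * g ^+ m.
  have cp k := (let: And3 cf _ _ := Hp k in cf).
  apply: (Int_fatou (f_ := fun k x => `|mass * phi k x - moll (phi k) (dyad m) x| `^ q)).
  - by move=> k; exact: (HA (phi k) m (cp k).1 (C1c_bsupp Om_r0 (cp k))).1.
  - by move=> k x; exact: powR_ge0.
  - apply: measurable_powR_abs; apply: measurable_funB.
      by apply: measurable_funM => //; exact: measurable_cst.
    by apply: continuous_measurable_rV; exact: continuous_moll.
  - by move=> x; exact: powR_ge0.
  - apply: filterS cu => x cx.
    apply: (powR_abs_cvg (u := fun k => mass * phi k x - moll (phi k) (dyad m) x)) => //.
    apply: cvgB; first exact: cvgMr.
    apply: cvgMr.
    have kr := @kernel_rho R N; have [D _ HD] := kernel_bounded kr.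
    have [_ cv1] := minimizing_cvg Om_r0 min_u ltr01 (ltW q1)
      (moved_meas (dyad m) x kr) (fun y => HD _).
    rewrite (_ : cv u rho (dyad m) x = Int (fun y => u y `^ 1 * moved rho (dyad m) x y)); last first.
      by apply: Int_ext => y; rewrite powRr1.
    apply: cvg_trans cv1; apply: near_eq_cvg; apply: nearW => k.
    by apply: Int_ext => y; have [_ p0 _] := Hp k; rewrite powRr1// ger0_norm.
  - move=> k; have [_ Hk] := HA (phi k) m (cp k).1 (C1c_bsupp Om_r0 (cp k)).
    apply: (le_trans Hk); rewrite ler_wpM2r ?exprn_ge0 ?(ltW g0)// ler_wpM2l//.
    have [_ _ Ek] := Hp k.
    have q20 : 0 <= q / 2 by rewrite divr_ge0// ltW.
    have Ek1 : energy (phi k) <= I + 1.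
      by rewrite (le_trans Ek)// lerD2l exprn_ile1 ?invr_ge0// invf_le1// ler1n.
    by rewrite ge0_ler_powR ?nnegrE ?energy_ge0// addr_ge0// ltW.
have cI : Int (f m) @[m --> \oo] --> 0.
  have c : C * (I + 1) `^ (q / 2) * g ^+ n @[n --> \oo] --> 0.
    by rewrite -(mulr0 (C * (I + 1) `^ (q / 2))); apply: cvgMr; apply: cvg_expr; rewrite ger0_norm// ltW.
  apply/cvgr0Pnorm_le => e e0; move/cvgr0_norm_le : c => /(_ e e0); apply: filterS => m.
  apply: le_trans; rewrite ger0_norm; last by apply: Int_ge0 => x; exact: powR_ge0.
  exact: le_trans (Hf m).2 (ler_norm _).
have [m [mj ae0]] := ae_subsequence (fun m => (Hf m).1) (fun m x => powR_ge0 _ _) cI.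
exists m; split => //; apply: filterS ae0 => x cx.
have qi : 0 < q^-1 by rewrite invr_gt0.
have := powR_abs_cvg qi cx; rewrite normr0 powR0 ?lt0r_neq0// => c0.
apply/cvgrPdist_le => e e0; move/cvgr0_norm_le : c0 => /(_ e e0); apply: filterS => j.
rewrite ger0_norm ?powR_ge0// (ger0_norm (powR_ge0 _ _)) /f -powRrM mulfV ?lt0r_neq0// powRr1//.
Qed.

End minimizer.

(* The a.e. bound allows replacing the minimizer by its truncation, which is
   bounded everywhere. *)
Lemma exists_weak_solution : exists (u : V -> R) (B : R) (m : nat -> nat),
  [/\ 0 < I, measurable_fun setT u /\ (forall x, ~ Om x -> u x = 0), forall x, 0 <= u x <= B,
   L1 (fun x => u x `^ q) /\ Int (fun x => u x `^ q) = 1 &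
   [/\ subsolution q I u, weak_equation (fun x => I * u x `^ (q - 1)) u, forall j, (j <= m j)%N &
  {ae mu, forall x, moll u (dyad (m j)) x @[j --> \oo] --> mass * u x}]].
Proof.
have [phi [u [H min_u]]] := exists_minimizing openOm Om_r0 Om_x0 q2 subcritical.
have I0 := sobolev_inf_gt0 openOm Om_r0 Om_x0 q2 min_u.
have [Lq Iq] := minimizer_norm Om_r0 q2 min_u.
have [_ _ [mu_ u0 uOm] _ _] := min_u.
have [m [mj cu]] := minimizer_moll_cvg min_u.
have sub := minimizer_sub min_u; have weq := minimizer_eq min_u.
have [B B0 uB] := ae_upper_bound Om_r0 q2 subcritical I0 mu_ u0 uOm Lq Iq sub mj cu.
pose w x := Num.min (u x) B.
have uw : {ae mu, forall x, u x = w x} by apply: filterS uB => x h; rewrite /w min_l.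
have mw : measurable_fun setT w by apply: measurable_minr => //; exact: measurable_cst.
have w0 x : 0 <= w x by rewrite /w le_min u0 B0.
have wu x : w x <= u x by rewrite /w ge_min lexx.
have EI (F : R -> V -> R) : L1 (fun x => F (u x) x) -> measurable_fun setT (fun x => F (w x) x) ->
    L1 (fun x => F (w x) x) /\ Int (fun x => F (w x) x) = Int (fun x => F (u x) x).
  move=> LF mF.
  have L : L1 (fun x => F (w x) x).
    have [_ fin] := (L1P _).1 LF; apply/L1P; split => //.
    rewrite (_ : (\int[mu]_x _)%E = (\int[mu]_x `|F (u x) x|%:E)%E)//.
    apply: ae_eq_integral => //; [| |by apply: filterS uw => x ->].
    - by apply/measurable_EFinP; exact: measurableT_comp.
    - by apply/measurable_EFinP; apply: measurableT_comp => //; exact: L1_meas.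
  by split => //; apply: Int_ae => //; apply: filterS uw => x ->.
have mpow e : measurable_fun setT (fun x => w x `^ e).
  by apply: (@measurableT_comp _ _ _ _ _ _ (@powR R ^~ e)) => //; exact: measurable_powR.
have L1u : L1 u.
  have qq := ltW q1.
  by apply: L1_ext (L1_lower_power Om_r0 q2 mu_ u0 uOm Lq ltr01 qq) => x; rewrite powRr1.
have mollw s x : moll w s x = moll u s x.
  congr (_ * _); apply: (EI (fun t y => t * rho (s *: (x - y))) _ _).2.
    exact: cv_L1 L1u (@kernel_rho R N).
  by apply: measurable_funM => //; exact: moved_meas (@kernel_rho R N).
have wk psi : Ck setT 2 psi -> bsupp psi ->
    Int (fun x => w x `^ (q - 1) * psi x) = Int (fun x => u x `^ (q - 1) * psi x) /\
    Int (fun x => w x * laplacian psi x) = Int (fun x => u x * laplacian psi x).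
  move=> c2 bp; have [LA LB] := minimizer_L1 min_u c2 bp; split.
    apply: (EI (fun t x => t `^ (q - 1) * psi x) _ _).2 => //.
    by apply: measurable_funM => //; apply: continuous_measurable_rV; exact: CkT_cont c2.
  apply: (EI (fun t x => t * laplacian psi x) _ _).2 => //.
  by apply: measurable_funM => //; apply: continuous_measurable_rV; exact: continuous_laplacian.
exists w, B, m; split.
- exact: I0.
- by split => // x nx; rewrite /w uOm// min_l.
- by move=> x; rewrite w0 /w ge_min lexx orbT.
- by have [L E] := EI (fun t x => t `^ q) Lq (mpow q); rewrite E Iq.
split; last 1 first.
- apply: filterS2 uw cu => x <-; apply: cvg_trans.
  by apply: near_eq_cvg; apply: nearW => j; rewrite mollw.
- by move=> psi c2 bp p0; have [E1 E2] := wk _ c2 bp; rewrite E1 E2; exact: sub.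
- move=> psi c2 sp; have bp := compact_bsupp sp; have [E1 E2] := wk _ c2 bp.
  apply: (etrans E2); apply: (etrans (weq psi c2 sp)).
  have [LA _] := minimizer_L1 min_u c2 bp.
  congr (- _); apply: esym; apply: (EI (fun t x => I * t `^ (q - 1) * psi x) _ _).2.
  + by apply: L1_ext (L1Z I LA) => x; rewrite mulrA.
  + apply: measurable_funM; last by apply: continuous_measurable_rV; exact: CkT_cont c2.
    by apply: measurable_funM => //; exact: measurable_cst.
- exact: mj.
Qed.

End weak_solution.

(** * Interior regularity and positivity *)

Section local_limits.
Context {R : realType} {N : nat}.
Notation V := 'rV[R]_N.
Notation e_ i := (delta_mx ord0 i : V).

Lemma geo_cvg (C : R) : C * 2^-1 ^+ n @[n --> \oo] --> 0.
Proof.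
rewrite -(mulr0 C); apply: cvgMr; apply: cvg_expr.
by rewrite ger0_norm ?invr_ge0// invf_lt1// ltr1n.
Qed.

Lemma cvg_sumr (I : Type) (s : seq I) (a : I -> nat -> R) (l : I -> R) :
  (forall i, a i n @[n --> \oo] --> l i) -> \sum_(i <- s) a i n @[n --> \oo] --> \sum_(i <- s) l i.
Proof.
move=> H; elim: s => [|i s IH].
  rewrite (_ : (fun n => _) = fun=> 0); last by apply/funext => n; rewrite big_nil.
  by rewrite big_nil; exact: cvg_cst.
rewrite (_ : (fun n => _) = fun n => a i n + \sum_(j <- s) a j n); last by apply/funext => n; rewrite big_cons.
by rewrite big_cons; exact: cvgD (H i) IH.
Qed.

Variables (A : nat -> V -> R) (x0 : V) (r C : R) (n0 : nat).
Hypotheses (r0 : 0 < r) (C0 : 0 <= C)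
  (HA : forall n x, (n0 <= n)%N -> `|x - x0| < r -> `|A n.+1 x - A n x| <= C * 2^-1 ^+ n).
Let a x := limn (A ^~ x).

Lemma local_limit x : `|x - x0| < r -> A n x @[n --> \oo] --> a x /\
  forall n, (n0 <= n)%N -> `|A n x - a x| <= 2 * C * 2^-1 ^+ n.
Proof. by move=> xr; apply: geo_limit => // n n0n; exact: HA. Qed.

Lemma local_uniform (e : R) : 0 < e -> \forall n \near \oo, forall y, `|y - x0| < r -> `|A n y - a y| <= e.
Proof.
move=> e0; have c := geo_cvg (2 * C); move/cvgr0_norm_le : c => /(_ e e0)[n1 _ H1].
exists (maxn n0 n1) => // n /=; rewrite geq_max => /andP[h0 h1] y yr.
by rewrite (le_trans ((local_limit yr).2 n h0))// (le_trans (ler_norm _))//; exact: H1.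
Qed.

Lemma local_continuous : (forall n, continuous (A n)) -> {for x0, continuous a}.
Proof.
move=> cA; apply: (ball_limit_continuous (f_ := A) r0) => e e0.
have [n1 _ H1] := local_uniform e0; exists n1; first exact: cA.
by move=> y yr; exact: H1 (leqnn n1) y yr.
Qed.

Lemma local_derive (B : nat -> V -> R) (b : V -> R) i : (forall n, continuous (A n)) ->
  (forall n y, is_derive y (e_ i) (B n) (A n y)) ->
  (forall y, `|y - x0| < r -> B n y @[n --> \oo] --> b y) -> is_derive x0 (e_ i) b (a x0).
Proof.
move=> cA DB cB; apply: (uniform_limit_derive (f_ := B) r0 cB); last exact: local_continuous.
  by apply: nearW => n y _; have [] := DB n y.
move=> e e0; apply: filterS (local_uniform e0) => n H y yr.
by rewrite (is_derive_partial (DB n y)); exact: H.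
Qed.

End local_limits.

Section regularity.
Context {R : realType} {M : nat}.
Local Notation N := M.+2.
Notation V := 'rV[R]_N.
Notation mu := (lebesgue_rV N).
Notation e_ i := (delta_mx ord0 i : V).
Local Notation mass := (@rho_mass R M.+2).
Local Notation theta := (@bumpf R M.+2 0).

Lemma moll_cvg_at (f : V -> R) x : L1 f -> {for x, continuous f} ->
  moll f (dyad n) x @[n --> \oo] --> mass * f x.
Proof.
move=> Lf cf; apply/cvgrPdist_le => e e0.
have c0 := @rho_mass_gt0 R N; have e1 : 0 < e / mass by rewrite divr_gt0.
move/cvgrPdist_le : cf => /(_ _ e1)/nbhs_ballP[d /= d0 H].
have d2 : 0 < d / 2 by rewrite divr_gt0.
have g := geo_cvg (1 : R); move/cvgr0_norm_le : g => /(_ _ d2); apply: filterS => n.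
rewrite mul1r ger0_norm ?exprn_ge0 ?invr_ge0// => hn.
have Lr := kernel_L1 (@kernel_rho R N).
rewrite distrC moll_sub ?dyad_gt0//.
have Lm : L1 (fun z => (f (x - (dyad n)^-1 *: z) - f x) * rho z).
  apply: L1_ext (L1B (moll_L1 x (dyad_gt0 n) Lf) (L1Z (f x) Lr)) => z.
  by rewrite mulrBl.
apply: (le_trans (le_Int_abs Lm)).
have -> : e = e / mass * mass by rewrite divfK// lt0r_neq0.
rewrite -IntZ//; apply: le_Int; [exact: L1_abs|exact: L1Z|move=> z].
rewrite normrM (ger0_norm (rho_ge0 z)).
have [z1|z1] := ltP 1 (sqn z); first by rewrite (@kernel_rho R N).2// !mulr0.
rewrite ler_wpM2r ?rho_ge0// distrC; apply: H.
rewrite mx_norm_ball /ball_/= opprB addrC subrK normrZ.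
rewrite ger0_norm ?invr_ge0 ?(ltW (dyad_gt0 n))// /dyad -exprVn.
apply: (@le_lt_trans _ _ (2^-1 ^+ n)).
  rewrite ler_piMr ?exprn_ge0 ?invr_ge0//.
  by rewrite -(@expr_le1 _ 2)// (le_trans (norm_le_sqn z)).
by apply: (le_lt_trans hn); rewrite ltr_pdivrMr// ltr_pMr// ltr1n.
Qed.

Variables (Om : set V) (u f : V -> R) (F : R).
Hypotheses (openOm : open Om) (Lu : L1 u) (Lf : L1 f) (fF : forall x, `|f x| <= F)
  (weq : weak_equation Om f u).

Let F0 : 0 <= F. Proof. exact: le_trans (fF 0). Qed.

(** [scaled N rho n] is the mollification of [u] at scale [2^n]; each differentiation in [x] adds a
    power of [dyad n] and a derivative on the kernel. *)
Definition scaled d chi n x : R := dyad n ^+ d * cv u chi (dyad n) x.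

Lemma scaled_derive d chi j n x : unit_kernel chi ->
  is_derive x (e_ j) (scaled d chi n) (scaled d.+1 (partial j chi) n x).
Proof.
move=> kc; rewrite /scaled exprSr -mulrA; apply: is_derive_scl.
exact: cv_derive_x.
Qed.

Lemma continuous_scaled d chi n : unit_kernel chi -> continuous (scaled d chi n).
Proof.
by move=> kc; apply: (CkT_cont (k := 0)); apply: Ck_scl; [exact: openT|exact: Ck_cv].
Qed.

Let mkernel th (s : R) x : 0 < s -> unit_kernel th -> (forall y, `|y - x| <= s^-1 -> Om y) ->
  forall y, ~ `|y - x| <= s^-1 -> moved th s x y = 0.
Proof.
move=> s0 kt _ y /negP; rewrite -ltNge => h; apply: moved_supp => //.
by rewrite gtr0_norm// distrC -ltr_pdivrMl// mulr1.
Qed.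

Lemma cv_weak th (s : R) x : 0 < s -> unit_kernel th -> (forall y, `|y - x| <= s^-1 -> Om y) ->
  cv u (laplacian th) s x = - (s ^- 2 * cv f th s x).
Proof.
move=> s0 kt H; apply: cv_laplacian_weak => //.
apply: weq; first exact: moved_Cinfty.
exists [set y | `|y - x| <= s^-1]; first exact: compact_ball.
by split; [exact: H|exact: mkernel].
Qed.

(** The length [2^n] of the dyadic interval turns a bound [s^-2] of the scale derivative into the
    summable [2^-n]. *)
Lemma scaled_step d chi th (Q : R) n x : 0 <= Q -> unit_kernel chi -> unit_kernel th -> euler_hom d.+1 chi th ->
  (forall s, dyad n <= s -> `|s ^+ d * cv u (laplacian th) s x| <= Q * s ^- 2) ->
  `|scaled d.+1 chi n.+1 x - scaled d.+1 chi n x| <= Q * 2^-1 ^+ n.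
Proof.
move=> Q0 kc kt hc HQ; have d0 := @dyad_gt0 R n.
have dS : dyad n.+1 = 2 * dyad n :> R by rewrite /dyad exprS.
have dle : dyad n <= dyad n.+1 :> R by rewrite dS ler_peMl ?ler1n ?ltW.
have HB s : dyad n <= s -> s <= dyad n.+1 -> `|s ^+ d * cv u (laplacian th) s x| <= Q * dyad n ^- 2.
  move=> s1 _; have s0 := lt_le_trans d0 s1.
  rewrite (le_trans (HQ s s1))// ler_wpM2l// lef_pV2 ?posrE ?exprn_gt0//.
  by rewrite lerXn2r ?nnegrE// ltW.
apply: (le_trans (cv_hom_step d0 dle Lu kc kt hc HB)).
rewrite dS exprVn -[2 ^+ n]/(dyad n) le_eqVlt; apply/orP; left; apply/eqP.
by field; rewrite lt0r_neq0.
Qed.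

Definition deep (K : set V) n x := forall y, `|y - x| <= 2^-1 ^+ n -> K y.

Lemma deep_dyad (K : set V) n x (s : R) : deep K n x -> dyad n <= s -> forall y, `|y - x| <= s^-1 -> K y.
Proof.
move=> dK sn y h; apply: dK; apply: (le_trans h).
have s0 : 0 < s by apply: lt_le_trans sn; exact: dyad_gt0.
by rewrite exprVn lef_pV2 ?posrE ?exprn_gt0.
Qed.

Lemma local_deep x0 : Om x0 -> exists (K : set V) (r : R) (n0 : nat), [/\ compact K, K `<=` Om, 0 < r &
  forall x, `|x - x0| < r -> forall n, (n0 <= n)%N -> deep K n x].
Proof.
move=> Ox; have /nbhs_ballP[e /= e0 He] : nbhs x0 Om by exact: open_nbhs_nbhs.
have e4 : 0 < e / 4 by rewrite divr_gt0.
have g := geo_cvg (1 : R); move/cvgr0_norm_le : g => /(_ _ e4)[n0 _ Hn].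
exists [set y | `|y - x0| <= e / 2], (e / 4), n0; split => //; first exact: compact_ball.
  move=> z /= h; apply: He; rewrite mx_norm_ball /ball_/= distrC (le_lt_trans h)//.
  by rewrite ltr_pdivrMr// ltr_pMr// ltr1n.
move=> x xr n n0n y yx /=.
have := Hn n n0n; rewrite /= mul1r ger0_norm ?exprn_ge0 ?invr_ge0// => h.
have -> : y - x0 = (y - x) + (x - x0) by rewrite addrA subrK.
apply: (le_trans (ler_normD _ _)).
have -> : e / 2 = e / 4 + e / 4 by lra.
by rewrite lerD// ?(ltW xr)// (le_trans yx).
Qed.

Let T1 (chi : V -> R) : R := Int (fun z : V => `|chi z|).

Let T10 (chi : V -> R) : 0 <= T1 chi. Proof. by apply: Int_ge0. Qed.

Let cvf th s x : 0 < s -> unit_kernel th -> `|cv f th s x| <= F * (s ^- N * T1 th).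
Proof. by move=> s0 kt; apply: cv_bound_sup. Qed.

Lemma scaled_step0 n x : deep Om n x ->
  `|scaled N rho n.+1 x - scaled N rho n x| <= F * T1 theta * 2^-1 ^+ n.
Proof.
have kb := @kernel_bump R N 0; move=> dO.
apply: (scaled_step _ (@kernel_rho R N) kb (@hom_base R N)); first by rewrite mulr_ge0.
move=> s sn; have s0 : 0 < s by apply: lt_le_trans sn; exact: dyad_gt0.
(* For the function itself the decay is [s^-3]; [s >= 1] weakens it to the form [s^-2] used for the
   derivatives too. *)
have s1 : 1 <= s by apply: le_trans sn; rewrite exprn_ege1// ler1n.
rewrite cv_weak//; last exact: deep_dyad dO sn.
have P : 0 <= s ^+ M.+1 * s ^- 2 by rewrite mulr_ge0 ?invr_ge0 ?exprn_ge0// ltW.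
rewrite mulrN normrN mulrA normrM (ger0_norm P).
apply: (le_trans (ler_wpM2l P (cvf x s0 kb))).
have -> : s ^+ M.+1 * s ^- 2 * (F * (s ^- N * T1 theta)) = (F * T1 theta * s ^- 2) * s^-1.
  have sp : s ^+ M.+1 != 0 by rewrite expf_neq0// lt0r_neq0.
  rewrite [s ^+ N]exprSr; move: (s ^+ M.+1) (T1 theta) sp => w t wp.
  by field; rewrite wp lt0r_neq0.
by rewrite ler_piMr ?invf_le1// mulr_ge0 ?invr_ge0 ?exprn_ge0 ?(ltW s0)// mulr_ge0.
Qed.

Let kpr i := kernel_partial i (@kernel_rho R N).
Let kpb i := kernel_partial i (@kernel_bump R N 0).
Let hom1 i := hom_step i (@kernel_rho R N) (@kernel_bump R N 0) (@hom_base R N).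

Lemma scaled_step1 i n x : deep Om n x ->
  `|scaled N.+1 (partial i rho) n.+1 x - scaled N.+1 (partial i rho) n x| <= F * T1 (partial i theta) * 2^-1 ^+ n.
Proof.
move=> dO.
apply: (scaled_step _ (kpr i) (kpb i) (@hom1 i)); first by rewrite mulr_ge0.
move=> s sn; have s0 : 0 < s by apply: lt_le_trans sn; exact: dyad_gt0.
rewrite (cv_weak s0 (kpb i) (deep_dyad dO sn)).
have P : 0 <= s ^+ N * s ^- 2 by rewrite mulr_ge0 ?invr_ge0 ?exprn_ge0// ltW.
rewrite mulrN normrN mulrA normrM (ger0_norm P).
apply: (le_trans (ler_wpM2l P (cvf x s0 (kpb i)))).
rewrite le_eqVlt; apply/orP; left; apply/eqP.
have sp : s ^+ N != 0 by rewrite expf_neq0// lt0r_neq0.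
move: (s ^+ N) (T1 _) sp => w t wp.
by field; rewrite wp lt0r_neq0.
Qed.

(** For second derivatives the bound of [f] alone would leave [s^-1], which is not summable over
    dyadic scales. Integration by parts moves one derivative from the kernel to [f] and restores
    [s^-2]; the kernel must then be supported in a compact subset of [Om]. *)
Lemma scaled_step2 (G : R) (K : set V) i j n x : compact K -> K `<=` Om -> deep K n x -> Ck Om 1 f -> 0 <= G ->
  (forall y, K y -> `|partial j f y| <= G) ->
  `|scaled N.+2 (partial j (partial i rho)) n.+1 x - scaled N.+2 (partial j (partial i rho)) n x| <=
  G * T1 (partial i theta) * 2^-1 ^+ n.
Proof.
move=> cK KO dK cf G0 fG; have kk := kernel_partial j (kpb i).
apply: (scaled_step _ (kernel_partial j (kpr i)) kk (hom_step j (kpr i) (kpb i) (@hom1 i))).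
  by rewrite mulr_ge0.
move=> s sn; have s0 : 0 < s by apply: lt_le_trans sn; exact: dyad_gt0.
have dKs := deep_dyad dK sn.
rewrite (cv_weak s0 kk); last by move=> y /dKs/KO.
have C1m : Ck setT 1 (moved (partial i theta) s x) by exact: moved_Cinfty.
have mK y : ~ K y -> moved (partial i theta) s x y = 0.
  move=> nK; apply: moved_supp => //; rewrite gtr0_norm// distrC -ltr_pdivrMl// mulr1 ltNge.
  by apply/negP => /dKs.
have clK : closed K by apply: compact_closed cK; exact: norm_hausdorff.
have bm := moved_bsupp x s0 (kpb i).
have I1 : cv f (partial j (partial i theta)) s x = s^-1 * Int (fun y => partial j f y * moved (partial i theta) s x y).
  rewrite (IBP_local j openOm clK KO cf C1m mK bm) (partial_moved s x j (kpb i)).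
  have -> : Int (fun y => f y * (- s * moved (partial j (partial i theta)) s x y)) = - s * cv f (partial j (partial i theta)) s x.
    rewrite -IntZ; last exact: cv_L1.
    by apply: Int_ext => y; rewrite mulrCA.
  by rewrite mulNr opprK mulKf// lt0r_neq0.
have Lm : L1 (fun y => partial j f y * moved (partial i theta) s x y).
  exact: (L1_glue openOm clK KO (Ck_partial (k := 0) j cf) (Ck_le (leq0n 1) C1m) mK bm).
have I2 : `|Int (fun y => partial j f y * moved (partial i theta) s x y)| <= G * (s ^- N * T1 (partial i theta)).
  have [La Ea] := Int_moved x s0 (L1_abs (kernel_L1 (kpb i))).
  apply: (le_trans (le_Int_abs Lm)).
  rewrite /T1 -Ea -IntZ//; apply: le_Int; [exact: L1_abs|exact: L1Z|move=> y].
  rewrite normrM; have [Ky|nKy] := pselect (K y); first by rewrite ler_wpM2r//; exact: fG.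
  by rewrite mK// normr0 mulr0 mulr_ge0.
have P : 0 <= s ^+ N.+1 * s ^- 2 * s^-1 by rewrite mulr_ge0 ?invr_ge0 ?(ltW s0)// mulr_ge0 ?invr_ge0 ?exprn_ge0 ?(ltW s0).
rewrite I1 mulrN normrN 2!mulrA normrM (ger0_norm P); apply: (le_trans (ler_wpM2l P I2)).
rewrite le_eqVlt; apply/orP; left; apply/eqP.
have sp : s ^+ N != 0 by rewrite expf_neq0// lt0r_neq0.
rewrite [s ^+ N.+1]exprSr; move: (s ^+ N) (T1 _) sp => w t wp.
by field; rewrite wp lt0r_neq0.
Qed.

Hypothesis ptw : forall x, Om x -> moll u (dyad n) x @[n --> \oo] --> mass * u x.

Let m0 : 0 < mass. Proof. exact: rho_mass_gt0. Qed.

Let D1 i x := mass^-1 * limn (fun n => scaled N.+1 (partial i rho) n x).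
Let D2 i j x := mass^-1 * limn (fun n => scaled N.+2 (partial j (partial i rho)) n x).

Let local1 x0 : Om x0 -> exists (K : set V) (r : R) (n0 : nat), [/\ compact K, K `<=` Om, 0 < r &
  forall n x, (n0 <= n)%N -> `|x - x0| < r -> deep K n x /\ Om x].
Proof.
move=> Ox; have [K [r [n0 [cK KO r0 H]]]] := local_deep Ox.
exists K, r, n0; split => // n x n0n xr; split; first exact: H.
by apply: KO; apply: (H x xr n n0n); rewrite subrr normr0 exprn_ge0// invr_ge0.
Qed.

Let Omr x0 K r (n0 : nat) : (forall n x, (n0 <= n)%N -> `|x - x0| < r -> deep K n x /\ Om x) ->
  forall x, `|x - x0| < r -> Om x.
Proof. by move=> H x xr; exact: (H n0 x (leqnn _) xr).2. Qed.

Let deepO K n x : K `<=` Om -> deep K n x -> deep Om n x.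
Proof. by move=> KO dK y /dK/KO. Qed.

Lemma regular_derive i x0 : Om x0 -> is_derive x0 (e_ i) u (D1 i x0) /\ {for x0, continuous (D1 i)}.
Proof.
move=> Ox; have [K [r [n0 [cK KO r0 H]]]] := local1 Ox.
have cA n : continuous (scaled N.+1 (partial i rho) n) by exact: continuous_scaled.
have st n x : (n0 <= n)%N -> `|x - x0| < r -> `|scaled N.+1 (partial i rho) n.+1 x - scaled N.+1 (partial i rho) n x| <= F * T1 (partial i theta) * 2^-1 ^+ n.
  by move=> n0n xr; apply: scaled_step1; exact: deepO KO (H n x n0n xr).1.
have Q0 : 0 <= F * T1 (partial i theta) by rewrite mulr_ge0.
split.
  have D := local_derive r0 Q0 st cA (fun n y => scaled_derive N i n y (@kernel_rho R N))
    (fun y yr => ptw (Omr H yr)).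
  have := is_derive_scl mass^-1 D.
  by rewrite (_ : (fun y => _) = u)//; apply/funext => y; rewrite mulKf// lt0r_neq0.
have c := local_continuous r0 Q0 st cA.
exact: (@continuousM _ _ (fun=> mass^-1) _ x0 (@cst_continuous _ _ _ _) c).
Qed.

Lemma regular_C1 : Ck Om 1 u.
Proof.
split.
  move=> x0 Ox; have [K [r [n0 [cK KO r0 H]]]] := local1 Ox.
  have cA n : continuous (scaled N rho n) by apply: continuous_scaled; exact: kernel_rho.
  have st n x : (n0 <= n)%N -> `|x - x0| < r -> `|scaled N rho n.+1 x - scaled N rho n x| <= F * T1 theta * 2^-1 ^+ n.
    by move=> n0n xr; apply: scaled_step0; exact: deepO KO (H n x n0n xr).1.
  have Q0 : 0 <= F * T1 theta by rewrite mulr_ge0.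
  have c := local_continuous r0 Q0 st cA.
  apply: (near_continuous (f := fun x => mass^-1 * limn (fun n => scaled N rho n x))); last first.
    exact: (@continuousM _ _ (fun=> mass^-1) _ x0 (@cst_continuous _ _ _ _) c).
  have : nbhs x0 Om by exact: open_nbhs_nbhs.
  apply: filterS => x Hx /=.
  by rewrite (cvg_lim _ (ptw Hx))// mulKf// lt0r_neq0.
move=> i; split.
  by move=> x Ox; have [[]] := regular_derive i Ox.
split => // x Ox; apply: (near_continuous (f := D1 i)); last exact: (regular_derive i Ox).2.
have : nbhs x Om by exact: open_nbhs_nbhs.
by apply: filterS => y Oy; rewrite (is_derive_partial (regular_derive i Oy).1).
Qed.

Lemma regular_derive2 i j x0 : Ck Om 1 f -> Om x0 ->
  [/\ is_derive x0 (e_ j) (D1 i) (D2 i j x0), {for x0, continuous (D2 i j)} &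
   scaled N.+2 (partial j (partial i rho)) n x0 @[n --> \oo] --> mass * D2 i j x0].
Proof.
move=> cf Ox; have [K [r [n0 [cK KO r0 H]]]] := local1 Ox.
have [G G0 HG] : exists2 G : R, 0 <= G & forall y, K y -> `|partial j f y| <= G.
  by apply: compact_bounded_on cK _ => y Ky; exact: Ck_cont (Ck_partial (k := 0) j cf) y (KO y Ky).
have cA n : continuous (scaled N.+2 (partial j (partial i rho)) n).
  by apply: continuous_scaled; exact: kernel_partial.
have st n x : (n0 <= n)%N -> `|x - x0| < r -> `|scaled N.+2 (partial j (partial i rho)) n.+1 x - scaled N.+2 (partial j (partial i rho)) n x| <= G * T1 (partial i theta) * 2^-1 ^+ n.
  by move=> n0n xr; exact: scaled_step2 cK KO (H n x n0n xr).1 cf G0 HG.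
have Q0 : 0 <= G * T1 (partial i theta) by rewrite mulr_ge0.
have st1 n x : (n0 <= n)%N -> `|x - x0| < r -> `|scaled N.+1 (partial i rho) n.+1 x - scaled N.+1 (partial i rho) n x| <= F * T1 (partial i theta) * 2^-1 ^+ n.
  by move=> n0n xr; apply: scaled_step1; exact: deepO KO (H n x n0n xr).1.
have Q1 : 0 <= F * T1 (partial i theta) by rewrite mulr_ge0.
split.
- apply: is_derive_scl.
  apply: (local_derive r0 Q0 st cA (fun n y => scaled_derive N.+1 j n y (kpr i))) => y yr.
  exact: (local_limit Q1 st1 yr).1.
- have c := local_continuous r0 Q0 st cA.
  exact: (@continuousM _ _ (fun=> mass^-1) _ x0 (@cst_continuous _ _ _ _) c).
- rewrite /D2 mulrA mulfV ?lt0r_neq0// mul1r.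
  by apply: (local_limit Q0 st _).1; rewrite subrr normr0.
Qed.

Lemma regular_partial i x : Om x -> partial i u x = D1 i x.
Proof. by move=> Ox; rewrite (is_derive_partial (regular_derive i Ox).1). Qed.

Lemma regular_partial2 i j x : Ck Om 1 f -> Om x -> partial j (partial i u) x = D2 i j x.
Proof.
move=> cf Ox; rewrite (near_partial (g := D1 i)).
  by have [D _ _] := regular_derive2 i j cf Ox; exact: is_derive_partial D.
have : nbhs x Om by exact: open_nbhs_nbhs.
by apply: filterS => y; exact: regular_partial.
Qed.

Lemma regular_C2 : Ck Om 1 f -> Ck Om 2 u /\ forall x, Om x -> - laplacian u x = f x.
Proof.
move=> cf; split.
  have [c1 c1'] := regular_C1; split => // i; split; first exact: (c1' i).1.
  apply: (Ck_ext openOm (f := D1 i)); first by move=> x Ox; rewrite regular_partial.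
  split; first by move=> x Ox; exact: (regular_derive i Ox).2.
  move=> j; split; first by move=> x Ox; have [[]] := regular_derive2 i j cf Ox.
  apply: (Ck_ext openOm (f := D2 i j)); last by split => // x Ox; have [] := regular_derive2 i j cf Ox.
  move=> x Ox; have [D _ _] := regular_derive2 i j cf Ox.
  by rewrite (is_derive_partial D).
move=> x Ox; have cx := Ck_cont cf Ox.
have cR : - moll f (dyad n) x @[n --> \oo] --> - (mass * f x) by apply: cvgN; exact: moll_cvg_at.
have cL : \sum_i scaled N.+2 (partial i (partial i rho)) n x @[n --> \oo] --> \sum_i mass * D2 i i x.
  have c2 i : scaled N.+2 (partial i (partial i rho)) n x @[n --> \oo] --> mass * D2 i i x.
    by have [] := regular_derive2 i i cf Ox.
  exact: (@cvg_sumr R 'I_N (index_enum 'I_N) (fun i n => scaled N.+2 (partial i (partial i rho)) n x) (fun i => mass * D2 i i x) c2).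
(* The weak equation tested with the kernel itself: the Laplacian of the mollification of [u] is
   minus the mollification of [f], as soon as the kernel at [x] is supported in [Om]. *)
have E : \forall n \near \oo, \sum_i scaled N.+2 (partial i (partial i rho)) n x = - moll f (dyad n) x.
  have [K [r [n0 [cK KO r0 H]]]] := local1 Ox.
  exists n0 => // n /= n0n.
  have dO : deep Om n x by apply: deepO KO (H n x n0n _).1; rewrite subrr normr0.
  have d0 := @dyad_gt0 R n.
  rewrite -mulr_sumr.
  have -> : \sum_i cv u (partial i (partial i rho)) (dyad n) x = cv u (laplacian rho) (dyad n) x.
    rewrite /cv -Int_sum; last by move=> i; apply: cv_L1 => //; exact: kernel_partial.
    by apply: Int_ext => y; rewrite /laplacian mulr_sumr.
  rewrite (cv_weak d0 (@kernel_rho R N) (deep_dyad dO (lexx _))).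
  rewrite mulrN /moll; congr (- _).
  by rewrite mulrA -addn2 exprD mulfK// expf_neq0// lt0r_neq0.
have cL' : - moll f (dyad n) x @[n --> \oo] --> \sum_i mass * D2 i i x.
  by apply: cvg_trans cL; exact: near_eq_cvg.
have := cvg_unique _ cL' cR; rewrite -mulr_sumr => /(_ (@norm_hausdorff _ _)) E2.
have -> : laplacian u x = \sum_i D2 i i x.
  by apply: eq_bigr => i _; exact: regular_partial2.
by apply: (mulfI (lt0r_neq0 m0)); rewrite mulrN E2 opprK.
Qed.

End regularity.

Section positive_power.
Context {R : realType}.

(** Extends [s^e] by [0] to negative [s]; for [e > 1] the extension is [C^1] on the line, as
    [C1_comp] demands. *)
Definition pos_pow (e s : R) : R := `|Num.max s 0| `^ e.

Lemma continuous_powR_abs (e : R) : 0 < e -> continuous (fun t : R => `|t| `^ e).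
Proof.
move=> e0 t; have [->|t0] := eqVneq t 0; last first.
  have cc : {for `|t|, continuous (fun t : R => t `^ e)}.
    apply: differentiable_continuous; apply/derivable1_diffP.
    have t1 : 0 < `|t| by rewrite normr_gt0.
    by have [] := is_derive1_powR e t1.
  by apply: (@continuous_comp _ _ _ (fun t : R => `|t|) (fun t : R => t `^ e)) cc; exact: norm_continuous.
apply/(@cvgrPdist_le _ _ _ (nbhs (0 : R))) => d d0.
have d1 : 0 < d `^ e^-1 by exact: powR_gt0.
have := @norm_continuous R R^o 0 => /(@cvgrPdist_le _ _ _ (nbhs (0 : R)))/(_ _ d1).
apply: filterS => s; rewrite !normr0 powR0 ?lt0r_neq0// !sub0r !normrN normr_id => h.
rewrite ger0_norm ?powR_ge0//.
have -> : d = (d `^ e^-1) `^ e by rewrite -powRrM mulVf ?lt0r_neq0// powRr1// ltW.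
by rewrite ge0_ler_powR ?nnegrE ?(ltW e0)// ltW.
Qed.

Lemma continuous_pos_pow (e : R) : 0 < e -> continuous (pos_pow e).
Proof.
move=> e0 s; apply: (@continuous_comp _ _ _ (fun s : R => Num.max s 0) (fun t => `|t| `^ e)).
  by apply: (@continuous_max _ _ (fun s : R => s) (fun=> 0)); [exact: cvg_id|exact: cst_continuous].
exact: continuous_powR_abs.
Qed.

Lemma pos_pow_ge0 (e s : R) : 0 <= s -> pos_pow e s = s `^ e.
Proof. by move=> s0; rewrite /pos_pow max_l// ger0_norm. Qed.

Lemma pos_pow_le0 (e s : R) : 0 < e -> s <= 0 -> pos_pow e s = 0.
Proof. by move=> e0 s0; rewrite /pos_pow max_r// normr0 powR0// lt0r_neq0. Qed.

Lemma is_derive_pos_pow (e s : R) : 1 < e -> is_derive s 1 (pos_pow e) (e * pos_pow (e - 1) s).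
Proof.
move=> e1; have e0 : 0 < e by exact: lt_trans e1.
have e10 : 0 < e - 1 by rewrite subr_gt0.
have [s0|s0|s0] := ltgtP s 0.
- rewrite (pos_pow_le0 e10 (ltW s0)) mulr0; apply/is_derive_epsP => d d0.
  exists (- s); first by rewrite oppr_gt0.
  move=> h h0 hs; rewrite -[h *: 1]/(h * 1) mulr1 mulr0 subr0.
  rewrite (pos_pow_le0 e0 (ltW s0)) subr0 pos_pow_le0 ?normr0 ?mulr_ge0 ?(ltW d0)//.
  by have := ler_norm h; lra.
- rewrite (pos_pow_ge0 (e - 1) (ltW s0)); apply/is_derive_epsP => d d0.
  have := is_derive1_powR e s0 => /is_derive_epsP/(_ d d0)[del del0 H].
  exists (Num.min del s); first by rewrite lt_min del0.
  move=> h h0; rewrite lt_min => /andP[h1 h2].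
  have := H h h0 h1; rewrite -[h *: 1]/(h * 1) mulr1 => H1.
  rewrite (pos_pow_ge0 e (ltW s0)) pos_pow_ge0//.
  by have := ler_norm (- h); rewrite normrN; lra.
- rewrite s0 (pos_pow_le0 e10 (lexx 0)) mulr0; apply/is_derive_epsP => d d0.
  exists (d `^ (e - 1)^-1); first exact: powR_gt0.
  move=> h h0 hd; rewrite -[h *: 1]/(h * 1) mulr1 mulr0 subr0 addr0.
  rewrite (pos_pow_le0 e0 (lexx 0)) subr0.
  have [hp|hn] := leP 0 h; last by rewrite pos_pow_le0 ?(ltW hn)// normr0 mulr_ge0// ltW.
  rewrite (pos_pow_ge0 e hp) ger0_norm ?powR_ge0//.
  have -> : e = e - 1 + 1 by rewrite subrK.
  rewrite powRD; last by rewrite h0 implybT.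
  rewrite powRr1// ger0_norm// ler_wpM2r//.
  have -> : d = (d `^ (e - 1)^-1) `^ (e - 1) by rewrite -powRrM mulVf ?lt0r_neq0// powRr1// ltW.
  rewrite ge0_ler_powR ?nnegrE ?powR_ge0 ?(ltW e10)//.
  by rewrite (le_trans (ler_norm _))// ltW.
Qed.

End positive_power.

(** * Regular representative of the minimizer *)

Section ground_state_regularity.
Context {R : realType} {M : nat}.
Local Notation N := M.+2.
Notation V := 'rV[R]_N.
Notation mu := (lebesgue_rV N).
Local Notation mass := (@rho_mass R M.+2).
Variables (Om : set V) (r0 q : R) (x0 : V).
Hypotheses (openOm : open Om) (Om_r0 : forall x, Om x -> `|x| <= r0) (Om_x0 : Om x0).
Hypotheses (q2 : 2 < q) (subcritical : M%:R * (q - 2) < 4).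
Let q0 : 0 < q. Proof. exact: lt_trans q2. Qed.
Let q1 : 1 < q. Proof. by apply: lt_trans q2; rewrite ltr1n. Qed.
Let q10 : 0 < q - 1. Proof. by rewrite subr_gt0. Qed.
Let q11 : 1 < q - 1. Proof. by have := q2; lra. Qed.
Local Notation I := (sobolev_inf Om q).

Lemma L1_ae (f g : V -> R) : L1 f -> measurable_fun setT g -> {ae mu, forall x, f x = g x} ->
  L1 g /\ Int g = Int f.
Proof.
move=> Lf mg fg.
have L : L1 g.
  have [mf fin] := (L1P _).1 Lf; apply/L1P; split => //.
  rewrite (_ : (\int[mu]_x `|g x|%:E)%E = (\int[mu]_x `|f x|%:E)%E)//.
  apply: ae_eq_integral => //; [| |by apply: filterS fg => x ->].
  - by apply/measurable_EFinP; exact: measurableT_comp.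
  - by apply/measurable_EFinP; exact: measurableT_comp.
by split => //; apply: Int_ae => //; apply: filterS fg => x ->.
Qed.

Lemma moll_bounds (u : V -> R) (B s : R) x : 0 < s -> L1 u -> (forall x, 0 <= u x <= B) ->
  0 <= moll u s x <= B * mass.
Proof.
move=> s0 Lu uB; rewrite mollE//; have Lr := kernel_L1 (@kernel_rho R N).
rewrite Int_ge0 /=; last by move=> z; rewrite mulr_ge0 ?rho_ge0//; have /andP[] := uB (x - s^-1 *: z).
rewrite -IntZ//; apply: le_Int; [exact: moll_L1|exact: L1Z|move=> z].
by rewrite ler_wpM2r ?rho_ge0//; have /andP[] := uB (x - s^-1 *: z).
Qed.

Definition regular_weak (w : V -> R) (B : R) :=
  [/\ measurable_fun setT w /\ (forall x, ~ Om x -> w x = 0), forall x, 0 <= w x <= B,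
    L1 (fun x => w x `^ q) /\ Int (fun x => w x `^ q) = 1,
    subsolution q I w /\ weak_equation Om (fun x => I * w x `^ (q - 1)) w &
    forall x, Om x -> moll w (dyad n) x @[n --> \oo] --> mass * w x].

(** Choice of a representative: at every point of [Om] the mollifications converge, their dyadic
    steps being geometric because the right-hand side is bounded. The limit agrees almost everywhere
    with the weak solution and has the same integrals. *)
Lemma exists_regular_weak : 0 < I /\ exists w B, regular_weak w B.
Proof.
have [u [B [m [I0 [mu_ uOm] uB [Lq Iq] [sub weq mj cu]]]]] :=
  exists_weak_solution openOm Om_r0 Om_x0 q2 subcritical.
split => //.
have u0 x : 0 <= u x by have /andP[] := uB x.
have qq : q - 1 <= q by rewrite gerBl.
have L1u : L1 u.
  by apply: L1_ext (L1_lower_power Om_r0 q2 mu_ u0 uOm Lq ltr01 (ltW q1)) => x; rewrite powRr1.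
have Lf := L1Z I (L1_lower_power Om_r0 q2 mu_ u0 uOm Lq q10 qq).
have fF x : `|I * u x `^ (q - 1)| <= I * B `^ (q - 1).
  have /andP[h0 h1] := uB x.
  rewrite ger0_norm ?mulr_ge0 ?powR_ge0 ?(ltW I0)// ler_wpM2l ?(ltW I0)//.
  by rewrite ge0_ler_powR ?nnegrE ?(ltW q10)// (le_trans h0).
pose l x := limn (fun n => moll u (dyad n) x).
have cl x : Om x -> moll u (dyad n) x @[n --> \oo] --> l x.
  move=> Ox; have [K [r [n0 [cK KO r0' H]]]] := local_deep openOm Ox.
  have C0 : 0 <= I * B `^ (q - 1) * Int (fun z : V => `|bumpf 0 z|).
    by rewrite mulr_ge0 ?Int_ge0// (le_trans _ (fF x)).
  apply: (local_limit (A := fun n x => moll u (dyad n) x) (x0 := x) (r := r) (n0 := n0) C0 _ _).1.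
    move=> n y n0n yr; apply: (scaled_step0 L1u Lf fF weq) => z zy.
    exact: KO (H y yr n n0n z zy).
  by rewrite subrr normr0.
pose w x := \1_Om x * (mass^-1 * l x).
have m0 := @rho_mass_gt0 R N.
have wO x : Om x -> w x = mass^-1 * l x by move=> Ox; rewrite /w indicE mem_set// mul1r.
have wN x : ~ Om x -> w x = 0 by move=> nO; rewrite /w indicE memNset// mul0r.
have mw : measurable_fun setT w.
  apply: (@measurable_fun_cvg _ _ _ _ (fun n x => \1_Om x * (mass^-1 * moll u (dyad n) x))).
    move=> n; apply: (@measurable_funM _ _ _ _ (\1_Om : V -> R)).
      by apply: measurable_indic; exact: open_measurable_rV.
    apply: measurable_funM; first exact: measurable_cst.
    by apply: continuous_measurable_rV; exact: continuous_moll.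
  move=> x _; have [Ox|nO] := pselect (Om x); first by apply: cvgMr; apply: cvgMr; exact: cl.
  rewrite wN// (_ : (fun n => _) = fun=> 0); first exact: cvg_cst.
  by apply/funext => n; rewrite indicE memNset// mul0r.
have uw : {ae mu, forall x, u x = w x}.
  apply: filterS cu => x cx; have [Ox|nO] := pselect (Om x); last by rewrite wN// uOm.
  rewrite wO//; have c2 : moll u (dyad (m j)) x @[j --> \oo] --> l x.
    apply: (cvg_comp (G := \oo) m (fun n => moll u (dyad n) x)) (cl x Ox).
    move=> P [k _ HP]; exists k => // j /= kj; apply: HP => /=; exact: leq_trans kj (mj j).
  have -> : l x = mass * u x by apply: cvg_unique c2 cx; exact: norm_hausdorff.
  by rewrite mulKf// lt0r_neq0.
have wB x : 0 <= w x <= B.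
  have [Ox|nO] := pselect (Om x); last by rewrite wN// lexx (le_trans (u0 x))//; have /andP[] := uB x.
  have b n := moll_bounds x (dyad_gt0 n) L1u uB.
  rewrite wO// ler_pdivrMl// mulrC [mass * B]mulrC; apply/andP; split.
    rewrite mulr_ge0 ?invr_ge0 ?(ltW m0)//.
    by apply: (cvgr_to_ge (cl x Ox)); apply: nearW => n; have /andP[] := b n.
  by apply: (cvgr_to_le (cl x Ox)); apply: nearW => n; have /andP[] := b n.
have mpow e : measurable_fun setT (fun x => w x `^ e).
  by apply: (@measurableT_comp _ _ _ _ _ _ (@powR R ^~ e)) => //; exact: measurable_powR.
have mollw s x : moll w s x = moll u s x.
  congr (_ * _); apply: (L1_ae (cv_L1 s x L1u (@kernel_rho R N)) _ _).2.
    by apply: measurable_funM => //; exact: moved_meas (@kernel_rho R N).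
  by apply: filterS uw => y ->.
have wk (psi : V -> R) : Ck setT 2 psi -> bsupp psi ->
    Int (fun x => w x `^ (q - 1) * psi x) = Int (fun x => u x `^ (q - 1) * psi x) /\
    Int (fun x => w x * laplacian psi x) = Int (fun x => u x * laplacian psi x).
  move=> c2 bp; have [C1 _ H1] := C0_bounded (CkT_cont c2) bp.
  have [C2 _ H2] := C0_bounded (continuous_laplacian c2) (bsupp_laplacian bp).
  have mp := continuous_measurable_rV (CkT_cont c2).
  have ml := continuous_measurable_rV (continuous_laplacian c2).
  split.
    apply: (L1_ae (L1Mb (L1_lower_power Om_r0 q2 mu_ u0 uOm Lq q10 qq) mp H1) _ _).2.
      by apply: measurable_funM.
    by apply: filterS uw => y ->.
  apply: (L1_ae (L1Mb L1u ml H2) _ _).2; first by apply: measurable_funM.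
  by apply: filterS uw => y ->.
exists w, B; split.
- by split.
- exact: wB.
- have [L E] := L1_ae Lq (mpow q) (filterS (fun x (h : u x = w x) => congr1 (fun t => t `^ q) h) uw).
  by split => //; rewrite E.
- split.
    by move=> psi c2 bp p0; have [E1 E2] := wk _ c2 bp; rewrite E1 E2; exact: sub.
  move=> psi c2 sp; have bp := compact_bsupp Om_r0 sp; have [E1 E2] := wk _ c2 bp.
  apply: (etrans E2); apply: (etrans (weq psi c2 sp)).
  have [C1 _ H1] := C0_bounded (CkT_cont c2) bp.
  have mp := continuous_measurable_rV (CkT_cont c2).
  congr (- _); apply: esym.
  apply: (L1_ae (L1Mb Lf mp H1) _ _).2; last by apply: filterS uw => y ->.
  by apply: measurable_funM => //; apply: measurable_funM => //; exact: measurable_cst.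
- move=> x Ox; rewrite wO// mulrA mulfV ?lt0r_neq0// mul1r.
  by apply: cvg_trans (cl x Ox); apply: near_eq_cvg; apply: nearW => n; rewrite mollw.
Qed.

Section boundary.
Variables (w : V -> R) (B : R).
Hypotheses (I0 : 0 < I) (rw : regular_weak w B).

Let w0 x : 0 <= w x. Proof. by have [_ wB _ _ _] := rw; have /andP[] := wB x. Qed.
Let wB x : w x <= B. Proof. by have [_ wB _ _ _] := rw; have /andP[] := wB x. Qed.
Let B0 : 0 <= B. Proof. exact: le_trans (w0 0) (wB 0). Qed.
Let wOm x : ~ Om x -> w x = 0. Proof. by have [[_ +] _ _ _ _] := rw; apply. Qed.

Lemma regular_L1_power e : 0 < e -> e <= q -> L1 (fun x => w x `^ e).
Proof. by have [[mw wO] _ [Lq _] _ _] := rw; exact: (L1_lower_power Om_r0 q2 mw w0 wO Lq). Qed.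

Lemma regular_L1 : L1 w.
Proof. by apply: L1_ext (regular_L1_power ltr01 (ltW q1)) => x; rewrite powRr1. Qed.

Let Lf : L1 (fun x => I * w x `^ (q - 1)).
Proof. by apply: L1Z; apply: regular_L1_power; rewrite ?gerBl. Qed.

Let fF x : `|I * w x `^ (q - 1)| <= I * B `^ (q - 1).
Proof.
rewrite ger0_norm ?mulr_ge0 ?powR_ge0 ?(ltW I0)// ler_wpM2l ?(ltW I0)//.
by rewrite ge0_ler_powR ?nnegrE ?(ltW q10).
Qed.

(** A bootstrap in one round: the bounded right-hand side makes [w] of class [C^1], and as
    [q - 1 > 1] the right-hand side is then [C^1] too, which gives second derivatives. *)
Lemma regular_classical : Ck Om 2 w /\ forall x, Om x -> - laplacian w x = I * w x `^ (q - 1).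
Proof.
have [_ _ _ [_ weq] ptw] := rw.
have c1 := regular_C1 openOm regular_L1 Lf fF weq ptw.
apply: (regular_C2 openOm regular_L1 Lf fF weq ptw).
have cb : continuous (fun s : R => (q - 1) * pos_pow (q - 1 - 1) s).
  move=> s; apply: (@continuousM _ _ (fun=> q - 1)); first exact: cst_continuous.
  by apply: continuous_pos_pow; rewrite subr_gt0.
have [cc _] := C1_comp openOm (fun s => is_derive_pos_pow s q11) cb c1.
by apply: Ck_ext (Ck_scl I openOm cc) => // x _; rewrite pos_pow_ge0.
Qed.

(** The one-sided dyadic steps are of order [4^-n] because the right-hand side is bounded. They are
    available at every [x], however close to the boundary, since subsolutions are tested without a
    support condition. *)
Lemma regular_upper : exists2 C : R, 0 <= C & forall n x, mass * w x <= moll w (dyad n) x + C * 4^-1 ^+ n.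
Proof.
have [[mw wO] _ [Lq Iq] [sub _] ptw] := rw.
pose K := @step_const R M * 2 ^+ N * (I * B `^ (q - 1)).
have K0 : 0 <= K.
  apply: mulr_ge0; first by apply: mulr_ge0; [exact: step_const_ge0|exact: exprn_ge0].
  by apply: mulr_ge0; [exact: ltW|exact: powR_ge0].
have st n x : moll w (dyad n.+1) x - moll w (dyad n) x <= K * 4^-1 ^+ n.
  apply: (le_trans (moll_step_upper Om_r0 q2 I0 mw w0 wO Lq sub n x)).
  have [Lb Eb] := @Int_near_box R M n x.
  have h : Int (fun y => w y `^ (q - 1) * near_box n x y) <= B `^ (q - 1) * (2 * 2^-1 ^+ n) ^+ N.
    rewrite -Eb -IntZ//; apply: le_Int; [|exact: L1Z|].
      apply: (L1Mb (C := 1)); [by apply: regular_L1_power; rewrite ?gerBl|exact: near_box_meas|].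
      by move=> y; rewrite ger0_norm ?near_box_ge0// near_box_le1.
    move=> y; rewrite ler_wpM2r ?near_box_ge0//.
    by rewrite ge0_ler_powR ?nnegrE ?(ltW q10).
  have P : 0 <= @step_const R M * (2 ^+ M) ^+ n by rewrite mulr_ge0 ?step_const_ge0// exprn_ge0// exprn_ge0.
  apply: (le_trans (ler_wpM2l P (ler_wpM2l (ltW I0) h))).
  have -> : (2 * 2^-1 ^+ n) ^+ N = 2 ^+ N * ((2 ^+ M) ^- n * 4^-1 ^+ n) :> R.
    rewrite exprMn; congr (_ * _); rewrite -[LHS]exprM mulnC [LHS]exprM.
    rewrite -[(2 ^+ M) ^- n]exprVn -exprMn -invfM; congr (_ ^+ n).
    by rewrite exprVn; congr (_^-1); rewrite !exprS; ring.
  rewrite /K; set a : R := (2 ^+ M) ^+ n; have a0 : a != 0 by rewrite expf_neq0// expf_neq0.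
  rewrite le_eqVlt; apply/orP; left; apply/eqP.
  move: (4^-1 ^+ n : R) (step_const) (2 ^+ N : R) (B `^ (q - 1)) => b c d e; field; exact: a0.
clearbody K.
have stk n k x : moll w (dyad (n + k)) x <= moll w (dyad n) x + 2 * K * 4^-1 ^+ n.
  rewrite -lerBlDl -(telescope_shift (fun n => moll w (dyad n) x)).
  apply: (le_trans (ler_sum _ (fun (j : 'I_k) _ => st (n + j)%N x))); rewrite -mulr_sumr.
  have i4 : 0 <= 4^-1 :> R by rewrite invr_ge0.
  have i41 : 4^-1 < 1 :> R by rewrite invf_lt1// ltr1n.
  rewrite [2 * K]mulrC -mulrA ler_wpM2l// (le_trans (geo_sum_le n k i4 i41))//.
  rewrite mulrC ler_wpM2r ?exprn_ge0//.
  have -> : (1 - 4^-1)^-1 = 4 / 3 :> R by field.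
  lra.
exists (2 * K); first by rewrite mulr_ge0.
move=> n x; have [Ox|nO] := pselect (Om x); last first.
  have wBB y : 0 <= w y <= B by rewrite w0 wB.
  have /andP[h _] := moll_bounds x (dyad_gt0 n) regular_L1 wBB.
  have h2 : 0 <= 2 * K * 4^-1 ^+ n by rewrite mulr_ge0 ?exprn_ge0 ?invr_ge0// mulr_ge0.
  by rewrite wOm// mulr0 addr_ge0.
apply: (cvgr_to_le (ptw x Ox)); exists n => // k /= nk.
by rewrite -(subnKC nk); exact: stk.
Qed.

(** At a zero of [w] the mollifications increase with [n] and tend to [0]; being nonnegative, they
    vanish from the first admissible scale on, so [w = 0] nearby. The zero set is open and closed in
    [Om], and it is not [Om] because the norm of [w] is [1]. *)
Lemma regular_positive : connected Om -> forall x, Om x -> 0 < w x.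
Proof.
move=> cOm; have [[mw wO] _ [Lq Iq] [_ weq] ptw] := rw.
have cw x : Om x -> {for x, continuous w} by move=> Ox; have [c2 _] := regular_classical; exact: (Ck_cont c2 Ox).
pose Z := [set x | Om x /\ w x = 0].
have openZ : open Z.
  rewrite openE => x [Ox wx]; have [K [r [n0 [cK KO r0' H]]]] := local_deep openOm Ox.
  have dO n : (n0 <= n)%N -> deep Om n x.
    by move=> n0n y /(H x _ n n0n); rewrite subrr normr0 => /(_ r0')/KO.
  have d0 n := @dyad_gt0 R n.
  have mono n : (n0 <= n)%N -> moll w (dyad n) x <= moll w (dyad n.+1) x.
    move=> n0n; have dle : dyad n <= dyad n.+1 :> R by rewrite /dyad exprS ler_peMl ?exprn_ge0// ler1n.
    apply: (cv_hom_mono (d0 n) dle regular_L1 (@kernel_rho R N) (@kernel_bump R N 0) (@hom_base R N)) => s s1 _.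
    have s0 : 0 < s by exact: lt_le_trans s1.
    rewrite (cv_weak regular_L1 weq s0 (@kernel_bump R N 0) (deep_dyad (dO n n0n) s1)).
    rewrite oppr_le0 mulr_ge0 ?invr_ge0 ?exprn_ge0 ?(ltW s0)//.
    by apply: Int_ge0 => y; rewrite mulr_ge0 ?bumpf0_ge0// mulr_ge0 ?powR_ge0// ltW.
  have up k : moll w (dyad n0) x <= moll w (dyad (n0 + k)) x.
    elim: k => [|k IH]; first by rewrite addn0.
    by rewrite addnS; exact: le_trans IH (mono _ (leq_addr k n0)).
  have U0 : moll w (dyad n0) x <= 0.
    have c : moll w (dyad n) x @[n --> \oo] --> (0 : R).
      by rewrite -[X in _ --> X](mulr0 mass) -wx; exact: ptw.
    apply: (cvgr_to_ge c); exists n0; first exact: Logic.I.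
    move=> n /= n0n.
    by rewrite -(subnKC n0n); exact: up.
  pose g y := w y * rho (dyad n0 *: (x - y)).
  have g0 y : 0 <= g y by rewrite mulr_ge0 ?rho_ge0.
  have Lg : L1 g by exact: cv_L1 regular_L1 (@kernel_rho R N).
  have Ig : Int g = 0.
    apply/eqP; rewrite eq_le Int_ge0// andbT.
    by move: U0; rewrite /moll pmulr_rle0 ?exprn_gt0.
  have rc : {for x, continuous (moved rho (dyad n0) x)}.
    exact: (CkT_cont (moved_Cinfty (dyad n0) x (@kernel_rho R N) 0%N)).
  have rx : 0 < moved rho (dyad n0) x x.
    rewrite /moved subrr scaler0 /rho /bumpf /sqn big1 => [|i _]; last by rewrite mxE expr0n.
    by rewrite subr0 flat1_gt0// mulr_gt0// mulr_gt0 ?invr_gt0 ?exprn_gt0// expR_gt0.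
  have rcn : \forall y \near x, 0 < moved rho (dyad n0) x y by exact: cvgr_gt rc _ rx.
  have On : nbhs x Om by exact: open_nbhs_nbhs.
  apply: filterS2 On rcn => y Oy ry; split => //.
  have cg : {for y, continuous g}.
    apply: (@continuousM _ _ w (moved rho (dyad n0) x)); first exact: cw.
    exact: (CkT_cont (moved_Cinfty (dyad n0) x (@kernel_rho R N) 0%N)).
  have := Int_eq0_at Lg g0 Ig cg; rewrite /g => /eqP; rewrite mulf_eq0 => /orP[/eqP//|].
  by rewrite -[rho _]/(moved rho (dyad n0) x y) gt_eqF.
have openP : open [set x | Om x /\ w x != 0].
  rewrite openE => x [Ox wx]; have On : nbhs x Om by exact: open_nbhs_nbhs.
  have wp : 0 < w x by have := w0 x; rewrite le_eqVlt eq_sym (negPf wx).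
  have rcn : \forall y \near x, 0 < w y by exact: cvgr_gt (cw x Ox) _ wp.
  by apply: filterS2 On rcn => y Oy wy; split => //; rewrite gt_eqF.
move=> x Ox; rewrite lt0r w0 andbT; apply/eqP => wx.
have ZO : Z = Om.
  apply: cOm; first by exists x.
    by exists Z => //; apply/seteqP; split=> y; [move=> [? ?]; split|case].
  exists (~` [set x | Om x /\ w x != 0]); first exact: open_closedC.
  apply/seteqP; split=> y; first by move=> [Oy wy]; split => // -[_]; rewrite wy eqxx.
  move=> [Oy nP]; split => //; apply/eqP; apply/negPn/negP => h; exact: nP.
have : Int (fun x => w x `^ q) = Int (fun _ : V => 0).
  apply: Int_ext => y; have [Oy|nO] := pselect (Om y).
    by move: Oy; rewrite -ZO => -[_ ->]; rewrite powR0// lt0r_neq0.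
  by rewrite wOm// powR0// lt0r_neq0.
by rewrite Iq Int0 => /eqP; rewrite oner_eq0.
Qed.

End boundary.

End ground_state_regularity.

(** * Continuity at the boundary *)

Section boundary_continuity.
Context {R : realType} {M : nat}.
Local Notation N := M.+2.
Notation V := 'rV[R]_N.
Notation e_ i := (delta_mx ord0 i : V).
Notation mu := (lebesgue_rV N).
Local Notation mass := (@rho_mass R M.+2).

Lemma norm_col' (i : 'I_N) (k : V) : `|col' i k| <= `|k|.
Proof. by apply: rV_norm_le => // j; rewrite mxE rV_coord_le. Qed.

(** Near the base point the graph of [h] descends with slope at most [L], so the downward cone of
    that slope at [x0] avoids [Om]. In the value chosen for [L], the sum comes from the differential
    of [h] and the [1] from the remainder of [C1_incr] with [e = 1]. *)
Lemma exterior_cone (Om : set V) x0 : open Om -> smooth_boundary Om -> boundary Om x0 ->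
  exists (i : 'I_N) (s : bool) (L r : R), [/\ 0 <= L, 0 < r &
    forall k : V, `|k| < r -> (-1) ^+ s * k ord0 i <= - (L * `|col' i k|) -> ~ Om (x0 + k)].
Proof.
move=> openOm sm bx; have [r [i [s [h [r0 sh H]]]]] := sm x0 bx.
have nO : ~ Om x0 by move=> Ox; case: bx => _; apply; rewrite (interior_id _).1.
have hx : (-1) ^+ s * x0 ord0 i <= h (col' i x0).
  by rewrite leNgt; apply/negP => /(H x0 (ballxx _ r0)).
pose g j := partial j h (col' i x0).
have [del del0 Hd] := C1_incr openT (sh 1%N) (Logic.I : [set: 'rV[R]_M.+1] (col' i x0)) ltr01.
exists i, s, (1 + \sum_j `|g j|), (Num.min r del); split.
- by rewrite addr_ge0// sumr_ge0.
- by rewrite lt_min r0.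
move=> k; rewrite lt_min => /andP[kr kd] kk; rewrite H; last first.
  by rewrite mx_norm_ball /ball_/= opprD addrA subrr sub0r normrN.
have -> : col' i (x0 + k) = col' i x0 + col' i k by apply/rowP => j; rewrite !mxE.
have {}Hd := Hd (col' i k) (le_lt_trans (norm_col' i k) kd).
have S : `|\sum_j (col' i k) ord0 j * g j| <= (\sum_j `|g j|) * `|col' i k|.
  apply: (le_trans (ler_norm_sum _ _ _)); rewrite mulr_suml; apply: ler_sum => j _.
  by rewrite normrM mulrC ler_wpM2l// rV_coord_le.
apply/negP; rewrite -leNgt mxE mulrDr.
move: Hd S kk hx; rewrite mul1r !ler_norml => /andP[H1 _] /andP[S1 _].
rewrite mulrDl mul1r; move: (\sum_j (col' i k) ord0 j * g j) H1 S1 => a H1 S1.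
move: (h (col' i x0 + col' i k)) (h (col' i x0)) (`|col' i k|) H1 S1 => b c d H1 S1.
lra.
Qed.

Variables (Om : set V) (r0 q : R) (x0 : V).
Hypotheses (openOm : open Om) (Om_r0 : forall x, Om x -> `|x| <= r0).
Hypotheses (q2 : 2 < q) (I0 : 0 < sobolev_inf Om q).
Variables (w : V -> R) (B : R).
Hypothesis rw : regular_weak Om q w B.
Variables (i : 'I_N) (s : bool) (L r : R).
Hypotheses (L0 : 0 <= L) (rp : 0 < r) (cone : forall k : V, `|k| < r ->
  (-1) ^+ s * k ord0 i <= - (L * `|col' i k|) -> ~ Om (x0 + k)).

Let w0 x : 0 <= w x. Proof. by have [_ wB _ _ _] := rw; have /andP[] := wB x. Qed.
Let wB x : w x <= B. Proof. by have [_ wB _ _ _] := rw; have /andP[] := wB x. Qed.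
Let wOm x : ~ Om x -> w x = 0. Proof. by have [[_ +] _ _ _ _] := rw; apply. Qed.
Let Lw : L1 w. Proof. exact: (regular_L1 Om_r0 q2 rw). Qed.

(** The displacement [d - t z] stays in the exterior cone for [|d| <= lam t] and [z] within [lam] of
    [z0] if [2 lam (1 + L) <= 1 / 2]; [lam] is the largest such number. *)
Let lam : R := (4 * (1 + L))^-1.
Let lam0 : 0 < lam. Proof. by rewrite invr_gt0 mulr_gt0// ltr_wpDr. Qed.
Let lamL : lam * (4 * (1 + L)) = 1.
Proof. by rewrite mulVf// mulf_neq0// lt0r_neq0// ltr_wpDr. Qed.

Let lam1 : lam <= 1.
Proof. by rewrite invf_le1 ?mulr_gt0 ?ltr_wpDr//; have := L0; lra. Qed.

Let sg : R := (-1) ^+ s.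
Let sg2 : sg * sg = 1. Proof. by rewrite /sg -expr2 sqrr_sign. Qed.
Let sg1 : `|sg| = 1. Proof. exact: normr_sign. Qed.

(** Centre of the part of the unit ball that [z |-> x - t z] sends into the exterior cone when [x]
    is close to [x0]; its kernel mass is [kap]. *)
Let z0 : V := (sg / 2) *: e_ i.
Let E (z : V) : R := \1_(@box R N lam) (z - z0).
Let kap : R := Int (fun z => rho z * E z).

Let E_meas : measurable_fun setT E.
Proof.
have mB : measurable_fun setT (\1_(@box R N lam) : V -> R).
  by apply: measurable_indic; exact: measurable_box.
rewrite (_ : E = (\1_(@box R N lam) : V -> R) \o (fun y => 1 *: y + (- z0))).
  exact: measurableT_comp mB (measurable_affine_rV 1 (- z0)).
by apply/funext => y /=; rewrite scale1r.
Qed.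

Let E01 z : 0 <= E z <= 1.
Proof. by rewrite /E indicE; case: (_ \in _); rewrite ?lexx ?ler01. Qed.

Let LE : L1 (fun z => rho z * E z).
Proof.
apply: (L1Mb (C := 1) (kernel_L1 (@kernel_rho R N)) E_meas) => z.
by have /andP[h1 h2] := E01 z; rewrite ger0_norm.
Qed.

Let kap_mass : kap <= mass.
Proof.
apply: le_Int; [exact: LE|exact: kernel_L1 (@kernel_rho R N)|move=> z].
by have /andP[h1 h2] := E01 z; rewrite ler_piMr// rho_ge0.
Qed.

Let z0i : z0 ord0 i = sg / 2.
Proof. by rewrite /z0 !mxE !eqxx mulr1. Qed.

Let z0j : col' i z0 = 0.
Proof.
apply/rowP => j; rewrite !mxE eqxx/=; case: eqP => [h|_]; last by rewrite mulr0.
by have := neq_lift i j; rewrite h eqxx.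
Qed.

Let rho_z0 : 0 < @rho R N z0.
Proof.
have sz : sqn z0 = 4^-1.
  rewrite /sqn (bigD1 i)//= z0i big1 ?addr0.
    by rewrite exprMn expr2 sg2 mul1r exprVn; congr (_^-1); rewrite expr2 -natrM.
  by move=> j ji; rewrite /z0 !mxE eqxx (negPf ji) mulr0 expr0n.
have p : 0 < 1 - 4^-1 :> R by rewrite subr_gt0 invf_lt1// ltr1n.
by rewrite /rho /bumpf sz flat1_gt0// mulr_gt0// mulr_gt0 ?invr_gt0 ?exprn_gt0// expR_gt0.
Qed.

Let kap0 : 0 < kap.
Proof.
have rc : {for z0, continuous (@rho R N)} by exact: (CkT_cont ((@kernel_rho R N).1 0%N)).
have r2 : 0 < @rho R N z0 / 2 by rewrite divr_gt0.
move/cvgrPdist_le : rc => /(_ _ r2)/nbhs_ballP[d /= d0 H].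
pose d' := Num.min (d / 2) lam.
have d'0 : 0 < d' by rewrite lt_min lam0 divr_gt0.
have P z : 0 <= rho z * E z by have /andP[h1 h2] := E01 z; rewrite mulr_ge0 ?rho_ge0.
apply: lt_le_trans (Int_ge_box (x := z0) (d := d') (e := rho z0 / 2) LE P (ltW d'0) _).
  by rewrite mulr_gt0// exprn_gt0// mulr_gt0.
move=> y; rewrite le_min => /andP[yd yl].
have -> : E y = 1 by rewrite /E indicE mem_set// => j; exact: le_trans (rV_coord_le _ _) yl.
rewrite mulr1; have := H y; rewrite mx_norm_ball /ball_/= distrC => /(_ _) h.
have {}h : `|rho z0 - rho y| <= rho z0 / 2.
  by apply: h; rewrite (le_lt_trans yd)// ltr_pdivrMr// ltr_pMr// ltr1n.
have := ler_norm (rho z0 - rho y); lra.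
Qed.

Let exterior n (d z : V) : 2 * 2^-1 ^+ n < r -> `|d| <= lam * 2^-1 ^+ n -> `|z| <= 1 -> E z != 0 ->
  w (x0 + d - 2^-1 ^+ n *: z) = 0.
Proof.
set t : R := 2^-1 ^+ n; have t0 : 0 < t by rewrite exprn_gt0// invr_gt0.
move=> tr dl z1 Ez.
have zb : forall j, `|(z - z0) ord0 j| <= lam.
  by move: Ez; rewrite /E indicE; case: (boolP (_ \in _)); [rewrite inE|rewrite eqxx].
apply: wOm; rewrite -addrA; apply: cone.
  apply: le_lt_trans tr; apply: (le_trans (ler_normB _ _)); rewrite normrZ gtr0_norm//.
  have h1 : lam * t <= t by rewrite ler_piMl// ltW.
  have h2 : t * `|z| <= t by rewrite ler_piMr// ltW.
  lra.
have c1 : `|col' i (d - t *: z)| <= 2 * lam * t.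
  have -> : col' i (d - t *: z) = col' i d - t *: col' i z by apply/rowP => j; rewrite !mxE.
  apply: (le_trans (ler_normB _ _)); rewrite normrZ gtr0_norm//.
  have h1 := le_trans (norm_col' i d) dl.
  have h2 : `|col' i z| <= lam.
    have -> : col' i z = col' i (z - z0).
      have -> : col' i (z - z0) = col' i z - col' i z0 by apply/rowP => j; rewrite !mxE.
      by rewrite z0j subr0.
    by apply: (le_trans (norm_col' _ _)); apply: rV_norm_le; rewrite ?ltW.
  have h3 : t * `|col' i z| <= t * lam by rewrite ler_wpM2l// ltW.
  lra.
have c2 : sg * (d - t *: z) ord0 i <= lam * t - t * (2^-1 - lam).
  rewrite !mxE mulrBr.
  have h1 : sg * d ord0 i <= lam * t.
    by rewrite (le_trans (ler_norm _))// normrM sg1 mul1r (le_trans (rV_coord_le _ _)).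
  have h2 : 2^-1 - lam <= sg * z ord0 i.
    have := zb i; rewrite !mxE -/z0 => h.
    have h3 : `|sg * (z ord0 i - z0 ord0 i)| <= lam by rewrite normrM sg1 mul1r /z0 !mxE.
    rewrite z0i mulrBr mulrA sg2 mul1r ler_norml in h3.
    by have /andP[] := h3; lra.
  have h3 : t * (2^-1 - lam) <= t * (sg * z ord0 i) by rewrite ler_wpM2l// ltW.
  by rewrite [sg * (t * _)]mulrCA; lra.
apply: (le_trans c2).
have c3 : L * `|col' i (d - t *: z)| <= L * (2 * lam * t) by rewrite ler_wpM2l.
have c4 : L * (2 * lam * t) = (lam * (4 * (1 + L))) * (t / 2) - 2 * lam * t by field.
rewrite lamL mul1r in c4; rewrite c4 in c3; lra.
Qed.

(* The exterior cone carries a fixed part [kap] of the mass of the kernel, where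
   [w] vanishes; hence the supremum of [w] contracts when the scale is refined. *)
Let decay A n x : 0 <= A -> 2 * 2^-1 ^+ n < r -> (forall y, `|y - x0| <= 2 * 2^-1 ^+ n -> w y <= A) ->
  `|x - x0| <= lam * 2^-1 ^+ n -> moll w (dyad n) x <= A * (mass - kap).
Proof.
move=> A0 tr wA xr; have Lr := kernel_L1 (@kernel_rho R N).
have t0 : 0 < 2^-1 ^+ n :> R by rewrite exprn_gt0// invr_gt0.
have dn : (dyad n)^-1 = 2^-1 ^+ n :> R by rewrite exprVn.
rewrite (mollE x (dyad_gt0 n) Lw) dn.
have -> : A * (mass - kap) = Int (fun z => A * (rho z - rho z * E z)).
  by rewrite (IntZ _ (L1B Lr LE)) (IntB Lr LE).
apply: le_Int.
- by have := moll_L1 x (dyad_gt0 n) Lw; rewrite dn.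
- exact: L1Z (L1B Lr LE).
move=> z; have [z1|z1] := ltP 1 (sqn z); first by rewrite (@kernel_rho R N).2// mul0r subrr !mulr0.
have zn : `|z| <= 1 by rewrite -(@expr_le1 _ 2)// (le_trans (norm_le_sqn z)).
have r1 := rho_ge0 z; have /andP[e0 e1] := E01 z.
have [Ez|Ez] := eqVneq (E z) 0.
  rewrite Ez mulr0 subr0 ler_wpM2r//; apply: wA.
  rewrite addrAC; apply: (le_trans (ler_normB _ _)); rewrite normrZ gtr0_norm//.
  have h1 : lam * 2^-1 ^+ n <= 2^-1 ^+ n by rewrite ler_piMl// ltW.
  have h2 : 2^-1 ^+ n * `|z| <= 2^-1 ^+ n by rewrite ler_piMr// ltW.
  lra.
have := exterior (d := x - x0) tr xr zn Ez; rewrite [x0 + _]addrC subrK => ->.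
rewrite mul0r mulr_ge0// subr_ge0 ler_piMr//.
Qed.

(** [inf S] is the upper limit of [w] at [x0]. If it were some [a > 0], then with [th = kap / mass]
    a bound [A < a + th a / 4] would be contracted by [1 - th] up to an error [th a / 4], giving a
    bound below [a]. *)
Lemma boundary_decay : ~ Om x0 -> {for x0, continuous w}.
Proof.
move=> nO; have m0 := @rho_mass_gt0 R N.
have [C C0 HC] := regular_upper Om_r0 q2 I0 rw.
pose S := [set A : R | exists2 t : R, 0 < t & forall y, `|y - x0| <= t -> w y <= A].
have Sx A : S A -> 0 <= A by move=> [t t0 H]; rewrite (le_trans (w0 x0))// H// subrr normr0 ltW.
have hS : has_inf S by split; [exists B, 1 => // y _; exact: wB|exists 0 => A /Sx].
have infS0 : inf S <= 0.
  rewrite leNgt; apply/negP => a0; set a := inf S in a0.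
  pose th := kap / mass.
  have th0 : 0 < th by rewrite divr_gt0.
  have th1 : th <= 1 by rewrite ler_pdivrMr// mul1r.
  have e0 : 0 < th * a / 4 by rewrite divr_gt0// mulr_gt0.
  have [A SA Aa] := inf_adherent e0 hS; have A0 := Sx _ SA; have [t t0 HA] := SA.
  have g1 := geo_cvg (2 : R); have g2 := geo_cvg (C / mass).
  have tr0 : 0 < Num.min t (r / 2) by rewrite lt_min t0 divr_gt0.
  move/cvgr0_norm_le : g1 => /(_ _ tr0) g1; move/cvgr0_norm_le : g2 => /(_ _ e0) g2.
  have [n _ /(_ n (leqnn n))/= [h1 h2]] := filterI g1 g2.
  have p0 : 0 < 2^-1 ^+ n :> R by rewrite exprn_gt0// invr_gt0.
  rewrite ger0_norm ?mulr_ge0 ?(ltW p0)// le_min in h1; have /andP[h11 h12] := h1.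
  have tr : 2 * 2^-1 ^+ n < r by rewrite (le_lt_trans h12)// ltr_pdivrMr// ltr_pMr// ltr1n.
  have SA' : S ((1 - th) * A + C / mass * 2^-1 ^+ n).
    exists (lam * 2^-1 ^+ n); first exact: mulr_gt0.
    move=> y yr; have := decay A0 tr (fun z zr => HA z (le_trans zr h11)) yr => D.
    have U := HC n y.
    have q4 : C * 4^-1 ^+ n <= C * 2^-1 ^+ n.
      by rewrite ler_wpM2l// lerXn2r ?nnegrE ?invr_ge0// lef_pV2 ?posrE// ler_nat.
    have : mass * w y <= mass * ((1 - th) * A + C / mass * 2^-1 ^+ n).
      have -> : mass * ((1 - th) * A + C / mass * 2^-1 ^+ n) = A * (mass - kap) + C * 2^-1 ^+ n.
        by rewrite /th; field; rewrite lt0r_neq0.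
      lra.
    by rewrite ler_pM2l.
  have := ge_inf hS.2 SA'; rewrite -/a => h3.
  have h4 : (1 - th) * A <= (1 - th) * (a + th * a / 4) by rewrite ler_wpM2l ?subr_ge0// ltW.
  have h5 : C / mass * 2^-1 ^+ n <= th * a / 4 by exact: le_trans (ler_norm _) h2.
  have h6 : (1 - th) * (th * a / 4) <= th * a / 4 by rewrite ler_piMl ?(ltW e0)// gerBl ltW.
  rewrite mulrDr in h4.
  have h7 : (1 - th) * a = a - 4 * (th * a / 4) by field.
  rewrite h7 in h4; move: (th * a / 4) e0 h3 h4 h5 h6 => v e0 h3 h4 h5 h6; lra.
apply/(@cvgrPdist_le _ _ _ (nbhs x0)) => e e0.
have [A [t t0 HA] Ae] := inf_adherent e0 hS.
apply/nbhs_ballP; exists t => // y; rewrite mx_norm_ball /ball_/= distrC => /ltW /HA h.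
rewrite (wOm nO) sub0r normrN ger0_norm//; lra.
Qed.

End boundary_continuity.

(** * Energy inequalities for classical solutions *)

Section odd_truncation.
Context {R : realType}.
Variable d : R.
Hypothesis d0 : 0 < d.

(** An odd [C^1] truncation. Its dead zone [[-d, d]] makes [soft d u] compactly supported in [Om] as
    soon as [u] is continuous and vanishes off the bounded set [Om]. *)
Definition soft (s : R) : R := beta d (s - d) - beta d (- s - d).
Definition dsoft (s : R) : R := dbeta d (s - d) + dbeta d (- s - d).

Lemma is_derive_soft (s : R) : is_derive s 1 soft (dsoft s).
Proof.
have E1 : (fun y : R => beta d (1 *: y + (- d))) = (fun y => beta d (y - d)).
  by apply: funext => y; rewrite scale1r.
have E2 : (fun y : R => -1 * beta d (-1 *: y + (- d))) = (fun y => - beta d (- y - d)).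
  by apply: funext => y; rewrite scaleN1r mulN1r.
have D1 : is_derive s 1 (fun y : R => beta d (1 *: y + (- d))) (1 * dbeta d (s - d)).
  by apply: is_derive_affine; rewrite scale1r; exact: is_derive_beta.
have D2 : is_derive s 1 (fun y : R => -1 * beta d (-1 *: y + (- d))) (-1 * (-1 * dbeta d (- s - d))).
  by apply: is_derive_scl; apply: is_derive_affine; rewrite scaleN1r; exact: is_derive_beta.
by rewrite E1 mul1r in D1; rewrite E2 !mulN1r opprK in D2; exact: is_derive_add D1 D2.
Qed.

Lemma continuous_dsoft : continuous dsoft.
Proof.
move=> s; apply: (@continuousD _ _ _ (fun s => dbeta d (s - d)) (fun s => dbeta d (- s - d))).
  apply: (@continuous_comp _ _ _ (fun s : R => s - d) (dbeta d)); last exact: continuous_dbeta.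
  by apply: (@continuousB _ _ _ (fun s : R => s) (fun=> d)); [exact: cvg_id|exact: cst_continuous].
apply: (@continuous_comp _ _ _ (fun s : R => - s - d) (dbeta d)); last exact: continuous_dbeta.
by apply: (@continuousB _ _ _ (fun s : R => - s) (fun=> d)); [exact: opp_continuous|exact: cst_continuous].
Qed.

Lemma soft_ge0 s : 0 <= s -> soft s = beta d (s - d).
Proof. by move=> s0; rewrite /soft (@beta_le0 _ d (- s - d)) ?subr0//; have := d0; lra. Qed.

Lemma softN s : soft (- s) = - soft s.
Proof. by rewrite /soft opprK opprB. Qed.

Lemma soft_small s : `|s| <= d -> soft s = 0.
Proof. by rewrite ler_norml => /andP[h1 h2]; rewrite /soft !beta_le0 ?subrr//; lra. Qed.

Lemma norm_soft s : `|soft s| = beta d (`|s| - d).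
Proof.
have [s0|s0] := leP 0 s; first by rewrite soft_ge0// !ger0_norm// beta_ge0.
by rewrite -[s]opprK softN normrN !normrN soft_ge0 ?oppr_ge0 ?(ltW s0)// (ger0_norm (beta_ge0 d0 _)) ltr0_norm// oppr_lt0 -?ltrN10.
Qed.

Lemma norm_soft_le s : `|soft s| <= `|s|.
Proof.
rewrite norm_soft; have [h|h] := leP 0 (`|s| - d); last by rewrite beta_le0// ltW.
by rewrite (le_trans (beta_le d0 h))// gerBl ltW.
Qed.

Lemma norm_soft_ge s : `|s| - 2 * d <= `|soft s|.
Proof. by rewrite norm_soft; have := beta_ge d0 (`|s| - d); lra. Qed.

Lemma soft_mul_le s : s * soft s <= s ^+ 2.
Proof.
apply: (le_trans (ler_norm _)); rewrite normrM -real_normK ?num_real// expr2.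
by rewrite ler_wpM2l// norm_soft_le.
Qed.

Lemma dsoft01 s : 0 <= dsoft s <= 1.
Proof.
rewrite /dsoft addr_ge0 ?dbeta_ge0//=.
have [h|h] := leP 0 s; first by rewrite [X in _ + X]dbeta_le0 ?addr0 ?dbeta_le1//; have := d0; lra.
by rewrite dbeta_le0 ?add0r ?dbeta_le1//; have := d0; lra.
Qed.

Lemma dsoft_large s : d < s -> dsoft s = 1 - (d / s) ^+ 2.
Proof.
move=> ds; have h : - s - d <= 0 by have := d0; lra.
rewrite /dsoft (dbeta_le0 d0 h) addr0.
have sd : 0 <= s - d by rewrite subr_ge0 ltW.
by rewrite /dbeta max_l// subrK.
Qed.

End odd_truncation.

Section open_support.
Context {R : realType} {N : nat}.

Lemma measurable_open_support (Om : set 'rV[R]_N) (f : 'rV[R]_N -> R) : open Om ->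
  (forall x, Om x -> {for x, continuous f}) -> (forall x, ~ Om x -> f x = 0) ->
  measurable_fun [set: 'rV[R]_N] f.
Proof.
move=> oO cf fO; apply: (measurability _ (RGenOInfty.measurableE R)) => // _ [_ [a ->] <-].
rewrite setTI (_ : _ @^-1` _ = (Om `&` [set x | a < f x]) `|` (~` Om `&` [set _ | a < 0])).
  have mO : measurable Om by exact: open_measurable_rV.
  apply: measurableU.
    apply: open_measurable_rV; rewrite openE => x [Ox fx].
    have h1 : nbhs x Om by exact: open_nbhs_nbhs.
    have h2 : \forall y \near x, a < f y by exact: cvgr_gt (cf x Ox) _ fx.
    by apply: filterS2 h1 h2 => y.
  have [a0|a0] := ltP a 0.
    rewrite (_ : [set _ | _] = setT); first by rewrite setIT; exact: measurableC.
    by apply/seteqP; split.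
  rewrite (_ : [set _ | _] = set0); first by rewrite setI0.
  by apply/seteqP; split.
apply/seteqP; split=> x /=; rewrite in_itv/= andbT.
  by move=> fx; have [Ox|nO] := pselect (Om x); [left|right; split => //; rewrite -(fO x nO)].
by move=> [[]//|[nO]]; rewrite fO.
Qed.

End open_support.

(** * The equation tested with truncations of its solution *)

Section energy_inequality.
Context {R : realType} {M : nat}.
Local Notation N := M.+2.
Notation V := 'rV[R]_N.
Notation mu := (lebesgue_rV N).
Variables (Om : set V) (r0 q : R) (x0 : V).
Hypotheses (openOm : open Om) (Om_r0 : forall x, Om x -> `|x| <= r0) (Om_x0 : Om x0).
Hypotheses (q2 : 2 < q).
Let q0 : 0 < q. Proof. exact: lt_trans q2. Qed.
Let r00 : 0 <= r0. Proof. exact: le_trans (Om_r0 Om_x0). Qed.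
Local Notation nrm f := (Int (fun x : V => `|f x| `^ q)).

(** The indicator discards the partial derivatives off [Om]: [u] need not be differentiable across
    the boundary. *)
Definition gradsq (u : V -> R) x : R := \1_Om x * \sum_i partial i u x ^+ 2.

Lemma gradsq_ge0 u x : 0 <= gradsq u x.
Proof. by rewrite /gradsq mulr_ge0// ?indicE// sumr_ge0// => i _; exact: sqr_ge0. Qed.

Section solution.
Variables (u : V -> R) (c : R).
Hypotheses (cu : continuous u) (uOm : forall x, ~ Om x -> u x = 0) (u2 : Ck Om 2 u) (c0 : 0 <= c)
  (ueq : forall x, Om x -> - laplacian u x = c * (`|u x| `^ (q - 2) * u x)).

Let bu : bsupp u.
Proof. by exists r0 => x xr; apply: uOm => /Om_r0; rewrite leNgt xr. Qed.

Lemma solution_Lq : L1 (fun x => `|u x| `^ q).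
Proof. exact: L1_powR_C0. Qed.

Section truncated.
Variable d : R.
Hypothesis d0 : 0 < d.
Let T x := soft d (u x).
Let K := [set x | d <= `|u x|].

Let clK : closed K.
Proof.
have -> : K = (fun x => `|u x|) @^-1` [set t | d <= t] by [].
apply: preimage_closed; last exact: closed_ge.
by move=> x _; apply: (@continuous_comp _ _ _ u (fun t : R => `|t|)); [exact: cu|exact: norm_continuous].
Qed.

Let KO : K `<=` Om.
Proof. by move=> x Kx; apply: contrapT => /uOm E; move: Kx; rewrite /K/= E normr0 leNgt d0. Qed.

Let TK x : ~ K x -> T x = 0.
Proof. by move=> /negP; rewrite -ltNge => h; rewrite /T soft_small// ltW. Qed.

Let u1 : Ck Om 1 u. Proof. exact: CkS u2. Qed.

Let TC1 : Ck Om 1 T /\ forall i x, Om x -> partial i T x = dsoft d (u x) * partial i u x.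
Proof. exact: C1_comp openOm (is_derive_soft d0) (continuous_dsoft d0) u1. Qed.

Let T1 : Ck setT 1 T. Proof. exact: Ck_glue openOm clK KO TC1.1 TK. Qed.

Let TC1c : C1c Om T.
Proof.
split => //; exists K; last by split.
have cB := @compact_cball R N r0.
have -> : K = K `&` [set x | `|x| <= r0].
  by apply/seteqP; split=> [x Kx|x []//]; split => //; exact: Om_r0 (KO Kx).
rewrite setIC; exact: compact_closedI.
Qed.

Let bT : bsupp T. Proof. exact: (C1c_bsupp Om_r0 TC1c). Qed.

Let dT0 i x : ~ K x -> partial i T x = 0.
Proof.
move=> nK; apply: partial0_near.
have : nbhs x (~` K) by apply: open_nbhs_nbhs; split => //; exact: closed_openC.
by apply: filterS => y; exact: TK.
Qed.

Let dTle i x : 0 <= partial i T x ^+ 2 <= partial i u x * partial i T x.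
Proof.
rewrite sqr_ge0/=; have [Kx|nK] := pselect (K x); last by rewrite dT0// expr0n mulr0.
have /andP[h0 h1] := dsoft01 d0 (u x).
rewrite TC1.2; last exact: KO.
have P2 : partial i u x * (dsoft d (u x) * partial i u x) = dsoft d (u x) * partial i u x ^+ 2 by ring.
rewrite P2 exprMn ler_wpM2r ?sqr_ge0// expr2 ler_piMr//.
Qed.

Let Ldd i : L1 (fun x => partial i u x * partial i T x).
Proof.
apply: (L1_glue openOm clK KO (Ck_partial (k := 0) i u1)).
- exact: Ck_partial T1.
- exact: dT0.
- exact: (bsupp_partial i bT).
Qed.

Let LuT : L1 (fun x => `|u x| `^ (q - 2) * u x * T x).
Proof.
apply: L1_C0; last exact: (bsupp_mulr _ bT).
move=> x; apply: (@continuousM _ _ (fun x => `|u x| `^ (q - 2) * u x) T); last exact: CkT_cont T1 x.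
apply: (@continuousM _ _ (fun x => `|u x| `^ (q - 2)) u); last exact: cu.
apply: (@continuous_comp _ _ _ u (fun t : R => `|t| `^ (q - 2))); first exact: cu.
by apply: continuous_powR_abs; rewrite subr_gt0.
Qed.

Lemma truncated_identity :
  L1 (fun x => \sum_i partial i u x * partial i T x) /\
  Int (fun x => \sum_i partial i u x * partial i T x) = c * Int (fun x => `|u x| `^ (q - 2) * u x * T x).
Proof.
split; first exact: (L1_sum _ Ldd).
have Ll i : L1 (fun x => partial i (partial i u) x * T x).
  have c1 : Ck Om 1 (partial i u) by exact: (Ck_partial (k := 1)).
  exact: (L1_glue openOm clK KO (Ck_partial (k := 0) i c1) (CkS T1) TK bT).
rewrite (Int_sum _ Ldd) -(IntZ _ LuT).
have -> : Int (fun x => c * (`|u x| `^ (q - 2) * u x * T x)) = - Int (fun x => \sum_i partial i (partial i u) x * T x).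
  rewrite -IntN; last exact: (L1_sum _ Ll).
  apply: Int_ext => x; have [Kx|nK] := pselect (K x).
    by rewrite -mulr_suml -mulNr -[\sum_i _]/(laplacian u x) ueq ?mulrA//; exact: KO.
  by rewrite TK// !mulr0 big1 ?oppr0// => i _; rewrite mulr0.
rewrite (Int_sum _ Ll) -sumrN; apply: eq_bigr => i _.
have c1 : Ck Om 1 (partial i u) by exact: (Ck_partial (k := 1)).
by rewrite (IBP_local i openOm clK KO c1 T1 TK bT) opprK.
Qed.

Lemma truncated_rhs : c * Int (fun x => `|u x| `^ (q - 2) * u x * T x) <= c * nrm u.
Proof.
apply: ler_wpM2l => //; apply: le_Int; [exact: LuT|exact: solution_Lq|move=> x].
rewrite -mulrA.
have [->|un] := eqVneq (u x) 0; first by rewrite mul0r mulr0 powR_ge0.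
have -> : `|u x| `^ q = `|u x| `^ (q - 2) * u x ^+ 2.
  rewrite -real_normK ?num_real// -powR_mulrn// -powRD ?subrK//.
  by rewrite normr_eq0 un implybT.
by rewrite ler_wpM2l ?powR_ge0// soft_mul_le.
Qed.

(** As [0 <= dsoft <= 1], the square of [grad T] is at most [grad u . grad T], whose integral is
    given by the equation. *)
Lemma truncated_energy : energy T <= c * nrm u.
Proof.
have [L E] := truncated_identity; rewrite (le_trans _ truncated_rhs)// -E.
have [Le _] := energyE T1 bT.
by apply: le_Int => // x; apply: ler_sum => i _; have /andP[] := dTle i x.
Qed.

Lemma truncated_energy_grad : L1 (gradsq u) -> energy T <= Int (gradsq u).
Proof.
move=> Lg; have [Le _] := energyE T1 bT; apply: le_Int => // x.
have [Kx|nK] := pselect (K x); last first.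
  by rewrite big1 ?gradsq_ge0// => i _; rewrite dT0// expr0n.
have Ox := KO Kx; rewrite /gradsq indicE mem_set// mul1r; apply: ler_sum => i _.
rewrite TC1.2// exprMn ler_piMl ?sqr_ge0//; have /andP[h0 h1] := dsoft01 d0 (u x).
by rewrite expr_le1.
Qed.

Lemma truncated_gradsq : L1 (fun x => dsoft d (u x) * gradsq u x) /\
  Int (fun x => dsoft d (u x) * gradsq u x) <= c * nrm u.
Proof.
have [L E] := truncated_identity.
have F : (fun x => \sum_i partial i u x * partial i T x) =1 (fun x => dsoft d (u x) * gradsq u x).
  move=> x; have [Kx|nK] := pselect (K x).
    rewrite /gradsq indicE mem_set ?mul1r; last exact: KO.
    rewrite mulr_sumr; apply: eq_bigr => i _; rewrite TC1.2; last exact: KO.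
    by rewrite mulrCA expr2.
  rewrite big1 => [|i _]; last by rewrite dT0// mulr0.
  move/negP : nK; rewrite -ltNge => h.
  rewrite /dsoft !dbeta_le0 ?addr0 ?mul0r//.
    by have := ler_norm (- u x); rewrite normrN; lra.
  by have := ler_norm (u x); lra.
by split; [exact: L1_ext F L|rewrite -(Int_ext F) E truncated_rhs].
Qed.

Lemma truncated_sobolev : sobolev_inf Om q * nrm T `^ (2 / q) <= energy T.
Proof. exact: (sobolev_ineq openOm Om_r0 Om_x0 q2 TC1c). Qed.

Lemma truncated_L1 : L1 (fun x => `|T x| `^ q).
Proof. exact: (C1c_L1q Om_r0 q0 TC1c). Qed.

End truncated.

Let dn n : R := 2^-1 ^+ n.
Let dn0 n : 0 < dn n. Proof. by rewrite exprn_gt0// invr_gt0. Qed.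
Let cdn : dn n @[n --> \oo] --> (0 : R).
Proof. by apply: cvg_expr; rewrite ger0_norm ?invr_ge0// invf_lt1// ltr1n. Qed.

Lemma truncation_cvg : nrm (fun x => soft (dn n) (u x)) @[n --> \oo] --> nrm u.
Proof.
have Lu := solution_Lq.
have [|||||_ //] := @Int_dct R N (fun n x => `|soft (dn n) (u x)| `^ q) (fun x => `|u x| `^ q) (fun x => `|u x| `^ q).
- by move=> n; apply: L1_meas; exact: truncated_L1.
- exact: L1_meas Lu.
- exact: Lu.
- apply: aeW => x; rewrite -(normr_id (u x)).
  have E n : `|soft (dn n) (u x)| = `|(`|soft (dn n) (u x)|)| by rewrite normr_id.
  under eq_fun do rewrite E.
  apply: powR_abs_cvg => //; apply/cvgrPdist_le => e e0.
  have e2 : 0 < e / 2 by rewrite divr_gt0.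
  move/cvgr0_norm_le : cdn => /(_ _ e2); apply: filterS => n.
  rewrite ger0_norm ?(ltW (dn0 n))// => h.
  rewrite ger0_norm ?subr_ge0 ?norm_soft_le//.
  by have := norm_soft_ge (dn0 n) (u x); lra.
- apply: aeW => x n; rewrite ger0_norm ?powR_ge0//.
  by rewrite ge0_ler_powR ?nnegrE ?(ltW q0)// norm_soft_le.
Qed.

Lemma solution_sobolev (X : R) : (forall d, 0 < d -> energy (fun x => soft d (u x)) <= X) ->
  sobolev_inf Om q * nrm u `^ (2 / q) <= X.
Proof.
move=> HX; have n0 (f : V -> R) : 0 <= nrm f by apply: Int_ge0 => x; exact: powR_ge0.
have q20 : 0 < 2 / q by rewrite divr_gt0.
have c1 := powR_abs_cvg q20 truncation_cvg.
have c2 : sobolev_inf Om q * `|nrm (fun x => soft (dn n) (u x))| `^ (2 / q) @[n --> \oo] -->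
    sobolev_inf Om q * `|nrm u| `^ (2 / q) by exact: cvgMr.
rewrite (ger0_norm (n0 _)) in c2.
apply: (ler_cvg_to c2 (@cvg_cst _ X _ _ _)); apply: nearW => n; rewrite (ger0_norm (n0 _)).
exact: le_trans (truncated_sobolev (dn0 n)) (HX _ (dn0 n)).
Qed.

Lemma solution_ineq1 : sobolev_inf Om q * nrm u `^ (2 / q) <= c * nrm u.
Proof. by apply: solution_sobolev => d d0; exact: truncated_energy. Qed.

Lemma solution_ineq2 : L1 (gradsq u) -> sobolev_inf Om q * nrm u `^ (2 / q) <= Int (gradsq u).
Proof. by move=> Lg; apply: solution_sobolev => d d0; exact: truncated_energy_grad. Qed.

Lemma measurable_gradsq : measurable_fun setT (gradsq u).
Proof.
apply: measurable_open_support openOm _ _ => x.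
  move=> Ox; apply: (near_continuous (f := fun x => \sum_i partial i u x ^+ 2)).
    have : nbhs x Om by exact: open_nbhs_nbhs.
    by apply: filterS => y Oy; rewrite /gradsq indicE mem_set// mul1r.
  have c0' : Ck Om 0 (fun x => \sum_i partial i u x ^+ 2).
    apply: (Ck_sum _ openOm) => i; apply: (Ck_mul openOm); exact: (Ck_partial (k := 0) i (CkS u2)).
  exact: (Ck_cont c0' Ox).
by move=> nO; rewrite /gradsq indicE memNset// mul0r.
Qed.

(** At a point where [u > 0] the factor [dsoft (dn n) (u x)] tends to [1], so Fatou's lemma recovers
    the whole gradient. At a zero of [u] this factor is [0] for every [n], hence the positivity
    assumption. *)
Lemma positive_gradsq : (forall x, Om x -> 0 < u x) -> L1 (gradsq u) /\ Int (gradsq u) <= c * nrm u.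
Proof.
move=> up.
apply: (Int_fatou (f_ := fun n x => dsoft (dn n) (u x) * gradsq u x)).
- by move=> n; exact: (truncated_gradsq (dn0 n)).1.
- by move=> n x; rewrite mulr_ge0 ?gradsq_ge0//; have /andP[] := dsoft01 (dn0 n) (u x).
- exact: measurable_gradsq.
- exact: gradsq_ge0.
- apply: aeW => x; have [Ox|nO] := pselect (Om x); last first.
    rewrite /gradsq indicE memNset// mul0r.
    rewrite (_ : (fun n => _) = fun=> 0); first exact: cvg_cst.
    by apply/funext => n; rewrite mulr0.
  have ux := up x Ox.
  have c1 : 1 - (dn n / u x) ^+ 2 @[n --> \oo] --> (1 : R).
    have c2 : dn n / u x @[n --> \oo] --> (0 : R).
      by rewrite -(mul0r (u x)^-1); exact: cvgMl.
    have c3 : (dn n / u x) ^+ 2 @[n --> \oo] --> (0 : R).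
      by rewrite -(mul0r (0 : R)); exact: (cvgM c2 c2).
    by rewrite -[X in _ --> X](subr0 (1 : R)); apply: cvgB => //; exact: cvg_cst.
  rewrite -[X in _ --> X]mul1r; apply: cvgMl.
  apply: cvg_trans c1; apply: near_eq_cvg.
  move/cvgr0_norm_lt : cdn => /(_ _ ux); apply: filterS => n; rewrite ger0_norm ?(ltW (dn0 n))// => h.
  by rewrite dsoft_large.
- by move=> n; exact: (truncated_gradsq (dn0 n)).2.
Qed.

End solution.

End energy_inequality.

(** * The Sobolev quotient on H^1_0 *)

Section norms.
Context {R : realType} {N : nat}.
Notation V := 'rV[R]_N.
Notation mu := (lebesgue_rV N).
Variable Om : set V.
Hypothesis openOm : open Om.

Definition zext (f : V -> R) x : R := \1_Om x * f x.

Lemma zext_in f x : Om x -> zext f x = f x.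
Proof. by move=> Ox; rewrite /zext indicE mem_set// mul1r. Qed.

Lemma zext_out f x : ~ Om x -> zext f x = 0.
Proof. by move=> Ox; rewrite /zext indicE memNset// mul0r. Qed.

Lemma measurable_zext f : measurable_fun Om f -> measurable_fun setT (zext f).
Proof.
move=> mf; have mO : measurable Om by exact: open_measurable_rV.
have := (measurable_restrictT f mO).1 mf; congr (measurable_fun _ _).
apply/funext => x; rewrite patchE /zext indicE.
by case: (x \in Om); rewrite ?mul1r ?mul0r.
Qed.

Lemma LqNorm_integral (e : R) f : 0 < e ->
  LqNorm Om e f = ((\int[mu]_x (`|zext f x| `^ e)%:E) `^ e^-1)%E.
Proof.
move=> e0; rewrite /LqNorm unlock; congr (_ `^ _)%E; apply: eq_integral => x _.
rewrite patchE /zext indicE.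
by case: (x \in Om); rewrite ?mul1r ?mul0r//= normr0.
Qed.

Lemma LqNormE (e : R) f : 0 < e -> L1 (fun x => `|zext f x| `^ e) ->
  LqNorm Om e f = (Int (fun x => `|zext f x| `^ e) `^ e^-1)%:E.
Proof. by move=> e0 L; rewrite LqNorm_integral// Int_EFin. Qed.

Lemma LqNorm_L1 (e : R) f : 0 < e -> measurable_fun setT (zext f) -> (LqNorm Om e f < +oo)%E ->
  L1 (fun x => `|zext f x| `^ e).
Proof.
move=> e0 mf; rewrite LqNorm_integral// => fin.
apply: L1_ge0P; [exact: measurable_powR_abs|by move=> x; exact: powR_ge0|].
rewrite ltey; apply/eqP => E; move: fin.
by rewrite E poweRyr ?ltxx// invr_eq0 lt0r_neq0.
Qed.

Lemma abs_powR2 (x : R) : `|x| `^ 2 = x ^+ 2.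
Proof. by rewrite powR_mulrn// real_normK ?num_real. Qed.

Lemma enorm_sqr (x : V) : enorm x ^+ 2 = \sum_i x ord0 i ^+ 2.
Proof. by rewrite sqr_sqrtr// sumr_ge0// => i _; exact: sqr_ge0. Qed.

Lemma zext_enorm (g : V -> V) x : zext (enorm \o g) x ^+ 2 = \sum_i zext (fun x => g x ord0 i) x ^+ 2.
Proof.
have [Ox|nO] := pselect (Om x).
  by rewrite zext_in// enorm_sqr; apply: eq_bigr => i _; rewrite zext_in.
by rewrite zext_out// expr0n/= big1// => i _; rewrite zext_out// expr0n.
Qed.

Lemma L2NormE f : L1 (fun x => zext f x ^+ 2) ->
  LqNorm Om 2 f = (Num.sqrt (Int (fun x => zext f x ^+ 2)))%:E.
Proof.
move=> L; have E : (fun x => `|zext f x| `^ 2) = (fun x => zext f x ^+ 2) by apply/funext => x; exact: abs_powR2.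
by rewrite LqNormE ?E// powR12_sqrt// Int_ge0// => x; exact: sqr_ge0.
Qed.

Lemma L2Norm_L1 f : measurable_fun setT (zext f) -> (LqNorm Om 2 f < +oo)%E -> L1 (fun x => zext f x ^+ 2).
Proof.
move=> mf /(LqNorm_L1 _ mf) L; apply: L1_ext (L _) => // x; exact: abs_powR2.
Qed.

Lemma L2Norm_cvg (f : nat -> V -> R) : (forall k, L1 (fun x => zext (f k) x ^+ 2)) ->
  LqNorm Om 2 (f k) @[k --> \oo] --> 0%E -> Int (fun x => zext (f k) x ^+ 2) @[k --> \oo] --> 0.
Proof.
move=> L c; have I0 k : 0 <= Int (fun x => zext (f k) x ^+ 2) by apply: Int_ge0 => x; exact: sqr_ge0.
have c1 : Num.sqrt (Int (fun x => zext (f k) x ^+ 2)) @[k --> \oo] --> (0 : R).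
  apply: cvg_trans (fine_cvg c); apply: near_eq_cvg; apply: nearW => k /=.
  by rewrite L2NormE.
rewrite -(mul0r (0 : R)); apply: cvg_trans (cvgM c1 c1); apply: near_eq_cvg; apply: nearW => k /=.
by rewrite -[RHS]sqr_sqrtr.
Qed.

End norms.

(** * Comparison of the infimum over C1c with the one over H^1_0 *)

Section Sobolev_quotients.
Context {R : realType} {M : nat}.
Local Notation N := M.+2.
Notation V := 'rV[R]_N.
Notation mu := (lebesgue_rV N).
Local Notation mass := (@rho_mass R M.+2).
Variables (Om : set V) (r0 q : R) (x0 : V).
Hypotheses (openOm : open Om) (Om_r0 : forall x, Om x -> `|x| <= r0) (Om_x0 : Om x0).
Hypotheses (q2 : 2 < q).
Let q0 : 0 < q. Proof. exact: lt_trans q2. Qed.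
Local Notation I := (sobolev_inf Om q).
Hypothesis I0 : 0 < I.
Local Notation nrm f := (Int (fun x : V => `|f x| `^ q)).

Lemma test_C1c phi : test_function Om phi -> C1c Om phi.
Proof. by move=> [s [K [cK KO pK]]]; split; [exact: s|exists K]. Qed.

Lemma C1c_out f x : C1c Om f -> ~ Om x -> f x = 0 /\ forall i, partial i f x = 0.
Proof.
move=> [_ [K cK [KO fK]]] nO; have nK : ~ K x by move=> /KO.
split; first exact: fK.
move=> i; apply: partial0_near.
have : nbhs x (~` K).
  by apply: open_nbhs_nbhs; split => //; apply: closed_openC; apply: compact_closed cK; exact: norm_hausdorff.
by apply: filterS => y; exact: fK.
Qed.

Lemma C1c_zext f x : C1c Om f -> zext Om f x = f x /\ forall i, zext Om (partial i f) x = partial i f x.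
Proof.
move=> cf; have [Ox|nO] := pselect (Om x); first by split=> [|i]; rewrite zext_in.
by have [f0 d0] := C1c_out cf nO; split=> [|i]; rewrite zext_out// d0.
Qed.

Lemma sqrB_le (a b : R) : (a - b) ^+ 2 <= 2 * a ^+ 2 + 2 * b ^+ 2.
Proof. by rewrite -subr_ge0 (_ : _ - _ = (a + b) ^+ 2) ?sqr_ge0//; ring. Qed.

Lemma sqr_young (a b eta : R) : 0 < eta -> a ^+ 2 <= (1 + eta) * b ^+ 2 + (1 + eta^-1) * (a - b) ^+ 2.
Proof.
move=> e0; rewrite -subr_ge0 (_ : _ - _ = (eta * b - (a - b)) ^+ 2 / eta).
  by rewrite divr_ge0 ?sqr_ge0// ltW.
by field; rewrite lt0r_neq0.
Qed.

Lemma sqr_cvg (a : nat -> R) (l : R) : (a n - l) ^+ 2 @[n --> \oo] --> 0 -> a n @[n --> \oo] --> l.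
Proof.
move=> c; apply/cvgrPdist_le => e e0.
have e2 : 0 < e ^+ 2 by exact: exprn_gt0.
move/cvgr0_norm_le : c => /(_ _ e2); apply: filterS => j.
rewrite ger0_norm ?sqr_ge0// => h.
by rewrite distrC -(@ler_pXn2r _ 2) ?nnegrE ?(ltW e0)// real_normK ?num_real.
Qed.

Section lower.
Variables (u : V -> R) (g : V -> V).
Hypothesis ug : H10 Om u g.
Let G x := \sum_i zext Om (fun x => g x ord0 i) x ^+ 2.

Let mu_ : measurable_fun setT (zext Om u).
Proof. by have [[[mu0 _] _ _ _] _] := ug; exact: measurable_zext. Qed.

Let mg i : measurable_fun setT (zext Om (fun x => g x ord0 i)).
Proof.
have [[[_ mg0] _ _ _] _] := ug; apply: measurable_zext => //.
exact: (measurableT_comp (measurable_coord i) mg0).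
Qed.

Let mE : measurable_fun setT (zext Om (enorm \o g)).
Proof.
have E : zext Om (enorm \o g) = fun x => G x `^ 2^-1.
  apply/funext => x; rewrite /G -zext_enorm powR12_sqrt ?sqr_ge0// sqrtr_sqr ger0_norm//.
  by rewrite /zext mulr_ge0 ?indicE// sqrtr_ge0.
rewrite E; apply: (@measurableT_comp _ _ _ _ _ _ (@powR R ^~ 2^-1)); first exact: measurable_powR.
by apply: measurable_sum => i; exact: measurable_funX.
Qed.

Lemma H10_L1 : L1 (fun x => zext Om u x ^+ 2) /\ L1 G.
Proof.
have [[_ fu fg _] _] := ug; split; first exact: L2Norm_L1.
have L := L2Norm_L1 mE fg; apply: L1_ext _ L => x; exact: zext_enorm.
Qed.

(** By [sqr_young] the energy of the approximating test functions is at most [1 + eta] times the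
    integral of [G], up to an error tending to [0]. Fatou's lemma along an almost everywhere
    convergent subsequence then gives both the integrability of [|u|^q] and the inequality, as [eta]
    tends to [0]. *)
Lemma H10_sobolev : L1 (fun x => `|zext Om u x| `^ q) /\ I * nrm (zext Om u) `^ (2 / q) <= Int G.
Proof.
have [Lu LG] := H10_L1; have [_ [phi [tphi cphi cgrad]]] := ug.
have cp k := test_C1c (tphi k).
have bp k := C1c_bsupp Om_r0 (cp k).
pose f k x := (phi k x - zext Om u x) ^+ 2.
have fE k x : zext Om (fun x => phi k x - u x) x = phi k x - zext Om u x.
  by rewrite -[phi k x in RHS](C1c_zext x (cp k)).1 /zext mulrBr.
have mp k : measurable_fun setT (phi k) by apply: continuous_measurable_rV; exact: CkT_cont (cp k).1.
have mdp k i : measurable_fun setT (partial i (phi k)).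
  by apply: continuous_measurable_rV; exact: C0_partial (cp k).1.
have Lf k : L1 (f k).
  have Lp := L1_sqr (CkT_cont (cp k).1) (bp k).
  apply: L1_le (L1D (L1Z 2 Lp) (L1Z 2 Lu)) _.
    by apply: measurable_funX; exact: measurable_funB.
  by move=> x; rewrite ger0_norm ?sqr_ge0// sqrB_le.
pose d k x := \sum_i (partial i (phi k) x - zext Om (fun x => g x ord0 i) x) ^+ 2.
have dE k x : zext Om (fun x => enorm (grad (phi k) x - g x)) x ^+ 2 = d k x.
  rewrite (zext_enorm Om (fun x => grad (phi k) x - g x)); apply: eq_bigr => i _.
  have E : zext Om (fun x => (grad (phi k) x - g x) ord0 i) x =
      zext Om (partial i (phi k)) x - zext Om (fun x => g x ord0 i) x.
    by rewrite /zext !mxE mulrBr.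
  by rewrite E ((C1c_zext x (cp k)).2 i).
have Ld k : L1 (d k).
  have [Lp _] := energyE (cp k).1 (bp k).
  apply: L1_le (L1D (L1Z 2 Lp) (L1Z 2 LG)) _.
    by apply: measurable_sum => i; apply: measurable_funX; exact: measurable_funB.
  move=> x; rewrite ger0_norm ?sumr_ge0// => [|i _]; last exact: sqr_ge0.
  rewrite !mulr_sumr -big_split; apply: ler_sum => i _; exact: sqrB_le.
have cf : Int (f k) @[k --> \oo] --> 0.
  have E k : f k =1 (fun x => zext Om (fun x => phi k x - u x) x ^+ 2) by move=> x; rewrite fE.
  have L k : L1 (fun x => zext Om (fun x => phi k x - u x) x ^+ 2) by exact: L1_ext (E k) (Lf k).
  apply: cvg_trans (L2Norm_cvg L cphi); apply: near_eq_cvg; apply: nearW => k.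
  by apply: Int_ext => x; rewrite E.
have cd : Int (d k) @[k --> \oo] --> 0.
  have L k : L1 (fun x => zext Om (fun x => enorm (grad (phi k) x - g x)) x ^+ 2).
    by apply: L1_ext (Ld k) => x; rewrite dE.
  apply: cvg_trans (L2Norm_cvg L cgrad); apply: near_eq_cvg; apply: nearW => k.
  by apply: Int_ext => x; rewrite dE.
have [m [mj ae0]] := ae_subsequence Lf (fun k x => sqr_ge0 _) cf.
have cu : {ae mu, forall x, phi (m j) x @[j --> \oo] --> zext Om u x}.
  by apply: filterS ae0 => x; exact: sqr_cvg.
have G0 : 0 <= Int G by apply: Int_ge0 => x; apply: sumr_ge0 => i _; exact: sqr_ge0.
have key eta : 0 < eta -> L1 (fun x => `|zext Om u x| `^ q) /\
    I * nrm (zext Om u) `^ (2 / q) <= (1 + eta) * Int G + eta.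
  move=> e0; pose X := ((1 + eta) * Int G + eta) / I.
  have X0 : 0 <= X.
    by rewrite divr_ge0 ?(ltW I0)// addr_ge0 ?(ltW e0)// mulr_ge0// addr_ge0// ltW.
  have Ek k : energy (phi k) <= (1 + eta) * Int G + (1 + eta^-1) * Int (d k).
    have [Lp _] := energyE (cp k).1 (bp k).
    have L1a := L1Z (1 + eta) LG; have L1b := L1Z (1 + eta^-1) (Ld k).
    rewrite -(IntZ _ LG) -(IntZ _ (Ld k)) -(IntD L1a L1b).
    apply: le_Int; [exact: Lp|exact: L1D|move=> x].
    by rewrite !mulr_sumr -big_split; apply: ler_sum => i _; exact: sqr_young.
  have cd' : (1 + eta^-1) * Int (d k) @[k --> \oo] --> 0.
    by rewrite -(mulr0 (1 + eta^-1)); exact: cvgMr.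
  move/cvgr0_norm_le : cd' => /(_ _ e0)[k0 _ Hk0].
  have nk k : (k0 <= k)%N -> nrm (phi k) <= X `^ (q / 2).
    move=> kk; have := sobolev_ineq openOm Om_r0 Om_x0 q2 (cp k) => h.
    have n0 : 0 <= nrm (phi k) by apply: Int_ge0 => x; exact: powR_ge0.
    have {}h : nrm (phi k) `^ (2 / q) <= X.
      rewrite ler_pdivlMr// mulrC (le_trans h)// (le_trans (Ek k))// lerD2l.
      exact: le_trans (ler_norm _) (Hk0 k kk).
    have -> : nrm (phi k) = (nrm (phi k) `^ (2 / q)) `^ (q / 2).
      by rewrite -powRrM mulrA divfK ?lt0r_neq0// mulfV// powRr1.
    rewrite ge0_ler_powR ?nnegrE ?powR_ge0//.
    by rewrite divr_ge0// ltW.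
  have mk j : (k0 <= m (k0 + j))%N by rewrite (leq_trans _ (mj _))// leq_addr.
  have [||||||L Iq] := @Int_fatou R N (fun j x => `|phi (m (k0 + j)%N) x| `^ q) (fun x => `|zext Om u x| `^ q) (X `^ (q / 2)).
  - by move=> j; exact: (C1c_L1q Om_r0 q0 (cp _)).
  - by move=> j x; exact: powR_ge0.
  - exact: measurable_powR_abs.
  - by move=> x; exact: powR_ge0.
  - apply: filterS cu => x cx; apply: (powR_abs_cvg (u := fun j => phi (m (k0 + j)%N) x)) => //.
    have -> : (fun j => phi (m (k0 + j)%N) x) = [sequence phi (m (j + k0)%N) x]_j by apply/funext => j; rewrite addnC.
    by rewrite (cvg_shiftn k0 (fun j => phi (m j) x)).
  - by move=> j; exact: nk (mk j).
  split => //.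
  have Y0 : 0 <= nrm (zext Om u) by apply: Int_ge0 => x; exact: powR_ge0.
  rewrite mulrC -ler_pdivlMr// -/X.
  have -> : X = (X `^ (q / 2)) `^ (2 / q).
    by rewrite -powRrM mulrA divfK// mulfV ?lt0r_neq0// powRr1.
  by rewrite ge0_ler_powR ?nnegrE ?powR_ge0// divr_ge0// ltW.
split; first by have [] := key 1 ltr01.
apply/ler_addgt0Pr => e e0; have G1 : 0 < Int G + 1 by rewrite ltr_wpDl.
(* This [eta] makes the error [eta * Int G + eta] equal to [e]. *)
have [_ h] := key (e / (Int G + 1)) (divr_gt0 e0 G1); apply: (le_trans h).
rewrite le_eqVlt; apply/orP; left; apply/eqP; field; exact: lt0r_neq0.
Qed.

End lower.

Lemma rayleigh_ge r : rayleigh_quotients Om q r -> (I%:E <= r)%E.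
Proof.
move=> [u [g [ug nz ->]]]; have [Lq HI] := H10_sobolev ug; have [_ LG] := H10_L1 ug.
set G := fun x => _ in LG HI.
have n0 : 0 <= nrm (zext Om u) by apply: Int_ge0 => x; exact: powR_ge0.
have np : 0 < nrm (zext Om u).
  rewrite lt_neqAle n0 andbT; apply/eqP => E; apply: nz.
  have := Int_eq0_ae Lq (fun x => powR_ge0 _ _) (esym E).
  apply: filterS => x /eqP; rewrite powR_eq0 => /andP[/eqP h _] Ox.
  by apply/eqP; rewrite -normr_eq0 -(zext_in u Ox) h.
have LE : L1 (fun x => zext Om (enorm \o g) x ^+ 2) by apply: L1_ext LG => x; rewrite zext_enorm.
have G0 : 0 <= Int G by apply: Int_ge0 => x; apply: sumr_ge0 => i _; exact: sqr_ge0.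
rewrite L2NormE// LqNormE//.
rewrite (_ : Int (fun x => zext Om (enorm \o g) x ^+ 2) = Int G); last by apply: Int_ext => x; rewrite zext_enorm.
rewrite -!EFin_expe sqr_sqrtr//.
have P : 0 < (nrm (zext Om u) `^ q^-1) ^+ 2 by rewrite exprn_gt0// powR_gt0.
rewrite inver (gt_eqF P) -EFinM lee_fin ler_pdivlMr//.
by rewrite -[(_ `^ q^-1) ^+ 2]powR_mulrn ?powR_ge0// -powRrM [q^-1 * _]mulrC.
Qed.

Lemma moll_abs_bound (h : V -> R) (C s : R) x : 0 < s -> L1 h -> (forall x, `|h x| <= C) ->
  `|moll h s x| <= C * mass.
Proof.
move=> s0 Lh hC; rewrite mollE//; have Lr := kernel_L1 (@kernel_rho R N).
apply: (le_trans (le_Int_abs (moll_L1 x s0 Lh))).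
rewrite -IntZ//; apply: le_Int; [exact: L1_abs (moll_L1 x s0 Lh)|exact: L1Z|move=> z].
by rewrite normrM (ger0_norm (rho_ge0 z)) ler_wpM2r ?rho_ge0.
Qed.

Lemma mollify_cvg (h : V -> R) (e : R) : 0 < e -> continuous h -> bsupp h ->
  Int (fun x => `|moll h (dyad n) x| `^ e) @[n --> \oo] --> Int (fun x => `|mass * h x| `^ e).
Proof.
move=> e0 ch [r hr]; have bh : bsupp h by exists r.
have Lh := L1_C0 ch bh; have [C C0 hC] := C0_bounded ch bh.
have m0 := @rho_mass_gt0 R N.
have LB : L1 (fun x => (C * mass) `^ e * \1_(@box R N (r + 1)) x) by apply: L1Z; exact: L1_indic_box.
have [||||_ //] := @Int_dct R N (fun n x => `|moll h (dyad n) x| `^ e) (fun x => `|mass * h x| `^ e) _ _ _ LB.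
- by move=> n; apply: measurable_powR_abs; apply: continuous_measurable_rV; exact: continuous_moll.
- apply: measurable_powR_abs; apply: measurable_funM; first exact: measurable_cst.
  exact: continuous_measurable_rV.
- apply: aeW => x; apply: powR_abs_cvg => //; exact: (moll_cvg_at Lh (ch x)).
- apply: aeW => x n; rewrite ger0_norm ?powR_ge0// indicE; case: (boolP (_ \in _)) => [_|].
    rewrite mulr1 ge0_ler_powR ?nnegrE ?(ltW e0)//; first by rewrite mulr_ge0// ltW.
    exact: moll_abs_bound (dyad_gt0 n) Lh hC.
  rewrite mulr0 => /negP xb; rewrite /moll (cv_bsupp (dyad_gt0 n) hr (@kernel_rho R N)).
    by rewrite mulr0 normr0 powR0// lt0r_neq0.
  rewrite ltNge; apply/negP => hx; apply: xb; rewrite inE => i.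
  apply: (le_trans (rV_coord_le _ _)); apply: (le_trans hx); rewrite lerD2l invf_le1 ?dyad_gt0//.
  by rewrite /dyad exprn_ege1// ler1n.
Qed.

Lemma partial_moll (f : V -> R) (s : R) i x : 0 < s -> Ck setT 1 f -> bsupp f ->
  partial i (moll f s) x = moll (partial i f) s x.
Proof.
move=> s0 cf bf; have Lf := L1_C0 (CkT_cont cf) bf; have kr := @kernel_rho R N.
have -> : partial i (moll f s) x = s ^+ N * (s * cv f (partial i rho) s x).
  by apply: is_derive_partial; apply: is_derive_scl; exact: cv_derive_x.
congr (_ * _); have cm : Ck setT 1 (moved rho s x) by exact: moved_Cinfty.
have bm := moved_bsupp x s0 kr.
have := IBP i cf cm bm; rewrite (partial_moved s x i kr) => E.
rewrite -[RHS]/(Int (fun y => partial i f y * moved rho s x y)) E.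
rewrite -IntZ; last by apply: cv_L1 => //; exact: kernel_partial.
rewrite -IntN; last first.
  apply: L1_ext (L1Z (- s) (cv_L1 s x Lf (kernel_partial i kr))) => y; exact: mulrCA.
by apply: Int_ext => y; rewrite mulNr mulrN opprK mulrCA.
Qed.

(** A positive distance from [K] to the complement of [Om], by a finite covering argument. *)
Lemma deep_compact (K : set V) : compact K -> K `<=` Om ->
  exists n0 : nat, forall y, K y -> deep Om n0 y.
Proof.
move=> cK KO; have := (compact_near_coveringP K).1 cK nat \oo (fun n y => deep Om n y) _.
move=> H; have [|n0 _ /(_ n0 (leqnn _)) H0] := H _; last by exists n0.
move=> x Kx; have [K' [r [n0 [_ KO' r0' HK]]]] := local_deep openOm (KO x Kx).
exists (ball x r, [set n | (n0 <= n)%N]).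
  split; first exact: nbhsx_ballx.
  by exists n0.
move=> [y n] [/= yx nn] z zy; apply: KO'; apply: (HK y _ n nn z zy).
by move: yx; rewrite mx_norm_ball /ball_/= distrC.
Qed.

(** The support is enclosed in [K'], the points whose open ball of radius [t] lies in [Om]: a closed
    bounded set, which contains every point within [t] of [K] because [2 t <= 2^-n0]. *)
Lemma moll_test (f : V -> R) : C1c Om f -> exists n0 : nat, forall n, (n0 < n)%N ->
  test_function Om (moll f (dyad n)).
Proof.
move=> cf; have [c1 [K cK [KO fK]]] := cf; have [n0 Hn0] := deep_compact cK KO.
have Lf := C1c_L1 Om_r0 cf.
exists n0 => n nn; split.
  by move=> k; apply: (Ck_scl _ openT); exact: Ck_cv Lf (@kernel_rho R N).
pose t : R := 2^-1 ^+ n.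
have t0 : 0 < t by rewrite exprn_gt0// invr_gt0.
have tt : t + t <= 2^-1 ^+ n0.
  have -> : t + t = 2^-1 ^+ n.-1.
    by rewrite /t -[in LHS](ltn_predK nn) exprS; field.
  by rewrite ler_wiXn2l ?invr_ge0// ?invf_le1 ?ler1n//; move: nn; case: (n).
pose K' := [set x : V | forall z, `|z - x| < t -> Om z].
have K'O : K' `<=` Om by move=> x; apply; rewrite subrr normr0.
exists K'; split => //.
  have -> : K' = [set x | `|x| <= r0] `&` K'.
    by apply/seteqP; split=> [x Kx|x []//]; split => //; apply: Om_r0; exact: K'O.
  apply: compact_closedI; first exact: compact_cball.
  rewrite -[K']setCK; apply: open_closedC; rewrite openE => x /= nK.
  have [z zx nz] : exists2 z, `|z - x| < t & ~ Om z.
    by apply: contrapT => h; apply: nK => z zx; apply: contrapT => nz; apply: h; exists z.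
  apply/nbhs_ballP; exists (t - `|z - x|); first by rewrite /= subr_gt0.
  move=> y; rewrite mx_norm_ball /ball_/= => h K'y; apply: nz; apply: K'y.
  have -> : z - y = (z - x) + (x - y) by rewrite addrA subrK.
  by apply: (le_lt_trans (ler_normD _ _)); lra.
move=> x nK; rewrite /moll; apply/eqP; rewrite mulf_eq0; apply/orP; right; apply/eqP.
rewrite -(@Int0 R N); apply: Int_ext => y.
have [Ky|nKy] := pselect (K y); last by rewrite fK// mul0r.
rewrite [rho _](_ : _ = 0) ?mulr0//; apply: (moved_supp (chi := rho) (@kernel_rho R N)).
rewrite gtr0_norm ?dyad_gt0// ltNge; apply/negP => h.
have {}h : `|x - y| <= t by rewrite /t exprVn -[leRHS]mul1r ler_pdivlMr ?exprn_gt0// mulrC.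
apply: nK => z zx; apply: (Hn0 y Ky).
have -> : z - y = (z - x) + (x - y) by rewrite addrA subrK.
by apply: (le_trans (ler_normD _ _)); apply: le_trans tt; rewrite lerD// ltW.
Qed.

Lemma test_H10 phi : test_function Om phi -> H10 Om phi (grad phi).
Proof.
move=> tp; have cp := test_C1c tp; have bp := C1c_bsupp Om_r0 cp.
have cd i : continuous (partial i phi) by exact: C0_partial cp.1.
have mO : measurable Om by exact: open_measurable_rV.
have [Le _] := energyE cp.1 bp.
have E2 x : zext Om (enorm \o grad phi) x ^+ 2 = \sum_i partial i phi x ^+ 2.
  rewrite zext_enorm; apply: eq_bigr => i _.
  by rewrite -[in RHS](C1c_zext x cp).2 /zext mxE.
have z f : (forall x, f x = 0) -> LqNorm Om 2 f = 0%E.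
  move=> f0; have E x : 0 = zext Om f x ^+ 2 by rewrite /zext f0 mulr0 expr0n.
  by rewrite (L2NormE (L1_ext E (@L1_0 R N))) -(Int_ext E) Int0 sqrtr0.
split; last first.
  exists (fun=> phi); split => //.
    by rewrite z; [exact: cvg_cst|move=> x; rewrite subrr].
  rewrite z; first exact: cvg_cst.
  by move=> x; rewrite subrr /enorm big1 ?sqrtr0// => i _; rewrite mxE expr0n.
split.
- split; first by apply: measurable_funTS; apply: continuous_measurable_rV; exact: CkT_cont cp.1.
  apply: measurable_funTS; apply: measurable_fun_rVP => i.
  rewrite (_ : (fun x => _) = partial i phi); last by apply/funext => x; rewrite mxE.
  exact: continuous_measurable_rV.
- rewrite L2NormE ?ltry//; apply: L1_ext (L1_sqr (CkT_cont cp.1) bp) => x.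
  by rewrite (C1c_zext x cp).1.
- by rewrite L2NormE ?ltry//; apply: L1_ext Le => x; rewrite E2.
move=> psi tpsi i; have cpsi := test_C1c tpsi; have bpsi := C1c_bsupp Om_r0 cpsi.
have RI (F : V -> R) : (forall x, ~ Om x -> F x = 0) -> \int[mu]_(x in Om) F x = Int F.
  move=> F0; rewrite /Int /Rintegral integral_mkcond; congr fine; apply: eq_integral => x _.
  by rewrite patchE; case: ifPn => // /negP; rewrite inE => /F0 ->.
rewrite RI; last by move=> x nO; rewrite (C1c_out cp nO).1 mul0r.
rewrite RI; last by move=> x nO; rewrite (C1c_out cpsi nO).1 mulr0.
rewrite (_ : Int (fun x => grad phi x ord0 i * psi x) = Int (fun x => partial i phi x * psi x)); last first.
  by apply: Int_ext => x; rewrite mxE.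
by rewrite (IBP i cp.1 cpsi.1 bpsi) opprK.
Qed.

(** An almost optimal [C1c] function is mollified into a test function. The kernel is not
    normalised, but the quotient is homogeneous: the factor [mass^2] of the energy cancels against
    [(mass^q)^(2/q)]. *)
Lemma rayleigh_le e : 0 < e -> exists2 r, rayleigh_quotients Om q r & (r <= (I + e)%:E)%E.
Proof.
move=> e0; have e2 : 0 < e / 2 by rewrite divr_gt0.
have [f [cf nf Ef]] := sobolev_near openOm Om_r0 Om_x0 q2 e2.
have bf := C1c_bsupp Om_r0 cf; have [n0 Hn0] := moll_test cf.
have m0 := @rho_mass_gt0 R N.
have Lf := C1c_L1 Om_r0 cf.
have cN : nrm (moll f (dyad n)) @[n --> \oo] --> mass `^ q.
  have := mollify_cvg q0 (CkT_cont cf.1) bf; rewrite (nrmZ Om_r0 q2 mass cf) (gtr0_norm m0) nf mulr1; exact.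
have cE : energy (moll f (dyad n)) @[n --> \oo] --> mass ^+ 2 * energy f.
  have ci i : Int (fun x => partial i (moll f (dyad n)) x ^+ 2) @[n --> \oo] -->
      mass ^+ 2 * Int (fun x => partial i f x ^+ 2).
    have t2 : 0 < 2 :> R by [].
    have := mollify_cvg t2 (@C0_partial _ _ i _ cf.1) (bsupp_partial i bf).
    have -> : Int (fun x => `|mass * partial i f x| `^ 2) = mass ^+ 2 * Int (fun x => partial i f x ^+ 2).
      rewrite -IntZ; last exact: L1_partial_sqr cf.1 bf.
      by apply: Int_ext => x; rewrite abs_powR2 exprMn.
    move=> c; apply: cvg_trans c; apply: near_eq_cvg; apply: nearW => n; apply: Int_ext => x.
    by rewrite abs_powR2 (partial_moll _ _ (dyad_gt0 n) cf.1 bf).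
  have c := cvg_sumr (s := index_enum _) ci.
  rewrite (energyE cf.1 bf).2 mulr_sumr.
  apply: cvg_trans c; apply: near_eq_cvg; exists n0.+1; first exact: Logic.I.
  move=> n /= nn.
  have ct := test_C1c (Hn0 n nn).
  by rewrite (energyE ct.1 (C1c_bsupp Om_r0 ct)).2.
have mq : 0 < mass `^ q by exact: powR_gt0.
have P : 0 < (mass `^ q) `^ (2 / q) by exact: powR_gt0.
have mE : (mass `^ q) `^ (2 / q) = mass ^+ 2.
  by rewrite -powRrM mulrCA mulfV ?lt0r_neq0// mulr1 powR_mulrn// ltW.
have cQ : energy (moll f (dyad n)) / `|nrm (moll f (dyad n))| `^ (2 / q) @[n --> \oo] --> energy f.
  have -> : energy f = mass ^+ 2 * energy f / `|mass `^ q| `^ (2 / q).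
    by rewrite (gtr0_norm mq) mE mulrAC divff ?mul1r// expf_neq0// lt0r_neq0.
  apply: cvgM => //; apply: cvgV; first by rewrite (gtr0_norm mq) lt0r_neq0.
  by apply: powR_abs_cvg => //; rewrite divr_gt0.
have lt1 : energy f < I + e by rewrite (le_lt_trans Ef)// ltrD2l ltr_pdivrMr// ltr_pMr// ltr1n.
have H1 : \forall n \near \oo, energy (moll f (dyad n)) / `|nrm (moll f (dyad n))| `^ (2 / q) <= I + e.
  by exact: cvgr_le cQ _ lt1.
have H2 : \forall n \near \oo, 0 < nrm (moll f (dyad n)) by exact: cvgr_gt cN _ mq.
have H3 : \forall n \near \oo, (n0 < n)%N by exists n0.+1.
have [n _ /(_ n (leqnn n)) [[h1 h2] h3]] := filterI (filterI H1 H2) H3.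
have tm := Hn0 n h3; have cm := test_C1c tm; have bm := C1c_bsupp Om_r0 cm.
pose w := moll f (dyad n); rewrite -/w in h1 h2 tm cm bm.
have [Le _] := energyE cm.1 bm.
have wE : zext Om w = w by apply/funext => x; rewrite (C1c_zext x cm).1.
have E2 : (fun x => zext Om (enorm \o grad w) x ^+ 2) = fun x => \sum_i partial i w x ^+ 2.
  apply/funext => x; rewrite zext_enorm; apply: eq_bigr => i _.
  by rewrite -[in RHS](C1c_zext x cm).2 /zext mxE.
exists (LqNorm Om 2 (enorm \o grad w) ^+ 2 / LqNorm Om q w ^+ 2)%E.
  exists w, (grad w); split => //; first exact: test_H10.
  move=> ae0; have : nrm w = Int (fun _ : V => 0).
    apply: Int_ae; [exact: (C1c_L1q Om_r0 q0 cm)|exact: L1_0|].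
    apply: filterS ae0 => x h; have [Ox|nO] := pselect (Om x).
      by rewrite h// normr0 powR0// lt0r_neq0.
    by rewrite (C1c_out cm nO).1 normr0 powR0// lt0r_neq0.
  by rewrite Int0 => E; rewrite E ltxx in h2.
have Lw := C1c_L1q Om_r0 q0 cm.
rewrite L2NormE ?E2// LqNormE ?wE// -!EFin_expe sqr_sqrtr; last exact: energy_ge0.
have P' : 0 < (nrm w `^ q^-1) ^+ 2 by rewrite exprn_gt0// powR_gt0.
rewrite inver (gt_eqF P') -EFinM lee_fin; move: h1; rewrite gtr0_norm//.
by rewrite -[(nrm w `^ q^-1) ^+ 2]powR_mulrn ?powR_ge0// -powRrM [q^-1 * _]mulrC.
Qed.

Lemma rayleigh_inf : ereal_inf (rayleigh_quotients Om q) = I%:E.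
Proof.
apply/eqP; rewrite eq_le; apply/andP; split; last by apply: le_ereal_inf_tmp => r; exact: rayleigh_ge.
apply/lee_addgt0Pr => e e0; have [r Hr Hle] := rayleigh_le e0.
by rewrite -EFinD; apply: le_trans Hle; exact: ereal_inf_lbound.
Qed.

End Sobolev_quotients.

Lemma for_continuous_dist {R : realType} {N : nat} (f : 'rV[R]_N -> R) (x : 'rV[R]_N) :
  (forall e, 0 < e -> \forall y \near x, `|f x - f y| < e) -> {for x, continuous f}.
Proof. by move=> h; apply/(@cvgrPdist_lt _ _ _ (nbhs x) _). Qed.

(** * Solutions and ground states *)

Section admissible_functions.
Context {R : realType} {M : nat}.
Notation N := M.+2.
Notation V := 'rV[R]_N.
Variable Om : set V.
Hypothesis openOm : open Om.

Definition gradnorm (u : V -> R) : R := fine (LqNorm Om 2 (enorm \o grad u)).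

Lemma boundary_out (x : V) : boundary Om x -> ~ Om x.
Proof. by move=> [_]; rewrite (interior_id Om).1. Qed.

Lemma admissible_out u x : admissible Om u -> ~ Om x -> u x = 0.
Proof.
move=> [_ _ ub _ uo] nO; have [cx|ncx] := pselect (closure Om x); last exact: uo.
by apply: ub; split => //; rewrite (interior_id Om).1.
Qed.

Lemma admissible_continuous u : admissible Om u -> continuous u.
Proof.
move=> au x; have [cu uc _ _ _] := au.
have [Ox|nO] := pselect (Om x); first exact: (Ck_cont cu Ox).
have ux := admissible_out au nO.
have [cx|ncx] := pselect (closure Om x).
  move/subspace_continuousP : uc => /(_ x cx) /cvgrPdist_lt h.
  apply: for_continuous_dist => e e0; have := h e e0; rewrite near_withinE; apply: filterS => y hy.
  have [cy|ncy] := pselect (closure Om y); first exact: hy.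
  by rewrite ux (admissible_out au) ?subrr ?normr0// => Oy; apply: ncy; exact: subset_closure.
apply: for_continuous_dist => e e0.
have : \forall y \near x, (~` closure Om) y by apply: open_nbhs_nbhs; split => //; exact/closed_openC/closed_closure.
apply: filterS => y ncy.
by rewrite ux (admissible_out au) ?subrr ?normr0// => Oy; apply: ncy; exact: subset_closure.
Qed.

Lemma zext_gradsq (u : V -> R) (x : V) : zext Om (enorm \o grad u) x ^+ 2 = gradsq Om u x.
Proof.
rewrite /zext exprMn /= enorm_sqr /gradsq; congr (_ * _).
  by rewrite indicE; case: (_ \in _); rewrite ?expr1n ?expr0n.
by apply: eq_bigr => i _; rewrite mxE.
Qed.

Lemma admissible_L1 u : admissible Om u -> L1 (gradsq Om u).
Proof.
move=> [cu _ _ fin _]; apply: L1_ext (L2Norm_L1 _ fin) => [x|]; first exact: zext_gradsq.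
rewrite (_ : zext Om _ = fun x => `|gradsq Om u x| `^ 2^-1).
  by apply: measurable_powR_abs; exact: measurable_gradsq.
apply/funext => x; rewrite ger0_norm ?gradsq_ge0// powR12_sqrt ?gradsq_ge0//.
rewrite -zext_gradsq sqrtr_sqr ger0_norm//.
by rewrite /zext mulr_ge0// /= sqrtr_ge0.
Qed.

Lemma LqNorm_gradsq u : L1 (gradsq Om u) ->
  LqNorm Om 2 (enorm \o grad u) = (Num.sqrt (Int (gradsq Om u)))%:E.
Proof.
move=> L; rewrite L2NormE; first by rewrite (Int_ext (zext_gradsq u)).
by apply: L1_ext L => x; rewrite zext_gradsq.
Qed.

Lemma gradnormE u : L1 (gradsq Om u) -> gradnorm u = Num.sqrt (Int (gradsq Om u)).
Proof. by move=> L; rewrite /gradnorm LqNorm_gradsq. Qed.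

Lemma gradnorm_ge0 u : 0 <= gradnorm u.
Proof. by rewrite /gradnorm fine_ge0// Lnorm_ge0. Qed.

Lemma admissible_intro u : continuous u -> Ck Om 2 u -> (forall x, ~ Om x -> u x = 0) ->
  L1 (gradsq Om u) -> admissible Om u.
Proof.
move=> uc cu uO L; split => //.
- exact: continuous_subspaceT.
- by move=> x bx; apply: uO; exact: boundary_out.
- by rewrite LqNorm_gradsq// ltry.
- by move=> x nx; apply: uO => Ox; apply: nx; exact: subset_closure.
Qed.

Section scale.
Variables (k : R) (u : V -> R).
Hypothesis au : admissible Om u.
Let ku x := k * u x.

Let cu : Ck Om 2 u. Proof. by have [] := au. Qed.

Let partial_ku i x : Om x -> partial i ku x = k * partial i u x.
Proof.
move=> Ox; apply: is_derive_partial; apply: is_derive_scl; apply: derivable_partial.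
exact: Ck_derivable cu Ox.
Qed.

Lemma laplacian_scale x : Om x -> laplacian ku x = k * laplacian u x.
Proof.
move=> Ox; rewrite /laplacian mulr_sumr; apply: eq_bigr => i _.
have E : {near x, partial i ku =1 fun y => k * partial i u y}.
  have : \forall y \near x, Om y by apply: open_nbhs_nbhs.
  by apply: filterS => y; exact: partial_ku.
rewrite (near_partial i E).
apply: is_derive_partial; apply: is_derive_scl; apply: derivable_partial.
apply: (@Ck_derivable _ _ Om 0 (partial i u) i x _ Ox).
exact: (@Ck_partial _ _ Om 1 u i cu).
Qed.

Let gradsq_ku x : k ^+ 2 * gradsq Om u x = gradsq Om ku x.
Proof.
have [Ox|nO] := pselect (Om x); last by rewrite /gradsq indicE memNset// !mul0r mulr0.
rewrite /gradsq mulrCA; congr (_ * _); rewrite mulr_sumr; apply: eq_bigr => i _.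
by rewrite (partial_ku i Ox) exprMn.
Qed.

Lemma admissible_scale : admissible Om ku.
Proof.
apply: admissible_intro.
- by move=> x; apply: (@continuousM _ _ (fun=> k) u x); [exact: cst_continuous|exact: admissible_continuous].
- exact: Ck_scl.
- by move=> x nO; rewrite /ku (admissible_out au nO) mulr0.
- exact: L1_ext gradsq_ku (L1Z _ (admissible_L1 au)).
Qed.

Lemma gradnorm_scale : gradnorm ku = `|k| * gradnorm u.
Proof.
rewrite !gradnormE; [|exact: admissible_L1|exact: admissible_L1 admissible_scale].
rewrite -(Int_ext gradsq_ku) (IntZ _ (admissible_L1 au)) sqrtrM ?sqr_ge0//.
by rewrite sqrtr_sqr.
Qed.

End scale.

Section ground_state.
Variables (r0 p : R) (x0 : V).
Hypothesis Om_r0 : forall x, Om x -> `|x| <= r0.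
Hypothesis Om_x0 : Om x0.
Hypothesis p1 : 1 < p.
Let q := p + 1.
Let q2 : 2 < q. Proof. by move: p1; rewrite /q; lra. Qed.
Let I := sobolev_inf Om q.

Lemma sobolev_SE : 0 < I -> sobolev_S Om p = I `^ ((p + 1) / 2).
Proof.
move=> I0; rewrite /sobolev_S (rayleigh_inf openOm Om_r0 Om_x0 q2 I0).
by rewrite poweR_EFin.
Qed.

Lemma sobolev_S_gt0 : 0 < I -> 0 < sobolev_S Om p.
Proof. by move=> I0; rewrite sobolev_SE// powR_gt0. Qed.

Lemma sobolev_S_mul : 0 < I -> sobolev_S Om p = I * I `^ ((p - 1) / 2).
Proof.
move=> I0; rewrite sobolev_SE// (_ : (p + 1) / 2 = 1 + (p - 1) / 2); last by field.
by rewrite powRD ?powRr1 ?(ltW I0)//; apply/implyP => _; rewrite lt0r_neq0.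
Qed.

(** Let [y] be the squared [L^q] norm of [u] and [k] its Kirchhoff factor. Testing the equation
    gives [k I <= y^((p-1)/2)], comparison with the gradient gives [I y <= D^2]. Eliminating [y]
    leaves [k I I^((p-1)/2) <= D^(p-1)], and [S = I I^((p-1)/2)]. *)
Lemma K_solution_bound a b alpha u : 0 < a -> 0 < b -> 0 < I ->
  K_solution Om a b alpha p u -> nontrivial_on Om u ->
  exists2 D : R, 0 < D & (a + b * D `^ (2 * alpha)) * sobolev_S Om p <= D `^ (p - 1).
Proof.
move=> a0 b0 I0 [au ueq] [x Ox ux].
have cu := admissible_continuous au; have uO y : ~ Om y -> u y = 0 by exact: admissible_out au.
have [u2 _ _ _ _] := au; have L := admissible_L1 au.
rewrite -/(gradnorm u) in ueq; pose D := gradnorm u; rewrite -/D in ueq.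
pose k := a + b * D `^ (2 * alpha); rewrite -/k in ueq.
have k0 : 0 < k by rewrite ltr_wpDr// mulr_ge0 ?(ltW b0)// powR_ge0.
have eq' y : Om y -> - laplacian u y = k^-1 * (`|u y| `^ (q - 2) * u y).
  move=> Oy; have -> : q - 2 = p - 1 by rewrite /q; ring.
  by rewrite -(ueq y Oy) mulNr mulrN mulKf// lt0r_neq0.
have k'0 : 0 <= k^-1 by rewrite invr_ge0 ltW.
have h1 := solution_ineq1 openOm Om_r0 Om_x0 q2 cu uO u2 k'0 eq'.
have h2 := solution_ineq2 openOm Om_r0 Om_x0 q2 cu uO u2 L.
set Y := Int (fun x => `|u x| `^ q) in h1 h2.
have q0 : 0 < q by exact: lt_trans q2.
have Lq := solution_Lq Om_r0 q2 cu uO.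
have Y0 : 0 < Y.
  rewrite lt_neqAle Int_ge0 ?andbT; last by move=> y; exact: powR_ge0.
  apply/eqP => /esym E; move/eqP: ux; apply.
  have := @Int_eq0_at R N (fun y => `|u y| `^ q) x Lq (fun y => powR_ge0 _ _) E _.
  move=> /(_ _)/eqP; rewrite powR_eq0 normr_eq0 => h.
  have [|/eqP //] := andP (h _).
  by apply: (@continuous_comp _ _ _ u (fun t => `|t| `^ q) x (cu x)); exact: continuous_powR_abs.
have D2 : Int (gradsq Om u) = D ^+ 2.
  by rewrite /D gradnormE// sqr_sqrtr// Int_ge0// => y; exact: gradsq_ge0.
rewrite -/I D2 in h1 h2.
have Y2 : 0 < Y `^ (2 / q) by exact: powR_gt0.
have D0 : 0 < D.
  rewrite lt_neqAle gradnorm_ge0 andbT; apply/eqP => E.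
  by move: h2; rewrite -E expr0n/= leNgt mulr_gt0.
exists D => //; rewrite -/k sobolev_S_mul//.
have E1 : Y = Y `^ (2 / q) * (Y `^ (2 / q)) `^ ((p - 1) / 2).
  rewrite -powRrM -powRD; last by apply/implyP => _; rewrite lt0r_neq0.
  rewrite (_ : _ + _ = 1) ?powRr1 ?(ltW Y0)//.
  by rewrite /q; field; rewrite -/q lt0r_neq0.
set y := Y `^ (2 / q) in h1 h2 Y2 E1.
have h3 : k * I <= y `^ ((p - 1) / 2).
  by rewrite -(ler_pM2l Y2) -E1 mulrCA -ler_pdivlMl// [y * I]mulrC.
have h4 : (I * y) `^ ((p - 1) / 2) <= D `^ (p - 1).
  have -> : D `^ (p - 1) = (D ^+ 2) `^ ((p - 1) / 2).
    rewrite -powR_mulrn ?(ltW D0)// -powRrM; congr (_ `^ _); by field.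
  apply: ge0_ler_powR => //.
  - by rewrite divr_ge0// subr_ge0 ltW.
  - by rewrite nnegrE mulr_ge0// ltW.
  - by rewrite nnegrE sqr_ge0.
apply: le_trans h4; rewrite powRM ?(ltW I0) ?(ltW Y2)//.
by rewrite mulrA mulrC ler_wpM2l ?powR_ge0.
Qed.

Hypothesis smooth : smooth_boundary Om.
Hypothesis connOm : connected Om.

(** The energy of [w] is at most [I] by testing the equation and at least [I] by the Sobolev
    inequality for its truncations, the [L^q] norm being [1]. *)
Lemma ground_state : M%:R * (q - 2) < 4 -> 0 < I /\
  exists w : V -> R, [/\ admissible Om w, positive_on Om w,
    forall x, Om x -> - laplacian w x = I * (`|w x| `^ (p - 1) * w x) & gradnorm w = Num.sqrt I].
Proof.
move=> sub; have [I0 [w [B rw]]] := exists_regular_weak openOm Om_r0 Om_x0 q2 sub.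
split => //; exists w.
have [[_ wO] w0 [Lw nw] _ _] := rw.
have [w2 weq] := regular_classical openOm Om_r0 q2 I0 rw.
have wp := regular_positive openOm Om_r0 q2 I0 rw connOm.
have weq' x : Om x -> - laplacian w x = I * (`|w x| `^ (q - 2) * w x).
  move=> Ox; have w0x := wp x Ox; rewrite weq//; congr (_ * _).
  rewrite (gtr0_norm w0x) -[X in _ * X](powRr1 (ltW w0x)) -powRD.
    by congr (_ `^ _); ring.
  by apply/implyP => _; rewrite lt0r_neq0.
have cw : continuous w.
  move=> x; have [Ox|nO] := pselect (Om x); first exact: (Ck_cont w2 Ox).
  have [cx|ncx] := pselect (closure Om x).
    have [|i [s [L [r [L0 r0' cone]]]]] := exterior_cone openOm smooth (x0 := x).
      by split => //; rewrite (interior_id Om).1.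
    exact: (boundary_decay Om_r0 q2 I0 rw L0 r0' cone nO).
  apply: for_continuous_dist => e e0.
  have : \forall y \near x, (~` closure Om) y by apply: open_nbhs_nbhs; split => //; exact/closed_openC/closed_closure.
  apply: filterS => y ncy; rewrite !wO ?subrr ?normr0// => Oy; apply: ncy; exact: subset_closure.
have [L hI] := positive_gradsq openOm Om_r0 q2 cw wO w2 (ltW I0) weq' wp.
have hI' := solution_ineq2 openOm Om_r0 Om_x0 q2 cw wO w2 L.
have E : Int (fun x => `|w x| `^ q) = 1.
  by rewrite -[RHS]nw; apply: Int_ext => x; rewrite ger0_norm//; case/andP: (w0 x).
rewrite E ?powR1 ?mulr1 -/I in hI hI'.
split => //.
- exact: admissible_intro.
- by move=> x Ox; rewrite weq'// (_ : q - 2 = p - 1)// /q; ring.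
- by rewrite gradnormE//; congr Num.sqrt; apply: le_anti; rewrite hI hI'.
Qed.

Lemma K_solution_exists a b alpha D : M%:R * (q - 2) < 4 -> 0 < D ->
  (a + b * D `^ (2 * alpha)) * sobolev_S Om p = D `^ (p - 1) ->
  exists u, [/\ K_solution Om a b alpha p u, positive_on Om u & gradnorm u = D].
Proof.
move=> sub D0 DE; have [I0 [w [aw wp weq wD]]] := ground_state sub.
(* The multiple with gradient norm [D]. As [S = I I^((p-1)/2)], the hypothesis on [D] says that
   [s^(p-1) = (a + b D^(2 alpha)) I], which is the condition for [s w] to solve (K). *)
pose s := D / Num.sqrt I.
have sI : 0 < Num.sqrt I by rewrite sqrtr_gt0.
have s0 : 0 < s by rewrite divr_gt0.
have uD : gradnorm (fun x => s * w x) = D.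
  by rewrite gradnorm_scale// wD gtr0_norm// divfK// lt0r_neq0.
exists (fun x => s * w x); split => //; last by move=> x Ox; rewrite mulr_gt0// wp.
split; first exact: admissible_scale.
move=> x Ox; rewrite -/(gradnorm _) uD laplacian_scale//.
rewrite mulNr -mulrN -mulrN weq//.
have -> : `|s * w x| `^ (p - 1) = s `^ (p - 1) * `|w x| `^ (p - 1).
  by rewrite normrM (gtr0_norm s0) powRM// ltW.
have -> : s `^ (p - 1) = (a + b * D `^ (2 * alpha)) * I.
  rewrite /s powRM ?(ltW D0) ?invr_ge0 ?(ltW sI)// -DE sobolev_S_mul//.
  rewrite -powR12_sqrt ?(ltW I0)// -(powR_inv1 (powR_ge0 I 2^-1)) -!powRrM.
  rewrite -!mulrA -powRD; last by apply/implyP => _; rewrite lt0r_neq0.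
  by rewrite (_ : (p - 1) / 2 + _ = 0) ?powRr0 ?mulr1//; field.
have E (A W t J : R) : A * (s * (J * (W * t))) = A * J * W * (s * t) by ring.
exact: E.
Qed.

End ground_state.

End admissible_functions.

(** * The scalar equation *)

Section scalar_equation.
Context {R : realType}.
Implicit Types a b S th x D s t : R.

(** The absolute values make the function continuous on the whole line, so that the intermediate
    value theorem applies on intervals starting at [0]; the one family serves [two_roots] and
    [balance_root]. *)
Lemma continuous_scalar a b c d (th e : R) : 0 < th -> 0 < e ->
  continuous (fun t => a + b * t + c * `|t| `^ th + d * `|t| `^ e).
Proof.
move=> t0 e0 t; have ct : {for t, continuous (fun t : R => `|t| `^ th)} by exact: continuous_powR_abs.
have ce : {for t, continuous (fun t : R => `|t| `^ e)} by exact: continuous_powR_abs.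
apply: (@cvgD _ _ _ (nbhs t)); last by apply: (@cvgMr _ _ (nbhs t)); exact: ce.
apply: (@cvgD _ _ _ (nbhs t)); last by apply: (@cvgMr _ _ (nbhs t)); exact: ct.
apply: (@cvgD _ _ _ (nbhs t)); first exact: cvg_cst.
by apply: (@cvgMr _ _ (nbhs t)); exact: cvg_id.
Qed.

Lemma two_roots a b S th x0 : 0 < a -> 0 < b -> 0 < S -> 0 < th -> th < 1 -> 0 < x0 ->
  (a + b * x0) * S < x0 `^ th ->
  exists x1 x2, [/\ 0 < x1, x1 < x2, (a + b * x1) * S = x1 `^ th & (a + b * x2) * S = x2 `^ th].
Proof.
move=> a0 b0 S0 t0 t1 x00 lt0.
pose F x : R := a * S + b * S * x + -1 * `|x| `^ th + 0 * `|x| `^ th.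
have FE x : 0 <= x -> F x = (a + b * x) * S - x `^ th.
  by move=> x0'; rewrite /F ger0_norm//; ring.
have cF : continuous F by exact: continuous_scalar.
have Fneg : F x0 < 0 by rewrite FE ?(ltW x00)// subr_lt0.
have t1' : 0 < 1 - th by rewrite subr_gt0.
(* [X] solves [b S X = X^th], so that [F X = a S > 0]; as [F] is also positive at [0] and negative
   at [x0], there is a root on each side of [x0]. *)
pose X := (b * S)^-1 `^ (1 - th)^-1.
have bS : 0 < b * S by rewrite mulr_gt0.
have X0 : 0 < X by rewrite powR_gt0// invr_gt0.
have XE : X `^ (1 - th) = (b * S)^-1.
  by rewrite /X -powRrM mulVf ?lt0r_neq0// powRr1// invr_ge0 ltW.
have split_pow y : 0 < y -> y = y `^ th * y `^ (1 - th).
  move=> y0; rewrite -powRD; last by apply/implyP => _; rewrite lt0r_neq0.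
  by rewrite addrC subrK powRr1// ltW.
have FX : F X = a * S.
  rewrite FE ?(ltW X0)// -[X in b * X](_ : X `^ th * (b * S)^-1 = X).
    by field; rewrite !lt0r_neq0.
  by rewrite -XE -split_pow.
have xX : x0 < X.
  rewrite ltNge; apply/negP => h.
  have : X `^ (1 - th) <= x0 `^ (1 - th).
    by apply: ge0_ler_powR; rewrite ?nnegrE ?(ltW t1')// ltW.
  rewrite XE -(ler_pM2l bS) mulfV ?lt0r_neq0// => h1.
  have P : 0 < x0 `^ th by exact: powR_gt0.
  have : x0 `^ th * 1 <= x0 `^ th * (b * S * x0 `^ (1 - th)) by rewrite ler_pM2l.
  rewrite mulr1 mulrCA -split_pow// => h2.
  have := mulr_gt0 a0 S0; lra.
have aS : 0 < a * S by rewrite mulr_gt0.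
have F0 : F 0 = a * S by rewrite FE// powR0 ?lt0r_neq0//; ring.
have root y : 0 <= y -> F y = 0 -> (a + b * y) * S = y `^ th.
  by move=> y0; rewrite FE// => /eqP; rewrite subr_eq0 => /eqP.
have [x1 x1i Fx1] : exists2 c, c \in `[0, x0] & F c = 0.
  apply: IVT; [exact: ltW|exact: continuous_subspaceT|].
  by rewrite F0 ge_min le_max (ltW Fneg) (ltW aS) orbT.
have [x2 x2i Fx2] : exists2 c, c \in `[x0, X] & F c = 0.
  apply: IVT; [exact: ltW|exact: continuous_subspaceT|].
  by rewrite FX ge_min le_max (ltW Fneg) (ltW aS) orbT.
move: x1i x2i; rewrite !in_itv/= => /andP[x1a x1b] /andP[x2a x2b].
have lt_x0 y : F y = 0 -> y != x0 by move=> Fy; apply/eqP => E; rewrite -E Fy ltxx in Fneg.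
have x1l : x1 < x0 by rewrite lt_neqAle lt_x0.
have x2l : x0 < x2 by rewrite lt_neqAle eq_sym lt_x0.
exists x1, x2; split.
- rewrite lt_neqAle x1a andbT; apply/eqP => E; rewrite -E F0 in Fx1.
  by rewrite Fx1 ltxx in aS.
- exact: lt_trans x2l.
- exact: root.
- by apply: root => //; apply: le_trans x2a; exact: ltW.
Qed.

Section threshold.
Variables a b al p : R.
Hypotheses (a0 : 0 < a) (b0 : 0 < b) (al0 : 0 < al) (p1 : 1 < p) (pal : p < 2 * al + 1).

(* The line [a + b x] touches a multiple of the concave function [x `^ crit_th]
   at [crit_x], and this multiple is [1 / crit_S]. *)
Definition crit_th := (p - 1) / (2 * al).
Definition crit_x := a * crit_th / (b * (1 - crit_th)).
Definition crit_S := crit_x `^ crit_th * (1 - crit_th) / a.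

Lemma crit_th_itv : 0 < crit_th < 1.
Proof.
rewrite /crit_th divr_gt0 ?subr_gt0 ?mulr_gt0//= ltr_pdivrMr ?mulr_gt0// mul1r ltrBlDr.
exact: pal.
Qed.

Let th0 : 0 < crit_th. Proof. by case/andP: crit_th_itv. Qed.
Let th1 : 0 < 1 - crit_th. Proof. by case/andP: crit_th_itv; rewrite subr_gt0. Qed.

Lemma crit_x_gt0 : 0 < crit_x.
Proof. by apply: divr_gt0; exact: mulr_gt0. Qed.

Lemma crit_S_gt0 : 0 < crit_S.
Proof. by rewrite divr_gt0// mulr_gt0// powR_gt0// crit_x_gt0. Qed.

Lemma crit_eq : (a + b * crit_x) * crit_S = crit_x `^ crit_th.
Proof.
rewrite /crit_S {1}/crit_x; move: (_ `^ _) => y; field.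
by rewrite !lt0r_neq0.
Qed.

(** Bernoulli's inequality at [x / crit_x]: a concave function lies below its tangent at
    [crit_x]. *)
Lemma crit_tangent x : 0 <= x -> x `^ crit_th <= (a + b * x) * crit_S.
Proof.
move=> x0; have cx := crit_x_gt0.
have xc : 0 <= x / crit_x by rewrite divr_ge0// ltW.
have th1' : crit_th < 1 by rewrite -subr_gt0.
have := powR_bernoulli xc th0 th1'.
have P : 0 < crit_x `^ crit_th by exact: powR_gt0.
rewrite -(ler_pM2l P) -powRM ?(ltW cx)// mulrCA mulfV ?lt0r_neq0// mulr1 => h.
apply: (le_trans h); rewrite le_eqVlt; apply/orP; left; apply/eqP.
rewrite /crit_S {2}/crit_x; move: (_ `^ _) => y; field.
by rewrite !lt0r_neq0.
Qed.

Let ga := 2 * al + 1 - p.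
Let ga0 : 0 < ga. Proof. by rewrite /ga subr_gt0. Qed.

(** Both sides of the condition of the theorem are products of real powers, so their logarithms are
    computed term by term. As [ga] and [2 al] are positive, the identity shows that comparing them
    amounts to comparing [S] with [crit_S]. *)
Lemma threshold_ln S : 0 < S ->
  let lhs := a * b `^ ((p - 1) / ga) in
  let rhs := ga * ((p - 1) `^ (p - 1) / (2 * al * S) `^ (2 * al)) `^ (1 / ga) in
  [/\ 0 < lhs, 0 < rhs & ga * (ln rhs - ln lhs) = 2 * al * (ln crit_S - ln S)].
Proof.
move=> S0 lhs rhs.
have m0 : 0 < p - 1 by rewrite subr_gt0.
have l0 : 0 < 2 * al by rewrite mulr_gt0.
have lS : 0 < 2 * al * S by rewrite mulr_gt0.
have P1 : 0 < b `^ ((p - 1) / ga) by exact: powR_gt0.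
have P2 : 0 < (p - 1) `^ (p - 1) by exact: powR_gt0.
have P3 : 0 < (2 * al * S) `^ (2 * al) by exact: powR_gt0.
have P4 : 0 < ((2 * al * S) `^ (2 * al))^-1 by rewrite invr_gt0.
have P5 : 0 < ((p - 1) `^ (p - 1) / (2 * al * S) `^ (2 * al)) `^ (1 / ga).
  by apply: powR_gt0; exact: mulr_gt0.
split; [exact: mulr_gt0|exact: mulr_gt0|].
have cx := crit_x_gt0.
have thE : ln crit_th = ln (p - 1) - ln (2 * al).
  by rewrite /crit_th lnM ?posrE ?invr_gt0// lnV ?posrE.
have th1E : ln (1 - crit_th) = ln ga - ln (2 * al).
  rewrite (_ : 1 - crit_th = ga / (2 * al)); last by rewrite /crit_th /ga; field; exact: lt0r_neq0.
  by rewrite lnM ?posrE ?invr_gt0// lnV ?posrE.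
have xE : ln crit_x = ln a + ln crit_th - (ln b + ln (1 - crit_th)).
  have bt : 0 < b * (1 - crit_th) by exact: mulr_gt0.
  have at' : 0 < a * crit_th by exact: mulr_gt0.
  rewrite /crit_x lnM ?posrE ?invr_gt0// lnV ?posrE//.
  by rewrite (lnM a0 th0) (lnM b0 th1).
have SE : ln crit_S = crit_th * ln crit_x + ln (1 - crit_th) - ln a.
  have P6 : 0 < crit_x `^ crit_th by exact: powR_gt0.
  have P7 := mulr_gt0 P6 th1.
  by rewrite /crit_S lnM ?posrE ?invr_gt0// lnM ?posrE// lnV ?posrE// ln_powR.
have lE : ln lhs = ln a + (p - 1) / ga * ln b by rewrite /lhs lnM ?posrE// ln_powR.
have rE : ln rhs = ln ga + ((p - 1) * ln (p - 1) - 2 * al * (ln (2 * al) + ln S)) / ga.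
  rewrite /rhs lnM ?posrE// ln_powR lnM ?posrE// lnV ?posrE// !ln_powR lnM ?posrE//.
  by rewrite mul1r mulrC.
rewrite lE rE SE xE thE th1E /crit_th.
have ga1 := lt0r_neq0 ga0; have al1 := lt0r_neq0 al0.
move: (ln _) (ln S) (ln a) (ln b) (ln ga) => *.
by rewrite /ga; field; rewrite ga1 al1.
Qed.

Lemma threshold S : 0 < S ->
  let lhs := a * b `^ ((p - 1) / ga) in
  let rhs := ga * ((p - 1) `^ (p - 1) / (2 * al * S) `^ (2 * al)) `^ (1 / ga) in
  [/\ lhs < rhs -> S < crit_S, lhs = rhs -> S = crit_S & rhs < lhs -> crit_S < S].
Proof.
move=> S0 lhs rhs; have [l0 r0 E] := threshold_ln S0; rewrite -/lhs -/rhs in l0 r0 E.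
have c0 := crit_S_gt0; have l2 : 0 < 2 * al by rewrite mulr_gt0.
split=> h.
- have : 0 < ga * (ln rhs - ln lhs) by rewrite mulr_gt0// subr_gt0 ltr_ln ?posrE.
  by rewrite E pmulr_rgt0// subr_gt0 ltr_ln ?posrE.
- have /eqP : ga * (ln rhs - ln lhs) = 0 by rewrite h subrr mulr0.
  rewrite E mulf_eq0 (gt_eqF l2)/= subr_eq0 => /eqP/ln_inj H.
  by symmetry; apply: H; rewrite posrE.
- have : ga * (ln rhs - ln lhs) < 0 by rewrite pmulr_rlt0// subr_lt0 ltr_ln ?posrE.
  by rewrite E pmulr_rlt0// subr_lt0 ltr_ln ?posrE.
Qed.

End threshold.

Section balance.
Variables A B e1 e2 : R.
Hypotheses (A0 : 0 < A) (B0 : 0 <= B) (e10 : 0 < e1) (e20 : 0 < e2).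

(** The left side is [0] at [0] and at least [1] at [A^(-1/e1)]. The case [B = 0] is included for
    the trivial solution, which has [D = 0]. *)
Lemma balance_root : exists2 t, 0 < t & A * t `^ e1 + B * t `^ e2 = 1.
Proof.
pose F t : R := 0 + 0 * t + A * `|t| `^ e1 + B * `|t| `^ e2.
have FE t : 0 <= t -> F t = A * t `^ e1 + B * t `^ e2.
  by move=> t0; rewrite /F ger0_norm// mul0r !add0r.
pose T := A^-1 `^ e1^-1.
have T0 : 0 <= T by exact: powR_ge0.
have FT : 1 <= F T.
  rewrite FE// /T -powRrM mulVf ?lt0r_neq0// powRr1 ?invr_ge0 ?(ltW A0)//.
  by rewrite mulfV ?lt0r_neq0// lerDl mulr_ge0// powR_ge0.
have F0 : F 0 = 0 by rewrite FE// !powR0 ?lt0r_neq0// !mulr0 addr0.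
have [t] : exists2 c, c \in `[0, T] & F c = 1.
  apply: IVT => //; first by apply: continuous_subspaceT; exact: continuous_scalar.
  by rewrite F0 ge_min ler01 le_max FT orbT.
rewrite in_itv/= => /andP[t0 _] Ft; exists t; last by rewrite -FE.
rewrite lt_neqAle t0 andbT; apply/eqP => E; move: Ft; rewrite -E F0 => /esym/eqP.
by rewrite oner_eq0.
Qed.

Lemma balance_unique s t : 0 < s -> 0 < t ->
  A * s `^ e1 + B * s `^ e2 = 1 -> A * t `^ e1 + B * t `^ e2 = 1 -> s = t.
Proof.
have lt1 x y : 0 < x -> x < y -> A * x `^ e1 + B * x `^ e2 < A * y `^ e1 + B * y `^ e2.
  move=> x0 xy; have y0 := lt_trans x0 xy; apply: ltr_leD.
    by rewrite ltr_pM2l//; apply: gt0_ltr_powR; rewrite ?nnegrE// ltW.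
  by rewrite ler_wpM2l//; apply: ge0_ler_powR; rewrite ?nnegrE// ltW.
move=> s0 t0 hs ht; have [h|h|//] := ltgtP s t.
  by have := lt1 s t s0 h; rewrite hs ht ltxx.
by have := lt1 t s t0 h; rewrite hs ht ltxx.
Qed.

End balance.

Section scaling_factor.
Variables a b al p D : R.
Hypotheses (a0 : 0 < a) (b0 : 0 < b) (al0 : 0 < al) (D0 : 0 <= D).
Hypothesis pal : p < 1 \/ 2 * al + 1 < p.

(** Division by [s^(p-1)] leaves the exponents [1 - p] and [2 al + 1 - p], which have the same sign
    precisely when [p < 1] or [p > 2 al + 1]; the left side is then monotone in [s]. *)
Let balance_eq s : 0 < s ->
  (a + b * (s * D) `^ (2 * al) = s `^ (p - 1)) <->
  (a * s `^ (1 - p) + b * D `^ (2 * al) * s `^ (2 * al + 1 - p) = 1).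
Proof.
move=> s0; have c0 : 0 < s `^ (p - 1) by exact: powR_gt0.
have -> : s `^ (1 - p) = (s `^ (p - 1))^-1 by rewrite -powRN opprB.
have -> : s `^ (2 * al + 1 - p) = s `^ (2 * al) * (s `^ (p - 1))^-1.
  rewrite -powRN -powRD; last by apply/implyP => _; rewrite lt0r_neq0.
  by congr (_ `^ _); ring.
rewrite powRM ?(ltW s0)//.
have E (X Z c : R) : a * c + b * X * (Z * c) = (a + b * (Z * X)) * c by ring.
rewrite E.
split=> [->|h]; first by rewrite mulfV// lt0r_neq0.
by apply: (mulIf (invr_neq0 (lt0r_neq0 c0))); rewrite h mulfV// lt0r_neq0.
Qed.

Let inv_pow s e : 0 <= s -> s^-1 `^ e = s `^ (- e).
Proof. by move=> s0; rewrite -powR_inv1// -powRrM mulN1r. Qed.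

Let B0 : 0 <= b * D `^ (2 * al). Proof. by rewrite mulr_ge0 ?powR_ge0// ltW. Qed.

Lemma scaling_factor_exists : exists2 s, 0 < s & a + b * (s * D) `^ (2 * al) = s `^ (p - 1).
Proof.
case: pal => hp.
  have e1 : 0 < 1 - p by rewrite subr_gt0.
  have e2 : 0 < 2 * al + 1 - p by rewrite -addrA addr_gt0// mulr_gt0.
  have [s s0 h] := balance_root a0 B0 e1 e2; exists s => //.
  exact/balance_eq.
(* Both exponents are negative here, so the balance is solved for [1 / s]. *)
have e2 : 0 < p - 1 - 2 * al by lra.
have e1 : 0 < p - 1 by apply: (lt_trans e2); rewrite ltrBlDr ltrDl mulr_gt0.
have [t t0 h] := balance_root a0 B0 e1 e2; exists t^-1; first by rewrite invr_gt0.
apply/balance_eq; first by rewrite invr_gt0.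
by rewrite !inv_pow ?(ltW t0)// opprB (_ : - _ = p - 1 - 2 * al)//; ring.
Qed.

Lemma scaling_factor_unique s t : 0 < s -> 0 < t ->
  a + b * (s * D) `^ (2 * al) = s `^ (p - 1) ->
  a + b * (t * D) `^ (2 * al) = t `^ (p - 1) -> s = t.
Proof.
move=> s0 t0 /(balance_eq s0) hs /(balance_eq t0) ht.
case: pal => hp.
  have e1 : 0 < 1 - p by rewrite subr_gt0.
  have e2 : 0 < 2 * al + 1 - p by rewrite -addrA addr_gt0// mulr_gt0.
  exact: (balance_unique a0 B0 e1 e2 s0 t0).
have e2 : 0 < p - 1 - 2 * al by lra.
have e1 : 0 < p - 1 by apply: (lt_trans e2); rewrite ltrBlDr ltrDl mulr_gt0.
have inv y : 0 < y -> a * y `^ (1 - p) + b * D `^ (2 * al) * y `^ (2 * al + 1 - p) = 1 ->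
    a * y^-1 `^ (p - 1) + b * D `^ (2 * al) * y^-1 `^ (p - 1 - 2 * al) = 1.
  move=> y0; rewrite !inv_pow ?(ltW y0)// opprB.
  by rewrite (_ : - (p - 1 - 2 * al) = 2 * al + 1 - p)//; ring.
apply: invr_inj; apply: (balance_unique a0 B0 e1 e2); rewrite ?invr_gt0//; exact: inv.
Qed.

End scaling_factor.

End scalar_equation.

(** * Correspondence between the solutions of the two problems *)

Section solution_sets.
Context {R : realType} {M : nat}.
Notation V := 'rV[R]_M.+2.
Variables (Om : set V) (a b al p : R).
Hypothesis openOm : open Om.
Hypotheses (a0 : 0 < a) (b0 : 0 < b) (al0 : 0 < al).
Let D (u : V -> R) := gradnorm Om u.
Let ka u := a + b * D u `^ (2 * al).

Let ka0 u : 0 < ka u.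
Proof. by rewrite /ka ltr_wpDr// mulr_ge0 ?powR_ge0// ltW. Qed.

Let pow_scale (s z : R) : 0 < s ->
  `|s * z| `^ (p - 1) * (s * z) = s `^ (p - 1) * (s * (`|z| `^ (p - 1) * z)).
Proof. by move=> s0; rewrite normrM (gtr0_norm s0) powRM ?(ltW s0)//; ring. Qed.

Lemma K_of_E v s : E_solution Om p v -> 0 < s ->
  a + b * (s * D v) `^ (2 * al) = s `^ (p - 1) -> K_solution Om a b al p (fun x => s * v x).
Proof.
move=> [av veq] s0 h; split; first exact: admissible_scale.
move=> x Ox; rewrite -/(gradnorm _ _) (gradnorm_scale openOm s av) (gtr0_norm s0) h.
rewrite (laplacian_scale openOm s av Ox) pow_scale// -veq//.
by rewrite mulNr !mulrN.
Qed.

Lemma E_of_K u s : K_solution Om a b al p u -> 0 < s -> ka u = s `^ (p - 1) ->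
  E_solution Om p (fun x => s^-1 * u x).
Proof.
move=> [au ueq] s0 h; split; first exact: admissible_scale.
move=> x Ox; rewrite (laplacian_scale openOm _ au Ox) pow_scale ?invr_gt0// -ueq//.
rewrite -/(gradnorm _ _) -/(D u) -/(ka u) h.
have P : 0 < s `^ (p - 1) by exact: powR_gt0.
have -> : s^-1 `^ (p - 1) = (s `^ (p - 1))^-1.
  by rewrite -(powR_inv1 (ltW s0)) -powRrM mulN1r powRN.
rewrite mulNr !mulrN; congr (- _); rewrite mulrCA; congr (_ * _).
by rewrite mulKf// lt0r_neq0.
Qed.

(** The bijection divides a solution [u] of (K) by [s u], the root determined by its Kirchhoff
    factor. Existence of the scaling factor gives surjectivity and uniqueness gives injectivity, the
    trivial solution included. *)
Lemma K_E_card : p != 1 -> p < 1 \/ 2 * al + 1 < p ->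
  [set u | K_solution Om a b al p u] #= [set v | E_solution Om p v].
Proof.
move=> p1 pal; have p10 : p - 1 != 0 by rewrite subr_eq0.
pose s u := ka u `^ (p - 1)^-1.
have s0 u : 0 < s u by exact: powR_gt0.
have sE u : ka u = s u `^ (p - 1) by rewrite /s -powRrM mulVf// powRr1// ltW.
pose phi u : V -> R := fun x => (s u)^-1 * u x.
have img : phi @` [set u | K_solution Om a b al p u] = [set v | E_solution Om p v].
  apply/seteqP; split=> [_ [u /= Ku <-]|v /= Ev]; first exact: E_of_K (sE u).
  have [t t0 ht] := scaling_factor_exists a0 b0 al0 (gradnorm_ge0 Om v) pal.
  exists (fun x => t * v x); first exact: K_of_E.
  have [av _] := Ev.
  have kE : ka (fun x => t * v x) = t `^ (p - 1).
    by rewrite /ka /D (gradnorm_scale openOm t av) (gtr0_norm t0).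
  apply/funext => x; rewrite /phi /s kE -powRrM mulfV// powRr1 ?(ltW t0)//.
  by rewrite mulKf// lt0r_neq0.
rewrite card_eq_sym -img; apply: inj_card_eq => u1 u2; rewrite !inE /= => K1 K2 E.
have nE u : K_solution Om a b al p u -> a + b * (s u * D (phi u)) `^ (2 * al) = s u `^ (p - 1).
  move=> [au _]; rewrite -sE /ka /D (gradnorm_scale openOm _ au).
  by rewrite gtr0_norm ?invr_gt0// mulrA mulfV ?mul1r// lt0r_neq0.
have h1 := nE _ K1; have h2 := nE _ K2; rewrite -E in h2.
have s12 := scaling_factor_unique a0 b0 al0 (gradnorm_ge0 Om (phi u1)) pal (s0 u1) (s0 u2) h1 h2.
apply/funext => x; have := congr1 (fun f : V -> R => f x) E; rewrite /phi -s12.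
by apply: mulfI; rewrite invr_eq0 lt0r_neq0.
Qed.

End solution_sets.

Lemma crit_exponent_lt {R : realType} (M : nat) (p : R) :
  (p%:E < crit_exponent R M.+2)%E -> M%:R * (p + 1 - 2) < 4.
Proof.
rewrite (_ : p + 1 - 2 = p - 1); last by ring.
rewrite /crit_exponent; case: M => [_|m]; first by rewrite mul0r.
have m0 : 0 < m.+1%:R :> R by rewrite ltr0n.
have E : m.+3%:R = m.+1%:R + 2 :> R by rewrite -natrD addn2.
rewrite /= E addrK lte_fin ltr_pdivlMr// mulrBr mulr1; lra.
Qed.

Theorem theorem2p1 (R : realType) (N : nat) (Om : set 'rV[R]_N)
    (a b alpha p : R)
    (hN : (2 <= N)%N) (hOm : bounded_smooth_domain Om)
    (ha : 0 < a) (hb : 0 < b) (halpha : 0 < alpha)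
    (hp0 : 0 < p) (hp : (p%:E < crit_exponent R N)%E) (hp1 : p <> 1) :
  let S := sobolev_S Om p in
  let gamma := 2 * alpha + 1 - p in
  let lhs := a * b `^ ((p - 1) / gamma) in
  let rhs := gamma *
    ((p - 1) `^ (p - 1) / (2 * alpha * S) `^ (2 * alpha)) `^ (1 / gamma) in
  [/\ (p < 1 \/ 2 * alpha + 1 < p ->
        [set u | K_solution Om a b alpha p u] #= [set v | E_solution Om p v]),
      (1 < p -> p < 2 * alpha + 1 ->
        [/\ (lhs < rhs -> exists u1 u2,
               [/\ u1 <> u2,
                   K_solution Om a b alpha p u1 /\ positive_on Om u1 &
                   K_solution Om a b alpha p u2 /\ positive_on Om u2]),
            (lhs = rhs -> exists u,
               K_solution Om a b alpha p u /\ positive_on Om u) &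
            (rhs < lhs -> ~ exists u,
               K_solution Om a b alpha p u /\ nontrivial_on Om u)]) &
      (p = 2 * alpha + 1 ->
        (b * S < 1 -> exists u,
           K_solution Om a b alpha p u /\ positive_on Om u) /\
        (1 <= b * S -> ~ exists u,
           K_solution Om a b alpha p u /\ nontrivial_on Om u))].
Proof.
move: N Om hN hOm hp => [//|[//|M]] Om _ [[x0 Om_x0] openOm connOm [r [_ /(_ (r + 1)) Om_r]] smooth] hp S gamma lhs rhs.
have Om_r0 : forall x, Om x -> `|x| <= r + 1 by apply: Om_r; rewrite ltrDl.
have sub : 1 < p -> M%:R * (p + 1 - 2) < 4 by move=> p1; exact: crit_exponent_lt.
have bound u : 1 < p -> K_solution Om a b alpha p u -> nontrivial_on Om u ->
    exists2 D : R, 0 < D & (a + b * D `^ (2 * alpha)) * S <= D `^ (p - 1).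
  move=> p1; have [I0 _] := ground_state openOm Om_r0 Om_x0 p1 smooth connOm (sub p1).
  exact: (K_solution_bound openOm Om_r0 Om_x0 p1 ha hb I0).
have S0 : 1 < p -> 0 < S.
  move=> p1; have [I0 _] := ground_state openOm Om_r0 Om_x0 p1 smooth connOm (sub p1).
  exact: (sobolev_S_gt0 openOm Om_r0 Om_x0 p1 I0).
have exist D : 1 < p -> 0 < D -> (a + b * D `^ (2 * alpha)) * S = D `^ (p - 1) ->
    exists u, [/\ K_solution Om a b alpha p u, positive_on Om u & gradnorm Om u = D].
  move=> p1 D0 h.
  exact: (K_solution_exists openOm Om_r0 Om_x0 p1 smooth connOm (sub p1) D0 h).
have al2 : 0 < 2 * alpha by rewrite mulr_gt0.
split.
- by move=> h; apply: K_E_card => //; apply/eqP.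
- move=> p1 pal; have [tl te tg] := threshold ha hb halpha p1 pal (S0 p1).
  rewrite -/gamma -/lhs -/rhs in tl te tg.
  have /andP[th0 th1] := crit_th_itv halpha p1 pal.
  have cx := crit_x_gt0 ha hb halpha p1 pal.
  (* The unknown is [x = D^(2 alpha)], in which the scalar equation reads [(a + b x) S = x^th] with
     [th = crit_th alpha p]. *)
  have [/(_ _) e1 e2] : (forall x, (x `^ (2 * alpha)^-1) `^ (2 * alpha) = x `^ 1) /\
      (forall x, (x `^ (2 * alpha)^-1) `^ (p - 1) = x `^ crit_th alpha p).
    split=> x; rewrite -powRrM; first by rewrite mulVf// lt0r_neq0.
    by rewrite mulrC.
  have existx x : 0 < x -> (a + b * x) * S = x `^ crit_th alpha p ->
      exists u, [/\ K_solution Om a b alpha p u, positive_on Om u &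
        gradnorm Om u = x `^ (2 * alpha)^-1].
    by move=> xp h; apply: exist => //; [exact: powR_gt0|rewrite e1 e2 powRr1// ltW].
  split.
  + move=> /tl h.
    (* At [crit_x] equality holds with [crit_S], hence strict inequality with the smaller [S]. *)
    have [|x1 [x2 [x10 x12 /(existx _ x10) H1 h2]]] := two_roots ha hb (S0 p1) th0 th1 cx.
      rewrite -(crit_eq ha hb halpha p1 pal) ltr_pM2l//.
      by rewrite addr_gt0// mulr_gt0.
    have x20 := lt_trans x10 x12; have [u2 [K2 P2 D2]] := existx _ x20 h2.
    have [u1 [K1 P1 D1]] := H1; exists u1, u2; split => // E.
    (* The two solutions differ because their gradient norms do. *)
    have : x1 `^ (2 * alpha)^-1 < x2 `^ (2 * alpha)^-1.
      by apply: gt0_ltr_powR; rewrite ?nnegrE ?invr_gt0// ltW.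
    by rewrite -D1 -D2 E ltxx.
  + move=> /te h; have [|u [Ku Pu _]] := existx _ cx; last by exists u.
    by rewrite h crit_eq.
  + move=> /tg h [u [Ku nu]]; have [D D0] := bound u p1 Ku nu; apply/negP; rewrite -ltNge.
    have X0 : 0 <= D `^ (2 * alpha) by exact: powR_ge0.
    have -> : D `^ (p - 1) = (D `^ (2 * alpha)) `^ crit_th alpha p.
      by rewrite -powRrM /crit_th mulrC divfK// lt0r_neq0.
    apply: (le_lt_trans (crit_tangent ha hb halpha p1 pal X0)).
    by rewrite ltr_pM2l// ltr_wpDr// mulr_ge0// ltW.
- move=> pE; have p1 : 1 < p by rewrite pE ltrDr.
  have pE1 : p - 1 = 2 * alpha by rewrite pE; ring.
  split=> h.
    have bS : 0 < 1 - b * S by rewrite subr_gt0.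
    (* With [p - 1 = 2 alpha] the equation is linear in [x = D^(2 alpha)], namely
       [(a + b x) S = x]. *)
    pose x := a * S / (1 - b * S).
    have x0' : 0 < x by rewrite divr_gt0// mulr_gt0// S0.
    have [||u [Ku Pu _]] := exist (x `^ (2 * alpha)^-1) p1; last by exists u.
    - exact: powR_gt0.
    - rewrite pE1 -powRrM mulVf ?lt0r_neq0// powRr1 ?(ltW x0')// /x.
      by field; exact: lt0r_neq0.
  move=> [u [Ku nu]]; have [D D0] := bound u p1 Ku nu; apply/negP; rewrite -ltNge pE1.
  have P : 0 < D `^ (2 * alpha) by exact: powR_gt0.
  have aS : 0 < a * S by rewrite mulr_gt0// S0.
  have : D `^ (2 * alpha) * 1 <= D `^ (2 * alpha) * (b * S) by rewrite ler_pM2l.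
  rewrite mulr1 => h1.
  have -> : (a + b * D `^ (2 * alpha)) * S = a * S + D `^ (2 * alpha) * (b * S) by ring.
  by lra.
Qed.
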